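(* Let $u_i:[0,t_f]\to U_i$ and $F_i:(0,t_f]\to U_\Gamma$, $i=1,2$, solve the semi-discrete problem (SD) of the context, and let $u_i^n,U_i^n,u_{\Gamma,i}^{\tilde n},F_i^{\tilde n}$ solve the multirate DGiT equations (S), (V), (T), (F) of the context on the coupling windows $N_0\le\tilde n\le N$. Assume that $u_i\in\mathcal H_i^{q+1}(n)$ for $1\le n\le M_i$, $u_i|_\Gamma\in\mathcal H_\Gamma^{r_i+1}(\tilde n)$ and $F_i\in\mathcal H_\Gamma^{r_i+1}(\tilde n)$ on all coupling windows $1\le\tilde n\le N$, $N=t_f/\Delta t\in\mathbb N$, with the uniform bounds $$\sum_{\tilde n=1}^N\sum_{n=1}^{M_i}\sum_{m=0}^{q+1}\int_{I_i^n}\|D^{(m)}u_i\|^2dt\le C,\qquad \sum_{\tilde n=1}^N\sum_{m=0}^{r_i+1}\int_{I^{\tilde n}}\|D^{(m)}u_i\|_\Gamma^2dt\le C,\qquad \sum_{\tilde n=1}^N\sum_{m=0}^{r_i+1}\int_{I^{\tilde n}}\|D^{(m)}F_i\|_\Gamma^2dt\le C$$ for some $C>0$ independent of $\Delta t$ and $\Delta t_i$. Assume the side conditions support the consistency bounds $$\Delta t_i\sum_{k=1}^{n_s}\Big\|u_i(t_i^{n,k})-\sum_{l=1}^{k_s+1}(\mathbb D)_{k,l}u_i(t_i^{n+1-l})\Big\|^2\le C(\Delta t_i)^{2q+2}\int_{t_i^{n-k_s}}^{t_i^n}\sum_{m=0}^{q+1}\|D^{(m)}u_i\|^2dt$$ for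 $1\le n\le M_i$ on every coupling window on which the side conditions are imposed, where $t_i^{n,k}=t_i^{n-1}+\theta_k\Delta t_i$. Assume also that for some $p>0$ the initialization data satisfy $$\sqrt{\sum_{i=1,2}\|u_i(t=0)-U_i^0\|^2}\le C\Delta t^p$$ at the initial time, and, if $N_0>1$, $$\sqrt{\sum_{i=1,2}\sum_{n=1}^{M_i}\|u_i(t_i^n)-U_i^n\|^2}\le C\Delta t^p,\qquad \sqrt{\sum_{i=1,2}\sum_{n=1}^{M_i}|||u_i-u_i^n|||^2}\le C\Delta t^p$$ on each coupling window $\tilde n$ with $1\le\tilde n<N_0$. If $n_s>0$, assume that the matrix $\tilde{\mathbb D}$ of the context is nonsingular. If $\Delta t_1$ and $\Delta t_2$ are small enough, then on each coupling window $\tilde n$ with $N_0\le\tilde n\le N$, $$\|u_j(t_j^n)-U_j^n\|\le C_h\Big(\Delta t^p+\sum_{i=1,2}\big(\Delta t_i^{q+1}+\Delta t^{r_i+1}\big)\Big),\qquad 1\le n\le M_j,\ j=1,2,$$ and $$\sqrt{\sum_{i=1,2}\sum_{n=1}^{M_i}|||u_i-u_i^n|||^2}\le C_h\Big(\Delta t^p+\sum_{i=1,2}\big(\Delta t_i^{q+1}+\Delta t^{r_i+1}\big)\Big),$$ where $C_h>0$ depends on the solution of (SD), $N_0$, $t_f$, and possibly $h$, but not on $\Delta t_i$, $M_i$ ($i=1,2$), $\Delta t$, or $\tilde n$.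
   Context: Spatial setting. Let $d\in\{2,3\}$, $\Gamma=(0,1)^{d-1}\times\{0\}\subset\mathbb R^d$, $\Omega_1=(0,1)^{d-1}\times(0,1)$, $\Omega_2=(0,1)^{d-1}\times(-1,0)$, $\Gamma_i=\partial\Omega_i\setminus\Gamma$, with unit outward normal $\mathbf n_i$ on $\partial\Omega_i$. For $i=1,2$: $\nu_i>0$ is constant, $\mathbf s_i\in[W^{1,\infty}(\Omega_i)]^d$ is a steady advection field with $\mathbf n_i\cdot\mathbf s_i=0$ on $\partial\Omega_i$, $f_i$ is a given forcing on $\Omega_i\times(0,t_f]$, $g_i$ is a given forcing on $\Gamma\times(0,t_f]$, $u_i^0$ is initial data, and $b_{i,j}$ are real constants. Let $\tau_i$ be a conforming mesh of $\Omega_i$ from a regular family with mesh parameter $h_i$ (triangles or quadrilaterals if $d=2$, tetrahedra or parallelepipeds if $d=3$), $h=\max\{h_1,h_2\}$; the two meshes coincide on $\Gamma$ and induce a partition $\tau_\Gamma$ of $\Gamma$. For a fixed integer $k\ge1$, $U_i$ is the space of continuous functions on $\overline{\Omega_i}$ that are in $\mathbb P_k$ on each cell (tensor-product polynomials on quadrilaterals/parallelepipeds) and vanish on $\Gamma_i$; $U_\Gamma$ is the analogous space on $\overline\Gamma$ with respect to $\tau_\Gamma$, vanishing on $\partial\Gamma$ (the trace space of $U_1$ and of $U_2$). Nodal bases are $\{\phi_{i,j}\}_{j=1}^{d_{\Omega_i}}$ and $\{\mu_j\}_{j=1}^{d_\Gamma}$. Write $(v,w)=\int_{\Omega_i}vw\,dx$,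 $\|v\|=(v,v)^{1/2}$, $(\mu,\lambda)_\Gamma=\int_\Gamma\mu\lambda\,d\Gamma$ (traces understood), $\|\mu\|_\Gamma=(\mu,\mu)_\Gamma^{1/2}$, and $L(v,w)=\int_{\Omega_i}\nu_i\nabla v\cdot\nabla w\,dx+\int_{\Omega_i}\nabla\cdot(\mathbf s_iv)\,w\,dx$. Standing assumption: there are positive constants $L_{i,1},L_{i,2}$ with $L_{i,1}\|v\|_{H^1(\Omega_i)}^2\le L(v,v)\le L_{i,2}\|v\|_{H^1(\Omega_i)}^2$ for all $v\in U_i$, $i=1,2$. Semi-discrete problem (SD): $u_i:[0,t_f]\to U_i$, $F_i:(0,t_f]\to U_\Gamma$ satisfy, for $i=1,2$: $(\dot u_i,v)=-L(u_i,v)-(F_i,v)_\Gamma+(f_i,v)$ for all $v\in U_i$, $0<t\le t_f$; $(u_i(0),v)=(u_i^0,v)$ for all $v\in U_i$; and $(F_i,\mu)_\Gamma=(b_{i,1}u_1+b_{i,2}u_2-g_i,\mu)_\Gamma$ for all $\mu\in U_\Gamma$. Time setting. $N\in\mathbb N$, $\Delta t=t_f/N$, $t^{\tilde n}=\tilde n\Delta t$, $I^{\tilde n}=(t^{\tilde n-1},t^{\tilde n})$; $[t^{\tilde n-1},t^{\tilde n}]$ is coupling window $\tilde n$. For $i=1,2$, $M_i\in\mathbb N$, $\Delta t_i=\Delta t/M_i$; on window $\tilde n$, $t_i^n=t^{\tilde n-1}+n\Delta t_i$ and $I_i^n=(t_i^{n-1},t_i^n)$. $\mathcal U_i^n(q)$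 is the space of functions $\sum_jv_j(t)\phi_{i,j}(x)$ with $v_j\in\mathbb P_q(I_i^n)$; $\mathcal V^{\tilde n}(r)$ is the space of functions $\sum_j\lambda_j(t)\mu_j(x)$ with $\lambda_j\in\mathbb P_r(I^{\tilde n})$. Polynomials in time are extended to all of $\mathbb R$ when evaluated outside their interval. With $D^{(m)}=d^m/dt^m$, $\mathcal H_i^k(n)$ is the set of $v(x,t)$ with $\|D^{(m)}v\|\in L^2(I_i^n)$ for $0\le m\le k$, and $\mathcal H_\Gamma^k(\tilde n)$ is the set of $\mu(x,t)$ with $\|D^{(m)}\mu\|_\Gamma\in L^2(I^{\tilde n})$ for $0\le m\le k$. For functions on $I_i^n$, $|||v|||=\big(\int_{I_i^n}\|v\|^2dt\big)^{1/2}$. Multirate DGiT method. Parameters: integers $q\ge0$, $0\le n_s\le q+1$, $k_s\ge0$, $r_1,r_2\ge0$, values $-\infty<\theta_1<\dots<\theta_{n_s}\le1$, and a fixed $n_s\times(k_s+1)$ real matrix $\mathbb D$. On window $\tilde n$ the unknowns are $u_i^n\in\mathcal U_i^n(q)$ and side values $U_i^n\in U_i$ (approximating $u_i(t_i^n)$) for $1\le n\le M_i$, and $u_{\Gamma,i}^{\tilde n},F_i^{\tilde n}\in\mathcal V^{\tilde n}(r_i)$, $i=1,2$; $U_i^m$ with $m\le0$ is the side value at time $t_i^m$, known from earlier windows or initialization. Initialization data are given on the windows $1\le\tilde n<N_0$, with $N_0\ge1$ large enough that all past times and values referred to are available, and the following equations hold on windows $N_0\le\tilde n\le N$, for $1\le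 n\le M_i$ and $i=1,2$: (S) $u_i^n(t_i^{n-1}+\theta_k\Delta t_i)=\sum_{l=1}^{k_s+1}(\mathbb D)_{k,l}U_i^{n+1-l}$, $1\le k\le n_s$ (no condition if $n_s=0$); (V) $(U_i^n,v(t_i^n))-\int_{I_i^n}(u_i^n,\dot v)\,dt=(U_i^{n-1},v(t_i^{n-1}))-\int_{I_i^n}\big[L(u_i^n,v)+(F_i^{\tilde n},v)_\Gamma-(f_i,v)\big]dt$ for all $v\in\mathcal U_i^n(q+1-n_s)$; (T) $\int_{I^{\tilde n}}(u_{\Gamma,i}^{\tilde n},\lambda)_\Gamma dt=\sum_{n=1}^{M_i}\int_{I_i^n}(u_i^n,\lambda)_\Gamma dt$ for all $\lambda\in\mathcal V^{\tilde n}(r_i)$; (F) $\int_{I^{\tilde n}}(F_i^{\tilde n},\lambda)_\Gamma dt=\int_{I^{\tilde n}}(b_{i,1}u_{\Gamma,1}^{\tilde n}+b_{i,2}u_{\Gamma,2}^{\tilde n}-g_i,\lambda)_\Gamma dt$ for all $\lambda\in\mathcal V^{\tilde n}(r_i)$. The matrix $\tilde{\mathbb D}$. Let $\{\psi_j\}_{j=0}^q$ be polynomials with $\psi_j\in\mathbb P_j(\mathbb R)$ whose restrictions to $[-1,1]$ form an $L^2$-orthogonal basis of $\mathbb P_q[-1,1]$. For $n_s\ge1$, $\tilde{\mathbb D}$ is the $n_s\times n_s$ matrix with entries $(\tilde{\mathbb D})_{j,k}=\psi_{m_k}(2\theta_j-1)$, $m_k=k+q-n_s$, $1\le j,k\le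 n_s$.
   Formalization: ''Δt_1 and Δt_2 small enough'' is taken as Δt_i ≤ δ/M_i, i.e. Δt ≤ δ, with δ independent of M_i and Δt; with a threshold on Δt_i independent of M_i the claim fails for some b_{i,j} (Δt fixed, M_i → ∞). *)

(* Defs.v *)
(* Spatial functions are plain functions on row vectors (MathComp-Analysis); a
   space-time function is curried, with time first. *)
From HB Require Import structures.
From mathcomp Require Import all_boot all_order all_algebra.
From mathcomp Require Import all_classical all_reals all_analysis.
Set Implicit Arguments. Unset Strict Implicit. Unset Printing Implicit Defensive.
Import Order.TTheory GRing.Theory Num.Theory.
Import numFieldNormedType.Exports.
Local Open Scope classical_set_scope.
Local Open Scope ring_scope.

Section rV_measurable.
Context (R : realType) (n : nat).
Let coords (i : 'I_n) (x : 'rV[R]_n) : R := x ord0 i.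

Let rV_set0 : g_sigma_preimage coords set0.
Proof. exact: sigma_algebra0. Qed.
Let rV_setC A : g_sigma_preimage coords A -> g_sigma_preimage coords (~` A).
Proof. exact: sigma_algebraC. Qed.
Let rV_bigcup (F : (set _)^nat) : (forall i, g_sigma_preimage coords (F i)) ->
  g_sigma_preimage coords (\bigcup_i (F i)).
Proof. exact: sigma_algebra_bigcup. Qed.

HB.instance Definition _ :=
  @isMeasurable.Build (measure_tuple_display default_measure_display)
    'rV[R]_n (g_sigma_preimage coords) rV_set0 rV_setC rV_bigcup.
End rV_measurable.

Section lebesgue_rV.
Context (R : realType).

Lemma measurable_coord n (i : 'I_n) :
  measurable_fun [set: 'rV[R]_n] (fun x => x ord0 i).
Proof.
move=> _ Y mY; rewrite setTI; apply: sub_sigma_algebra => /=.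
rewrite -bigcup_seq/=; exists i => /=; first by rewrite mem_index_enum.
by exists Y => //; rewrite setTI.
Qed.

Definition snoc n (z : 'rV[R]_n * R) : 'rV[R]_n.+1 :=
  \row_j (if unlift ord_max j is Some k then z.1 ord0 k else z.2).

Lemma measurable_snoc n : measurable_fun setT (@snoc n).
Proof.
move=> _ Y mY; rewrite setTI.
have : (image_set_system setT (@snoc n) measurable) Y.
  apply: mY; split; first exact/sigma_algebra_image/sigma_algebra_measurable.
  rewrite -bigcup_seq => A [/= j _ [B mB <-]].
  rewrite /image_set_system /= !setTI.
  have -> : @snoc n @^-1` ((fun x : 'rV_n.+1 => x ord0 j) @^-1` B) =
     (fun z => snoc z ord0 j) @^-1` B by [].
  rewrite -[X in measurable X]setTI.
  suff: measurable_fun setT (fun z : 'rV[R]_n * R => snoc z ord0 j) by apply.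
  case: (unliftP ord_max j) => [k ->|->].
    under eq_fun do rewrite mxE liftK.
    by apply: (measurableT_comp (measurable_coord k)); exact: measurable_fst.
  under eq_fun do rewrite mxE unlift_none.
  exact: measurable_snd.
by rewrite /image_set_system /= setTI.
Qed.

Fixpoint leb n : {measure set 'rV[R]_n -> \bar R} :=
  match n with
  | 0 => \d_(0 : 'rV[R]_0)
  | n'.+1 => measure_function_pushforward__canonical__measure_function_Measure
               (leb n' \x lebesgue_measure)%E (@measurable_snoc n')
  end.

End lebesgue_rV.

Section Spaces.
Context (R : realType).

Definition inner n (A : set 'rV[R]_n) (v w : 'rV[R]_n -> R) : R :=
  (\int[leb R n]_(x in A) (v x * w x))%R.
Definition nsq n (A : set 'rV[R]_n) v : R := inner A v v.
Definition nrm n (A : set 'rV[R]_n) v : R := Num.sqrt (nsq A v).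

Definition L2 n (A : set 'rV[R]_n) (f : 'rV[R]_n -> R) : Prop :=
  measurable_fun A f /\ (leb R n).-integrable A (fun x => (f x ^+ 2)%:E).

(* Continuously differentiable functions with compact support in [A], the test
   functions of all weak derivatives below. *)
Definition C1c (V : normedModType R) (A : set V) (phi : V -> R) : Prop :=
  [/\ forall x, differentiable phi x,
      forall e : V, continuous (fun x => 'D_e phi x)
    & exists K : set V,
        [/\ compact K, K `<=` A & forall x, ~ K x -> phi x = 0]].

Definition ess_bounded n (A : set 'rV[R]_n) (f : 'rV[R]_n -> R) : Prop :=
  measurable_fun A f /\
  exists B : R, {ae leb R n, forall x, A x -> `|f x| <= B}.

(* [f] is in W^{1,oo}(A) with weak gradient [g]. *)
Definition W1inf n (A : set 'rV[R]_n) (f : 'rV[R]_n -> R)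
    (g : 'rV[R]_n -> 'rV[R]_n) : Prop :=
  ess_bounded A f /\ forall j : 'I_n,
    ess_bounded A (fun x => g x ord0 j) /\
    forall phi, C1c A phi ->
      inner A f (fun x => 'D_(delta_mx ord0 j) phi x)
        = - inner A (fun x => g x ord0 j) phi.

(* A brick with vertices [w s], [s] in {0,1}^n, is the image of the unit cube
   under the multilinear map sending the vertex [s] of the cube to [w s]: a
   segment, a quadrilateral or a parallelepiped. *)
Inductive cell n : Type :=
| Simplex of ('I_n.+1 -> 'rV[R]_n)
| Brick of ({ffun 'I_n -> bool} -> 'rV[R]_n).

Definition is_simplex n (K : cell n) : bool :=
  if K is Simplex _ then true else false.

Definition hull n (w : 'I_n.+1 -> 'rV[R]_n) (S : {set 'I_n.+1})
    : set 'rV[R]_n :=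
  [set x | exists l : 'I_n.+1 -> R,
    [/\ forall j, 0 <= l j, forall j, j \notin S -> l j = 0,
        \sum_j l j = 1 & x = \sum_j l j *: w j]].

Definition unit_cube n : set 'rV[R]_n :=
  [set x | forall j, 0 <= x ord0 j <= 1].

Definition brick_map n (w : {ffun 'I_n -> bool} -> 'rV[R]_n) (x : 'rV[R]_n)
    : 'rV[R]_n :=
  \sum_(s : {ffun 'I_n -> bool})
    (\prod_j (if s j then x ord0 j else 1 - x ord0 j)) *: w s.

Definition cell_set n (K : cell n) : set 'rV[R]_n :=
  match K with
  | Simplex w => hull w [set: 'I_n.+1]
  | Brick w => brick_map w @` @unit_cube n
  end.

(* [F] is a face of [K] of codimension [c]. *)
Definition cell_face n (K : cell n) (c : nat) (F : set 'rV[R]_n) : Prop :=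
  match K with
  | Simplex w => exists S : {set 'I_n.+1},
      [/\ S != finset.set0, #|finset.setC S| = c & F = hull w S]
  | Brick w => exists a : {ffun 'I_n -> option bool},
      #|[pred j | a j != None]| = c /\
      F = brick_map w @` [set x | @unit_cube n x /\
            forall j s, a j = Some s -> x ord0 j = s%:R]
  end.

Definition flip n (s : {ffun 'I_n -> bool}) (j : 'I_n) : {ffun 'I_n -> bool} :=
  [ffun k => s k (+) (k == j)].

Definition parallelepiped n (w : {ffun 'I_n -> bool} -> 'rV[R]_n) : Prop :=
  let o := [ffun => false] in
  forall s, w s = w o + \sum_(j | s j) (w (flip o j) - w o).

(* The Jacobian of the bilinear map of a quadrilateral is invertible on the
   closed reference square iff the quadrilateral is strictly convex. *)
Definition nondegenerate n (K : cell n) : Prop :=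
  match K with
  | Simplex w => \matrix_j (w (lift ord0 j) - w ord0) \in unitmx
  | Brick w => (n <> 2%N -> parallelepiped w) /\
      forall x, @unit_cube n x -> jacobian (brick_map w) x \in unitmx
  end.

Definition conforming n (tau : set (cell n)) : Prop :=
  forall K K', tau K -> tau K' -> K <> K' ->
    let A := cell_set K `&` cell_set K' in
    A = set0 \/ ((exists2 c, (0 < c)%N & cell_face K c A) /\
                 (exists2 c, (0 < c)%N & cell_face K' c A)).

Definition is_mesh n (D : set 'rV[R]_n) (tau : set (cell n)) : Prop :=
  [/\ finite_set tau,
      (forall K, tau K -> is_simplex K) \/ (forall K, tau K -> ~~ is_simplex K),
      forall K, tau K -> nondegenerate K,
      \bigcup_(K in tau) cell_set K = closure D
    & conforming tau].

Definition enorm n (x : 'rV[R]_n) : R := Num.sqrt (\sum_j x ord0 j ^+ 2).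

Definition corner n (w : {ffun 'I_n -> bool} -> 'rV[R]_n)
    (s : {ffun 'I_n -> bool}) (j : 'I_n.+1) : 'rV[R]_n :=
  if unlift ord0 j is Some k then w (flip s k) else w s.

(* diam K <= sigma * rho, with rho the radius of some ball contained in the
   simplex [K] or, for a brick, in each of the simplices cut off at a vertex. *)
Definition shape_regular n (sigma : R) (K : cell n) : Prop :=
  let chunky S := exists c r, [/\ 0 < r,
    forall x : 'rV[R]_n, enorm (x - c) <= r -> S x
    & forall x y, cell_set K x -> cell_set K y -> enorm (x - y) <= sigma * r] in
  match K with
  | Simplex w => chunky (cell_set K)
  | Brick w => forall s, chunky (hull (corner w s) [set: 'I_n.+1])
  end.

(* Polynomials of degree at most [k] in each variable and, if [total], of total
   degree at most [k]. *)
Definition polyfun n (k : nat) (total : bool) : set ('rV[R]_n -> R) :=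
  [set p | exists c : {ffun 'I_n -> 'I_k.+1} -> R, p = fun x : 'rV[R]_n =>
    \sum_(a : {ffun 'I_n -> 'I_k.+1} | total ==> (\sum_j a j <= k)%N)
      c a * \prod_j x ord0 j ^+ a j].

Definition cell_poly n (k : nat) (K : cell n) (v : 'rV[R]_n -> R) : Prop :=
  match K with
  | Simplex w => exists2 p, polyfun k true p & forall x, cell_set K x -> v x = p x
  | Brick w => exists2 p, polyfun k false p &
      forall x, @unit_cube n x -> v (brick_map w x) = p x
  end.

(* Functions on the closure of [D], extended by zero, that vanish on [B]. *)
Definition fe_space n (k : nat) (D : set 'rV[R]_n) (tau : set (cell n))
    (B : set 'rV[R]_n) : set ('rV[R]_n -> R) :=
  [set v | [/\ {within closure D, continuous v},
               forall x, ~ closure D x -> v x = 0,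
               forall K, tau K -> cell_poly k K v
             & forall x, B x -> v x = 0]].

(* The gradient of a finite element function, computed in the interior of the
   cells; the value 0 on the skeleton is immaterial. *)
Definition fe_grad n (tau : set (cell n)) (v : 'rV[R]_n -> R) (x : 'rV[R]_n)
    : 'rV[R]_n :=
  if `[< exists2 K, tau K & interior (cell_set K) x >]
  then \row_j 'D_(delta_mx ord0 j) v x else 0.

Definition boundary n (A : set 'rV[R]_n) := closure A `\` interior A.

Definition box n (lo hi : 'rV[R]_n) : set 'rV[R]_n :=
  [set x | forall j, lo ord0 j < x ord0 j < hi ord0 j].

Definition outward_normal n (lo hi x nn : 'rV[R]_n) : Prop :=
  exists j, (x ord0 j = hi ord0 j /\ nn = delta_mx ord0 j) \/
            (x ord0 j = lo ord0 j /\ nn = - delta_mx ord0 j).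

Section Domain.
(* The space dimension is d = m + 1; the vertical coordinate is the last one.
   Indices i = 1, 2 are the elements 0, 1 of 'I_2. *)
Context (m : nat).

Definition lo (i : 'I_2) : 'rV[R]_m.+1 :=
  \row_j (if (j == ord_max) && (i != ord0) then -1 else 0).
Definition hi (i : 'I_2) : 'rV[R]_m.+1 :=
  \row_j (if (j == ord_max) && (i != ord0) then 0 else 1).
Definition Omega (i : 'I_2) : set 'rV[R]_m.+1 := box (lo i) (hi i).
Definition Gam : set 'rV[R]_m := box (const_mx 0) (const_mx 1).

Definition emb (y : 'rV[R]_m) : 'rV[R]_m.+1 := snoc (y, 0).
Definition trace (v : 'rV[R]_m.+1 -> R) : 'rV[R]_m -> R := v \o emb.

End Domain.

Definition tint (a b : R) (f : R -> R) : R :=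
  (\int[lebesgue_measure]_(t in `]a, b[) f t)%R.

Definition deriv_within (A : set R) (f : R -> R) (t l : R) : Prop :=
  (fun s => (f s - f t) / (s - t)) @ within A t^' --> l.

Section Time.
Context (n : nat).
Implicit Types (v : R -> 'rV[R]_n -> R) (W : set ('rV[R]_n -> R)).

Definition weak_dt (a b : R) v v' : Prop := forall x,
  [/\ lebesgue_measure.-integrable `]a, b[ (fun t => (v t x)%:E),
      lebesgue_measure.-integrable `]a, b[ (fun t => (v' t x)%:E)
    & forall phi, C1c (`]a, b[%classic : set R) phi ->
        tint a b (fun t => v t x * derive1 phi t)
          = - tint a b (fun t => v' t x * phi t)].

(* [v] has W-valued weak time derivatives D^(j) v = Dv j on ]a, b[ up to order
   [k], whose norms on [A] are square integrable in time. *)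
Definition sobolev_time W (A : set 'rV[R]_n) (a b : R) (k : nat) v
    (Dv : nat -> R -> 'rV[R]_n -> R) : Prop :=
  [/\ forall t, a < t < b -> Dv 0%N t = v t,
      forall j, (j <= k)%N ->
        (forall t, a < t < b -> W (Dv j t)) /\
        lebesgue_measure.-integrable `]a, b[ (fun t => (nsq A (Dv j t))%:E)
    & forall j, (j < k)%N -> weak_dt a b (Dv j) (Dv j.+1)].

(* Finite sums of c_j(t) w_j(x) with [w_j] in [W] and polynomials [c_j] of
   degree at most [q], defined for all times. *)
Definition timepoly W (q : nat) : set (R -> 'rV[R]_n -> R) :=
  [set v | exists p (c : 'I_p -> {poly R}) (w : 'I_p -> 'rV[R]_n -> R),
    [/\ forall j, (size (c j) <= q.+1)%N, forall j, W (w j)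
      & v = fun t x => \sum_j (c j).[t] * w j x]].

Definition dtime v (t : R) (x : 'rV[R]_n) : R := derive1 (fun s => v s x) t.

End Time.

Section SemiDiscrete.
Context (m : nat).

Record problem := Problem {
  tf : R;
  nu : 'I_2 -> R;
  adv : 'I_2 -> 'rV[R]_m.+1 -> 'rV[R]_m.+1;
  (* row j is the weak gradient of the j-th component of the advection field *)
  dadv : 'I_2 -> 'rV[R]_m.+1 -> 'M[R]_m.+1;
  src : 'I_2 -> R -> 'rV[R]_m.+1 -> R;
  srcG : 'I_2 -> R -> 'rV[R]_m -> R;
  init : 'I_2 -> 'rV[R]_m.+1 -> R;
  cpl : 'I_2 -> 'I_2 -> R;
  mesh : 'I_2 -> set (cell m.+1);
  meshG : set (cell m);
  deg : nat
}.

Variable pb : problem.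
Implicit Types (i : 'I_2).

Definition Usp i : set ('rV[R]_m.+1 -> R) :=
  fe_space (deg pb) (@Omega m i) (mesh pb i)
    (boundary (@Omega m i) `\` (@emb m @` @Gam m)).

Definition UG : set ('rV[R]_m -> R) :=
  fe_space (deg pb) (@Gam m) (meshG pb) (boundary (@Gam m)).

Definition H1sq i (v : 'rV[R]_m.+1 -> R) : R :=
  nsq (Omega i) v +
  \sum_j nsq (Omega i) (fun x => fe_grad (mesh pb i) v x ord0 j).

(* div (s v), by the product rule (div s) v + s . grad v. *)
Definition div_adv i (v : 'rV[R]_m.+1 -> R) (x : 'rV[R]_m.+1) : R :=
  \tr (dadv pb i x) * v x +
  \sum_j adv pb i x ord0 j * fe_grad (mesh pb i) v x ord0 j.

Definition Lform i (v w : 'rV[R]_m.+1 -> R) : R :=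
  (\int[leb R m.+1]_(x in @Omega m i) (nu pb i *
     \sum_j fe_grad (mesh pb i) v x ord0 j * fe_grad (mesh pb i) w x ord0 j))
  + inner (Omega i) (div_adv i v) w.

Record admissible : Prop := Admissible {
  adm_tf : 0 < tf pb;
  adm_nu : forall i, 0 < nu pb i;
  adm_deg : (1 <= deg pb)%N;
  adm_adv : forall i j,
    W1inf (@Omega m i) (fun x => adv pb i x ord0 j) (fun x => row j (dadv pb i x));
  (* the continuous representative, so that the boundary values make sense *)
  adm_adv_cont : forall i, {within closure (@Omega m i), continuous (adv pb i)};
  adm_adv_tangent : forall i x nn, boundary (@Omega m i) x ->
    outward_normal (lo m i) (hi m i) x nn ->
    \sum_j nn ord0 j * adv pb i x ord0 j = 0;
  adm_src : forall i t, 0 < t <= tf pb -> L2 (@Omega m i) (src pb i t);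
  adm_srcG : forall i t, 0 < t <= tf pb -> L2 (@Gam m) (srcG pb i t);
  adm_init : forall i, L2 (@Omega m i) (init pb i);
  adm_mesh : forall i, is_mesh (@Omega m i) (mesh pb i);
  adm_meshG : is_mesh (@Gam m) (meshG pb);
  adm_regular : exists sigma : R, forall i K, mesh pb i K -> shape_regular sigma K;
  adm_match : forall i,
    [set F | (exists2 K, mesh pb i K & cell_face K 1 F) /\
             F `<=` @emb m @` closure (@Gam m)]
    = [set @emb m @` cell_set T | T in meshG pb];
  adm_coercive : exists c1 c2 : 'I_2 -> R, forall i,
    [/\ 0 < c1 i, 0 < c2 i & forall v, Usp i v ->
        c1 i * H1sq i v <= Lform i v v <= c2 i * H1sq i v]
}.

Record sd_solution (u : 'I_2 -> R -> 'rV[R]_m.+1 -> R)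
    (F : 'I_2 -> R -> 'rV[R]_m -> R) : Prop := SDSolution {
  sd_u : forall i t, 0 <= t <= tf pb -> Usp i (u i t);
  sd_F : forall i t, 0 < t <= tf pb -> UG (F i t);
  sd_cont : forall i x, {within `[0, tf pb], continuous (fun t => u i t x)};
  sd_ode : forall i t, 0 < t <= tf pb -> exists du : 'rV[R]_m.+1 -> R,
    [/\ Usp i du,
        forall x, deriv_within `[0, tf pb] (fun s => u i s x) t (du x)
      & forall v, Usp i v ->
          inner (Omega i) du v = - Lform i (u i t) v
            - inner (@Gam m) (F i t) (trace v) + inner (Omega i) (src pb i t) v];
  sd_init : forall i v, Usp i v ->
    inner (Omega i) (u i 0) v = inner (Omega i) (init pb i) v;
  sd_flux : forall i t mu, 0 < t <= tf pb -> UG mu ->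
    inner (@Gam m) (F i t) mu =
    inner (@Gam m) (fun y => \sum_j cpl pb i j * trace (u j t) y
                             - srcG pb i t y) mu
}.

Record method := Method {
  qd : nat;
  ns : nat;
  ks : nat;
  rd : 'I_2 -> nat;
  theta : 'I_ns -> R;
  sideD : 'M[R]_(ns, ks.+1);
  N0 : nat
}.

Definition method_ok (mt : method) : Prop :=
  [/\ (ns mt <= (qd mt).+1)%N,
      forall k l : 'I_(ns mt), (k < l)%N -> theta k < theta l,
      forall k : 'I_(ns mt), theta k <= 1
    & (1 <= N0 mt)%N].

(* N coupling windows, numbered w = 1, ..., N; M i steps of subdomain i in each
   window. *)
Definition dt (N : nat) : R := tf pb / N%:R.
Definition dti (N : nat) (M : 'I_2 -> nat) i : R := dt N / (M i)%:R.

(* t_i^z in window [w], where [z] need not be an integer *)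
Definition tpt N M i (w : nat) (z : R) : R := w.-1%:R * dt N + z * dti N M i.

(* The global number of step [n] of window [w]. *)
Definition gidx (M : 'I_2 -> nat) i (w n : nat) : nat := (w.-1 * M i + n)%N.

Definition wint N (w : nat) (f : R -> R) : R :=
  tint (w.-1%:R * dt N) (w%:R * dt N) f.
Definition sint N M i (w n : nat) (f : R -> R) : R :=
  tint (tpt N M i w n.-1%:R) (tpt N M i w n%:R) f.

Section Run.
Variables (mt : method) (N : nat) (M : 'I_2 -> nat).
(* [ud i w n] is u_i^n on window [w]; [US i g] is the side value at time
   g * dti, so that U_i^n of window [w] is [US i (gidx M i w n)]. *)
Variables (ud : 'I_2 -> nat -> nat -> R -> 'rV[R]_m.+1 -> R)
  (US : 'I_2 -> nat -> 'rV[R]_m.+1 -> R)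
  (uG FG : 'I_2 -> nat -> R -> 'rV[R]_m -> R).

(* From window [N0] on, no past side value or past time precedes t = 0. *)
Definition available : Prop := forall i (k : 'I_(ns mt)),
  (ks mt <= (N0 mt).-1 * M i + 1)%N /\
  0 <= ((N0 mt).-1 * M i)%:R + theta k.

Record dgit_solution : Prop := DGiTSolution {
  dg_ud : forall i w n, (1 <= w <= N)%N -> (1 <= n <= M i)%N ->
    timepoly (Usp i) (qd mt) (ud i w n);
  dg_US : forall i g, (g <= N * M i)%N -> Usp i (US i g);
  dg_uG : forall i w, (N0 mt <= w <= N)%N -> timepoly UG (rd mt i) (uG i w);
  dg_FG : forall i w, (N0 mt <= w <= N)%N -> timepoly UG (rd mt i) (FG i w);
  dg_S : forall i w n (k : 'I_(ns mt)),
    (N0 mt <= w <= N)%N -> (1 <= n <= M i)%N -> forall x,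
    ud i w n (tpt N M i w (n.-1%:R + theta k)) x =
      \sum_(l < (ks mt).+1) sideD mt k l * US i (gidx M i w n - l)%N x;
  dg_V : forall i w n v,
    (N0 mt <= w <= N)%N -> (1 <= n <= M i)%N ->
    timepoly (Usp i) ((qd mt).+1 - ns mt) v ->
    inner (Omega i) (US i (gidx M i w n)) (v (tpt N M i w n%:R))
      - sint N M i w n (fun t => inner (Omega i) (ud i w n t) (dtime v t))
    = inner (Omega i) (US i (gidx M i w n.-1)) (v (tpt N M i w n.-1%:R))
      - sint N M i w n (fun t =>
          Lform i (ud i w n t) (v t)
          + inner (@Gam m) (FG i w t) (trace (v t))
          - inner (Omega i) (src pb i t) (v t));
  dg_T : forall i w lam,
    (N0 mt <= w <= N)%N -> timepoly UG (rd mt i) lam ->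
    wint N w (fun t => inner (@Gam m) (uG i w t) (lam t)) =
    \sum_(1 <= n < (M i).+1)
      sint N M i w n (fun t => inner (@Gam m) (trace (ud i w n t)) (lam t));
  dg_F : forall i w lam,
    (N0 mt <= w <= N)%N -> timepoly UG (rd mt i) lam ->
    wint N w (fun t => inner (@Gam m) (FG i w t) (lam t)) =
    wint N w (fun t => inner (@Gam m)
      (fun y => \sum_j cpl pb i j * uG j w t y - srcG pb i t y) (lam t))
}.

End Run.

Section Hypotheses.
Variables (mt : method) (u : 'I_2 -> R -> 'rV[R]_m.+1 -> R)
  (F : 'I_2 -> R -> 'rV[R]_m -> R).
(* D^(j) u_i, D^(j) (u_i restricted to Gamma) and D^(j) F_i *)
Variables (Du : 'I_2 -> nat -> R -> 'rV[R]_m.+1 -> R)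
  (DuG DF : 'I_2 -> nat -> R -> 'rV[R]_m -> R).

Definition regular_on (C : R) N M : Prop := forall i,
  (forall w n, (1 <= w <= N)%N -> (1 <= n <= M i)%N ->
     sobolev_time (Usp i) (Omega i) (tpt N M i w n.-1%:R) (tpt N M i w n%:R)
       (qd mt).+1 (u i) (Du i)) /\
  (forall w, (1 <= w <= N)%N ->
     sobolev_time UG (@Gam m) (w.-1%:R * dt N) (w%:R * dt N)
       (rd mt i).+1 (fun t => trace (u i t)) (DuG i) /\
     sobolev_time UG (@Gam m) (w.-1%:R * dt N) (w%:R * dt N)
       (rd mt i).+1 (F i) (DF i)) /\
  [/\ \sum_(1 <= w < N.+1) \sum_(1 <= n < (M i).+1) \sum_(j < (qd mt).+2)
        sint N M i w n (fun t => nsq (Omega i) (Du i j t)) <= C,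
      \sum_(1 <= w < N.+1) \sum_(j < (rd mt i).+2)
        wint N w (fun t => nsq (@Gam m) (DuG i j t)) <= C
    & \sum_(1 <= w < N.+1) \sum_(j < (rd mt i).+2)
        wint N w (fun t => nsq (@Gam m) (DF i j t)) <= C].

Definition consistent (C : R) N M : Prop := forall i w n,
  (N0 mt <= w <= N)%N -> (1 <= n <= M i)%N ->
  dti N M i * \sum_(k < ns mt)
    nsq (Omega i) (fun x =>
      u i (tpt N M i w (n.-1%:R + theta k)) x
      - \sum_(l < (ks mt).+1)
          sideD mt k l * u i (tpt N M i w (n%:R - (l : nat)%:R)) x)
  <= C * dti N M i ^+ (2 * qd mt + 2) *
     tint (tpt N M i w (n%:R - (ks mt)%:R)) (tpt N M i w n%:R)
       (fun t => \sum_(j < (qd mt).+2) nsq (Omega i) (Du i j t)).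

Definition side_error N M (US : 'I_2 -> nat -> 'rV[R]_m.+1 -> R) i w n
    : 'rV[R]_m.+1 -> R :=
  fun x => u i (tpt N M i w n%:R) x - US i (gidx M i w n) x.

(* square root of the sum over i and n of |||u_i - u_i^n|||^2 on window [w] *)
Definition window_error N M
    (ud : 'I_2 -> nat -> nat -> R -> 'rV[R]_m.+1 -> R) w : R :=
  Num.sqrt (\sum_(i < 2) \sum_(1 <= n < (M i).+1)
    sint N M i w n (fun t => nsq (Omega i) (fun x => u i t x - ud i w n t x))).

Definition init_accurate (C p : R) N M ud US : Prop :=
  Num.sqrt (\sum_(i < 2) nsq (Omega i) (fun x => u i 0 x - US i 0%N x))
    <= C * dt N `^ p /\
  forall w, (1 <= w < N0 mt)%N ->
    Num.sqrt (\sum_(i < 2) \sum_(1 <= n < (M i).+1)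
      nsq (Omega i) (side_error N M US i w n)) <= C * dt N `^ p /\
    window_error N M ud w <= C * dt N `^ p.

Definition rate (p : R) N M : R :=
  dt N `^ p +
  \sum_(i < 2) (dti N M i ^+ (qd mt).+1 + dt N ^+ (rd mt i).+1).

End Hypotheses.

(* [psi 0], ..., [psi q] is an L^2(-1,1)-orthogonal basis of the polynomials of
   degree at most [q], with [psi j] of degree at most [j]. *)
Definition orthogonal_basis (q : nat) (psi : nat -> {poly R}) : Prop :=
  [/\ forall j, (j <= q)%N -> (size (psi j) <= j.+1)%N,
      forall j k, (j <= q)%N -> (k <= q)%N -> j <> k ->
        tint (-1) 1 (fun t => (psi j).[t] * (psi k).[t]) = 0
    & forall p : {poly R}, (size p <= q.+1)%N ->
        exists! c : 'rV[R]_q.+1, p = \sum_j c ord0 j *: psi j].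

(* With indices starting from 0, m_k is k + q + 1 - ns. *)
Definition Dtilde (mt : method) (psi : nat -> {poly R}) : 'M[R]_(ns mt) :=
  \matrix_(j, k) (psi (k + (qd mt).+1 - ns mt)%N).[2 * theta j - 1].

End SemiDiscrete.
End Spaces.

(* Main.v *)
(* On a fixed mesh everything happens in finite dimensional spaces, so the errors
   are measured by their coordinates in nodal bases, and the variational
   equations are tested with the dual bases. On one step, the coordinates of
   u_i^n - p, where p is a polynomial approximating u_i, are polynomials of degree
   at most q that are determined by ns point values and by their moments against
   polynomials of degree at most q - ns; since Dtilde is nonsingular these data
   vanish only for the zero polynomial, so by compactness and scaling the error
   on a step is bounded by the side values, the residual of the side conditions,
   the approximation error and the integrals in time of the errors in u_i and
   F_i. On a window, (T) and (F) are L^2 projections in time, which bounds the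
   integral of the error in F_i by that of the errors in u_1, u_2. When the
   window is short these integrals are absorbed, and a discrete Gronwall
   inequality over the windows concludes. *)
Require Import Defs.
From HB Require Import structures.
From mathcomp Require Import all_boot all_order all_algebra.
From mathcomp Require Import all_classical all_reals all_analysis.
From mathcomp Require Import measurable_realfun ring lra.
Set Implicit Arguments. Unset Strict Implicit. Unset Printing Implicit Defensive.
Import Order.TTheory GRing.Theory Num.Theory.
Import numFieldNormedType.Exports.
Local Open Scope classical_set_scope.
Local Open Scope ring_scope.

(** * Lebesgue measure on row vectors *)

(** The discrete flux of a window depends on the errors of both subdomains over the whole window, so
    no estimate closes step by step. Within a window the side errors may therefore only grow
    additively, by time integrals of the errors, and these integrals are bounded for the whole
    window at once. They are taken in L^1 in time, where projections onto polynomials stay bounded.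
    The consistency hypothesis is quadratic; the arithmetic-geometric inequality makes it linear in
    the integral attached to each step, so that summing over steps only needs the bounded overlap of
    the look-back intervals.

    Two notions of time derivative have to be reconciled: (SD) supplies a pointwise one, the
    regularity hypothesis a weak one. Lebesgue differentiation shows that they agree almost
    everywhere.

    Bilinearity of [Lform] needs bounded, measurable gradients. The delicate case is a
    quadrilateral, where polynomials are composed with the inverse of a bilinear map; the increments
    of such a map are given exactly by its Jacobian at the midpoint, which avoids any inverse
    function theorem. *)

Section RowVectors.
Context (R : realType).

Lemma ball_rVE n (c : 'rV[R]_n) (e : R) : 0 < e -> ball c e =
  \big[setI/setT]_(j < n) ((fun x : 'rV[R]_n => x ord0 j) @^-1` ball (c ord0 j) e).
Proof.
move=> e0; rewrite -bigcap_seq; apply/seteqP; split => x.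
  by move=> [_ h] i _; exact: (h ord0 i).
by move=> h; split=> // i j; rewrite ord1; apply: h; rewrite /= mem_index_enum.
Qed.

Lemma measurable_ball_rV n (c : 'rV[R]_n) (e : R) : measurable (ball c e).
Proof.
have [e0|e0] := ltP 0 e; last first.
  by rewrite (_ : ball c e = set0)//; apply/seteqP; split=> // x [/lt_geF]; rewrite e0.
rewrite ball_rVE//; apply: bigsetI_measurable => j _.
rewrite -[X in measurable X]setTI; apply: measurable_coord => //.
by rewrite ball_itv; exact: measurable_itv.
Qed.

(** The sigma-algebra is generated by the coordinates, not by the topology. Sup-norm balls with
    rational centre and radius are countable, so [pickle] can enumerate those contained in [A], and
    they already cover it. *)
Lemma open_measurable_rV n (A : set 'rV[R]_n) : open A -> measurable A.
Proof.
move=> oA.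
pose B (k : nat) : set 'rV[R]_n :=
  if @unpickle ('rV[rat]_n * rat)%type k is Some z then
    if `[< ball (map_mx ratr z.1 : 'rV[R]_n) (ratr z.2) `<=` A >] then
      ball (map_mx ratr z.1 : 'rV[R]_n) (ratr z.2) else set0
  else set0.
suff -> : A = \bigcup_k B k.
  apply: bigcup_measurable => k _; rewrite /B; case: unpickle => // z.
  by case: ifP => // _; exact: measurable_ball_rV.
apply/seteqP; split=> x; last first.
  by case=> k _; rewrite /B; case: unpickle => // z; case: ifP => // /asboolP; apply.
move=> Ax; have [e e0 eA] : exists2 e : R, 0 < e & ball x e `<=` A.
  by have /nbhs_ballP[e e0 eA] := open_nbhs_nbhs (conj oA Ax); exists e.
(* With [r] below half of [e], a ball of radius [r] that contains [x] lies within [ball x e],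
   whatever its centre. *)
have [r /andP[r0 re]] : exists r : rat, 0 < (ratr r : R) < e / 2.
  have e2 : 0 < e / 2 by rewrite divr_gt0.
  by have [r] := rat_in_itvoo e2; rewrite in_itv; exists r.
have hc j : exists c : rat, `|ratr c - x ord0 j| < (ratr r : R).
  have xr : x ord0 j - ratr r < x ord0 j + ratr r.
    by rewrite ltrBlDr -addrA ltrDl addr_gt0.
  by have [c] := rat_in_itvoo xr; rewrite in_itv /= -ltr_distl; exists c.
pose c : 'rV[rat]_n := \row_j sval (cid (hc j)).
have cx j : `|ratr (c ord0 j) - x ord0 j| < (ratr r : R).
  by rewrite mxE; case: (cid (hc j)).
exists (pickle (c, r)) => //; rewrite /B pickleK /=.
case: asboolP => [_|]; first by split=> // i j; rewrite ord1 mxE; exact: cx.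
case=> y [_ yc]; apply: eA; split=> // i j; rewrite ord1.
have /= := yc i j; rewrite ord1 mxE /ball /= => h.
have := cx j; rewrite distrC => h'.
apply: le_lt_trans (ler_distD (ratr (c ord0 j)) _ _) _.
by rewrite (splitr e) ltrD// (lt_trans _ re).
Qed.

Lemma continuous_measurable_rV n (D : set 'rV[R]_n) (f : 'rV[R]_n -> R) :
  measurable D -> {within D, continuous f} -> measurable_fun D f.
Proof.
move=> mD /continuousP fD.
apply: (measurability _ (RGenOpens.measurableE R)).
move=> _ [_ [a [b ->] <-]].
have oab : open (`]a, b[%classic : set R) by exact: interval_open.
have /open_subspaceP[V oV e] := fD _ oab.
rewrite setIC -[X in measurable X]e; apply: measurableI => //.
exact: open_measurable_rV.
Qed.

Lemma box_open n (l h : 'rV[R]_n) : open (box l h).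
Proof.
rewrite (_ : box l h = \big[setI/setT]_(j < n)
   ((fun x : 'rV[R]_n => x ord0 j) @^-1` `]l ord0 j, h ord0 j[)).
  elim/big_ind : _ => [||j _]; [exact: openT|exact: openI|].
  apply: open_comp; last exact: interval_open.
  move=> x _; exact: coord_continuous.
rewrite -bigcap_seq; apply/seteqP; split=> x /=.
  by move=> hx j _ /=; rewrite in_itv /=.
by move=> hx j; have := hx j (mem_index_enum j); rewrite /= in_itv.
Qed.

Lemma box_measurable n (l h : 'rV[R]_n) : measurable (box l h).
Proof. by apply: open_measurable_rV; exact: box_open. Qed.

(** Follows the recursion of [leb]: the preimage of a box under [snoc] is a box times an interval,
    where the product measure factors. Edges of length zero are allowed and make both sides 0. *)
Lemma leb_box n (l h : 'rV[R]_n) : (forall j, l ord0 j <= h ord0 j) ->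
  leb R n (box l h) = (\prod_j (h ord0 j - l ord0 j))%:E.
Proof.
elim: n l h => [|n IH] l h lh.
  by rewrite /= diracE big_ord0 mem_set// => -[].
pose p (x : 'rV[R]_n.+1) : 'rV[R]_n := \row_j x ord0 (lift ord_max j).
rewrite /= /pushforward.
have -> : @snoc R n @^-1` box l h =
    box (p l) (p h) `*` `]l ord0 ord_max, h ord0 ord_max[%classic.
  apply/seteqP; split=> -[y t] /=.
    move=> b; split=> [j|] /=.
      by have := b (lift ord_max j); rewrite /snoc !mxE liftK.
    by have := b ord_max; rewrite in_itv /= /snoc !mxE unlift_none.
  move=> [b]; rewrite in_itv /= => tb j; rewrite /snoc mxE.
  by case: unliftP => [k ->|->//] /=; have := b k; rewrite !mxE.
rewrite product_measure1E//; last exact: box_measurable.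
rewrite IH; last by move=> j; rewrite !mxE.
rewrite /= lebesgue_measure_itv /= lte_fin.
rewrite (bigD1_ord ord_max)//= [in RHS]mulrC.
under eq_bigr do rewrite !mxE.
case: ltP => hl; first by rewrite EFinM.
have -> : h ord0 ord_max = l ord0 ord_max by apply/eqP; rewrite eq_le hl lh.
by rewrite subrr !mulr0 mule0.
Qed.

End RowVectors.

(** * Finite sums and essentially bounded functions under the integral *)

Section LinearCombination.
Context d (T : measurableType d) (R : realType) (mu : {measure set T -> \bar R}).
Variable D : set T.
Hypothesis mD : measurable D.

Lemma integrable_scale (c : R) (g : T -> R) : mu.-integrable D (EFin \o g) ->
  mu.-integrable D (EFin \o (fun x => c * g x)).
Proof. by move=> hg; have := integrableZl mD c hg. Qed.

Lemma integrable_add (f g : T -> R) : mu.-integrable D (EFin \o f) ->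
  mu.-integrable D (EFin \o g) -> mu.-integrable D (EFin \o (fun x => f x + g x)).
Proof. by move=> hf hg; have := integrableD mD hf hg. Qed.

Lemma integrable_sub (f g : T -> R) : mu.-integrable D (EFin \o f) ->
  mu.-integrable D (EFin \o g) -> mu.-integrable D (EFin \o (fun x => f x - g x)).
Proof. by move=> hf hg; have := integrableB mD hf hg. Qed.

Lemma integrable_zero : mu.-integrable D (EFin \o (fun=> 0 : R)).
Proof. exact: integrable0. Qed.

Lemma integrable_bigsum (I : Type) (r : seq I) (P : pred I) (g : I -> T -> R) :
  (forall i, P i -> mu.-integrable D (EFin \o g i)) ->
  mu.-integrable D (EFin \o (fun x => \sum_(i <- r | P i) g i x)).
Proof.
move=> hg; elim: r => [|i r IH].
  by under eq_fun do rewrite big_nil; exact: integrable_zero.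
under eq_fun do rewrite big_cons.
by have := hg i; case: (P i) => // hi; apply: integrable_add => //; exact: hi.
Qed.

Lemma Rintegral_bigsum (I : Type) (r : seq I) (P : pred I) (g : I -> T -> R) :
  (forall i, P i -> mu.-integrable D (EFin \o g i)) ->
  (\int[mu]_(x in D) (\sum_(i <- r | P i) g i x))%R =
  \sum_(i <- r | P i) (\int[mu]_(x in D) g i x)%R.
Proof.
move=> hg; elim: r => [|i r IH].
  rewrite big_nil; under eq_Rintegral do rewrite big_nil.
  by rewrite /Rintegral integral0.
rewrite big_cons; under eq_Rintegral do rewrite big_cons.
case: ifP => // Pi; rewrite RintegralD ?IH//; first exact: hg.
exact: integrable_bigsum.
Qed.

Lemma Rintegral_lincomb (I : Type) (r : seq I) (P : pred I) (c : I -> R) (g : I -> T -> R) :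
  (forall i, P i -> mu.-integrable D (EFin \o g i)) ->
  (\int[mu]_(x in D) (\sum_(i <- r | P i) c i * g i x))%R =
  \sum_(i <- r | P i) c i * (\int[mu]_(x in D) g i x)%R.
Proof.
move=> hg; rewrite Rintegral_bigsum.
  by apply: eq_bigr => i Pi; rewrite RintegralZl//; exact: hg.
by move=> i Pi; apply: integrable_scale; exact: hg.
Qed.

Lemma integrable_dominated (f g : T -> R) : measurable_fun D f ->
  mu.-integrable D (EFin \o g) -> (forall x, D x -> `|f x| <= g x) ->
  mu.-integrable D (EFin \o f).
Proof.
move=> mf ig fg; apply: (le_integrable mD _ _ ig); first exact/measurable_EFinP.
by move=> x Dx /=; rewrite lee_fin (le_trans (fg _ Dx))// ler_norm.
Qed.

End LinearCombination.

Section EssBounded.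
Context (R : realType) (n : nat) (D : set 'rV[R]_n).
Hypothesis mD : measurable D.
Implicit Types f g : 'rV[R]_n -> R.

Lemma ess_bounded_cst (c : R) : ess_bounded D (fun=> c).
Proof.
split; first exact: measurable_cst.
by exists `|c|; apply: aeW => x _.
Qed.

Lemma ess_boundedD f g : ess_bounded D f -> ess_bounded D g ->
  ess_bounded D (fun x => f x + g x).
Proof.
move=> [mf [B hB]] [mg [B' hB']]; split; first exact: measurable_funD.
exists (B + B'); apply: filterS2 hB hB' => x hf hg Dx.
by rewrite (le_trans (ler_normD _ _))// lerD ?hf ?hg.
Qed.

Lemma ess_boundedM f g : ess_bounded D f -> ess_bounded D g ->
  ess_bounded D (fun x => f x * g x).
Proof.
move=> [mf [B hB]] [mg [B' hB']]; split; first exact: measurable_funM.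
exists (`|B| * `|B'|); apply: filterS2 hB hB' => x hf hg Dx.
rewrite normrM ler_pM//.
  by rewrite (le_trans (hf Dx))// ler_norm.
by rewrite (le_trans (hg Dx))// ler_norm.
Qed.

Lemma ess_bounded_sum (I : Type) (r : seq I) (P : pred I) (f : I -> 'rV[R]_n -> R) :
  (forall i, P i -> ess_bounded D (f i)) ->
  ess_bounded D (fun x => \sum_(i <- r | P i) f i x).
Proof.
move=> hf; elim: r => [|i r IH].
  by under eq_fun do rewrite big_nil; exact: ess_bounded_cst.
under eq_fun do rewrite big_cons.
by have := hf i; case: (P i) => // hi; apply: ess_boundedD => //; exact: hi.
Qed.

Lemma ess_bounded_bounded f (B : R) : measurable_fun D f ->
  (forall x, D x -> `|f x| <= B) -> ess_bounded D f.
Proof. by move=> mf hB; split=> //; exists B; exact: aeW. Qed.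

Hypothesis finD : (leb R n D < +oo)%E.

Lemma ess_bounded_integrable f : ess_bounded D f ->
  (leb R n).-integrable D (EFin \o f).
Proof.
move=> [mf [B hB]]; apply/integrableP; split; first exact/measurable_EFinP.
apply: (@le_lt_trans _ _ (\int[leb R n]_(x in D) (`|B|%:E))%E).
  apply: ae_ge0_le_integral => //.
  - by apply: measurableT_comp => //; exact/measurable_EFinP.
  - apply: filterS hB => x hf Dx.
    by rewrite /= lee_fin (le_trans (hf Dx))// ler_norm.
by rewrite integral_cst// lte_mul_pinfty.
Qed.

End EssBounded.

Section Box.
Context (R : realType) (n : nat) (l h : 'rV[R]_n).
Hypothesis lh : forall j, l ord0 j < h ord0 j.
Let D := box l h.

Lemma leb_box_fin : (leb R n D < +oo)%E.
Proof. by rewrite leb_box ?ltry// => j; exact: ltW. Qed.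

Lemma box_closure_compact : compact (closure D).
Proof.
have cK := @rV_compact R n (fun i => `[l ord0 i, h ord0 i]%classic)
  (fun i => @segment_compact _ _ _).
have sub : D `<=` [set v : 'rV[R]_n | forall i, `[l ord0 i, h ord0 i]%classic (v ord0 i)].
  by move=> x xD i /=; rewrite in_itv/=; have /andP[/ltW -> /ltW ->] := xD i.
apply: (subclosed_compact _ cK); first exact: closed_closure.
apply: subset_trans (closure_subset sub) _.
by have := compact_closed (@norm_hausdorff _ _) cK => /closure_id <-.
Qed.

Lemma cont_ess_bounded f : {within closure D, continuous f} -> ess_bounded D f.
Proof.
move=> cf; have [B hB] : exists B, forall x, closure D x -> `|f x| <= B.
  have := continuous_compact cf box_closure_compact.
  move=> /compact_bounded[M [_ /(_ (M + 1))]]; rewrite ltrDl ltr01 => /(_ erefl) h'.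
  by exists (M + 1) => x Dx; apply: h'; exists x.
apply: (@ess_bounded_bounded _ _ _ _ B); last by move=> x /subset_closure; exact: hB.
apply: continuous_measurable_rV; first exact: box_measurable.
by apply: continuous_subspaceW cf; exact: subset_closure.
Qed.

Lemma open_nonempty_leb (A : set 'rV[R]_n) x : open A -> A x -> (0 < leb R n A)%E.
Proof.
move=> oA Ax; have /nbhs_ballP[e /= e0 eA] := open_nbhs_nbhs (conj oA Ax).
pose a : 'rV[R]_n := \row_j (x ord0 j - e).
pose b : 'rV[R]_n := \row_j (x ord0 j + e).
apply: (@lt_le_trans _ _ (leb R n (box a b))).
  rewrite leb_box; last by move=> j; rewrite !mxE; lra.
  by rewrite lte_fin prodr_gt0// => j _; rewrite !mxE; lra.
apply: le_measure; rewrite ?inE; [exact: box_measurable|exact: open_measurable_rV|].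
move=> y hy; apply: eA; split=> // i j; rewrite ord1.
by have := hy j; rewrite !mxE /ball /= distrC ltr_distl.
Qed.

(** Near an interior point where it does not vanish, [f] is nonzero on an open set; this has
    positive measure because it contains a box, which contradicts [f * f] being zero almost
    everywhere. The boundary follows by continuity. This is what makes Gram matrices invertible. *)
Lemma cont_definite f : {within closure D, continuous f} -> inner D f f = 0 ->
  forall x, closure D x -> f x = 0.
Proof.
move=> cf f0.
have mD : measurable D by exact: box_measurable.
have ebf := cont_ess_bounded cf.
have iff := ess_bounded_integrable mD leb_box_fin (ess_boundedM ebf ebf).
have fD x : D x -> f x = 0.
  move=> Dx; apply/eqP; apply: contraPT f0 => fx0.
  suff : 0 < inner D f f by move=> /lt0r_neq0/eqP.
  have cfD : {in D, continuous f}.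
    rewrite -continuous_open_subspace; last exact: box_open.
    by apply: continuous_subspaceW cf; exact: subset_closure.
  pose A := D `&` f @^-1` [set y | y != 0].
  have oA : open A.
    have := @continuous_inP _ _ D f (@box_open _ _ l h).
    case=> [/(_ cfD) + _]; apply.
    have := @open_neq R 0; apply.
  have Ax : A x by [].
  have Apos := open_nonempty_leb oA Ax.
  rewrite lt_neqAle Rintegral_ge0 ?andbT; last by move=> z _; rewrite -expr2 sqr_ge0.
  apply/negP => /eqP I0.
  have : (\int[leb R n]_(z in D) `|(f z * f z)%:E| = 0)%E.
    transitivity (\int[leb R n]_(z in D) (f z * f z)%:E)%E.
      by apply: eq_integral => z _ /=; rewrite ger0_norm// -expr2 sqr_ge0.
    by move: I0; rewrite /inner /Rintegral => I0; rewrite -[LHS]fineK -?I0//; exact: integrable_fin_num.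
  have mff : measurable_fun D (EFin \o (fun z => f z * f z)).
    by apply/measurable_EFinP; case: (ess_boundedM ebf ebf).
  move=> /(ae_eq_integral_abs _ mD mff)[N [mN N0 subN]].
  have : (leb R n A <= leb R n N)%E.
    apply: le_measure; rewrite ?inE//; first exact: open_measurable_rV.
    move=> z [Dz /= fz]; apply: subN => /= /(_ Dz) /eqP.
    by rewrite eqe mulf_eq0 orbb; apply/negP.
  by rewrite N0 leNgt Apos.
move=> x Dx; apply/eqP; apply/negP => /negP fx0.
have cfx : f y @[y --> within (closure D) (nbhs x)] --> f x.
  by move/subspace_continuousP : cf; apply.
have nb : nbhs x [set y | closure D y -> f y != 0].
  by apply: (cfx [set y | y != 0]); apply: open_nbhs_nbhs; split => //; exact: open_neq.
have [z [Dz /(_ (subset_closure Dz))]] := Dx _ nb.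
by rewrite fD// eqxx.
Qed.

End Box.

(** * Coordinates on finite element spaces *)

Definition lin_closed (T : Type) (R : fieldType) (W : set (T -> R)) : Prop :=
  forall (a b : R) v w, W v -> W w -> W (fun x => a * v x + b * w x).

(** The index [i0] covers empty sums: the zero function is obtained as a combination of [v i0] with
    coefficients 0, which requires [W] to be inhabited. *)
Lemma lin_closed_sum (T : Type) (R : fieldType) (W : set (T -> R)) (I : finType)
    (c : I -> R) (v : I -> T -> R) (i0 : I) :
  lin_closed W -> (forall i, W (v i)) -> W (fun x => \sum_i c i * v i x).
Proof.
move=> hW hv; elim: (index_enum I) => [|i r IH].
  have := hW 0 0 _ _ (hv i0) (hv i0); congr (W _).
  by apply/funext => x; rewrite big_nil !mul0r addr0.
have := hW (c i) 1 _ _ (hv i) IH; congr (W _).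
by apply/funext => x; rewrite big_cons mul1r.
Qed.

(* Elimination: if [v x0 != 0] for some [v] in [W], the members of [W] that
   vanish at [x0] lie in the span of one function less. *)
Lemma point_basis_ord (T : Type) (R : fieldType) n (W : set (T -> R))
    (g : 'I_n -> T -> R) : lin_closed W ->
  (forall v, W v -> exists c : 'I_n -> R, forall x, v x = \sum_s c s * g s x) ->
  exists d (pt : 'I_d -> T) (phi : 'I_d -> T -> R),
    [/\ forall k, W (phi k), forall k l, phi l (pt k) = (k == l)%:R
      & forall v, W v -> forall x, v x = \sum_k v (pt k) * phi k x].
Proof.
elim: n W g => [|n IH] W g hW hg.
  exists 0%N, (fun k : 'I_0 => False_rect T (notF (ltn_ord k))), (fun _ _ => 0).
  split=> [[]//|[]//|v Wv x]; have [c ->] := hg _ Wv.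
  by rewrite !big_ord0.
have [[v0 [x0 [Wv0 v0x]]]|nW] := pselect (exists v x, W v /\ v x != 0); last first.
  exists 0%N, (fun k : 'I_0 => False_rect T (notF (ltn_ord k))), (fun _ _ => 0).
  split=> [[]//|[]//|v Wv x]; rewrite big_ord0; apply/eqP/negP => /negP vx.
  by apply: nW; exists v, x.
have [s0 gs0] : exists s0, g s0 x0 != 0.
  apply/not_existsP => h; move/eqP: v0x; apply.
  have [c ->] := hg _ Wv0; rewrite big1// => s _.
  by have /negP := h s; rewrite negbK => /eqP ->; rewrite mulr0.
pose W' := [set v | W v /\ v x0 = 0].
(* Gaussian elimination with pivot [g s0 x0]: every other generator is corrected so as to vanish at
   [x0]. *)
pose g' s x := g (lift s0 s) x - g (lift s0 s) x0 / g s0 x0 * g s0 x.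
have [||d [pt [phi [Wphi dphi ephi]]]] := IH W' g'.
- move=> a b v w [Wv vx] [Ww wx]; split; first exact: hW.
  by rewrite /= vx wx !mulr0 addr0.
- move=> v [Wv vx]; have [c hc] := hg _ Wv; exists (fun s => c (lift s0 s)) => x.
  move: vx; rewrite !hc !(bigD1_ord s0)//= => /eqP; rewrite addr_eq0 => /eqP cs0.
  have -> : c s0 = - (\sum_(i < n) c (lift s0 i) * g (lift s0 i) x0) / g s0 x0.
    by rewrite -cs0 mulfK.
  rewrite !mulNr !mulr_suml -sumrN -big_split/=; apply: eq_bigr => i _.
  by rewrite /g'; ring.
pose p0 x := v0 x / v0 x0.
have Wp0 : W p0.
  have := hW (v0 x0)^-1 0 _ _ Wv0 Wv0; congr (W _).
  by apply/funext => x; rewrite /p0 mul0r addr0 mulrC.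
have Wphi' k : W (phi k) by have [] := Wphi k.
have phi0 k : phi k x0 = 0 by have [] := Wphi k.
have p00 : p0 x0 = 1 by rewrite /p0 divff.
(* [p0] is 1 at [x0]; subtracting its interpolant at the other points makes it vanish there and
   changes nothing at [x0], since the [phi k] vanish at [x0]. So [q0] is the nodal function of
   [x0]. *)
pose q0 x := 1 * p0 x + -1 * (\sum_k p0 (pt k) * phi k x).
have Wq0 : W q0.
  (* When no other point exists there is no index to give to [lin_closed_sum], and [q0] reduces to
     [p0]. *)
  case: d pt phi Wphi dphi ephi Wphi' phi0 @q0 => [|d] pt phi _ _ _ Wphi' _ q0.
    have := hW 1 0 _ _ Wp0 Wp0; congr (W _).
    by apply/funext => x; rewrite /q0 big_ord0 mulr0 mul0r.
  by apply: (hW) => //; exact: (lin_closed_sum (fun k => p0 (pt k)) ord0 hW Wphi').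
pose f (A : Type) (a : A) (b : 'I_d -> A) (k : 'I_d.+1) :=
  if unlift ord0 k is Some j then b j else a.
exists d.+1, (f _ x0 pt), (f _ q0 phi); split.
- by move=> k; rewrite /f; case: unliftP => [j _|_//]; exact: Wphi'.
- move=> k l; rewrite /f.
  case: (unliftP ord0 k) => [k' ->|->]; case: (unliftP ord0 l) => [l' ->|->].
  + by rewrite dphi (inj_eq lift_inj).
  + rewrite /q0 (bigD1 k')//= dphi eqxx big1.
      by rewrite /=; ring.
    by move=> j jk; rewrite dphi eq_sym (negbTE jk) mulr0.
  + by rewrite phi0 (negbTE (neq_lift _ _)).
  + rewrite /q0 p00 eqxx big1 ?mulr0 ?addr0 ?mulr1// => j _.
    by rewrite phi0 mulr0.
- move=> v Wv x; rewrite big_ord_recl /f unlift_none.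
  have Wv' : W' (fun x => 1 * v x + (- v x0) * p0 x).
    by split; [exact: hW|rewrite /= p00; ring].
  have := ephi _ Wv' x => /= e.
  have -> : v x = v x0 * p0 x + (1 * v x + - v x0 * p0 x) by ring.
  rewrite e /q0.
  under [X in _ = _ + X]eq_bigr do rewrite liftK.
  rewrite mulrDr mul1r -addrA; congr (_ + _).
  rewrite mulrA mulrN1 mulr_sumr -big_split/=.
  by apply: eq_bigr => k _; ring.
Qed.

Lemma point_basis (T : Type) (R : fieldType) (I : finType) (W : set (T -> R))
    (g : I -> T -> R) : lin_closed W ->
  (forall v, W v -> exists c : I -> R, forall x, v x = \sum_s c s * g s x) ->
  exists d (pt : 'I_d -> T) (phi : 'I_d -> T -> R),
    [/\ forall k, W (phi k), forall k l, phi l (pt k) = (k == l)%:R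
      & forall v, W v -> forall x, v x = \sum_k v (pt k) * phi k x].
Proof.
move=> hW hg; apply: (@point_basis_ord _ _ #|I| W (fun s => g (enum_val s))) => //.
move=> v /hg[c hc]; exists (fun s => c (enum_val s)) => x.
by rewrite hc big_enum_val.
Qed.

(** Classical equality on cells, so that a finite mesh can be listed and searched as a sequence. *)
HB.instance Definition _ (R : realType) n := gen_eqMixin (cell R n).

Section FESpace.
Context (R : realType) (n k : nat) (D : set 'rV[R]_n) (tau : set (cell R n))
  (B : set 'rV[R]_n).

Lemma polyfun_lin total : lin_closed (@polyfun R n k total).
Proof.
move=> a b v w [c ->] [c' ->]; exists (fun m => a * c m + b * c' m).
apply/funext => x; rewrite !mulr_sumr -big_split/=; apply: eq_bigr => m _; ring.
Qed.

Lemma fe_space_lin : lin_closed (fe_space k D tau B).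
Proof.
move=> a b v w [cv v0 pv Bv] [cw w0 pw Bw]; split.
- by move=> x; apply: cvgD; apply: cvgMr; [exact: cv|exact: cw].
- by move=> x Dx; rewrite v0// w0// !mulr0 addr0.
- move=> K tK; have := pv K tK; have := pw K tK; case: K {tK} => p /=.
    move=> [q hq e] [q' hq' e'].
    exists (fun x => a * q' x + b * q x); first exact: polyfun_lin.
    by move=> x Kx; rewrite e// e'.
  move=> [q hq e] [q' hq' e'].
  exists (fun x => a * q' x + b * q x); first exact: polyfun_lin.
  by move=> x Kx; rewrite e// e'.
- by move=> x Bx; rewrite Bv// Bw// !mulr0 addr0.
Qed.

(** Any preimage serves for a brick: [cell_poly] expresses the value of [v] at [x] through each of
    them. *)
Definition ref_pt (K : cell R n) (x : 'rV[R]_n) : 'rV[R]_n :=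
  match K with
  | Simplex _ => x
  | Brick w => xget 0 [set y | @unit_cube R n y /\ brick_map w y = x]
  end.

Lemma cell_polyE (K : cell R n) v : cell_poly k K v ->
  exists c : {ffun 'I_n -> 'I_k.+1} -> R, forall x, cell_set K x ->
    v x = \sum_a c a * \prod_j ref_pt K x ord0 j ^+ a j.
Proof.
case: K => w /= [p [c ->] e].
  exists (fun a : {ffun 'I_n -> 'I_k.+1} =>
    if (true ==> (\sum_j a j <= k)%N) then c a else 0) => x Kx.
  by rewrite e// big_mkcond; apply: eq_bigr => a _; case: ifP => _ //; rewrite mul0r.
exists c => x [y uy yx]; case: xgetP => [z _ [uz <-]|/(_ y)[]//].
by rewrite e.
Qed.

(** The generators are discontinuous and usually outside the space: monomials in the reference
    coordinates, cut off to the points whose first cell in the enumeration is the given one. Shared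
    faces are thus counted once. *)
Lemma fe_space_span : finite_set tau -> \bigcup_(K in tau) cell_set K = closure D ->
  exists (I : finType) (g : I -> 'rV[R]_n -> R), forall v, fe_space k D tau B v ->
    exists c : I -> R, forall x, v x = \sum_s c s * g s x.
Proof.
move=> /finite_seqP[s taus] cov.
pose N := size s; pose L := nth (Simplex (fun=> 0 : 'rV[R]_n)) s.
have hL1 i : (i < N)%N -> tau (L i) by move=> iN; rewrite taus /= mem_nth.
have hL2 K : tau K -> exists2 i, (i < N)%N & L i = K.
  by rewrite taus /= => Ks; exists (index K s); [rewrite index_mem|exact: nth_index].
pose fst_in (i : 'I_N) x := cell_set (L i) x /\ forall j, (j < i)%N -> ~ cell_set (L j) x.
exists ('I_N * {ffun 'I_n -> 'I_k.+1})%type,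
  (fun (s : 'I_N * {ffun 'I_n -> 'I_k.+1}) x => if `[< fst_in s.1 x >] then \prod_j ref_pt (L s.1) x ord0 j ^+ s.2 j else 0).
move=> v [_ v0 pv _].
have /choice[c hc] (i : 'I_N) := cell_polyE (pv _ (hL1 _ (ltn_ord i))).
exists (fun s => c s.1 s.2) => x.
rewrite -(pair_bigA _ (fun i a => c i a *
  (if `[< fst_in i x >] then \prod_j ref_pt (L i) x ord0 j ^+ a j else 0)))/=.
have [Dx|nDx] := pselect (closure D x); last first.
  rewrite v0// big1// => i _; rewrite big1// => a _.
  case: asboolP => [[Kx _]|_]; last by rewrite mulr0.
  by exfalso; apply: nDx; rewrite -cov; exists (L i) => //; exact: hL1.
have [i0 [i0x mini0]] : exists i : 'I_N, fst_in i x /\ forall j : 'I_N, fst_in j x -> j = i.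
  have ex : exists i, `[< cell_set (L i) x >].
    move: Dx; rewrite -cov => -[K /hL2[i _ <-] Kx]; exists i; exact/asboolP.
  case: (ex_minnP ex) => i /asboolP ix imin.
  have iN : (i < N)%N.
    move: Dx; rewrite -cov => -[K /hL2[j jN <-] Kx].
    by apply: leq_ltn_trans jN; apply: imin; exact/asboolP.
  exists (Ordinal iN); split.
    by split=> //= j ji jx; move: ji; rewrite ltnNge imin//; exact/asboolP.
  move=> j [jx jmin]; apply/val_inj/eqP => /=.
  by rewrite eqn_leq imin; [rewrite andbT leqNgt; apply/negP => /jmin|exact/asboolP].
rewrite (bigD1 i0)//= (hc i0)//; last by case: i0x.
rewrite [X in _ + X]big1 ?addr0.
  by apply: eq_bigr => a _; rewrite asboolT.
move=> i ii0; rewrite big1// => a _; rewrite asboolF ?mulr0//.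
by move=> /mini0 e; rewrite e eqxx in ii0.
Qed.

End FESpace.

(* Coordinates on a space [W] of functions, for the inner product of [L^2(D)]:
   [phi] is a nodal basis for the points [pt], and [dual] its dual basis. *)
Record is_coords (R : realType) n (D : set 'rV[R]_n) (W : set ('rV[R]_n -> R)) d
    (pt : 'I_d -> 'rV[R]_n) (phi dual : 'I_d -> 'rV[R]_n -> R) (C : R) : Prop := IsCoords {
  coords_phi : forall k, W (phi k);
  coords_dual : forall k, W (dual k);
  coordsE : forall v, W v -> v = fun x => \sum_k v (pt k) * phi k x;
  coords_inner : forall v, W v -> forall k, inner D v (dual k) = v (pt k);
  coords_pos : 0 < C;
  coords_sqr_le : forall v, W v -> forall k, v (pt k) ^+ 2 <= C * nsq D v;
  coords_nsq_le : forall v, W v -> nsq D v <= C * (\sum_k `|v (pt k)|) ^+ 2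
}.

Section InnerTheory.
Context (R : realType) (n : nat) (D : set 'rV[R]_n).
Hypothesis mD : measurable D.
Implicit Types v w : 'rV[R]_n -> R.

Lemma innerC v w : inner D v w = inner D w v.
Proof. by rewrite /inner; under eq_Rintegral do rewrite mulrC. Qed.

Lemma inner_suml (I : Type) (r : seq I) (P : pred I) (c : I -> R) (f : I -> 'rV[R]_n -> R) w :
  (forall i, P i -> (leb R n).-integrable D (EFin \o (fun x => f i x * w x))) ->
  inner D (fun x => \sum_(i <- r | P i) c i * f i x) w =
  \sum_(i <- r | P i) c i * inner D (f i) w.
Proof.
move=> h; rewrite /inner -Rintegral_lincomb//; apply: eq_Rintegral => x _.
by rewrite mulr_suml; apply: eq_bigr => i _; rewrite mulrA.
Qed.

Lemma inner_lin (a b : R) v1 v2 w :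
  (leb R n).-integrable D (EFin \o (fun x => v1 x * w x)) ->
  (leb R n).-integrable D (EFin \o (fun x => v2 x * w x)) ->
  inner D (fun x => a * v1 x + b * v2 x) w = a * inner D v1 w + b * inner D v2 w.
Proof.
move=> h1 h2; rewrite /inner -!RintegralZl// -RintegralD//; last 2 first.
- exact: integrable_scale.
- exact: integrable_scale.
by apply: eq_Rintegral => x _; ring.
Qed.

Lemma nsq_ge0 v : 0 <= nsq D v.
Proof. by apply: Rintegral_ge0 => x _; rewrite -expr2 sqr_ge0. Qed.

(** Expansion of [nsq] of [nsq w * v - inner v w * w]. The common factor [nsq D w] stays on both
    sides so that no division is made here. *)
Lemma inner_cauchy v w : ess_bounded D v -> ess_bounded D w -> (leb R n D < +oo)%E ->
  nsq D w * inner D v w ^+ 2 <= nsq D w * (nsq D w * nsq D v).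
Proof.
move=> bv bw finD.
have I f g : ess_bounded D f -> ess_bounded D g ->
    (leb R n).-integrable D (EFin \o (fun x => f x * g x)).
  by move=> bf bg; apply: ess_bounded_integrable => //; exact: ess_boundedM.
set c := nsq D w; set b := inner D v w.
pose z x := c * v x + - b * w x.
have bz : ess_bounded D z.
  by apply: ess_boundedD; apply: ess_boundedM => //; exact: ess_bounded_cst.
have := nsq_ge0 z; rewrite /nsq {1}/z inner_lin; [|exact: I|exact: I].
rewrite ![inner D _ z]innerC /z !inner_lin; [|exact: I..].
rewrite (innerC w v) -/b -/(nsq D w) -/c -/(nsq D v) => h.
rewrite -subr_ge0; apply: le_trans h _; rewrite le_eqVlt; apply/orP; left.
by apply/eqP; ring.
Qed.

End InnerTheory.

(** The Gram matrix of the nodal basis is invertible: a row in its kernel gives a member of [W] with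
    zero norm, hence zero, hence with zero nodal values. The rows of the inverse are the
    coefficients of the dual basis. *)
Lemma coords_exist (R : realType) n (l h : 'rV[R]_n) (W : set ('rV[R]_n -> R))
    (I : finType) (g : I -> 'rV[R]_n -> R) :
  (forall j, l ord0 j < h ord0 j) -> lin_closed W ->
  (forall v, W v -> {within closure (box l h), continuous v}) ->
  (forall v, W v -> forall x, ~ closure (box l h) x -> v x = 0) ->
  (forall v, W v -> exists c : I -> R, forall x, v x = \sum_s c s * g s x) ->
  exists d (pt : 'I_d -> 'rV[R]_n) (phi dual : 'I_d -> 'rV[R]_n -> R) (C : R),
    is_coords (box l h) W pt phi dual C.
Proof.
move=> lh Wlin Wcont W0 Wspan; set D := box l h.
have mD : measurable D := box_measurable _ _.
have finD : (leb R n D < +oo)%E := leb_box_fin lh.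
have eb v : W v -> ess_bounded D v by move=> /Wcont; exact: cont_ess_bounded.
have I2 v w : W v -> W w -> (leb R n).-integrable D (EFin \o (fun x => v x * w x)).
  by move=> /eb bv /eb bw; apply: ess_bounded_integrable => //; exact: ess_boundedM.
have def v : W v -> nsq D v = 0 -> v = fun=> 0.
  move=> Wv v0; apply/funext => x; have [Dx|] := pselect (closure D x); last exact: W0.
  exact: (cont_definite lh (Wcont _ Wv) v0).
have [d [pt [phi [Wphi dphi ephi]]]] := point_basis Wlin Wspan.
have ephi' v : W v -> v = fun x => \sum_k v (pt k) * phi k x.
  by move=> Wv; apply/funext => x; exact: ephi.
case: d pt phi Wphi dphi ephi ephi' => [|d] pt phi Wphi dphi ephi ephi'.
  exists 0%N, pt, phi, phi, 1; split=> //; try by case.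
  - by move=> v _ [].
  - by move=> v _ [].
  - move=> v Wv; rewrite big_ord0 expr0n mulr0 (ephi' _ Wv) /nsq /inner.
    by under eq_Rintegral do rewrite big_ord0 mul0r; rewrite /Rintegral integral0.
pose G : 'M[R]_d.+1 := \matrix_(k, j) inner D (phi k) (phi j).
have Wsum (c : 'I_d.+1 -> R) : W (fun x => \sum_k c k * phi k x).
  exact: lin_closed_sum ord0 _ _.
have innerG (c : 'I_d.+1 -> R) w : W w ->
    inner D (fun x => \sum_k c k * phi k x) w = \sum_k c k * inner D (phi k) w.
  by move=> Ww; apply: inner_suml => // i _; exact: I2.
have Gu : G \in unitmx.
  rewrite -row_free_unit; apply: inj_row_free => c cG.
  pose v x := \sum_k c ord0 k * phi k x.
  have Wv : W v by exact: Wsum.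
  have v0 : v = fun=> 0.
    apply: def => //; rewrite /nsq {1}/v innerG//.
    under eq_bigr do rewrite innerC /v innerG//.
    rewrite big1// => k _; apply/eqP; rewrite mulf_eq0; apply/orP; right; apply/eqP.
    have /matrixP/(_ ord0 k) := cG; rewrite !mxE => e; rewrite -[RHS]e.
    by apply: eq_bigr => j _; rewrite mxE.
  apply/rowP => k; rewrite mxE.
  have := congr1 (fun f => f (pt k)) v0; rewrite /v /= (bigD1 k)//= dphi eqxx mulr1.
  by rewrite big1 ?addr0// => j jk; rewrite dphi eq_sym (negbTE jk) mulr0.
pose dual k x := \sum_j invmx G k j * phi j x.
have Wd k : W (dual k) by exact: Wsum.
have dualE v : W v -> forall k, inner D v (dual k) = v (pt k).
  move=> Wv k; rewrite [in LHS](ephi' _ Wv) innerG//.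
  rewrite (bigD1 k)//= innerC /dual innerG//.
  have dE j : \sum_l invmx G k l * inner D (phi l) (phi j) = (k == j)%:R.
    have := mulVmx Gu => /matrixP/(_ k j); rewrite !mxE => <-.
    by apply: eq_bigr => i _; rewrite mxE.
  rewrite dE eqxx mulr1 big1 ?addr0// => j jk.
  by rewrite innerC innerG// dE eq_sym (negbTE jk) mulr0.
(* [C1] serves Cauchy-Schwarz against the dual functions, which bounds nodal values by the norm;
   [C2], the entries of the Gram matrix, serves the converse. *)
pose C1 := \sum_k nsq D (dual k).
pose C2 := \sum_k \sum_j `|inner D (phi k) (phi j)|.
have C10 : 0 <= C1 by apply: sumr_ge0 => k _; exact: nsq_ge0.
have C20 : 0 <= C2 by apply: sumr_ge0 => k _; apply: sumr_ge0 => j _.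
exists d.+1, pt, phi, dual, (1 + C1 + C2); split=> //.
- by rewrite -addrA ltr_pwDl// addr_ge0.
- move=> v Wv k; rewrite -dualE//.
  have cs := inner_cauchy mD (eb _ Wv) (eb _ (Wd k)) finD.
  have [w0|w0] := eqVneq (nsq D (dual k)) 0.
    rewrite (def _ (Wd k) w0) /inner.
    under eq_Rintegral do rewrite mulr0.
    rewrite /Rintegral integral0// expr0n/= mulr_ge0 ?nsq_ge0//.
    by rewrite -addrA addr_ge0// addr_ge0.
  have wp : 0 < nsq D (dual k) by rewrite lt_neqAle eq_sym w0 nsq_ge0.
  rewrite ler_pM2l// in cs; apply: le_trans cs _; apply: ler_wpM2r; first exact: nsq_ge0.
  suff : nsq D (dual k) <= C1 by move: C20; lra.
  by rewrite /C1 (bigD1 k)//= lerDl; apply: sumr_ge0 => i _; exact: nsq_ge0.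
- move=> v Wv; rewrite /nsq {1}(ephi' _ Wv) innerG//.
  apply: (@le_trans _ _ (C2 * (\sum_k `|v (pt k)|) ^+ 2)); last first.
    by apply: ler_wpM2r; [exact: sqr_ge0|move: C10; lra].
  set S := \sum_k `|v (pt k)|.
  have hS k : `|v (pt k)| <= S.
    by rewrite /S (bigD1 k)//= lerDl; apply: sumr_ge0.
  rewrite /C2 mulr_suml; apply: ler_sum => k _.
  apply: le_trans (ler_norm _) _; rewrite normrM innerC {2}(ephi' _ Wv) innerG//.
  rewrite expr2 mulrA [X in _ <= X]mulrC; apply: ler_pM => //.
  rewrite mulr_suml; apply: le_trans (ler_norm_sum _ _ _) _; apply: ler_sum => j _.
  by rewrite normrM mulrC innerC; apply: ler_pM.
Qed.

Lemma fe_coords (R : realType) n k (l h : 'rV[R]_n) tau (B : set 'rV[R]_n) :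
  (forall j, l ord0 j < h ord0 j) -> is_mesh (box l h) tau ->
  exists d (pt : 'I_d -> 'rV[R]_n) (phi dual : 'I_d -> 'rV[R]_n -> R) (C : R),
    is_coords (box l h) (fe_space k (box l h) tau B) pt phi dual C.
Proof.
move=> lh [ftau _ _ cov _].
have [I [g hg]] := fe_space_span k B ftau cov.
apply: (coords_exist lh) hg => [|v []//|v []//].
exact: fe_space_lin.
Qed.

(** * Gradients of finite element functions *)

Section Hadamard.
Context (R : realType) (n : nat).
Implicit Types p : 'rV[R]_n -> R.

(* Increments factor through the coordinate increments, with jointly continuous
   factors. *)
Definition hadamard p : Prop := continuous p /\
  exists q : 'I_n -> 'rV[R]_n -> 'rV[R]_n -> R,
    (forall j, continuous (fun z : 'rV[R]_n * 'rV[R]_n => q j z.1 z.2)) /\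
    forall y y', p y - p y' = \sum_j (y ord0 j - y' ord0 j) * q j y y'.

Lemma continuous_coord (i : 'I_n) : continuous (fun x : 'rV[R]_n => x ord0 i).
Proof. exact: coord_continuous. Qed.

Lemma hadamard_cst (c : R) : hadamard (fun=> c).
Proof.
split; first exact: cst_continuous.
exists (fun _ _ _ => 0); split; first by move=> j; exact: cst_continuous.
by move=> y y'; rewrite subrr big1// => j _; rewrite mulr0.
Qed.

Lemma hadamard_coord i : hadamard (fun x => x ord0 i).
Proof.
split; first exact: continuous_coord.
exists (fun j _ _ => (i == j)%:R); split; first by move=> j; exact: cst_continuous.
move=> y y'; rewrite (bigD1 i)//= eqxx mulr1 big1 ?addr0// => j ji.
by rewrite eq_sym (negbTE ji) mulr0.
Qed.

Lemma hadamardD p1 p2 : hadamard p1 -> hadamard p2 -> hadamard (fun x => p1 x + p2 x).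
Proof.
move=> [c1 [q1 [h1 e1]]] [c2 [q2 [h2 e2]]]; split.
  by move=> x; exact: (continuousD (c1 x) (c2 x)).
exists (fun j y y' => q1 j y y' + q2 j y y'); split.
  by move=> j z; apply: cvgD; [exact: h1|exact: h2].
move=> y y'; rewrite opprD addrACA e1 e2 -big_split/=.
by apply: eq_bigr => j _; rewrite mulrDr.
Qed.

Lemma hadamardM p1 p2 : hadamard p1 -> hadamard p2 -> hadamard (fun x => p1 x * p2 x).
Proof.
move=> [c1 [q1 [h1 e1]]] [c2 [q2 [h2 e2]]]; split.
  by move=> x; exact: (continuousM (c1 x) (c2 x)).
exists (fun j y y' => p1 y * q2 j y y' + p2 y' * q1 j y y'); split.
  move=> j z; apply: cvgD; apply: cvgM; [|exact: h2| |exact: h1].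
  - by apply: (@cvg_comp _ _ _ fst p1 _ (nbhs z.1)); [exact: cvg_fst|exact: c1].
  - by apply: (@cvg_comp _ _ _ snd p2 _ (nbhs z.2)); [exact: cvg_snd|exact: c2].
move=> y y'; transitivity (p1 y * (p2 y - p2 y') + p2 y' * (p1 y - p1 y')); first ring.
rewrite e1 e2 !mulr_sumr -big_split/=; apply: eq_bigr => j _; ring.
Qed.

Lemma hadamard_sum (I : Type) (r : seq I) (P : pred I) (p : I -> 'rV[R]_n -> R) :
  (forall i, hadamard (p i)) -> hadamard (fun x => \sum_(i <- r | P i) p i x).
Proof.
move=> h; elim: r => [|i r IH].
  by under eq_fun do rewrite big_nil; exact: hadamard_cst.
under eq_fun do rewrite big_cons.
by case: (P i) => //; exact: hadamardD.
Qed.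

Lemma hadamard_prod (I : Type) (r : seq I) (P : pred I) (p : I -> 'rV[R]_n -> R) :
  (forall i, hadamard (p i)) -> hadamard (fun x => \prod_(i <- r | P i) p i x).
Proof.
move=> h; elim: r => [|i r IH].
  by under eq_fun do rewrite big_nil; exact: hadamard_cst.
under eq_fun do rewrite big_cons.
by case: (P i) => //; exact: hadamardM.
Qed.

Lemma hadamardX p k : hadamard p -> hadamard (fun x => p x ^+ k).
Proof.
move=> h; elim: k => [|k IH].
  by under eq_fun do rewrite expr0; exact: hadamard_cst.
by under eq_fun do rewrite exprS; exact: hadamardM.
Qed.

Lemma polyfun_hadamard k total p : polyfun k total p -> hadamard p.
Proof.
move=> [c ->]; apply: hadamard_sum => a; apply: hadamardM; first exact: hadamard_cst.
by apply: hadamard_prod => j; apply: hadamardX; exact: hadamard_coord.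
Qed.

End Hadamard.

(** * Difference quotients of polynomials transported to a cell *)

Section CellMap.
Context (R : realType) (n : nat).

(** Cramer's formula rather than [invmx]: it has no case distinction, so continuity of the entries
    is read off the determinant and the cofactors. *)
Definition cramer_inv (A : 'M[R]_n) : 'M[R]_n := (\det A)^-1 *: \adj A.

Lemma mulmx_cramer (A : 'M[R]_n) : A \in unitmx -> A *m cramer_inv A = 1%:M.
Proof.
rewrite unitmxE unitfE => dA.
by rewrite -scalemxAr mul_mx_adj scale_scalar_mx mulVf.
Qed.

Lemma cvg_bigsum (T : Type) (F : set_system T) {FF : Filter F} (I : Type) (r : seq I)
    (f : I -> T -> R) (a : I -> R) :
  (forall i, f i @ F --> a i) -> (fun z => \sum_(i <- r) f i z) @ F --> \sum_(i <- r) a i.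
Proof.
move=> h; elim: r => [|i r IH].
  by under eq_fun do rewrite big_nil; rewrite big_nil; exact: cvg_cst.
by under eq_fun do rewrite big_cons; rewrite big_cons; apply: cvgD.
Qed.

Lemma cvg_det (T : Type) (F : set_system T) {FF : Filter F} k (J : T -> 'M[R]_k) (A : 'M[R]_k) :
  (forall i j, (fun z => J z i j) @ F --> A i j) -> (fun z => \det (J z)) @ F --> \det A.
Proof.
move=> h; rewrite /determinant.
apply: cvg_bigsum => s; apply: cvgMr.
elim: (index_enum _) => [|i r IH].
  by under eq_fun do rewrite big_nil; rewrite big_nil; exact: cvg_cst.
by under eq_fun do rewrite big_cons; rewrite big_cons; apply: cvgM.
Qed.

Lemma cvg_cramer (T : Type) (F : set_system T) {FF : ProperFilter F} (J : T -> 'M[R]_n) (A : 'M[R]_n) i j :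
  (forall i j, (fun z => J z i j) @ F --> A i j) -> A \in unitmx ->
  (fun z => cramer_inv (J z) i j) @ F --> cramer_inv A i j.
Proof.
rewrite unitmxE unitfE => h dA; under eq_fun do rewrite !mxE; rewrite !mxE.
apply: cvgM; first by apply: cvgV => //; exact: cvg_det.
rewrite /cofactor; apply: cvgMr; apply: cvg_det => a b.
by under eq_fun do rewrite !mxE; rewrite !mxE; exact: h.
Qed.

(* [F] maps the reference cell [S] onto [K], with increments given exactly by
   the invertible Jacobian [J] at the midpoint. *)
Record cell_map (K S : set 'rV[R]_n) (F : 'rV[R]_n -> 'rV[R]_n)
    (J : 'rV[R]_n -> 'M[R]_n) : Prop := CellMap {
  cm_onto : forall x, K x <-> exists2 y, S y & F y = x;
  cm_mid : forall y y', S y -> S y' -> S (2^-1 *: (y + y'));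
  cm_unit : forall y, S y -> J y \in unitmx;
  cm_cont : forall i j, continuous (fun y => J y i j);
  cm_incr : forall y y', S y -> S y' -> F y - F y' = (y - y') *m J (2^-1 *: (y + y'));
  cm_bounded : exists2 C, compact C & S `<=` C;
  cm_inv_bounded : exists B : R, forall y i j, S y -> `|cramer_inv (J y) i j| <= B
}.

(** The inverse of [F] inherits the exact increment formula, with the inverse Jacobian at the
    midpoint. Composed with the factorization of the increments of [p], it gives quotients that are
    bounded on the whole cell and continuous on the diagonal. *)
Lemma cell_map_quotient K S F J (v p : 'rV[R]_n -> R) : cell_map K S F J ->
  hadamard p -> (forall y, S y -> v (F y) = p y) ->
  exists (Q : 'I_n -> 'rV[R]_n -> 'rV[R]_n -> R) (B : R),
    [/\ forall z z', K z -> K z' -> v z - v z' = \sum_k (z ord0 k - z' ord0 k) * Q k z z',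
        forall k z z', K z -> K z' -> `|Q k z z'| <= B
      & forall k x, K x -> Q k z x @[z --> within K (nbhs x)] --> Q k x x].
Proof.
move=> cm [cp [q [cq pq]]] vp.
have [C cC SC] := cm_bounded cm.
have [B hB] := cm_inv_bounded cm.
pose G (x : 'rV[R]_n) : 'rV[R]_n := xget 0 [set y | S y /\ F y = x].
have hG x : K x -> S (G x) /\ F (G x) = x.
  by move=> /(cm_onto cm)[y Sy yx]; rewrite /G; case: xgetP => // /(_ y)[].
pose mid z z' := 2^-1 *: (G z + G z').
have Smid z z' : K z -> K z' -> S (mid z z').
  by move=> /hG[? _] /hG[? _]; exact: (cm_mid cm).
have Gincr z z' : K z -> K z' -> G z - G z' = (z - z') *m cramer_inv (J (mid z z')).
  move=> Kz Kz'; have [SGz e] := hG _ Kz; have [SGz' e'] := hG _ Kz'.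
  have := cm_incr cm SGz SGz'; rewrite e e' => ->.
  rewrite -mulmxA mulmx_cramer ?mulmx1//.
  by apply: (cm_unit cm); exact: Smid.
(* Joint continuity of the factors on the compact square [C x C] is what makes this bound uniform in
   both arguments. *)
have [Bq hBq] : exists Bq : R, forall j y y', S y -> S y' -> `|q j y y'| <= Bq.
  have /choice[b hb] : forall j, exists b, forall y y', S y -> S y' -> `|q j y y'| <= b.
    move=> j; have cCC : compact (C `*` C) by exact: compact_setX.
    have := continuous_compact (continuous_subspaceT (cq j)) cCC.
    move=> /compact_bounded[M [_ /(_ (M + 1))]]; rewrite ltrDl ltr01 => /(_ erefl) h'.
    by exists (M + 1) => y y' /SC Cy /SC Cy'; apply: h'; exists (y, y').
  exists (\sum_j `|b j|) => j y y' Sy Sy'.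
  apply: le_trans (hb j _ _ Sy Sy') _; apply: le_trans (ler_norm _) _.
  by rewrite (bigD1 j)//= lerDl sumr_ge0.
pose Q k z z' := \sum_j cramer_inv (J (mid z z')) k j * q j (G z) (G z').
have Gcont x j : K x -> G z ord0 j @[z --> within K (nbhs x)] --> G x ord0 j.
  move=> Kx; apply/cvgrPdist_le => e e0.
  have B10 : 0 < `|B| + 1 by rewrite ltr_wpDl.
  have n0 : 0 < n.+1%:R :> R by rewrite ltr0n.
  (* The inverse map is Lipschitz: [n] increments of size [d], each times at most the bound [B],
     stay below [e]. Dividing by [n.+1] also covers dimension 0. *)
  pose d := e / (`|B| + 1) / n.+1%:R.
  have d0 : 0 < d by rewrite !divr_gt0.
  have : nbhs x (ball x d) by exact: nbhsx_ballx.
  apply: filterS => z [_ xz] Kz /=.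
  have -> : G x ord0 j - G z ord0 j = (G x - G z) ord0 j by rewrite !mxE.
  rewrite Gincr// !mxE; apply: le_trans (ler_norm_sum _ _ _) _.
  apply: (@le_trans _ _ (\sum_(k < n) (d * (`|B| + 1)))).
    apply: ler_sum => k _; rewrite normrM; apply: ler_pM => //.
      by have := xz ord0 k; rewrite /ball /= !mxE => /ltW.
    apply: (@le_trans _ _ B); first by apply: hB; exact: Smid.
    by apply: le_trans (ler_norm _) _; rewrite lerDl.
  rewrite sumr_const card_ord -mulr_natr /d.
  rewrite -[_ / n.+1%:R * _]mulrAC divfK ?gt_eqF// -mulrAC ler_pdivrMr//.
  by rewrite ler_pM2l// ler_nat.
exists Q, (\sum_(j < n) `|B| * `|Bq|); split.
- move=> z z' Kz Kz'; have [SGz e] := hG _ Kz; have [SGz' e'] := hG _ Kz'.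
  rewrite -{1}e -{1}e' !vp// pq.
  transitivity (\sum_j (\sum_k (z ord0 k - z' ord0 k) *
      cramer_inv (J (mid z z')) k j) * q j (G z) (G z')).
    apply: eq_bigr => j _; congr (_ * _).
    have -> : G z ord0 j - G z' ord0 j = (G z - G z') ord0 j by rewrite !mxE.
    by rewrite Gincr// !mxE; apply: eq_bigr => k _; rewrite !mxE.
  under eq_bigr do rewrite mulr_suml.
  rewrite exchange_big/=; apply: eq_bigr => k _; rewrite mulr_sumr.
  by apply: eq_bigr => j _; rewrite mulrA.
- move=> k z z' Kz Kz'; apply: le_trans (ler_norm_sum _ _ _) _.
  have [SGz _] := hG _ Kz; have [SGz' _] := hG _ Kz'.
  apply: ler_sum => j _; rewrite normrM; apply: ler_pM => //.
    by apply: le_trans (ler_norm _); apply: hB; exact: Smid.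
  by apply: le_trans (ler_norm _); apply: hBq.
- move=> k x Kx.
  have wF : ProperFilter (within K (nbhs x)).
    by apply: within_nbhs_proper; exact: subset_closure.
  have Gc : G z @[z --> within K (nbhs x)] --> G x.
    apply/cvg_ballP => e e0.
    have : \forall z \near within K (nbhs x), forall j, `|G x ord0 j - G z ord0 j| < e.
      apply: filter_forall => j.
      by have /cvgrPdist_lt/(_ _ e0) := Gcont x j Kx.
    by apply: filterS => z h; split => // i j; rewrite ord1; exact: h.
  apply: cvg_bigsum => j; apply: cvgM.
    apply: cvg_cramer => [a b|]; last by apply: (cm_unit cm); exact: Smid.
    apply: (@cvg_comp _ _ _ (fun z => mid z x) (fun y => J y a b) _ (nbhs (mid x x))).
      by apply: cvgZr; apply: cvgD => //; exact: cvg_cst.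
    exact: (cm_cont cm).
  apply: (cvg_comp2 (h := q j) Gc (cvg_cst (G x))).
  exact: (cq j (G x, G x)).
Qed.

End CellMap.

Section Simplices.
Context (R : realType) (n : nat).

Lemma hull_bounded (w : 'I_n.+1 -> 'rV[R]_n) S : exists2 C, compact C & hull w S `<=` C.
Proof.
pose b (j : 'I_n) := \sum_i `|w i ord0 j|.
exists [set x : 'rV[R]_n | forall j, `[- b j, b j]%classic (x ord0 j)].
  by apply: (@rV_compact _ _ (fun j => `[- b j, b j]%classic)) => j; exact: segment_compact.
move=> x [l [l0 _ l1 ->]] j /=; rewrite in_itv /= -ler_norml summxE.
apply: le_trans (ler_norm_sum _ _ _) _; apply: ler_sum => i _.
rewrite mxE normrM ger0_norm// ler_piMl// -l1 (bigD1 i)//= lerDl.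
exact: sumr_ge0.
Qed.

(** A simplex is its own reference cell, because its polynomials are posed in physical coordinates;
    convexity gives the midpoints. *)
Lemma simplex_cell_map (w : 'I_n.+1 -> 'rV[R]_n) :
  cell_map (cell_set (Simplex w)) (hull w [set: 'I_n.+1]) id (fun=> 1%:M).
Proof.
split=> [x||y _|i j|y y' _ _||].
- by split=> [hx|[y hy <-]]; [exists x|].
- move=> y y' [l [l0 _ l1 ->]] [l' [l0' _ l1' ->]].
  exists (fun j => 2^-1 * (l j + l' j)); split.
  + by move=> j; rewrite mulr_ge0// addr_ge0.
  + by move=> j; rewrite inE.
  + by rewrite -mulr_sumr big_split/= l1 l1' mulVf.
  + rewrite -big_split/= scaler_sumr; apply: eq_bigr => j _.
    by rewrite -scalerDl scalerA.
- exact: unitmx1.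
- exact: cst_continuous.
- by rewrite mulmx1.
- exact: hull_bounded.
- exists (\sum_i \sum_j `|cramer_inv (1%:M : 'M[R]_n) i j|) => _ i j _.
  rewrite (bigD1 i)//= (bigD1 j)//= -addrA lerDl addr_ge0//.
    by apply: sumr_ge0.
  by apply: sumr_ge0 => k _; apply: sumr_ge0.
Qed.

End Simplices.

Section Bricks.
Context (R : realType) (n : nat).
Implicit Types (w : {ffun 'I_n -> bool} -> 'rV[R]_n) (x : 'rV[R]_n).

Let weight (s : {ffun 'I_n -> bool}) x : R :=
  \prod_j (if s j then x ord0 j else 1 - x ord0 j).

Let sum_weight x : \sum_s weight s x = 1.
Proof.
rewrite -(bigA_distr_bigA (fun j (b : bool) => if b then x ord0 j else 1 - x ord0 j)).
by apply: big1 => j _; rewrite big_bool /= addrC subrK.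
Qed.

(** Replacing the factor [1 - x] of coordinate [j0] by 0 kills exactly the vertices with [s j0]
    false; the full sum then factors over the coordinates. *)
Let sum_weight_coord x j0 : \sum_(s : {ffun 'I_n -> bool} | s j0) weight s x = x ord0 j0.
Proof.
pose f j (b : bool) := if b then x ord0 j else if j == j0 then 0 else 1 - x ord0 j.
transitivity (\sum_(s : {ffun 'I_n -> bool}) \prod_j f j (s j)).
  rewrite big_mkcond; apply: eq_bigr => s _; case: ifP => sj.
    by apply: eq_bigr => j _; rewrite /f; case: eqP => // ->; rewrite sj.
  by rewrite (bigD1 j0)//= /f sj eqxx mul0r.
rewrite -(bigA_distr_bigA f) (bigD1 j0)//= big_bool /f /= eqxx addr0.
rewrite big1 ?mulr1// => j /negbTE jj; rewrite big_bool /= jj.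
by rewrite addrC subrK.
Qed.

Lemma parallelepiped_affine w x : parallelepiped w ->
  brick_map w x = w [ffun=> false] +
    \sum_j x ord0 j *: (w (flip [ffun=> false] j) - w [ffun=> false]).
Proof.
move=> pw; rewrite /brick_map.
under eq_bigr => s _ do rewrite pw -/(weight s x) scalerDr.
rewrite big_split/= -scaler_suml sum_weight scale1r; congr (_ + _).
under eq_bigr do rewrite scaler_sumr big_mkcond/=.
rewrite exchange_big/=; apply: eq_bigr => j _.
by rewrite -big_mkcond/= -scaler_suml sum_weight_coord.
Qed.

(** The symmetric difference keeps only the part that is odd in [h]. In the plane the map has degree
    at most 2, so this part is linear; in the other dimensions the map is affine. *)
Lemma brick_map_odd w (m h : 'rV[R]_n) (t : R) : (n <> 2%N -> parallelepiped w) ->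
  brick_map w (m + t *: h) - brick_map w (m - t *: h) =
  t *: (brick_map w (m + h) - brick_map w (m - h)).
Proof.
have [n2 _|n2 /(_ n2) pw] := pselect (n = 2%N).
  rewrite /brick_map -!sumrB scaler_sumr; apply: eq_bigr => s _.
  rewrite -!scalerBl scalerA; congr (_ *: _).
  clear -n2; subst n; rewrite !big_ord_recl !big_ord0 !mxE.
  by case: (s _); case: (s _); ring.
have AB (a b c : 'rV[R]_n) : (a + b) - (a + c) = b - c.
  by rewrite opprD addrACA subrr add0r.
rewrite !parallelepiped_affine// !AB.
rewrite -!sumrB scaler_sumr; apply: eq_bigr => j _.
by rewrite -!scalerBl scalerA !mxE; congr (_ *: _); ring.
Qed.

Lemma differentiable_bigsum (V W : normedModType R) (I : Type) (r : seq I)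
    (f : I -> V -> W) (x : V) : (forall i, differentiable (f i) x) ->
  differentiable (fun z => \sum_(i <- r) f i z) x.
Proof.
move=> h; elim: r => [|i r IH].
  by under eq_fun do rewrite big_nil; exact: differentiable_cst.
by under eq_fun do rewrite big_cons; exact: (differentiableD (h i) IH).
Qed.

Lemma brick_map_differentiable w x : differentiable (brick_map w) x.
Proof.
apply: differentiable_bigsum => s; apply: differentiableZl.
elim: (index_enum _) => [|i r IH].
  by under eq_fun do rewrite big_nil; exact: differentiable_cst.
under eq_fun do rewrite big_cons; apply: (differentiableM _ IH).
case: (s i); first exact: differentiable_coord.
rewrite (_ : (fun _ => _) = (cst 1 : 'rV[R]_n -> R) - (fun z : 'rV[R]_n => z ord0 i))//.
by apply: differentiableB; [exact: differentiable_cst|exact: differentiable_coord].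
Qed.

(** By [brick_map_odd] the central difference quotient does not depend on its step, so it equals its
    limit: the central difference is exact. *)
Lemma brick_map_diff w (m h : 'rV[R]_n) : (n <> 2%N -> parallelepiped w) ->
  brick_map w (m + h) - brick_map w (m - h) = 2 *: 'd (brick_map w) m h.
Proof.
move=> pw; have df := brick_map_differentiable w m.
have dd v : (fun t : R => t^-1 *: (brick_map w (t *: v + m) - brick_map w m)) @ 0^'
    --> 'd (brick_map w) m v.
  by have := @diff_derivable _ _ _ _ m v df; rewrite /derivable -deriveE.
have dB : (fun t : R => t^-1 *: (brick_map w (t *: h + m) - brick_map w m) -
    t^-1 *: (brick_map w (t *: - h + m) - brick_map w m)) @ (0 : R)^'
    --> 2 *: 'd (brick_map w) m h.
  have -> : 2 *: 'd (brick_map w) m h = 'd (brick_map w) m h - 'd (brick_map w) m (- h).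
    by rewrite linearN opprK scaler_nat mulr2n.
  by apply: cvgB; exact: dd.
apply: (cvg_unique (@norm_hausdorff _ _) _ dB).
apply: (@cvg_trans _ ((fun=> brick_map w (m + h) - brick_map w (m - h)) @ (0 : R)^')).
  apply: near_eq_cvg; near=> t.
  have t0 : t != 0 by near: t; exact: nbhs_dnbhs_neq.
  rewrite /= -scalerBr opprB addrA subrK [_ + m]addrC [_ *: - h + m]addrC scalerN.
  by rewrite brick_map_odd// scalerA mulVf// scale1r.
exact: cvg_cst.
Unshelve. all: by end_near. Qed.

Lemma unit_cube_compact : compact (@unit_cube R n).
Proof.
have -> : @unit_cube R n = [set x | forall j, `[0, 1]%classic (x ord0 j)].
  by apply/seteqP; split=> x hx j; have := hx j; rewrite /= in_itv.
by apply: (@rV_compact R n (fun=> `[0, 1]%classic)) => j; exact: segment_compact.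
Qed.

Lemma brick_cell_map w : Defs.nondegenerate (Brick w) ->
  cell_map (cell_set (Brick w)) (@unit_cube R n) (brick_map w) (jacobian (brick_map w)).
Proof.
move=> [pw Ju].
(* Written as a half central difference, the Jacobian is continuous because [brick_map] is; no
   second derivative is computed. *)
have JE z (h : 'rV[R]_n) : h *m jacobian (brick_map w) z =
    2^-1 *: (brick_map w (z + h) - brick_map w (z - h)).
  by rewrite brick_map_diff// scalerA mulVf// scale1r /jacobian mul_rV_lin1.
have Jc i j : continuous (fun y => jacobian (brick_map w) y i j).
  have -> : (fun y => jacobian (brick_map w) y i j) = (fun y =>
      2^-1 * (brick_map w (y + delta_mx ord0 i) ord0 j -
              brick_map w (y - delta_mx ord0 i) ord0 j)).
    apply/funext => y; have := JE y (delta_mx ord0 i).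
    by rewrite -rowE => /matrixP/(_ ord0 j); rewrite !mxE => ->.
  have cF (a : 'rV[R]_n) : continuous (fun y : 'rV[R]_n => brick_map w (y + a) ord0 j).
    move=> y; apply: (@continuous_comp _ _ _ (fun y : 'rV[R]_n => y + a)
       (fun z => brick_map w z ord0 j)).
      by apply: (@continuousD _ _ _ id (cst a)); [exact: cvg_id|exact: cst_continuous].
    apply: (@continuous_comp _ _ _ (brick_map w) (fun z : 'rV[R]_n => z ord0 j)).
      exact: (differentiable_continuous (brick_map_differentiable _ _)).
    exact: coord_continuous.
  move=> y; have c2 : {for y, continuous (fun _ : 'rV[R]_n => 2^-1 : R)} by exact: cst_continuous.
  exact: (continuousM c2 (continuousB (cF _ y) (cF _ y))).
split=> //.
- move=> y y' hy hy' j; rewrite !mxE.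
  by have /andP[? ?] := hy j; have /andP[? ?] := hy' j; apply/andP; split; lra.
- move=> y y' _ _.
  (* [y] and [y'] are the midpoint plus and minus [2^-1 *: (y - y')], so their increment is a
     central difference. *)
  have -> : y - y' = 2 *: (2^-1 *: (y - y')) by rewrite scalerA divff// scale1r.
  rewrite -scalemxAl JE scalerA divff// scale1r -scalerDr -scalerBr opprB.
  rewrite addrACA subrr addr0 [y + y' + _]addrC addrA subrK -!mulr2n.
  have d2 (z : 'rV[R]_n) : 2^-1 *: (z *+ 2) = z.
    by rewrite -[z *+ 2]scaler_nat scalerA mulVf// scale1r.
  by rewrite !d2.
- by exists (@unit_cube R n); [exact: unit_cube_compact|].
- have /choice[b hb] : forall ij : 'I_n * 'I_n, exists b, forall y, @unit_cube R n y ->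
      `|cramer_inv (jacobian (brick_map w) y) ij.1 ij.2| <= b.
    move=> [i j]; pose f y := cramer_inv (jacobian (brick_map w) y) i j.
    have cf : {within @unit_cube R n, continuous f}.
      apply/subspace_continuousP => y uy.
      have wF : ProperFilter (within (@unit_cube R n) (nbhs y)).
        by apply: within_nbhs_proper; exact: subset_closure.
      apply: cvg_cramer => [a c|]; last exact: Ju.
      by apply: cvg_within_filter; exact: Jc.
    have := continuous_compact cf unit_cube_compact.
    move=> /compact_bounded[M [_ /(_ (M + 1))]]; rewrite ltrDl ltr01 => /(_ erefl) h'.
    by exists (M + 1) => y uy; apply: h'; exists y.
  exists (\sum_ij `|b ij|) => y i j uy; apply: le_trans (hb (i, j) y uy) _.
  apply: le_trans (ler_norm _) _; rewrite (bigD1 (i, j))//= lerDl.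
  exact: sumr_ge0.
Qed.

End Bricks.

Lemma measurable_rV d (T : measurableType d) (R : realType) n (F : T -> 'rV[R]_n) :
  (forall j, measurable_fun setT (fun x => F x ord0 j)) -> measurable_fun setT F.
Proof.
move=> mF _ Y mY; rewrite setTI.
have : (image_set_system setT F measurable) Y.
  apply: mY; split; first exact/sigma_algebra_image/sigma_algebra_measurable.
  rewrite -bigcup_seq => A [/= j _ [B mB <-]].
  rewrite /image_set_system /= !setTI.
  have -> : F @^-1` ((fun x : 'rV_n => x ord0 j) @^-1` B) =
     (fun z => F z ord0 j) @^-1` B by [].
  by rewrite -[X in measurable X]setTI; exact: mF.
by rewrite /image_set_system /= setTI.
Qed.

(** * Boundedness and measurability of piecewise gradients *)

Section Gradient.
Context (R : realType) (n k : nat) (l h : 'rV[R]_n) (tau : set (cell R n))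
  (B : set 'rV[R]_n).
Let D := box l h.
Hypothesis mesh : is_mesh D tau.
Let W := fe_space k D tau B.

Lemma cell_quotient K v : tau K -> W v ->
  exists (Q : 'I_n -> 'rV[R]_n -> 'rV[R]_n -> R) (b : R),
    [/\ forall z z', cell_set K z -> cell_set K z' ->
          v z - v z' = \sum_k (z ord0 k - z' ord0 k) * Q k z z',
        forall k z z', cell_set K z -> cell_set K z' -> `|Q k z z'| <= b
      & forall k x, cell_set K x ->
          Q k z x @[z --> within (cell_set K) (nbhs x)] --> Q k x x].
Proof.
move=> tK [_ _ /(_ K tK) + _]; have := mesh.
case=> _ _ /(_ K tK) + _ _; case: K {tK} => w /= nd.
  move=> [p /polyfun_hadamard hp e].
  exact: (cell_map_quotient (simplex_cell_map w) hp e).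
move=> [p /polyfun_hadamard hp e].
exact: (cell_map_quotient (brick_cell_map nd) hp e).
Qed.

Lemma cell_derivable K v : tau K -> W v -> exists b : R, forall x j,
  interior (cell_set K) x ->
  derivable v x (delta_mx ord0 j) /\ `|'D_(delta_mx ord0 j) v x| <= b.
Proof.
move=> tK Wv; have [Q [b [eQ bQ cQ]]] := cell_quotient tK Wv.
exists b => x j ix; have Kx : cell_set K x by exact: interior_subset.
pose e : 'rV[R]_n := delta_mx ord0 j.
have te : t *: e + x @[t --> (0 : R)^'] --> x.
  have {2}-> : x = 0 *: e + x by rewrite scale0r add0r.
  apply: cvg_within_filter; apply: cvgD; last exact: cvg_cst.
  by apply: cvgZr_tmp; exact: cvg_id.
have nK : \forall t \near (0 : R)^', cell_set K (t *: e + x) by exact: te.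
have dq : (fun t : R => t^-1 *: (v (t *: e + x) - v x)) @ (0 : R)^' --> Q j x x.
  apply: (@cvg_trans _ ((fun t : R => Q j (t *: e + x) x) @ (0 : R)^')).
    apply: near_eq_cvg; near=> t.
    have t0 : t != 0 by near: t; exact: nbhs_dnbhs_neq.
    have Kt : cell_set K (t *: e + x) by near: t.
    rewrite eQ// (bigD1 j)//= big1 => [|i ij]; last first.
      by rewrite !mxE eqxx (negbTE ij) mulr0 add0r subrr mul0r.
    by rewrite !mxE !eqxx mulr1 addrK addr0 /GRing.scale/= mulKf.
  apply: (@cvg_comp _ _ _ (fun t : R => t *: e + x) (fun z => Q j z x) _
    (within (cell_set K) (nbhs x))); last exact: cQ.
  move=> A hA; rewrite /nbhs/=.
  by apply: filterS2 nK (te _ hA) => t Kt; apply.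
split; first by apply/cvg_ex; exists (Q j x x).
have -> : 'D_e v x = Q j x x by rewrite /derive; exact: cvg_lim.
exact: bQ.
Unshelve. all: by end_near. Qed.

Let cells_interior := [set x | exists2 K, tau K & interior (cell_set K) x].

Lemma fe_grad_derivable v x j : W v -> cells_interior x ->
  derivable v x (delta_mx ord0 j) /\ fe_grad tau v x ord0 j = 'D_(delta_mx ord0 j) v x.
Proof.
move=> Wv cx; rewrite /fe_grad asboolT// mxE; split=> //.
by case: cx => K tK ix; have [b hb] := cell_derivable tK Wv; have [] := hb x j ix.
Qed.

Lemma fe_grad_lin (a b : R) v w x j : W v -> W w ->
  fe_grad tau (fun x => a * v x + b * w x) x ord0 j =
  a * fe_grad tau v x ord0 j + b * fe_grad tau w x ord0 j.
Proof.
move=> Wv Ww; have Wvw : W (fun x => a * v x + b * w x) by exact: fe_space_lin.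
have [cx|ncx] := pselect (cells_interior x); last first.
  by rewrite /fe_grad asboolF// !mxE !mulr0 addr0.
have [dv ->] := fe_grad_derivable j Wv cx; have [dw ->] := fe_grad_derivable j Ww cx.
have [_ ->] := fe_grad_derivable j Wvw cx.
have := deriveD (@derivableZ _ _ _ v a _ _ dv) (@derivableZ _ _ _ w b _ _ dw).
by rewrite deriveZ// deriveZ.
Qed.

Lemma fe_grad_bounded v : W v -> exists b : R, forall x j, `|fe_grad tau v x ord0 j| <= b.
Proof.
move=> Wv; have /choice[b hb] : forall K, exists b : R, 0 <= b /\ (tau K -> forall x j,
    interior (cell_set K) x -> `|'D_(delta_mx ord0 j) v x| <= b).
  move=> K; have [tK|ntK] := pselect (tau K); last by exists 0.
  have [b hb] := cell_derivable tK Wv; exists `|b|; split=> // _ x j /hb-/(_ j)[_].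
  by move=> /le_trans; apply; exact: ler_norm.
have [/finite_seqP[s taus] _ _ _ _] := mesh.
exists (\sum_(K <- s) b K) => x j.
have s0 : 0 <= \sum_(K <- s) b K by apply: sumr_ge0 => K _; have [] := hb K.
have [cx|ncx] := pselect (cells_interior x); last first.
  by rewrite /fe_grad asboolF// !mxE normr0.
have [_ ->] := fe_grad_derivable j Wv cx; case: cx => K tK ix.
apply: le_trans ((hb K).2 tK x j ix) _.
have Ks : K \in s by move: tK; rewrite taus.
rewrite (big_rem K)//= lerDl; apply: sumr_ge0 => K' _; by have [] := hb K'.
Qed.

Lemma fe_measurable v : W v -> measurable_fun setT v.
Proof.
move=> [cv v0 _ _]; rewrite -(setUv (closure D)).
have mc : measurable (closure D).
  by rewrite -[X in measurable X]setCK; apply: measurableC; apply: open_measurable_rV;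
     exact/closed_openC/closed_closure.
apply/measurable_funU => //; first exact: measurableC.
split; first exact: continuous_measurable_rV.
apply: (eq_measurable_fun (fun=> 0 : R)); last exact: measurable_cst.
by move=> x; rewrite inE /= => /v0 ->.
Qed.

Lemma fe_grad_ess_bounded v j : W v -> ess_bounded D (fun x => fe_grad tau v x ord0 j).
Proof.
move=> Wv; have [b hb] := fe_grad_bounded Wv.
apply: (@ess_bounded_bounded _ _ _ _ b); last by move=> x _; exact: hb.
have oO : open cells_interior.
  have -> : cells_interior = \bigcup_(K in tau) interior (cell_set K) by [].
  by apply: bigcup_open => K _; exact: open_interior.
have mO := open_measurable_rV oO.
suff mg : measurable_fun setT (fun x => fe_grad tau v x ord0 j).
  exact: measurable_funS mg.
rewrite -(setUv cells_interior); apply/measurable_funU => //; first exact: measurableC.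
split; last first.
  apply: (eq_measurable_fun (fun=> 0 : R)); last exact: measurable_cst.
  by move=> x; rewrite inE /= /fe_grad => nx; rewrite asboolF// mxE.
pose e : 'rV[R]_n := delta_mx ord0 j.
(* On the open union of the cell interiors the partial derivative is a pointwise limit of difference
   quotients of the zero extension of [v], which is measurable everywhere. *)
apply: (@measurable_fun_cvg _ _ _ _
  (fun m x => m.+1%:R * (v (m.+1%:R^-1 *: e + x) - v x))).
  move=> m; apply: measurable_funM => //; apply: measurable_funB.
    apply: (@measurable_funS _ _ _ _ setT) => //.
    apply: (measurableT_comp (fe_measurable Wv)); apply: measurable_rV => i.
    under eq_fun do rewrite !mxE; apply: measurable_funD; first exact: measurable_cst.
    exact: measurable_coord.
  by apply: (@measurable_funS _ _ _ _ setT) => //; exact: fe_measurable.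
move=> x cx; have [dv ->] := fe_grad_derivable j Wv cx.
have lim0 : (m.+1%:R^-1 : R) @[m --> \oo] --> (0 : R)^'.
  move=> A hA; have h' : \forall m \near \oo, (m.+1%:R^-1 : R) != 0 -> A (m.+1%:R^-1).
    exact: (@cvg_harmonic R _ hA).
  by apply: filterS h' => m; apply; rewrite invr_eq0 pnatr_eq0.
have := cvg_comp _ _ lim0 dv; rewrite /derive; apply: cvg_trans.
by apply: near_eq_cvg; apply: nearW => m /=; rewrite invrK.
Qed.

End Gradient.

(** * The bilinear form *)

(** A point of the closed box is approached from inside by moving it slightly towards the centre. *)
Lemma closure_box (R : realType) n (l h : 'rV[R]_n) :
  (forall j, l ord0 j < h ord0 j) ->
  closure (box l h) = [set x : 'rV[R]_n | forall j, l ord0 j <= x ord0 j <= h ord0 j].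
Proof.
move=> lh; apply/seteqP; split=> x /=.
  have cK := @rV_compact R n (fun i => `[l ord0 i, h ord0 i]%classic)
    (fun i => @segment_compact _ _ _).
  have sub : box l h `<=` [set v : 'rV[R]_n | forall i, `[l ord0 i, h ord0 i]%classic (v ord0 i)].
    by move=> z zD i /=; rewrite in_itv/=; have /andP[/ltW -> /ltW ->] := zD i.
  move=> /(closure_subset sub).
  have /closure_id <- := compact_closed (@norm_hausdorff _ _) cK.
  by move=> hx j; have := hx j; rewrite /= in_itv.
move=> hx U /nbhs_ballP[e /= e0 eU].
pose c j := (l ord0 j + h ord0 j) / 2.
pose S := 1 + \sum_j `|c j - x ord0 j|.
have S0 : 0 < S by rewrite ltr_pwDl// sumr_ge0.
(* [t <= 1 / 2] keeps the moved point strictly inside; [t * S <= e / 2] keeps every coordinate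
   within [e] of [x]. *)
pose t := Num.min (1 / 2) (e / 2 / S).
have t0 : 0 < t by rewrite lt_min !divr_gt0.
have t1 : t <= 1 / 2 by rewrite ge_min lexx.
have tS : t * S <= e / 2 by rewrite -ler_pdivlMr// ge_min lexx orbT.
exists (\row_j (x ord0 j + t * (c j - x ord0 j))); split.
  move=> j; rewrite mxE; have := hx j; have := lh j; rewrite /c => lj /andP[h1 h2].
  by apply/andP; split; nra.
apply: eU; split=> // i j; rewrite ord1 mxE /ball /= opprD addrA subrr add0r normrN.
rewrite normrM gtr0_norm//; apply: (@le_lt_trans _ _ (t * S)).
  rewrite ler_pM2l// /S (bigD1 j)//= addrCA lerDl addr_ge0// sumr_ge0//.
by apply: le_lt_trans tS _; rewrite ltr_pdivrMr// ltr_pMr// ltr1n.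
Qed.

Section Forms.
Context (R : realType) (m : nat) (pb : problem R m) (hpb : admissible pb).
Implicit Types (i : 'I_2) (v w : 'rV[R]_m.+1 -> R).

Lemma lo_lt_hi i j : lo R m i ord0 j < hi R m i ord0 j.
Proof.
rewrite !mxE; case: (j == ord_max); case: (i != ord0) => /=; rewrite ?ltr01//; exact: ltrN10.
Qed.

Lemma Gam_lt j : (const_mx 0 : 'rV[R]_m) ord0 j < (const_mx 1 : 'rV[R]_m) ord0 j.
Proof. by rewrite !mxE ltr01. Qed.

Let mO i : measurable (@Omega R m i) := box_measurable _ _.
Let fO i : (leb R m.+1 (@Omega R m i) < +oo)%E := leb_box_fin (lo_lt_hi i).

Lemma Usp_lin i : lin_closed (Usp pb i).
Proof. exact: fe_space_lin. Qed.

Lemma UG_lin : lin_closed (UG pb).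
Proof. exact: fe_space_lin. Qed.

Lemma Usp_ess_bounded i v : Usp pb i v -> ess_bounded (@Omega R m i) v.
Proof. by case=> cv _ _ _; exact: cont_ess_bounded. Qed.

Lemma UG_ess_bounded (v : 'rV[R]_m -> R) : UG pb v -> ess_bounded (@Gam R m) v.
Proof. by case=> cv _ _ _; exact: cont_ess_bounded. Qed.

Lemma emb_closure i y : closure (@Gam R m) y -> closure (@Omega R m i) (emb y).
Proof.
rewrite /Gam /Omega !closure_box; [|exact: lo_lt_hi|exact: Gam_lt].
move=> hy j; rewrite /emb /snoc !mxE.
case: unliftP => [k ->|->] /=.
  have -> : (lift ord_max k == ord_max) = false by rewrite eq_sym; apply/negbTE/neq_lift.
  by have := hy k; rewrite !mxE.
by rewrite eqxx /=; case: (i != ord0); rewrite /= lexx ?ler01 ?oppr_le0 ?ler01.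
Qed.

Lemma emb_continuous : continuous (@emb R m).
Proof.
move=> y; have FF := nbhs_filter y; apply/cvg_ballP => e e0.
have : nbhs y (ball y e) by exact: nbhsx_ballx.
apply: filterS => z [_ yz]; split=> // a j; rewrite ord1 /emb /snoc !mxE.
case: unliftP => [k _|_] /=; last exact: ballxx.
exact: yz.
Qed.

Lemma trace_ess_bounded i v : Usp pb i v -> ess_bounded (@Gam R m) (trace v).
Proof.
case=> cv _ _ _; apply: cont_ess_bounded.
apply/subspace_continuousP => y Dy; move/subspace_continuousP : cv => cv.
apply: (@cvg_comp _ _ _ (@emb R m) v _ (within (closure (@Omega R m i)) (nbhs (emb y)))).
  move=> A hA.
  have hB : nbhs y [set z | closure (@Omega R m i) (emb z) -> A (emb z)].
    exact: (emb_continuous hA).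
  suff : nbhs y [set z | closure (@Gam R m) z -> A (emb z)] by [].
  by apply: filterS hB => z hz Dz; apply: hz; exact: emb_closure.
by apply: cv; exact: emb_closure.
Qed.

Lemma grad_ess_bounded i v j : Usp pb i v ->
  ess_bounded (@Omega R m i) (fun x => fe_grad (mesh pb i) v x ord0 j).
Proof.
by apply: fe_grad_ess_bounded; exact: (adm_mesh hpb).
Qed.

(** The divergence of the advection field involves only the diagonal of [dadv], each entry of which
    belongs to the weak gradient of one component and is bounded by [W1inf]. *)
Lemma div_adv_ess_bounded i v : Usp pb i v -> ess_bounded (@Omega R m i) (div_adv pb i v).
Proof.
move=> Uv; apply: ess_boundedD => //.
  apply: ess_boundedM => //; last exact: Usp_ess_bounded.
  rewrite /mxtrace; apply: ess_bounded_sum => // j _.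
  have [_ /(_ j)[+ _]] := adm_adv hpb i j.
  by under eq_fun do rewrite mxE.
apply: ess_bounded_sum => // j _; apply: ess_boundedM => //.
  by have [] := adm_adv hpb i j.
exact: grad_ess_bounded.
Qed.

Lemma integrableM i v w : ess_bounded (@Omega R m i) v -> ess_bounded (@Omega R m i) w ->
  (leb R m.+1).-integrable (@Omega R m i) (EFin \o (fun x => v x * w x)).
Proof. by move=> bv bw; apply: ess_bounded_integrable => //; exact: ess_boundedM. Qed.

Lemma integrable_diffusion i v w : Usp pb i v -> Usp pb i w ->
  (leb R m.+1).-integrable (@Omega R m i) (EFin \o (fun x => nu pb i *
     \sum_j fe_grad (mesh pb i) v x ord0 j * fe_grad (mesh pb i) w x ord0 j)).
Proof.
move=> Uv Uw; apply: ess_bounded_integrable => //.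
apply: ess_boundedM => //; first exact: ess_bounded_cst.
by apply: ess_bounded_sum => // j _; apply: ess_boundedM => //; exact: grad_ess_bounded.
Qed.

Lemma div_adv_lin i (a b : R) v w : Usp pb i v -> Usp pb i w ->
  div_adv pb i (fun x => a * v x + b * w x) =
  (fun x => a * div_adv pb i v x + b * div_adv pb i w x).
Proof.
move=> Uv Uw; apply/funext => x; rewrite /div_adv.
under eq_bigr => j _ do
  rewrite (fe_grad_lin (adm_mesh hpb i) _ _ _ _ Uv Uw) mulrDr.
rewrite big_split/= !mulrDr !mulr_sumr.
have mulCA (c : R) (f g : 'I_m.+1 -> R) : \sum_i f i * (c * g i) = \sum_i c * (f i * g i).
  by apply: eq_bigr => j _; rewrite mulrCA.
rewrite !mulCA; ring.
Qed.

(** Splitting the integrals requires each of them to converge: gradients, advection and its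
    divergence are essentially bounded, and the domain has finite measure. *)
Lemma Lform_linl i (a b : R) v1 v2 w : Usp pb i v1 -> Usp pb i v2 -> Usp pb i w ->
  Lform pb i (fun x => a * v1 x + b * v2 x) w = a * Lform pb i v1 w + b * Lform pb i v2 w.
Proof.
move=> U1 U2 Uw; rewrite /Lform div_adv_lin// inner_lin//; last 2 first.
- by apply: integrableM; [exact: div_adv_ess_bounded|exact: Usp_ess_bounded].
- by apply: integrableM; [exact: div_adv_ess_bounded|exact: Usp_ess_bounded].
rewrite !mulrDr addrACA; congr (_ + _).
rewrite -!RintegralZl//; [|exact: integrable_diffusion..].
rewrite -RintegralD//; [|by apply: integrable_scale => //; exact: integrable_diffusion..].
apply: eq_Rintegral => x _; under eq_bigr => j _ do
  rewrite (fe_grad_lin (adm_mesh hpb i) _ _ _ _ U1 U2) mulrDl -!mulrA.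
rewrite big_split/= -!mulr_sumr; ring.
Qed.

Lemma Lform_linr i (a b : R) v w1 w2 : Usp pb i v -> Usp pb i w1 -> Usp pb i w2 ->
  Lform pb i v (fun x => a * w1 x + b * w2 x) = a * Lform pb i v w1 + b * Lform pb i v w2.
Proof.
move=> Uv U1 U2; rewrite /Lform innerC inner_lin//; last 2 first.
- by apply: integrableM; [exact: Usp_ess_bounded|exact: div_adv_ess_bounded].
- by apply: integrableM; [exact: Usp_ess_bounded|exact: div_adv_ess_bounded].
rewrite ![inner _ (div_adv _ _ _) _]innerC.
rewrite !mulrDr addrACA; congr (_ + _).
rewrite -!RintegralZl//; [|exact: integrable_diffusion..].
rewrite -RintegralD//; [|by apply: integrable_scale => //; exact: integrable_diffusion..].
apply: eq_Rintegral => x _; under eq_bigr => j _ do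
  rewrite (fe_grad_lin (adm_mesh hpb i) _ _ _ _ U1 U2) mulrDr.
rewrite big_split/= !mulrDr !mulr_sumr.
by congr (_ + _); apply: eq_bigr => j _; ring.
Qed.

End Forms.

(** * Integrals in time *)

Section TimeIntegral.
Context (R : realType).
Implicit Types (a b c d : R) (f g F : R -> R) (P Q : R -> Prop).
Notation mu := (@lebesgue_measure R).

Lemma ae_impl P Q : {ae mu, forall t, P t} -> (forall t, P t -> Q t) ->
  {ae mu, forall t, Q t}.
Proof.
move=> hP PQ; move: hP; apply: filterS => //; exact: (ae_filter_ringOfSetsType mu).
Qed.

Definition tintegrable a b f : Prop := mu.-integrable `]a, b[ (EFin \o f).

Lemma eq_tint a b f g : (forall t, a < t < b -> f t = g t) -> tint a b f = tint a b g.
Proof.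
by move=> h; apply: eq_Rintegral => t; rewrite inE /= in_itv => /h.
Qed.

Lemma eq_tintegrable a b f g : (forall t, a < t < b -> f t = g t) ->
  tintegrable a b f -> tintegrable a b g.
Proof.
move=> h; apply: eq_integrable => // t; rewrite inE /= in_itv /= => /h e.
by rewrite e.
Qed.

Lemma tintegrable_measurable a b f : tintegrable a b f -> measurable_fun `]a, b[ f.
Proof. by move=> /integrableP[/measurable_EFinP]. Qed.

Lemma tint_ae a b f g : measurable_fun `]a, b[ f -> measurable_fun `]a, b[ g ->
  {ae mu, forall t, a < t < b -> f t = g t} -> tint a b f = tint a b g.
Proof.
move=> mf mg h; rewrite /tint /Rintegral; congr fine.
apply: ae_eq_integral => //; [exact/measurable_EFinP|exact/measurable_EFinP|].
apply: (@ae_impl _ (fun t => `]a, b[%classic t -> (f t)%:E = (g t)%:E) h) => t {}h.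
by rewrite /= in_itv /= => /h ->.
Qed.

Lemma tintegrable_ae a b f g : tintegrable a b f -> measurable_fun `]a, b[ g ->
  {ae mu, forall t, a < t < b -> f t = g t} -> tintegrable a b g.
Proof.
move=> /integrableP[mf hf] mg h; apply/integrableP; split; first exact/measurable_EFinP.
apply: le_lt_trans hf; rewrite le_eqVlt; apply/orP; left; apply/eqP.
apply: ae_eq_integral => //.
- by apply: measurableT_comp => //; exact/measurable_EFinP.
- exact: measurableT_comp.
- apply: (@ae_impl _ (fun t => `]a, b[%classic t -> `|(EFin \o g) t|%E = `|(EFin \o f) t|%E) h).
  by move=> t {}h; rewrite /= in_itv /= => /h ->.
Qed.

Lemma tintegrableS a b c d f : a <= c -> d <= b -> tintegrable a b f -> tintegrable c d f.
Proof.
move=> ac db; apply: integrableS => //; apply: subset_itv; by rewrite bnd_simp.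
Qed.

Lemma tintegrableD a b f g : tintegrable a b f -> tintegrable a b g ->
  tintegrable a b (fun t => f t + g t).
Proof. exact: integrable_add. Qed.

Lemma tintegrableB a b f g : tintegrable a b f -> tintegrable a b g ->
  tintegrable a b (fun t => f t - g t).
Proof. exact: integrable_sub. Qed.

Lemma tintegrableZ a b c f : tintegrable a b f -> tintegrable a b (fun t => c * f t).
Proof. exact: integrable_scale. Qed.

Lemma tintegrable_sum a b (I : Type) (r : seq I) (f : I -> R -> R) :
  (forall i, tintegrable a b (f i)) -> tintegrable a b (fun t => \sum_(i <- r) f i t).
Proof. by move=> h; apply: integrable_bigsum => // i _; exact: h. Qed.

Lemma tintegrable_norm a b f : tintegrable a b f -> tintegrable a b (fun t => `|f t|).
Proof. by move=> /integrable_norm. Qed.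

Lemma tintD a b f g : tintegrable a b f -> tintegrable a b g ->
  tint a b (fun t => f t + g t) = tint a b f + tint a b g.
Proof. by move=> hf hg; rewrite /tint RintegralD. Qed.

Lemma tintB a b f g : tintegrable a b f -> tintegrable a b g ->
  tint a b (fun t => f t - g t) = tint a b f - tint a b g.
Proof. by move=> hf hg; rewrite /tint RintegralB. Qed.

Lemma tintZ a b c f : tintegrable a b f -> tint a b (fun t => c * f t) = c * tint a b f.
Proof. by move=> hf; rewrite /tint RintegralZl. Qed.

Lemma tint_sum a b (I : Type) (r : seq I) (f : I -> R -> R) :
  (forall i, tintegrable a b (f i)) ->
  tint a b (fun t => \sum_(i <- r) f i t) = \sum_(i <- r) tint a b (f i).
Proof. by move=> h; rewrite /tint Rintegral_bigsum// => i _; exact: h. Qed.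

Lemma tint_ge0 a b f : (forall t, a < t < b -> 0 <= f t) -> 0 <= tint a b f.
Proof. by move=> h; apply: Rintegral_ge0 => t; rewrite /= in_itv => /h. Qed.

Lemma le_tint a b f g : tintegrable a b f -> tintegrable a b g ->
  (forall t, a < t < b -> f t <= g t) -> tint a b f <= tint a b g.
Proof.
move=> hf hg h; apply: le_Rintegral => // t; rewrite /= in_itv; exact: h.
Qed.

Lemma ler_norm_tint a b f : tintegrable a b f ->
  `|tint a b f| <= tint a b (fun t => `|f t|).
Proof. by move=> hf; apply: le_normr_Rintegral. Qed.

Lemma tintegrable_cst a b c : tintegrable a b (fun=> c).
Proof.
apply/integrableP; split; first by apply/measurable_EFinP; exact: measurable_cst.
rewrite integral_cst//= lebesgue_measure_itv /=.
by case: ifP => _; rewrite ?mule0 ?ltry// -EFinD -EFinM ltry.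
Qed.

Lemma tint_cst a b c : a <= b -> tint a b (fun=> c) = c * (b - a).
Proof.
rewrite le_eqVlt => /predU1P[->|ab].
  by rewrite subrr mulr0 /tint set_itv_ge ?bnd_simp ?ltxx// Rintegral_set0.
rewrite /tint Rintegral_cst//; congr (_ * _).
have := @lebesgue_measure_itv R (Interval (BRight a) (BLeft b)).
by rewrite /= lte_fin ab -EFinD => ->.
Qed.

Lemma tint0 a b f : b <= a -> tint a b f = 0.
Proof.
by move=> ba; rewrite /tint set_itv_ge ?Rintegral_set0// bnd_simp -leNgt.
Qed.

(** The two open intervals miss only the point [c]; the degenerate cases rest on [tint] being 0 over
    an empty interval. *)
Lemma tint_split a b c f : a <= c -> c <= b -> tintegrable a b f ->
  tint a b f = tint a c f + tint c b f.
Proof.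
rewrite le_eqVlt => /predU1P[->|ac]; first by rewrite (tint0 _ (lexx c)) add0r.
rewrite le_eqVlt => /predU1P[->|cb] hf; first by rewrite (tint0 _ (lexx b)) addr0.
have := @Rintegral_itvB _ f (BRight a) (BLeft b) c hf.
rewrite !bnd_simp => /(_ (ltW ac) cb) e.
have hac : tintegrable a c f by apply: tintegrableS hf => //; exact: ltW.
have e2 := Rintegral_itv_bndo_bndc hac.
by rewrite /tint e2 -e addrC subrK.
Qed.

Lemma tint_le_sub a b c d f : a <= c -> d <= b -> tintegrable a b f ->
  (forall t, a < t < b -> 0 <= f t) -> tint c d f <= tint a b f.
Proof.
move=> ac db hf f0; have [cd|dc] := leP c d; last first.
  by rewrite (tint0 _ (ltW dc)) tint_ge0.
rewrite (tint_split ac (le_trans cd db) hf).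
have hf' : tintegrable c b f by apply: tintegrableS hf.
rewrite (tint_split cd db hf') addrCA lerDl addr_ge0// tint_ge0// => t /andP[h1 h2].
  by rewrite f0// h1 (lt_le_trans h2)// (le_trans cd).
by rewrite f0// h2 andbT (le_lt_trans _ h1)// (le_trans ac).
Qed.

Lemma within_continuous_tintegrable a b f : {within `[a, b], continuous f} -> tintegrable a b f.
Proof.
move=> cf; have h : mu.-integrable `[a, b] (EFin \o f).
  by apply: continuous_compact_integrable => //; exact: segment_compact.
by apply: integrableS h => //; apply: subset_itv; rewrite bnd_simp.
Qed.

Lemma continuous_tintegrable a b f : continuous f -> tintegrable a b f.
Proof. by move=> cf; apply: within_continuous_tintegrable; exact: continuous_subspaceT. Qed.

Lemma tintegrable_le a b f g : measurable_fun `]a, b[ f -> tintegrable a b g ->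
  (forall t, a < t < b -> `|f t| <= g t) -> tintegrable a b f.
Proof.
move=> mf ig h; exact: (@integrable_dominated _ _ _ mu _ _ f g).
Qed.

Lemma continuous_bounded a b g : {within `[a, b], continuous g} ->
  exists2 B : R, 0 <= B & forall t, a <= t <= b -> `|g t| <= B.
Proof.
move=> cg; have := continuous_compact cg (@segment_compact _ a b).
move=> /compact_bounded[M [_ /(_ (`|M| + 1))]].
rewrite (le_lt_trans (ler_norm M)) ?ltrDl// => /(_ isT) h.
exists (`|M| + 1); first by rewrite addr_ge0.
by move=> t tab; apply: h; exists t => //=; rewrite in_itv.
Qed.

Lemma tintegrableM_cont a b f g : tintegrable a b f -> continuous g ->
  tintegrable a b (fun t => f t * g t).
Proof.
move=> hf cg; have [B _ hB] := continuous_bounded (continuous_subspaceT cg : {within `[a, b], continuous g}).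
apply: (@tintegrable_le _ _ _ (fun t => B * `|f t|)).
- apply: measurable_funM; first exact: tintegrable_measurable hf.
  by apply: measurable_funS (continuous_measurable_fun cg).
- exact/tintegrableZ/tintegrable_norm.
- move=> t /andP[/ltW ta /ltW tb]; rewrite normrM mulrC ler_wpM2r// hB// ta tb//.
Qed.

Lemma tint_FTC a b f F : a <= b -> (forall t : R, is_derive t 1 F (f t)) -> continuous f ->
  tint a b f = F b - F a.
Proof.
rewrite le_eqVlt => /predU1P[->|ab] dF cf; first by rewrite tint0// subrr.
have cF : continuous F.
  by move=> t; apply/differentiable_continuous/derivable1_diffP; have [] := dF t.
have dF' : derivable_oo_LRcontinuous F a b.
  split; first by move=> t _; have [] := dF t.
    by apply: cvg_at_right_filter; exact: cF.
  by apply: cvg_at_left_filter; exact: cF.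
have h := continuous_FTC2 ab (continuous_subspaceT cf) dF'.
have e : {in `]a, b[, F^`()%classic =1 f}.
  by move=> t _; rewrite derive1E; have [_ ->] := dF t.
have := h e; rewrite integral_itv_bndoo; first by rewrite /tint /Rintegral => ->.
apply/measurable_EFinP; apply: (@measurable_funS _ _ _ _ setT) => //.
exact: continuous_measurable_fun.
Qed.

End TimeIntegral.

(** * Weak derivatives in time *)

Section Cutoff.
Context (R : realType).
Implicit Types (x y s t e : R) (F f : R -> R).

(** A quadratic remainder is checked by one inequality. It lets [ppart ^+ 2], which is C^1 but not
    smooth, be differentiated without cases at its knot. *)
Lemma is_derive_quadratic F (d C x : R) :
  (forall h, `|F (x + h) - F x - h * d| <= C * h ^+ 2) -> is_derive x 1 F d.
Proof.
move=> hF; have C0 : 0 <= C.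
  by have := hF 1; rewrite expr1n mulr1; apply: le_trans.
have lim : (fun h : R => h^-1 *: (F (h *: (1 : R) + x) - F x)) @ (0 : R)^' --> d.
  apply/cvgrPdist_le => e e0; near=> h.
  have h0 : h != 0 by near: h; exact: nbhs_dnbhs_neq.
  have -> : d - h^-1 *: (F (h *: (1 : R) + x) - F x) = - (h^-1 * (F (x + h) - F x - h * d)).
    by rewrite /GRing.scale /= mulr1 [h + x]addrC; field.
  rewrite normrN normrM normfV ler_pdivrMl ?normr_gt0//.
  apply: le_trans (hF h) _; rewrite -[h ^+ 2]real_normK ?num_real// expr2 mulrA mulrC.
  rewrite ler_wpM2l//; near: h.
  have [->|Cn0] := eqVneq C 0; first by apply: nearW => h; rewrite mul0r ltW.
  have Cp : 0 < C by rewrite lt_neqAle eq_sym Cn0.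
  have : \forall h \near (0 : R), `|0 - h| < e / C by apply/nbhs_ballP; exists (e / C) => //=; rewrite divr_gt0.
  move=> /(@nbhs_dnbhs _ _ _); apply: filterS => h; rewrite sub0r normrN => /ltW.
  by rewrite ler_pdivlMr// mulrC.
apply: DeriveDef; first by apply/cvg_ex; exists d.
by rewrite /derive; exact: cvg_lim.
Unshelve. all: by end_near. Qed.

Definition ppart x : R := Num.max x 0.

Lemma ppart_sqr x h : `|ppart (x + h) ^+ 2 - ppart x ^+ 2 - h * (2 * ppart x)| <= h ^+ 2.
Proof.
rewrite /ppart; case: (leP (x + h) 0) => h1; case: (leP x 0) => h2; rewrite ler_norml;
  apply/andP; split; nra.
Qed.

(* integral of the hat function supported on [0, 1], a quadratic B-spline *)
Definition step x : R := 2 * (ppart x ^+ 2 - 2 * ppart (x - 2^-1) ^+ 2 + ppart (x - 1) ^+ 2).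
Definition hat x : R := 4 * (ppart x - 2 * ppart (x - 2^-1) + ppart (x - 1)).

Lemma is_derive_step x : is_derive x 1 step (hat x).
Proof.
(* [8 = 2 * (1 + 2 + 1)]: the coefficients of the three squares in [step], each having a remainder
   of at most [h ^+ 2]. *)
apply: (@is_derive_quadratic _ _ 8) => h; rewrite /step /hat.
have := ppart_sqr x h; have := ppart_sqr (x - 2^-1) h; have := ppart_sqr (x - 1) h.
rewrite ![_ - _ + h]addrAC.
move: (ppart _ ^+ 2) (ppart _ ^+ 2) (ppart _ ^+ 2) (ppart _ ^+ 2) (ppart _ ^+ 2) (ppart _ ^+ 2) => A1 A2 A3 A4 A5 A6.
move: (ppart _) (ppart _) (ppart _) => B1 B2 B3.
rewrite !ler_norml => /andP[h1 h2] /andP[h3 h4] /andP[h5 h6]; apply/andP; split; lra.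
Qed.

Lemma ppart_cont : continuous ppart.
Proof. by move=> x; apply: continuous_max; [exact: cvg_id|exact: cst_continuous]. Qed.

Lemma hat_cont : continuous hat.
Proof.
have c (a : R) : continuous (fun x => ppart (x - a)).
  move=> x; apply: (@continuous_comp _ _ _ (fun x => x - a) ppart); last exact: ppart_cont.
  by apply: (@continuousB _ _ _ id (cst a)); [exact: cvg_id|exact: cst_continuous].
move=> x; apply: cvgMr; apply: cvgD; last exact: c.
by apply: cvgB; [exact: ppart_cont|apply: cvgMr; exact: c].
Qed.

Lemma step_le0 x : x <= 0 -> step x = 0.
Proof.
by move=> x0; rewrite /step /ppart !max_r; [ring|lra..].
Qed.

Lemma step_ge1 x : 1 <= x -> step x = 1.
Proof.
by move=> x0; rewrite /step /ppart !max_l; [field|lra..].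
Qed.

Lemma step01 x : 0 <= step x <= 1.
Proof.
rewrite /step /ppart; case: (leP x 0) => h1; case: (leP (x - 2^-1) 0) => h2;
case: (leP (x - 1) 0) => h3; apply/andP; split; nra.
Qed.

Lemma hat_le0 x : x <= 0 -> hat x = 0.
Proof.
by move=> x0; rewrite /hat /ppart !max_r; [ring|lra..].
Qed.

Lemma hat_ge1 x : 1 <= x -> hat x = 0.
Proof.
by move=> x0; rewrite /hat /ppart !max_l; [field|lra..].
Qed.

Lemma hat_bound x : 0 <= hat x <= 2.
Proof.
rewrite /hat /ppart; case: (leP x 0) => h1; case: (leP (x - 2^-1) 0) => h2;
case: (leP (x - 1) 0) => h3; apply/andP; split; lra.
Qed.

Lemma is_derive_affine_comp F f (c x0 x : R) : is_derive ((x - x0) * c) 1 F (f ((x - x0) * c)) ->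
  is_derive x 1 (fun y => F ((y - x0) * c)) (c * f ((x - x0) * c)).
Proof.
move=> dF.
have dg : is_derive x 1 (fun y : R => (y - x0) * c) c.
  apply: (@is_derive_quadratic _ _ 0) => h.
  by rewrite mul0r (_ : _ - _ = 0) ?normr0//; ring.
have := @is_derive1_comp _ F (fun y : R => (y - x0) * c) x _ _ dF dg.
by move=> h; apply: is_derive_eq h _; rewrite mulrC.
Qed.

Lemma C1c_intro a b (phi dphi : R -> R) c d :
  (forall x : R, is_derive x 1 phi (dphi x)) -> continuous dphi ->
  a < c -> d < b -> (forall x, ~ (c <= x <= d) -> phi x = 0) ->
  C1c (`]a, b[%classic : set R) phi.
Proof.
move=> dp cd ac db h0.
have df x : differentiable phi x by apply/derivable1_diffP; have [] := dp x.
split=> //.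
  move=> e; have -> : (fun x => 'D_e phi x) = (fun x => e * dphi x).
    apply/funext => x; rewrite deriveE// -[X in 'd phi x X]mulr1 linearZ/= -deriveE//.
    by have [_ ->] := dp x.
  by move=> x; apply: cvgMr; exact: cd.
exists `[c, d]%classic; split; first exact: segment_compact.
  by move=> x /=; rewrite !in_itv /= => /andP[h1 h2]; rewrite (lt_le_trans ac)// (le_lt_trans h2).
by move=> x /= nx; apply: h0 => cxd; apply: nx; rewrite in_itv.
Qed.

(* a smooth approximation of the indicator function of ]s, t[ *)
Definition plateau s t e x : R := step ((x - s) * e^-1) - step ((x - t) * e^-1).
Definition dplateau s t e x : R := e^-1 * hat ((x - s) * e^-1) - e^-1 * hat ((x - t) * e^-1).

Lemma is_derive_plateau s t e x : is_derive x 1 (plateau s t e) (dplateau s t e x).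
Proof.
apply: is_deriveB; apply: is_derive_affine_comp; exact: is_derive_step.
Qed.

Lemma hat_comp_cont s e : continuous (fun x => hat ((x - s) * e^-1)).
Proof.
move=> x; apply: (@continuous_comp _ _ _ (fun x => (x - s) * e^-1) hat); last exact: hat_cont.
apply: cvgMl; apply: (@continuousB _ _ _ id (cst s)); [exact: cvg_id|exact: cst_continuous].
Qed.

Lemma dplateau_cont s t e : continuous (dplateau s t e).
Proof. by move=> x; apply: cvgB; apply: cvgMr; exact: hat_comp_cont. Qed.

Lemma plateau_out s t e x : s < t -> 0 < e -> ~ (s <= x <= t + e) -> plateau s t e x = 0.
Proof.
move=> st e0 nx; rewrite /plateau; have [xs|sx] := leP x s.
  by rewrite !step_le0 ?subrr// pmulr_lle0 ?invr_gt0// subr_le0// (le_trans xs)// ltW.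
have xt : t + e < x by rewrite ltNge; apply/negP => h; apply: nx; rewrite (ltW sx).
by rewrite !step_ge1 ?subrr// ler_pdivlMr// mul1r; lra.
Qed.

Lemma plateau_bound s t e x : `|plateau s t e x| <= 1.
Proof.
rewrite /plateau; have := step01 ((x - s) * e^-1); have := step01 ((x - t) * e^-1).
by move=> /andP[h1 h2] /andP[h3 h4]; rewrite ler_norml; apply/andP; split; lra.
Qed.

Lemma tint_hat s e : 0 < e -> tint s (s + e) (fun x => hat ((x - s) * e^-1)) = e.
Proof.
move=> e0; have dF (x : R) : is_derive x 1 (fun x => e * step ((x - s) * e^-1)) (hat ((x - s) * e^-1)).
  have h := @is_derive_affine_comp step hat e^-1 s x (is_derive_step _).
  have h' := @is_deriveZ _ _ _ (fun y => step ((y - s) / e)) e x 1 _ h.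
  by apply: is_derive_eq h' _; rewrite /GRing.scale/= mulVKf ?gt_eqF.
rewrite (tint_FTC _ dF); [|by rewrite lerDl ltW|exact: hat_comp_cont].
have -> : (s + e - s) / e = 1 by field; rewrite gt_eqF.
have -> : (s - s) / e = 0 by ring.
by rewrite (step_le0 (lexx 0)) (step_ge1 (lexx 1)); ring.
Qed.

End Cutoff.

(** * The fundamental theorem of calculus for weak derivatives, at Lebesgue points *)

Section WeakDerivative.
Context (R : realType).
Implicit Types (a b s t : R) (f g : R -> R).
Notation mu := (@lebesgue_measure R).

Definition weak_deriv a b f g : Prop :=
  [/\ tintegrable a b f, tintegrable a b g
    & forall phi, C1c (`]a, b[%classic : set R) phi ->
        tint a b (fun t => f t * derive1 phi t) = - tint a b (fun t => g t * phi t)].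

Lemma lebesgue_pt_ae a b f : tintegrable a b f ->
  {ae mu, forall t, lebesgue_pt (f \_ `]a, b[) t}.
Proof.
move=> hf; apply: lebesgue_differentiation.
exact: integrable_locally_restrict.
Qed.

(** A one-sided mollification: the kernel has mass 1 and is supported in [[s, s + e]]. Such averages
    are what the derivative of a plateau produces. *)
Definition hat_avg a b f s (e : R) := tint a b (fun r => f r * (e^-1 * hat ((r - s) * e^-1))).

(** The kernel has mass 1 and height at most [2 / e], so the deviation from [f s] is dominated by a
    multiple of the mean of [|f - f s|] on the ball of radius [e], which tends to 0 at a Lebesgue
    point. *)
Lemma hat_avg_cvg a b f s : a < s < b -> tintegrable a b f ->
  lebesgue_pt (f \_ `]a, b[) s -> hat_avg a b f s e @[e --> 0^'+] --> f s.
Proof.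
move=> /andP[as_ sb] hf ls; pose f0 := f \_ `]a, b[.
have f0s : f0 s = f s by rewrite /f0 patchE mem_set//= in_itv /= as_ sb.
have ch (e : R) : continuous (fun r => e^-1 * hat ((r - s) * e^-1)).
  by move=> r; apply: cvgMr; exact: hat_comp_cont.
have dv : (fine (davg f0 s e)) @[e --> 0^'+] --> (0 : R).
  exact: (fine_cvg ls).
apply/cvgrPdist_le => d d0; near=> e.
have e0 : 0 < e by near: e; exact: nbhs_right_gt.
have eb : e < b - s by near: e; apply: nbhs_right_lt; rewrite subr_gt0.
have ea : e < s - a by near: e; apply: nbhs_right_lt; rewrite subr_gt0.
(* The factor 4 compares the height [2 / e] of the kernel with the weight [1 / (2 e)] of the ball
   average. *)
have hd : `|0 - fine (davg f0 s e)| <= d / 4.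
  by near: e; move/cvgrPdist_le : dv; apply; rewrite divr_gt0.
pose k r := e^-1 * hat ((r - s) * e^-1).
have kout r : ~ (s < r < s + e) -> k r = 0.
  move=> nr; rewrite /k; have [rs|sr] := leP r s.
    by rewrite hat_le0 ?mulr0// pmulr_lle0 ?invr_gt0// subr_le0.
  have er : s + e <= r by rewrite leNgt; apply/negP => h; apply: nr; rewrite sr.
  by rewrite hat_ge1 ?mulr0// ler_pdivlMr// mul1r; lra.
have kle r : 0 <= k r <= 2 * e^-1.
  have := hat_bound ((r - s) * e^-1) => /andP[h1 h2].
  by rewrite /k mulr_ge0 ?invr_ge0 ?(ltW e0)//= mulrC ler_pM2r ?invr_gt0.
have hfe : tintegrable s (s + e) f by apply: tintegrableS hf; lra.
have hfk : tintegrable s (s + e) (fun r => f r * k r) by exact: (tintegrableM_cont hfe (ch e)).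
have -> : hat_avg a b f s e = tint s (s + e) (fun r => f r * k r).
  have hI : tintegrable a b (fun r => f r * k r) by exact: (tintegrableM_cont hf (ch e)).
  rewrite /hat_avg (tint_split (ltW as_) (ltW sb) hI).
  have hI' : tintegrable s b (fun r => f r * k r) by apply: tintegrableS hI; lra.
  rewrite (@tint_split _ s b (s + e) _ _ _ hI'); [|lra|lra].
  rewrite (eq_tint (g := fun=> 0)) => [|r /andP[h1 h2]]; last first.
    by rewrite kout ?mulr0//; move=> /andP[]; rewrite ltNge (ltW h2).
  rewrite tint_cst ?(ltW as_)// mul0r add0r.
  rewrite [X in _ + X](eq_tint (g := fun=> 0)) => [|r /andP[h1 h2]]; last first.
    by rewrite kout ?mulr0//; move=> /andP[_]; rewrite ltNge (ltW h1).
  by rewrite tint_cst; [rewrite mul0r addr0|lra].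
have kint : tintegrable s (s + e) k by apply: continuous_tintegrable; exact: ch.
have -> : f s = tint s (s + e) (fun r => f s * k r).
  rewrite tintZ// /k tintZ ?tint_hat// ?mulVf ?mulr1 ?gt_eqF//.
  by apply: continuous_tintegrable; exact: hat_comp_cont.
rewrite -tintB//; last exact: tintegrableZ.
have hfs : tintegrable s (s + e) (fun r => f r - f s).
  by apply: tintegrableB => //; exact: tintegrable_cst.
apply: le_trans (ler_norm_tint _) _.
  by apply: tintegrableB => //; exact: tintegrableZ.
apply: (@le_trans _ _ (tint s (s + e) (fun r => 2 * e^-1 * `|f r - f s|))).
  apply: le_tint.
  - by apply: tintegrable_norm; apply: tintegrableB => //; exact: tintegrableZ.
  - by apply: tintegrableZ; exact: tintegrable_norm.
  - move=> r _; rewrite -mulrBl normrM mulrC distrC; apply: ler_wpM2r => //.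
    by have /andP[h1 h2] := kle r; rewrite ger0_norm.
rewrite tintZ; last exact: tintegrable_norm.
rewrite sub0r normrN ger0_norm in hd; last by rewrite fine_ge0// davg_ge0.
have bE : ball s e = `]s - e, s + e[%classic by rewrite ball_itv.
have hfb : tintegrable (s - e) (s + e) (fun r => `|f r - f s|).
  apply: tintegrable_norm; apply: tintegrableB; last exact: tintegrable_cst.
  by apply: tintegrableS hf; lra.
have dE : fine (davg f0 s e) = (e *+ 2)^-1 * tint (s - e) (s + e) (fun r => `|f r - f s|).
  rewrite /davg /iavg lebesgue_measure_ball ?(ltW e0)//.
  rewrite inver mulrn_eq0 /= gt_eqF//=.
  rewrite /tint /Rintegral bE.
  have -> : (\int[mu]_(y in `](s - e)%R, (s + e)%R[) `|((center (f0 s) \o f0) y)%:E| =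
     \int[mu]_(x in `](s - e)%R, (s + e)%R[) `|f x - f s|%:E)%E.
    apply: eq_integral => r; rewrite inE /= in_itv /= => /andP[h1 h2].
    rewrite f0s /f0 patchE ifT// inE /= in_itv /=; apply/andP; split; lra.
  by rewrite fineM//; exact: integrable_fin_num.
have hle : tint s (s + e) (fun r => `|f r - f s|) <= tint (s - e) (s + e) (fun r => `|f r - f s|).
  by apply: tint_le_sub hfb _ => //; lra.
rewrite dE in hd.
have : e^-1 * tint (s - e) (s + e) (fun r => `|f r - f s|) <= d / 2.
  have e2 : (e *+ 2)^-1 = 2^-1 * e^-1 by rewrite -[e *+ 2]mulr_natl invfM.
  by move: hd; rewrite e2 -mulrA; lra.
have : e^-1 * tint s (s + e) (fun r => `|f r - f s|) <=
   e^-1 * tint (s - e) (s + e) (fun r => `|f r - f s|).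
  by rewrite ler_pM2l ?invr_gt0.
by rewrite -mulrA; lra.
Unshelve. all: by end_near. Qed.

Lemma harmonic_lt (d : R) : 0 < d -> \forall m \near \oo, (m.+1%:R^-1 : R) < d.
Proof.
move=> d0; have /cvgrPdist_lt/(_ _ d0) := @cvg_harmonic R.
by apply: filterS => m; rewrite sub0r normrN ger0_norm ?invr_ge0.
Qed.

Lemma cvg_harmonic_right : (m.+1%:R^-1 : R) @[m --> \oo] --> (0 : R)^'+.
Proof.
move=> A hA; have h' : \forall m \near \oo, 0 < (m.+1%:R^-1 : R) -> A (m.+1%:R^-1).
  exact: (@cvg_harmonic R _ hA).
by apply: filterS h' => m; apply; rewrite invr_gt0.
Qed.

(** Dominated convergence: plateaus are bounded by 1 and converge everywhere to an indicator
    function. *)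
Lemma plateau_cvg a b g s t : a < s -> s < t -> t < b -> tintegrable a b g ->
  tint a b (fun r => g r * plateau s t m.+1%:R^-1 r) @[m --> \oo] --> tint s t g.
Proof.
move=> as_ st tb hg.
(* Half-open on purpose: a plateau vanishes at [s], and its value at [t] is eventually 1. *)
pose ind r : R := \1_(`]s, t]%classic) r.
have indE r : ind r = ((s < r) && (r <= t))%:R.
  by rewrite /ind indicE mem_setE in_itv.
have mg : measurable_fun `]a, b[ g by exact: tintegrable_measurable hg.
have mgi : measurable_fun `]a, b[ (fun r => g r * ind r).
  by apply: measurable_funM => //; exact: measurable_indic.
have hgi : tintegrable a b (fun r => g r * ind r).
  apply: (tintegrable_le mgi (tintegrable_norm hg)) => r _.
  by rewrite normrM indE; case: (_ && _); rewrite ?normr1 ?mulr1 ?normr0 ?mulr0.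
have -> : tint s t g = tint a b (fun r => g r * ind r).
  rewrite (@tint_split _ a b s _ _ _ hgi); [|lra|lra].
  have hgi' : tintegrable s b (fun r => g r * ind r) by apply: tintegrableS hgi; lra.
  rewrite (@tint_split _ s b t _ _ _ hgi'); [|lra|lra].
  rewrite (@eq_tint _ a s _ (fun=> 0)) => [|r /andP[_ h]]; last first.
    by rewrite indE ltNge (ltW h) mulr0.
  rewrite (@eq_tint _ s t _ g) => [|r /andP[h1 h2]]; last first.
    by rewrite indE h1 (ltW h2) mulr1.
  rewrite (@eq_tint _ t b _ (fun=> 0)) => [|r /andP[h _]]; last first.
    by rewrite indE [r <= t]leNgt h andbF mulr0.
  by rewrite !tint_cst ?mul0r ?add0r ?addr0//; exact: ltW.
have cpl m : continuous (plateau s t (m.+1%:R^-1)).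
  move=> x; apply/differentiable_continuous/derivable1_diffP.
  by have [] := is_derive_plateau s t m.+1%:R^-1 x.
have hgp m : tintegrable a b (fun r => g r * plateau s t m.+1%:R^-1 r).
  exact: tintegrableM_cont.
have I1 : (\int[mu]_(x in `]a, b[) (g x * ind x)%:E)%E = (tint a b (fun r => g r * ind r))%:E.
  by rewrite /tint /Rintegral fineK//; exact: integrable_fin_num.
have D1 m : measurable_fun `]a, b[ (fun r => (g r * plateau s t m.+1%:R^-1 r)%:E).
  by apply/measurable_EFinP; exact: tintegrable_measurable (hgp m).
have D2 : measurable_fun `]a, b[ (fun r => (g r * ind r)%:E) by exact/measurable_EFinP.
have D3 : {ae mu, forall r, `]a, b[%classic r ->
    (g r * plateau s t m.+1%:R^-1 r)%:E @[m --> \oo] --> (g r * ind r)%:E}.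
  apply: aeW => r _; apply: cvg_near_cst.
  rewrite indE /plateau; have [rs|sr] := leP r s.
    apply: nearW => m; rewrite !step_le0 ?subrr//.
      by rewrite pmulr_lle0 ?invr_gt0// subr_le0; lra.
    by rewrite pmulr_lle0 ?invr_gt0// subr_le0.
  have [rt|tr] := leP r t.
    have := @harmonic_lt (r - s); rewrite subr_gt0 => /(_ sr); apply: filterS => m hm.
    rewrite step_ge1 ?step_le0 ?subr0//.
      by rewrite pmulr_lle0 ?invr_gt0// subr_le0.
    by rewrite ler_pdivlMr ?invr_gt0// mul1r ltW.
  have := @harmonic_lt (r - t); rewrite subr_gt0 => /(_ tr); apply: filterS => m hm.
  rewrite !step_ge1 ?subrr ?mulr0//.
    by rewrite ler_pdivlMr ?invr_gt0// mul1r ltW.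
  by rewrite ler_pdivlMr ?invr_gt0// mul1r ltW// (lt_trans hm)// ltrD2l ltrN2.
have D5 : {ae mu, forall r (m : nat), `]a, b[%classic r ->
    (`|(g r * plateau s t m.+1%:R^-1 r)%:E| <= `|g r|%:E)%E}.
  apply: aeW => r m _; rewrite lee_fin normrM ler_piMr//.
  exact: plateau_bound.
have [_ _] := dominated_convergence (mu := mu) (measurable_itv _) D1 D2 D3 (tintegrable_norm hg) D5.
by rewrite I1 => h; exact: (fine_cvg h).
Qed.

(** A plateau is a test function as soon as [t + e < b]. Its derivative is the difference of two hat
    kernels, so the weak identity compares averages of [f] near [s] and near [t] with an integral of
    [g]; then [e] tends to 0. *)
Lemma weak_deriv_ftc a b f g s t : weak_deriv a b f g -> a < s -> s < t -> t < b ->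
  lebesgue_pt (f \_ `]a, b[) s -> lebesgue_pt (f \_ `]a, b[) t ->
  f t - f s = tint s t g.
Proof.
move=> [hf hg wd] as_ st tb ls lt.
pose e (m : nat) : R := m.+1%:R^-1.
have e0 m : 0 < e m by rewrite invr_gt0.
have cve : e m @[m --> \oo] --> (0 : R)^'+ := cvg_harmonic_right.
have h1 : (hat_avg a b f s (e m) - hat_avg a b f t (e m)) @[m --> \oo] --> f s - f t.
  apply: cvgB; apply: (cvg_comp _ _ cve); apply: hat_avg_cvg => //; apply/andP; split; lra.
have h2 := plateau_cvg as_ st tb hg.
have h3 : \forall m \near \oo, hat_avg a b f s (e m) - hat_avg a b f t (e m) =
   - tint a b (fun r => g r * plateau s t (e m) r).
  have := @harmonic_lt (b - t); rewrite subr_gt0 => /(_ tb); apply: filterS => m emb.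
  rewrite -wd; last first.
    apply: (C1c_intro (c := s) (d := t + e m) (is_derive_plateau s t (e m))) => //.
    - exact: dplateau_cont.
    - by rewrite -ltrBrDl.
    - by move=> x; apply: plateau_out.
  rewrite /hat_avg -tintB; [|apply: tintegrableM_cont => //|apply: tintegrableM_cont => //].
  - apply: eq_tint => r _; rewrite derive1E; have [_ ->] := is_derive_plateau s t (e m) r.
    by rewrite /dplateau mulrBr.
  - by move=> r; apply: cvgMr; exact: hat_comp_cont.
  - by move=> r; apply: cvgMr; exact: hat_comp_cont.
have : f s - f t = - tint s t g.
  apply: (cvg_unique (@norm_hausdorff _ _) h1).
  apply: (@cvg_trans _ ((fun m => - tint a b (fun r => g r * plateau s t (e m) r)) @ \oo)).
    by apply: near_eq_cvg; apply: filterS h3 => m ->.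
  exact: cvgN.
by move=> /eqP; rewrite -opprB eqr_opp => /eqP.
Qed.

End WeakDerivative.

Section WeakCalculus.
Context (R : realType).
Implicit Types (a b s t T : R) (f g : R -> R) (p : {poly R}).
Notation mu := (@lebesgue_measure R).

Lemma tint_cc a b f : tintegrable a b f -> parameterized_integral mu a b f = tint a b f.
Proof.
move=> hf; rewrite /parameterized_integral /tint /Rintegral; congr fine.
by apply: integral_itv_bndoo; case/integrableP: hf.
Qed.

Lemma tint_continuous T g : 0 <= T -> tintegrable 0 T g ->
  {within `[0, T], continuous (fun t => tint 0 t g)}.
Proof.
move=> T0 hg; have hg' : mu.-integrable `[0, T] (EFin \o g).
  case/integrableP: hg => mg ig; apply/integrableP; split.
    exact: emeasurable_fun_itv_cc mg.
  rewrite integral_itv_bndoo//; exact: measurableT_comp.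
have := parameterized_integral_continuous T0 hg'.
apply: subspace_eq_continuous => t; rewrite inE /= in_itv /= => /andP[t0 tT].
by rewrite /from_subspace tint_cc//; apply: tintegrableS hg.
Qed.

Lemma ae_dense a b (P : R -> Prop) : a < b -> {ae mu, forall t, P t} ->
  exists2 t, a < t < b & P t.
Proof.
move=> ab [N [mN N0 subN]].
apply: contrapT => h; have : (mu `]a, b[%classic <= mu N)%E.
  apply: le_measure; rewrite ?inE// => t /=; rewrite in_itv /= => tab.
  by apply: subN => /= Pt; apply: h; exists t.
by rewrite N0 lebesgue_measure_itv /= lte_fin ab -EFinD lee_fin subr_le0 leNgt ab.
Qed.

(** Almost every time is a Lebesgue point; one of them is fixed as [s0] and determines the constant
    [c]. *)
Lemma weak_deriv_ae T f g : 0 < T -> weak_deriv 0 T f g ->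
  exists c, {ae mu, forall t, 0 < t < T -> f t = c + tint 0 t g}.
Proof.
move=> T0 wd; have [hf hg _] := wd.
have ls := lebesgue_pt_ae hf.
have [s0 /andP[s00 s0T] ls0] := ae_dense T0 ls.
exists (f s0 - tint 0 s0 g); apply: (ae_impl ls) => t lt /andP[t0 tT].
have hS a b : 0 <= a -> b <= T -> tintegrable a b g by move=> ? ?; apply: tintegrableS hg.
case: (ltgtP s0 t) => [st|ts|<-].
- rewrite (@tint_split _ 0 t s0); [|lra..|apply: hS; lra].
  by rewrite -(weak_deriv_ftc wd s00 st tT)//; ring.
- rewrite (@tint_split _ 0 s0 t); [|lra..|apply: hS; lra].
  by rewrite -(weak_deriv_ftc wd t0 ts s0T)//; ring.
- by ring.
Qed.

(** If the continuous difference were nonzero at [t], it would be nonzero on an interval meeting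
    []0, T[], which is not a null set. This also reaches the two endpoints. *)
Lemma within_eq_ae T f g : 0 < T -> {within `[0, T], continuous f} ->
  {within `[0, T], continuous g} -> {ae mu, forall t, 0 < t < T -> f t = g t} ->
  forall t, 0 <= t <= T -> f t = g t.
Proof.
move=> T0 cf cg h t tT.
pose d t := f t - g t.
have cd : {within `[0, T], continuous d}.
  by move=> x; apply: cvgB; [exact: cf|exact: cg].
apply/eqP; rewrite -subr_eq0 -/(d t); apply/negP => /negP dt.
have tI : `[0, T]%classic t by rewrite /= in_itv.
have nb : nbhs t [set y | `[0, T]%classic y -> d y != 0].
  have cdt : d y @[y --> within `[0, T]%classic (nbhs t)] --> d t.
    by move/subspace_continuousP : cd; apply.
  by apply: (cdt [set y | y != 0]); apply: open_nbhs_nbhs; split => //; exact: open_neq.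
have /nbhs_ballP[e /= e0 he] := nb.
have [x /andP[x1 x2] hx] : exists2 x, Num.max 0 (t - e) < x < Num.min T (t + e) &
    (0 < x < T -> f x = g x).
  by apply: ae_dense h; case/andP: tT => *; rewrite lt_min !gt_max; apply/andP; split; apply/andP; split; lra.
move: x1 x2; rewrite gt_max lt_min => /andP[x0 xt] /andP[xT xe].
have : d x != 0.
  apply: he; last by rewrite /= in_itv /= !ltW.
  by rewrite /ball /= ltr_norml; apply/andP; split; lra.
by rewrite /d hx ?subrr ?eqxx// x0.
Qed.

Lemma weak_deriv_continuous T f g : 0 < T -> weak_deriv 0 T f g ->
  {within `[0, T], continuous f} ->
  forall s t, 0 <= s -> s <= t -> t <= T -> f t - f s = tint s t g.
Proof.
move=> T0 wd cf; have [_ hg _] := wd.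
have [c hc] := weak_deriv_ae T0 wd.
have e : forall t, 0 <= t <= T -> f t = c + tint 0 t g.
  apply: within_eq_ae => //.
  move=> x; apply: cvgD; first exact: cvg_cst.
  by apply: tint_continuous => //; exact: ltW.
move=> s t s0 st tT; rewrite !e ?s0 ?tT ?(le_trans st) ?(le_trans s0)//.
rewrite (@tint_split _ 0 t s)//; first ring.
by apply: tintegrableS hg.
Qed.

Lemma C1c_poly a b (phi : R -> R) p : C1c (`]a, b[%classic : set R) phi ->
  C1c (`]a, b[%classic : set R) (fun t => p.[t] * phi t).
Proof.
move=> [dphi cphi [K [cK KA K0]]].
have dp x : differentiable (horner p) x by apply/derivable1_diffP; exact: derivable_horner.
split.
- by move=> x; apply: differentiableM.
- move=> e; have -> : (fun x => 'D_e (fun t => p.[t] * phi t) x) =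
      (fun x => p.[x] * 'D_e phi x + phi x * (e * p^`().[x])).
    apply/funext => x; have := @deriveM _ _ (horner p) phi x e (diff_derivable (dp x)) (diff_derivable (dphi x)).
    move=> ->; rewrite /GRing.scale/=; congr (_ + _ * _).
    rewrite deriveE// -[X in 'd (horner p) x X]mulr1 linearZ/= -deriveE//.
    by have [_ ->] := is_derive_poly p x.
  move=> x; apply: cvgD; apply: cvgM.
  + exact: continuous_horner.
  + exact: cphi.
  + exact: differentiable_continuous.
  + by apply: cvgMr; exact: continuous_horner.
- by exists K; split=> // x /K0 ->; rewrite mulr0.
Qed.

(** The weak identity for [f] is applied to the test function [p * phi], and its derivative is split
    by the product rule. *)
Lemma weak_derivM_poly T f g p : weak_deriv 0 T f g ->
  weak_deriv 0 T (fun t => p.[t] * f t) (fun t => p^`().[t] * f t + p.[t] * g t).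
Proof.
move=> [hf hg wd].
have hM q h : tintegrable 0 T h -> tintegrable 0 T (fun t => q.[t] * h t).
  move=> hh; apply: (@eq_tintegrable _ _ _ (fun t => h t * q.[t])); first by move=> t _; rewrite mulrC.
  by apply: tintegrableM_cont => //; exact: continuous_horner.
split; [exact: hM|by apply: tintegrableD; exact: hM|].
move=> phi Cphi; have [dphi cphi _] := Cphi.
have cph : continuous phi by move=> x; exact: differentiable_continuous.
have cD : continuous (derive1 phi).
  by have -> : derive1 phi = (fun x => 'D_1 phi x); [apply/funext => x; rewrite derive1E|exact: cphi].
have := wd _ (C1c_poly p Cphi).
have e1 : forall t, derive1 (fun t => p.[t] * phi t) t = p.[t] * derive1 phi t + phi t * p^`().[t].
  move=> t; rewrite !derive1E.
  have := @deriveM _ _ (horner p) phi t 1 (@derivable_horner _ _ _) (diff_derivable (dphi t)).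
  move=> ->; rewrite /GRing.scale/=; congr (_ + _ * _).
  by have [_ ->] := is_derive_poly p t.
have hA : tintegrable 0 T (fun t => p.[t] * f t * derive1 phi t).
  by apply: tintegrableM_cont cD; exact: hM.
have hB : tintegrable 0 T (fun t => p^`().[t] * f t * phi t).
  by apply: tintegrableM_cont cph; exact: hM.
have hC : tintegrable 0 T (fun t => p.[t] * g t * phi t).
  by apply: tintegrableM_cont cph; exact: hM.
rewrite (@eq_tint _ 0 T _ (fun t => p.[t] * f t * derive1 phi t + p^`().[t] * f t * phi t)); last first.
  by move=> t _; rewrite e1; ring.
rewrite (@eq_tint _ 0 T (fun t => g t * _) (fun t => p.[t] * g t * phi t)); last first.
  by move=> t _; ring.
rewrite tintD// => e.
rewrite (@eq_tint _ 0 T (fun t => (_ + _) * phi t) (fun t => p^`().[t] * f t * phi t + p.[t] * g t * phi t)); last first.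
  by move=> t _; ring.
by rewrite tintD//; move: e; lra.
Qed.

Lemma weak_deriv_by_parts T f g p s t : 0 < T -> weak_deriv 0 T f g ->
  {within `[0, T], continuous f} -> 0 <= s -> s <= t -> t <= T ->
  p.[t] * f t - p.[s] * f s = tint s t (fun r => p^`().[r] * f r + p.[r] * g r).
Proof.
move=> T0 wd cf s0 st tT.
have := weak_deriv_continuous T0 (weak_derivM_poly p wd) _ s0 st tT; apply.
move=> x; apply: cvgM; last exact: cf.
exact: (continuous_subspaceT (@continuous_horner _ p)).
Qed.

(** Identifies the pointwise derivative of (SD) with the weak one. Being continuous, [f] is the
    integral of [g] up to a constant; Lebesgue's theorem differentiates this integral almost
    everywhere, and limits are unique. *)
Lemma deriv_within_ae T f g : 0 < T -> weak_deriv 0 T f g ->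
  {within `[0, T], continuous f} ->
  {ae mu, forall t, 0 < t < T -> forall l, deriv_within `[0, T] f t l -> l = g t}.
Proof.
move=> T0 wd cf; have [_ hg _] := wd.
pose g0 := g \_ `]0, T[.
have ig0 : mu.-integrable setT (EFin \o g0).
  by rewrite /g0 -restrict_EFin; apply/(integrable_mkcond _ _).1.
have iy y : mu.-integrable [set` Interval (BRight 0) (BRight y)] (EFin \o g0).
  exact: integrableS ig0.
have := @FTC1 R g0 (BRight 0) iy (integrable_locally_restrict (measurable_itv _) hg).
set G := fun x : R => _; move=> h; apply: (ae_impl h) => t {}h /andP[t0 tT] l hl.
have [dG Gt] := h t0.
have g0E r : 0 < r < T -> g0 r = g r by move=> rT; rewrite /g0 patchE ifT// inE /= in_itv.
have GE r : 0 < r < T -> G r = f r - f 0.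
  move=> /andP[r0 rT]; rewrite (weak_deriv_continuous T0 wd cf)//; [|exact: ltW..].
  rewrite -(@eq_tint _ 0 r g0) => [|s /andP[s0 sr]]; last by rewrite g0E// s0 (lt_trans sr).
  by rewrite /G -Rintegral_itv_bndo_bndc//; exact: integrableS ig0.
have c1 : (fun e : R => e^-1 * (f (e + t) - f t)) @ (0 : R)^' --> g t.
  have <- : G^`()%classic t = g t by rewrite Gt g0E// t0.
  rewrite derive1E; apply: cvg_trans dG; apply: near_eq_cvg.
  have n0 : \forall e \near (0 : R)^', `|e| < Num.min t (T - t).
    have mt : 0 < Num.min t (T - t) by rewrite lt_min t0 subr_gt0.
    apply: cvg_within; have := @nbhsx_ballx _ _ (0 : R) _ mt.
    by apply: filterS => e; rewrite /ball /= sub0r normrN.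
  apply: filterS n0 => e; rewrite lt_min !ltr_norml => /andP[/andP[e1 e2] /andP[e3 e4]].
  rewrite /GRing.scale /= mulr1 !GE ?t0//; last by apply/andP; split; lra.
  by congr (_ * _); ring.
have c2 : (fun e : R => e^-1 * (f (e + t) - f t)) @ (0 : R)^' --> l.
  (* Translates increments tending to 0 into times tending to [t] within the interval. Only interior
     [t] occur, so staying in [[0, T]] is automatic for small increments. *)
  have sh : (e + t) @[e --> (0 : R)^'] --> within `[0, T]%classic t^'.
    move=> A hA.
    have n0 : nbhs t [set s | 0 <= s <= T].
      have : nbhs t `]0, T[%classic.
        by apply: open_nbhs_nbhs; split; [exact: interval_open|rewrite /= in_itv /= t0].
      by apply: filterS => s /=; rewrite in_itv /= => /andP[/ltW -> /ltW ->].
    have hA1 : nbhs t [set s | s != t -> `[0, T]%classic s -> A s] by exact: hA.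
    have hA' : nbhs t [set s | s != t -> 0 <= s <= T -> A s].
      by apply: filterS hA1 => s h1 st sT; apply: h1 => //; rewrite /= in_itv.
    have : nbhs (0 : R) [set e | e + t != t -> A (e + t)].
      have cs : (e + t) @[e --> (0 : R)] --> t.
        by rewrite -{2}[t]add0r; apply: cvgD; [exact: cvg_id|exact: cvg_cst].
      have nA : nbhs (0 : R) [set e | 0 <= e + t <= T /\
          (e + t != t -> 0 <= e + t <= T -> A (e + t))].
        have n1 : nbhs t ([set s | 0 <= s <= T] `&` [set s | s != t -> 0 <= s <= T -> A s]).
          exact: filterI.
        exact: (cs _ n1).
      by apply: filterS nA => e [h1 h2] h3; exact: h2.
    move=> nA; suff : nbhs (0 : R) [set e | e != 0 -> A (e + t)] by [].
    by apply: filterS nA => e /= he e0; apply: he; rewrite -subr_eq0 addrK.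
  have := cvg_comp _ _ sh hl; apply: cvg_trans; apply: near_eq_cvg.
  by apply: nearW => e /=; rewrite addrK mulrC.
exact: (cvg_unique (@norm_hausdorff _ _) c2 c1).
Qed.

(** At [i = 0] the coefficient is a division by zero, which is 0, so the constant term vanishes. *)
Definition antideriv p : {poly R} := \poly_(i < (size p).+1) (p`_i.-1 / i%:R).

Lemma size_antideriv p k : (size p <= k)%N -> (size (antideriv p) <= k.+1)%N.
Proof. by move=> h; apply: leq_trans (size_poly _ _) _. Qed.

Lemma deriv_antideriv p : (antideriv p)^`() = p.
Proof.
apply/polyP => i; rewrite coef_deriv coef_poly ltnS /=; case: ltnP => h.
  by rewrite -[LHS]mulr_natr divfK// pnatr_eq0.
by rewrite mul0rn nth_default.
Qed.

Lemma tint_poly a b p : a <= b -> tint a b (horner p) = (antideriv p).[b] - (antideriv p).[a].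
Proof.
move=> ab; apply: tint_FTC => //; last exact: continuous_horner.
by move=> t; rewrite -{2}[p]deriv_antideriv; exact: is_derive_poly.
Qed.

(* Bramble-Hilbert in one variable, by iterated integration. *)
Lemma iterated_approx T a b k (g : nat -> R -> R) (c : R) : 0 < T ->
  tintegrable 0 T (g 0%N) -> (forall j, (j < k)%N -> weak_deriv 0 T (g j) (g j.+1)) ->
  0 <= a -> a <= b -> b <= T ->
  exists2 p : {poly R}, (size p <= k.+1)%N & forall t, a <= t <= b ->
    `|c + tint 0 t (g 0%N) - p.[t]| <= (b - a) ^+ k * tint a b (fun r => `|g k r|).
Proof.
move=> T0 hg0 hg a0 ab bT; elim: k g c hg0 hg => [|k IH] g c hg0 hg.
  (* For [k = 0] the approximation is the value at the left endpoint [a]. *)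
  exists (c + tint 0 a (g 0%N))%:P; first exact: size_polyC_leq1.
  move=> t /andP[at_ tb]; rewrite hornerC expr0 mul1r.
  rewrite (@tint_split _ 0 t a)//; last by apply: tintegrableS hg0; lra.
  rewrite addrA [_ - _]addrC addKr.
  apply: le_trans (ler_norm_tint _) _; first by apply: tintegrableS hg0; lra.
  apply: tint_le_sub => //.
  by apply/tintegrable_norm; apply: tintegrableS hg0.
have wd0 := hg 0%N isT.
have [c1 hc1] := weak_deriv_ae T0 wd0.
have [_ hg1 _] := wd0.
have [p1 sp1 hp1] := IH (fun j => g j.+1) c1 hg1 (fun j jk => hg j.+1 jk).
(* The approximation [p1] of the derivative is integrated, with the constant chosen to match the
   function at [a]. *)
exists ((c + tint 0 a (g 0%N) - (antideriv p1).[a])%:P + antideriv p1).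
  apply: leq_trans (size_polyD _ _) _; rewrite geq_max size_antideriv// andbT.
  by apply: leq_trans (size_polyC_leq1 _) _.
move=> t /andP[at_ tb]; rewrite hornerD hornerC.
have hI : tintegrable a t (g 0%N) by apply: tintegrableS hg0; lra.
have -> : c + tint 0 t (g 0%N) - (c + tint 0 a (g 0%N) - (antideriv p1).[a] + (antideriv p1).[t])
    = tint a t (fun r => g 0%N r - p1.[r]).
  rewrite (@tint_split _ 0 t a)//; last by apply: tintegrableS hg0; lra.
  rewrite tintB//; last exact: (continuous_tintegrable _ _ (@continuous_horner _ p1)).
  by rewrite tint_poly//; ring.
have hI2 : tintegrable a t (fun r => g 0%N r - p1.[r]).
  by apply: tintegrableB => //; exact: (continuous_tintegrable _ _ (@continuous_horner _ p1)).
apply: le_trans (ler_norm_tint hI2) _.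
set M := (b - a) ^+ k * tint a b (fun r => `|g k.+1 r|).
have M0 : 0 <= M by rewrite mulr_ge0 ?exprn_ge0 ?subr_ge0// tint_ge0.
apply: (@le_trans _ _ (tint a t (fun=> M))); last first.
  rewrite tint_cst// exprS -mulrA -/M mulrC; apply: ler_wpM2r => //; lra.
(* The induction hypothesis bounds the integrand by [M] only almost everywhere. Truncating at [M]
   leaves the integral unchanged and makes the bound hold at every point, as [le_tint] requires. *)
rewrite (@tint_ae _ _ _ _ (fun r => Num.min M `|g 0%N r - p1.[r]|)).
- apply: le_tint; [|exact: tintegrable_cst|by move=> r _; rewrite ge_min lexx].
  apply: (@tintegrable_le _ _ _ _ (fun=> M)); [|exact: tintegrable_cst|].
    apply: measurable_minr; first exact: measurable_cst.
    exact: tintegrable_measurable (tintegrable_norm hI2).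
  by move=> r _; rewrite ger0_norm ?ge_min ?lexx// le_min M0 normr_ge0.
- exact: tintegrable_measurable (tintegrable_norm hI2).
- apply: measurable_minr; first exact: measurable_cst.
  exact: tintegrable_measurable (tintegrable_norm hI2).
- apply: (ae_impl hc1) => r h /andP[ar rt].
  rewrite min_r// h; first by apply: hp1; rewrite !ltW//; lra.
  by apply/andP; split; lra.
Qed.

End WeakCalculus.

(** * Polynomials on one time step *)

Section Unisolvence.
Context (R : realType).
Implicit Types (p P Q a : {poly R}).
Notation mu := (@lebesgue_measure R).

Lemma poly_tintegrable s t p : tintegrable s t (horner p).
Proof. by apply: continuous_tintegrable; exact: continuous_horner. Qed.

Lemma tint_affine p (s tau : R) : 0 < tau ->
  tint s (s + tau) (fun t => p.[(t - s) * tau^-1]) = tau * tint 0 1 (horner p).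
Proof.
move=> tau0; pose G := antideriv p.
have dG (x : R) : is_derive x 1 (horner G) (horner p x).
  by have := is_derive_poly G x; rewrite deriv_antideriv.
have dF (x : R) : is_derive x 1 (fun t => tau * G.[(t - s) * tau^-1]) (p.[(x - s) * tau^-1]).
  have h := @is_derive_affine_comp R (horner G) (horner p) tau^-1 s x (dG _).
  have h' := @is_deriveZ _ _ _ (fun y => G.[(y - s) * tau^-1]) tau x 1 _ h.
  by apply: is_derive_eq h' _; rewrite /GRing.scale/= mulVKf ?gt_eqF.
rewrite (tint_FTC _ dF); first last.
- move=> x; apply: (@continuous_comp _ _ _ (fun x => (x - s) * tau^-1) (horner p)).
    by apply: cvgMl; apply: (@continuousB _ _ _ id (cst s)); [exact: cvg_id|exact: cst_continuous].
  exact: continuous_horner.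
- by rewrite lerDl ltW.
rewrite tint_poly ?ler01// mulrBr; congr (_ * _.[_] - _ * _.[_]).
  by field; rewrite gt_eqF.
by ring.
Qed.

(** The square vanishes almost everywhere, so each of [size p] disjoint subintervals contains a
    root: too many for a nonzero polynomial. *)
Lemma poly_sqr_int0 (s t : R) p : s < t -> tint s t (fun x => p.[x] * p.[x]) = 0 -> p = 0.
Proof.
move=> st h0; apply/eqP; apply/negP => /negP p0.
have hI : tintegrable s t (fun x => p.[x] * p.[x]).
  apply: (@eq_tintegrable _ _ _ (horner (p * p))); last exact: poly_tintegrable.
  by move=> x _; rewrite hornerM.
have mI : measurable_fun `]s, t[ (EFin \o (fun x => p.[x] * p.[x])) by case/integrableP: hI.
have : (\int[mu]_(x in `]s, t[) `|(p.[x] * p.[x])%:E| = 0)%E.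
  transitivity (\int[mu]_(x in `]s, t[) (p.[x] * p.[x])%:E)%E.
    by apply: eq_integral => x _ /=; rewrite ger0_norm// -expr2 sqr_ge0.
  have hf : (\int[mu]_(x in `]s, t[) (p.[x] * p.[x])%:E)%E \is a fin_num by exact: integrable_fin_num.
  by rewrite -(fineK hf); congr (_%:E).
move=> /(ae_eq_integral_abs mu (measurable_itv _) mI).1 hae.
pose n := size p; have n0 : (0 < n)%N by rewrite size_poly_gt0.
have n0' : 0 < n%:R :> R by rewrite ltr0n.
pose e := (t - s) / n%:R; have e0 : 0 < e by rewrite divr_gt0// subr_gt0.
have et : e * n%:R = t - s by rewrite divfK// gt_eqF.
have /choice[x hx] (i : nat) : exists y, (i < n)%N ->
    s + i%:R * e < y < s + i.+1%:R * e /\ root p y.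
  have [y yi hy] : exists2 y, s + i%:R * e < y < s + i.+1%:R * e &
      (`]s, t[%classic y -> EFin (p.[y] * p.[y]) = 0%E).
    by apply: ae_dense hae; rewrite ltrD2l ltr_pM2r// ltr_nat.
  exists y => ni; split=> //; move/andP: yi => [y1 y2].
  have ie : 0 <= i%:R * e by rewrite mulr_ge0 ?ler0n ?ltW.
  have ie' : i.+1%:R * e <= t - s by rewrite -et mulrC ler_pM2l// ler_nat.
  have : (p.[y] * p.[y])%:E = 0%E by apply: hy; rewrite /= in_itv /=; apply/andP; split; lra.
  by move=> [/eqP]; rewrite mulf_eq0 orbb.
have := @max_poly_roots R p (mkseq x n) p0.
rewrite size_mkseq ltnn => H; suff : false by []; apply: H.
  by apply/allP => y /mapP[i]; rewrite mem_iota add0n => /andP[_ ni] ->; have [] := hx i ni.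
rewrite map_inj_in_uniq ?iota_uniq// => i j; rewrite !mem_iota !add0n => /andP[_ ni] /andP[_ nj] xij.
have lt_x k l : (k < n)%N -> (l < n)%N -> (k < l)%N -> x k < x l.
  move=> kn ln kl; have [/andP[_ h1] _] := hx k kn; have [/andP[h2 _] _] := hx l ln.
  apply: lt_trans h1 (le_lt_trans _ h2).
  by rewrite lerD2l ler_pM2r// ler_nat.
case: (ltngtP i j) => // ij; first by have := lt_x _ _ ni nj ij; rewrite xij ltxx.
by have := lt_x _ _ nj ni ij; rewrite xij ltxx.
Qed.

Definition moment (j : nat) P : R := tint 0 1 (fun x => P.[x] * x ^+ j).

Lemma moment_lin j n P : (size P <= n)%N ->
  moment j P = \sum_(i < n) P`_i * moment j 'X^i.
Proof.
move=> sP; rewrite /moment.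
have hI (i : 'I_n) : tintegrable 0 1 (fun x : R => 'X^i.[x] * x ^+ j).
  apply: (@eq_tintegrable _ _ _ (horner ('X^i * 'X^j))); last exact: poly_tintegrable.
  by move=> x _; rewrite hornerM !hornerXn.
rewrite (@eq_tint _ _ _ _ (fun x => \sum_(i < n) P`_i * ('X^i.[x] * x ^+ j))); last first.
  move=> x _; rewrite (horner_coef_wide _ sP) mulr_suml.
  by apply: eq_bigr => i _; rewrite hornerXn mulrA.
rewrite tint_sum; last by move=> i; exact: tintegrableZ.
by apply: eq_bigr => i _; rewrite tintZ.
Qed.

(** These are the data that one step controls: the nodes of (S), and the moments of order below
    [q + 1 - ns], because the test functions of (V) have degree at most [q + 1 - ns] and enter
    differentiated. *)
Definition unisolvent q ns (theta : 'I_ns -> R) : Prop := forall P, (size P <= q.+1)%N ->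
  (forall j, (j < q.+1 - ns)%N -> moment j P = 0) -> (forall k, P.[theta k] = 0) -> P = 0.

Lemma moment_test P Q n : (size Q <= n)%N -> (forall j, (j < n)%N -> moment j P = 0) ->
  tint 0 1 (fun x => P.[x] * Q.[x]) = 0.
Proof.
move=> sQ h; rewrite (@eq_tint _ _ _ _ (fun x => \sum_(j < n) Q`_j * (P.[x] * x ^+ j))); last first.
  move=> x _; rewrite (horner_coef_wide _ sQ) mulr_sumr; apply: eq_bigr => j _; ring.
have hI (j : 'I_n) : tintegrable 0 1 (fun x => P.[x] * x ^+ j).
  apply: (@eq_tintegrable _ _ _ (horner (P * 'X^j))); last exact: poly_tintegrable.
  by move=> x _; rewrite !hornerE.
rewrite tint_sum; last by move=> j; exact: tintegrableZ.
by rewrite big1// => j _; rewrite tintZ// -/(moment j P) h// mulr0.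
Qed.

Lemma unisolvent0 q (theta : 'I_0 -> R) : unisolvent q theta.
Proof.
move=> P sP h _; apply: (@poly_sqr_int0 0 1) => //.
by apply: moment_test sP _ => j jq; apply: h; rewrite subn0.
Qed.

(** Transported to [[-1, 1]], the vanishing moments kill, by orthogonality, the coefficients on
    [psi j] with [j < q + 1 - ns]. The [ns] remaining coefficients are in the kernel of the matrix
    of point values. *)
Lemma orthogonal_basis_unisolvent q ns (theta : 'I_ns -> R) (psi : nat -> {poly R}) :
  (ns <= q.+1)%N -> orthogonal_basis q psi ->
  ((0 < ns)%N -> (\matrix_(j, k) (psi (k + q.+1 - ns)%N).[2 * theta j - 1] : 'M[R]_ns) \in unitmx) ->
  unisolvent q theta.
Proof.
move=> nsq [spsi opsi bpsi] hD P sP hm ht.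
pose Q := P \Po (2^-1 *: ('X + 1)).
have QE s : Q.[s] = P.[(s - -1) * 2^-1].
  by rewrite /Q horner_comp !hornerE; congr P.[_]; ring.
have sQ : (size Q <= q.+1)%N.
  have s2 : size (2^-1 *: ('X + 1) : {poly R}) = 2%N.
    by rewrite size_scale ?invr_eq0// -[1]opprK -polyC1 -polyCN size_XsubC.
  by rewrite /Q size_comp_poly2.
have Qorth j : (j < q.+1 - ns)%N -> tint (-1) 1 (fun s => Q.[s] * (psi j).[s]) = 0.
  move=> jn; pose r := P * (psi j \Po (2 *: 'X - 1)).
  have -> : tint (-1) 1 (fun s => Q.[s] * (psi j).[s]) = 2 * tint 0 1 (horner r).
    have := tint_affine r (-1) (ltr0Sn R 1); rewrite (_ : -1 + 2 = 1) => [<-|]; last ring.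
    apply: eq_tint => s _.
    rewrite QE /r hornerM horner_comp; congr (_ * _.[_]).
    by rewrite !hornerE /=; field.
  rewrite (@eq_tint _ _ _ (horner r) (fun x => P.[x] * (psi j \Po (2 *: 'X - 1)).[x])); last first.
    by move=> x _; rewrite hornerM.
  rewrite (@moment_test _ _ (q.+1 - ns)) ?mulr0//.
  have s2 : size (2 *: 'X - 1 : {poly R}) = 2%N.
    have -> : 2 *: 'X - 1 = 2 *: ('X - (2^-1)%:P) :> {poly R}.
      by rewrite scalerBr -mul_polyC -[2 *: _%:P]mul_polyC -polyCM divff// polyC1.
    by rewrite size_scale// size_XsubC.
  rewrite size_comp_poly2//; apply: leq_trans (spsi _ _) _ => //.
  by rewrite -ltnS (leq_trans jn)// leq_subr.
have [c [Qc _]] := bpsi Q sQ.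
(* If [psi j] were 0, both the zero row and the unit row [j] would expand the zero polynomial,
   against uniqueness. *)
have psi_neq0 (j : 'I_q.+1) : psi j <> 0.
  move=> pj0; have [c0 [e0 u0]] := bpsi 0 (ltac:(by rewrite size_poly0)).
  have h0 : c0 = 0 by apply: u0; rewrite big1// => i _; rewrite mxE scale0r.
  have h1 : c0 = delta_mx ord0 j.
    apply: u0; rewrite (bigD1 j)//= pj0 scaler0 add0r big1// => i ij.
    by rewrite mxE eqxx (negbTE ij) scale0r.
  have : c0 ord0 j = (delta_mx ord0 j : 'rV[R]_q.+1) ord0 j by rewrite h1.
  by rewrite h0 !mxE !eqxx => /eqP; rewrite eq_sym oner_eq0.
have c0 (j : 'I_q.+1) : (j < q.+1 - ns)%N -> c ord0 j = 0.
  move=> jn; have := Qorth j jn.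
  rewrite (@eq_tint _ _ _ _ (fun s => \sum_i c ord0 i * ((psi i).[s] * (psi j).[s]))); last first.
    move=> s _; rewrite {1}Qc horner_sum mulr_suml; apply: eq_bigr => i _.
    by rewrite hornerZ mulrA.
  have hI (i : 'I_q.+1) : tintegrable (-1) 1 (fun s => (psi i).[s] * (psi j).[s]).
    apply: (@eq_tintegrable _ _ _ (horner (psi i * psi j))); last exact: poly_tintegrable.
    by move=> s _; rewrite hornerM.
  rewrite tint_sum; last by move=> i; exact: tintegrableZ.
  rewrite (bigD1 j)//= big1 ?addr0 => [|i ij]; last first.
    rewrite tintZ// opsi ?mulr0// ?leq_ord//.
    by move=> e; move: ij; rewrite (val_inj e) eqxx.
  rewrite tintZ// => /eqP; rewrite mulf_eq0 => /orP[/eqP//|/eqP hz].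
  by exfalso; apply: (psi_neq0 j); apply: poly_sqr_int0 hz; lra.
have Q0 : Q = 0.
  have [ns0|ns0] := posnP ns.
    by rewrite Qc big1// => j _; rewrite c0 ?scale0r// ns0 subn0.
  pose A : 'M[R]_ns := \matrix_(j, k) (psi (k + q.+1 - ns)%N).[2 * theta j - 1].
  (* Column [k] of the matrix carries the basis polynomial of index [k + q + 1 - ns], with [k]
     counted from 0. *)
  pose f (k : 'I_ns) : 'I_q.+1 := inord (k + q.+1 - ns)%N.
  have fE k : (f k = k + q.+1 - ns :> nat)%N.
    by rewrite /f inordK// ltn_subLR ?ltn_add2r// (leq_trans nsq)// leq_addl.
  have sumE (V : zmodType) (F : 'I_q.+1 -> V) :
      (forall j : 'I_q.+1, (j < q.+1 - ns)%N -> F j = 0) -> \sum_j F j = \sum_k F (f k).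
    move=> F0; rewrite (bigID (fun j : 'I_q.+1 => (j < q.+1 - ns)%N))/= big1 ?add0r//.
    rewrite (reindex_onto f (fun j => insubd (Ordinal ns0) (j - (q.+1 - ns))%N)) /=; last first.
      move=> j; rewrite -leqNgt => hj; apply/val_inj; rewrite /= fE val_insubd.
      rewrite ifT; last by rewrite ltn_subLR// subnK.
      by rewrite -addnBA// subnK.
    apply: eq_bigl => k; rewrite fE -addnBA// -leqNgt leq_addl/=.
    by apply/eqP/val_inj; rewrite /= val_insubd addnK ltn_ord.
  pose v : 'cV[R]_ns := \col_k c ord0 (f k).
  have Av : A *m v = 0.
    apply/colP => j; rewrite !mxE.
    have := ht j; have -> : P.[theta j] = Q.[2 * theta j - 1].
      by rewrite QE; congr P.[_]; field.
    rewrite Qc horner_sum (sumE _ (fun i => (c ord0 i *: psi i).[2 * theta j - 1])); last first.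
      by move=> i hi; rewrite c0// scale0r horner0.
    by move=> e; rewrite -[RHS]e; apply: eq_bigr => k _; rewrite !mxE hornerZ fE mulrC.
  have v0 : v = 0 by rewrite -[v](mulKmx (hD ns0)) -/A Av mulmx0.
  rewrite Qc sumE; last by move=> j hj; rewrite c0// scale0r.
  rewrite big1// => k _.
  by have /colP/(_ k) := v0; rewrite !mxE => ->; rewrite scale0r.
have -> : P = Q \Po (2 *: 'X - 1).
  rewrite /Q -comp_polyA; have -> : (2^-1 *: ('X + 1) : {poly R}) \Po (2 *: 'X - 1) = 'X.
    rewrite comp_polyZ comp_polyD comp_polyX comp_polyC /=.
    by rewrite subrK scalerA mulVf// scale1r.
  by rewrite comp_polyXr.
by rewrite Q0 comp_poly0.
Qed.

(** On monomial coefficients the [q + 1] data form a square matrix, injective by unisolvence. The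
    entries of its inverse give an explicit constant on the reference interval. *)
Lemma unisolvent_bound q ns (theta : 'I_ns -> R) : (ns <= q.+1)%N -> unisolvent q theta ->
  exists2 C : R, 0 <= C & forall P, (size P <= q.+1)%N -> forall x, 0 <= x <= 1 ->
    `|P.[x]| <= C * (\sum_(j < (q.+1 - ns)%N) `|moment j P| + \sum_k `|P.[theta k]|).
Proof.
move=> nsq uni; pose m := (q.+1 - ns)%N.
have mns : (m + ns = q.+1)%N by rewrite subnK.
pose L (j : 'I_(m + ns)) P : R :=
  match fintype.split j with inl k => moment k P | inr k => P.[theta k] end.
have Llin j P : (size P <= q.+1)%N -> L j P = \sum_(i < m + ns) P`_i * L j 'X^i.
  rewrite -mns => sP; rewrite /L; case: (fintype.split j) => k; first exact: moment_lin.
  by rewrite (horner_coef_wide _ sP); apply: eq_bigr => i _; rewrite hornerXn.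
pose A : 'M[R]_(m + ns) := \matrix_(i, j) L j 'X^i.
have rowA P : (size P <= q.+1)%N -> (\row_(i < m + ns) P`_i) *m A = \row_j L j P.
  move=> sP; apply/rowP => j; rewrite !mxE (Llin _ _ sP).
  by apply: eq_bigr => i _; rewrite !mxE.
have Au : A \in unitmx.
  rewrite -row_free_unit; apply: inj_row_free => v vA.
  pose P := \poly_(i < m + ns) (if insub i is Some k then v ord0 k else 0).
  have Pc (i : 'I_(m + ns)) : P`_i = v ord0 i.
    by rewrite coef_poly ltn_ord valK.
  have sP : (size P <= q.+1)%N by rewrite -mns; exact: size_poly.
  have rP : \row_(i < m + ns) P`_i = v by apply/rowP => i; rewrite mxE Pc.
  have LP j : L j P = 0.
    by have := rowA P sP; rewrite rP vA => /rowP/(_ j); rewrite !mxE => <-.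
  have P0 : P = 0.
    apply: uni => // [j jm|k].
      by have := LP (lshift _ (Ordinal jm)); rewrite /L (unsplitK (inl _)).
    by have := LP (rshift _ k); rewrite /L (unsplitK (inr _)).
  by rewrite -rP P0; apply/rowP => i; rewrite !mxE coef0.
exists (\sum_i \sum_j `|invmx A i j|).
  by apply: sumr_ge0 => i _; apply: sumr_ge0.
move=> P sP x /andP[x0 x1].
have -> : \sum_(j < m) `|moment j P| + \sum_k `|P.[theta k]| = \sum_j `|L j P|.
  rewrite big_split_ord /=; congr (_ + _); apply: eq_bigr => k _.
    by rewrite /L (unsplitK (inl _)).
  by rewrite /L (unsplitK (inr _)).
set S := \sum_j `|L j P|.
have LS j : `|L j P| <= S by rewrite /S (bigD1 j)//= lerDl sumr_ge0.
have sP' : (size P <= m + ns)%N by rewrite mns.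
rewrite (horner_coef_wide _ sP'); apply: le_trans (ler_norm_sum _ _ _) _.
have Pc (i : 'I_(m + ns)) : P`_i = \sum_j L j P * invmx A j i.
  have := congr1 (fun B => B *m invmx A) (rowA P sP); rewrite mulmxK// => /rowP/(_ i).
  by rewrite !mxE => ->; apply: eq_bigr => j _; rewrite mxE.
rewrite exchange_big mulr_suml; apply: ler_sum => i _.
rewrite normrM [X in _ * X]ger0_norm ?exprn_ge0//.
apply: (@le_trans _ _ `|P`_i|); first by rewrite ler_piMr// exprn_ile1.
rewrite Pc mulr_suml; apply: le_trans (ler_norm_sum _ _ _) _; apply: ler_sum => j _.
by rewrite normrM mulrC; apply: ler_wpM2l.
Qed.

Lemma affine_comp_poly (s tau : R) p : exists2 P : {poly R}, (size P <= size p)%N &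
  forall x, P.[x] = p.[s + tau * x].
Proof.
have [->|tau0] := eqVneq tau 0.
  exists p.[s]%:P; last by move=> x; rewrite hornerC mul0r addr0.
  have [->|p0] := eqVneq p 0; first by rewrite horner0 polyC0.
  by apply: leq_trans (size_polyC_leq1 _) _; rewrite size_poly_gt0.
exists (p \Po (tau *: 'X + s%:P)).
  rewrite size_comp_poly2// (_ : tau *: 'X + s%:P = tau *: ('X - (- (s / tau))%:P)).
    by rewrite size_scale// size_XsubC.
  rewrite scalerBr -[tau *: _%:P]mul_polyC -polyCM mulrN mulrC divfK//.
  by rewrite polyCN opprK.
by move=> x; rewrite horner_comp !hornerE /= addrC.
Qed.

(** Test polynomials adapted to a step: between 0 and 1 on it, with derivative of size at most
    [j / tau]. *)
Definition shifted_mono (s tau : R) (j : nat) : {poly R} := (tau^-1 *: ('X - s%:P)) ^+ j.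

Lemma size_shifted_mono s tau j : (size (shifted_mono s tau j) <= j.+1)%N.
Proof.
apply: leq_trans (size_poly_exp_leq _ _) _; rewrite ltnS.
have : (size (tau^-1 *: ('X - s%:P)) <= 2)%N.
  by apply: leq_trans (size_scale_leq _ _) _; rewrite size_XsubC.
by case: (size _) => [|[|[|]]]//= _; rewrite ?mul0n// mul1n.
Qed.

Lemma shifted_monoE s tau j t : (shifted_mono s tau j).[t] = ((t - s) * tau^-1) ^+ j.
Proof. by rewrite horner_exp hornerZ hornerXsubC mulrC. Qed.

Lemma deriv_shifted_monoE s tau j t :
  (shifted_mono s tau j.+1)^`().[t] = j.+1%:R * tau^-1 * ((t - s) * tau^-1) ^+ j.
Proof.
rewrite /shifted_mono deriv_exp derivZ derivB derivX derivC subr0 /=.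
rewrite hornerMn hornerM horner_exp !hornerZ hornerXsubC hornerC mulr1.
by rewrite -mulr_natl mulrA [_ * (t - s)]mulrC.
Qed.

(* One step of the method, for one coordinate of the error. *)
Definition step_stable q ns (theta : 'I_ns -> R) (C : R) : Prop :=
  forall (s tau : R) (eta : {poly R}) (rho g : R -> R)
      (E0 E1 : R) (sigma : 'I_ns -> R),
    0 < tau -> (size eta <= q.+1)%N -> tintegrable s (s + tau) rho ->
    tintegrable s (s + tau) g ->
    (forall a : {poly R}, (size a <= (q.+1 - ns).+1)%N ->
      a.[s + tau] * E1 - tint s (s + tau) (fun t => (eta.[t] - rho t) * a^`().[t]) =
      a.[s] * E0 - tint s (s + tau) (fun t => a.[t] * g t)) ->
    (forall k, eta.[s + theta k * tau] = sigma k) ->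
    E1 = E0 - tint s (s + tau) g /\
    forall t, s <= t <= s + tau -> `|eta.[t]| <= C * (`|E0| + \sum_k `|sigma k| +
      tau^-1 * tint s (s + tau) (fun t => `|rho t|) + tint s (s + tau) (fun t => `|g t|)).

(** The constant test polynomial gives [E1]. Powers of the normalized time, of positive degree, give
    the moments of the solution on the reference interval; with the nodal values these determine it
    by [unisolvent_bound]. *)
Lemma unisolvent_step_stable q ns (theta : 'I_ns -> R) : (ns <= q.+1)%N ->
  unisolvent q theta -> exists2 C : R, 0 <= C & step_stable q theta C.
Proof.
move=> nsq uni; have [C C0 hC] := unisolvent_bound nsq uni.
(* At most [q + 1] moments, each costing at most [q + 2], then [ns] copies of [E0] from the shifted
   nodal values; the outer 1 restores [E0] itself. *)
exists (1 + C * (q.+1%:R * q.+2%:R + ns%:R + 1)).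
  by rewrite addr_ge0// mulr_ge0// !addr_ge0// mulr_ge0.
move=> s tau eta rho g E0 E1 sigma tau0 seta hrho hg hV hS.
have sst : s <= s + tau by rewrite lerDl ltW.
have heta p : tintegrable s (s + tau) (fun t => (eta.[t] - rho t) * p.[t]).
  apply: tintegrableM_cont; last exact: continuous_horner.
  by apply: tintegrableB => //; exact: poly_tintegrable.
have hE1 : E1 = E0 - tint s (s + tau) g.
  have := hV 1; rewrite size_poly1 => /(_ isT); rewrite !hornerE ?mul1r.
  rewrite (@eq_tint _ _ _ _ (fun=> 0)); last first.
    by move=> t _; rewrite -polyC1 derivC horner0 mulr0.
  rewrite tint_cst// mul0r subr0 => ->; congr (_ - _).
  by apply: eq_tint => t _; rewrite hornerE ?mul1r.
split=> //.
have [P0 sP0 P0E] := affine_comp_poly s tau eta.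
(* Subtracting the incoming value [E0] makes the moment equations below free of endpoint terms. *)
pose P := P0 - E0%:P.
have PE x : P.[x] = eta.[s + tau * x] - E0 by rewrite /P !hornerE P0E.
have sP : (size P <= q.+1)%N.
  apply: leq_trans (size_polyD _ _) _; rewrite geq_max size_polyN.
  by rewrite (leq_trans sP0 seta) (leq_trans (size_polyC_leq1 _)).
set Ir := tint s (s + tau) (fun t => `|rho t|).
set Ig := tint s (s + tau) (fun t => `|g t|).
have Ir0 : 0 <= Ir by exact: tint_ge0.
have Ig0 : 0 <= Ig by exact: tint_ge0.
have unit_itv t : s < t < s + tau -> 0 <= (t - s) / tau <= 1.
  move=> /andP[st ts]; rewrite ler_pdivrMr// mul1r mulr_ge0 ?invr_ge0 ?subr_ge0 ?(ltW st) ?(ltW tau0)//=; lra.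
have mle (j : nat) : (j < q.+1 - ns)%N -> `|moment j P| <= Ig + q.+2%:R * (tau^-1 * Ir).
  move=> jn; pose a := shifted_mono s tau j.+1.
  have sa : (size a <= (q.+1 - ns).+1)%N.
    by apply: leq_trans (size_shifted_mono _ _ _) _.
  have as0 : a.[s] = 0 by rewrite shifted_monoE subrr mul0r expr0n.
  have as1 : a.[s + tau] = 1.
    by rewrite shifted_monoE addrAC subrr add0r divff ?gt_eqF// expr1n.
  have := hV a sa; rewrite as0 as1 mul0r sub0r mul1r => e.
  have hga : tintegrable s (s + tau) (fun t => a.[t] * g t).
    apply: (@eq_tintegrable _ _ _ (fun t => g t * a.[t])); first by move=> t _; rewrite mulrC.
    by apply: tintegrableM_cont => //; exact: continuous_horner.
  have hra : tintegrable s (s + tau) (fun t => rho t * a^`().[t]).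
    by apply: tintegrableM_cont => //; exact: continuous_horner.
  have hPa : tintegrable s (s + tau) (fun t => (eta.[t] - E0) * a^`().[t]).
    apply: tintegrableM_cont; last exact: continuous_horner.
    by apply: tintegrableB; [exact: poly_tintegrable|exact: tintegrable_cst].
  have hda : tintegrable s (s + tau) (fun t => E0 * a^`().[t]).
    by apply: tintegrableZ; exact: poly_tintegrable.
  have int_da : tint s (s + tau) (horner a^`()) = 1.
    rewrite (@tint_FTC _ _ _ _ (horner a))//; last exact: continuous_horner.
    by rewrite as0 as1 subr0.
  have momE : moment j P * j.+1%:R =
      tint s (s + tau) (fun t => (eta.[t] - E0) * a^`().[t]).
    have := tint_affine (P * 'X^j) s tau0.
    rewrite (@eq_tint _ _ _ (horner (P * 'X^j)) (fun x => P.[x] * x ^+ j)); last first.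
      by move=> x _; rewrite !hornerE.
    rewrite -/(moment j P) => em.
    rewrite -[moment j P](mulKf (lt0r_neq0 tau0)) -em.
    have hPj : tintegrable s (s + tau) (fun t => (P * 'X^j).[(t - s) / tau]).
      apply: (@eq_tintegrable _ _ _ (fun t => (j.+1%:R * tau^-1)^-1 * ((eta.[t] - E0) * a^`().[t]))).
        move=> t _; rewrite deriv_shifted_monoE hornerM hornerXn PE.
        have -> : s + tau * ((t - s) / tau) = t by field; rewrite gt_eqF.
        rewrite /=; field; rewrite gt_eqF//= pnatr_eq0 //.
      exact: tintegrableZ.
    rewrite mulrAC -tintZ//; apply: eq_tint => t _.
    rewrite deriv_shifted_monoE hornerM hornerXn PE.
    have -> : s + tau * ((t - s) / tau) = t by field; rewrite gt_eqF.
    by rewrite /=; ring.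
  (* The test polynomial is 0 at the start and 1 at the end of the step, so [E1] enters alone;
     replacing it by [E0] minus the integral of [g] cancels [E0]. *)
  have key : moment j P * j.+1%:R = tint s (s + tau) (fun t => a.[t] * g t - g t) +
      tint s (s + tau) (fun t => rho t * a^`().[t]).
    rewrite momE tintB//.
    have -> : tint s (s + tau) (fun t => (eta.[t] - E0) * a^`().[t]) =
        tint s (s + tau) (fun t => (eta.[t] - rho t) * a^`().[t]) +
        tint s (s + tau) (fun t => rho t * a^`().[t]) - E0.
      rewrite -{2}[E0]mulr1 -int_da -tintZ; last exact: poly_tintegrable.
      rewrite -tintD// -tintB//; last exact: tintegrableD.
      by apply: eq_tint => t _; ring.
    by rewrite hE1 in e; move: e; lra.
  have b1 : `|tint s (s + tau) (fun t => a.[t] * g t - g t)| <= Ig.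
    have hI := tintegrableB hga hg.
    apply: le_trans (ler_norm_tint hI) _; apply: le_tint; [exact: tintegrable_norm..|].
    move=> t ts; have /andP[x0 x1] := unit_itv t ts.
    rewrite -{2}[g t]mul1r -mulrBl normrM ler_piMl// shifted_monoE.
    have h0 := exprn_ge0 j.+1 x0; have h1 := exprn_ile1 j.+1 x0 x1.
    by rewrite ler_norml; apply/andP; split; lra.
  have b2 : `|tint s (s + tau) (fun t => rho t * a^`().[t])| <= j.+1%:R * (tau^-1 * Ir).
    apply: le_trans (ler_norm_tint hra) _; rewrite mulrA -tintZ; last exact: tintegrable_norm.
    apply: le_tint; [exact: tintegrable_norm|by apply/tintegrableZ/tintegrable_norm|].
    move=> t ts; have /andP[x0 x1] := unit_itv t ts.
    rewrite normrM mulrC; apply: ler_wpM2r => //.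
    rewrite deriv_shifted_monoE ger0_norm; last first.
      by rewrite !mulr_ge0 ?invr_ge0 ?ler0n ?(ltW tau0)// exprn_ge0.
    by rewrite ler_piMr ?exprn_ile1// mulr_ge0 ?invr_ge0 ?ler0n ?ltW.
  apply: (@le_trans _ _ `|moment j P * j.+1%:R|).
    by rewrite normrM [ `|_.+1%:R| ]ger0_norm// ler_peMr// ler1n.
  rewrite key; apply: le_trans (ler_normD _ _) _; apply: lerD b1 _.
  apply: le_trans b2 _; apply: ler_wpM2r; first by rewrite mulr_ge0// invr_ge0 ltW.
  by rewrite ler_nat; rewrite ltnS (leq_trans (ltnW jn))// leq_subr.
move=> t /andP[st ts].
have xt : 0 <= (t - s) / tau <= 1.
  rewrite ler_pdivrMr// mul1r mulr_ge0 ?invr_ge0 ?subr_ge0 ?(ltW tau0)//=; lra.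
have -> : eta.[t] = P.[(t - s) / tau] + E0.
  by rewrite PE subrK; congr _.[_]; field; rewrite gt_eqF.
apply: le_trans (ler_normD _ _) _.
set S := \sum_k `|sigma k|.
have S0 : 0 <= S by exact: sumr_ge0.
have Tr0 : 0 <= tau^-1 * Ir by rewrite mulr_ge0// invr_ge0 ltW.
have bP : `|P.[(t - s) / tau]| <= C * ((q.+1%:R * q.+2%:R) * (Ig + tau^-1 * Ir) + (S + ns%:R * `|E0|)).
  apply: le_trans (hC P sP _ xt) _; apply: ler_wpM2l => //; apply: lerD.
    apply: (@le_trans _ _ (\sum_(j < (q.+1 - ns)%N) (q.+2%:R * (Ig + tau^-1 * Ir)))).
      apply: ler_sum => j _; apply: le_trans (mle j (ltn_ord j)) _.
      rewrite mulrDr lerD2r ler_peMl// ler1n//.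
    rewrite sumr_const card_ord -[_ *+ (q.+1 - ns)]mulr_natl -mulrA; apply: ler_wpM2r.
      by apply: mulr_ge0 => //; exact: addr_ge0.
    by rewrite ler_nat leq_subr.
  apply: (@le_trans _ _ (\sum_k (`|sigma k| + `|E0|))).
    apply: ler_sum => k _; rewrite PE mulrC hS; exact: ler_normB.
  by rewrite big_split/= sumr_const card_ord mulr_natl.
apply: le_trans (lerD bP (lexx _)) _.
set A : R := q.+1%:R * q.+2%:R; set B : R := ns%:R.
have A0 : 0 <= A by rewrite mulr_ge0.
have B0 : 0 <= B by rewrite ler0n.
have e0 : 0 <= `|E0| by [].
rewrite -subr_ge0.
have -> : (1 + C * (A + B + 1)) * (`|E0| + S + tau^-1 * Ir + Ig) -
   (C * (A * (Ig + tau^-1 * Ir) + (S + B * `|E0|)) + `|E0|) =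
   S + tau^-1 * Ir + Ig + C * ((A + 1) * `|E0| + (A + B) * S + (B + 1) * (tau^-1 * Ir + Ig)) by ring.
by repeat first [assumption | exact: ler01 | apply: addr_ge0 | apply: mulr_ge0].
Qed.

(** Unisolvence without nodes: the moments alone determine a polynomial. Scaled monomials are
    admissible tests, being bounded by 1, so [J] controls all moments, and this makes the L^2
    projection in time stable in L^1. *)
Lemma projection_bound r : exists2 C : R, 0 <= C &
  forall (s tau : R) (d : {poly R}) (J : R), 0 < tau -> (size d <= r.+1)%N ->
    (forall a : {poly R}, (size a <= r.+1)%N ->
      (forall t, s < t < s + tau -> `|a.[t]| <= 1) ->
      `|tint s (s + tau) (fun t => d.[t] * a.[t])| <= J) ->
    tint s (s + tau) (fun t => `|d.[t]|) <= C * J.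
Proof.
have [C C0 hC] := unisolvent_bound (leq0n r.+1) (@unisolvent0 r (fun k => 0)).
exists (C * r.+1%:R); first by rewrite mulr_ge0.
move=> s tau d J tau0 sd hd.
have sst : s <= s + tau by rewrite lerDl ltW.
have [P sP PE] := affine_comp_poly s tau d.
have it0 : 0 < tau^-1 by rewrite invr_gt0.
have mle (j : 'I_r.+1) : `|moment j P| <= tau^-1 * J.
  pose a := shifted_mono s tau j.
  have -> : moment j P = tau^-1 * tint s (s + tau) (fun t => d.[t] * a.[t]).
    have := tint_affine (P * 'X^j) s tau0.
    rewrite (@eq_tint _ _ _ (horner (P * 'X^j)) (fun x => P.[x] * x ^+ j)); last first.
      by move=> x _; rewrite !hornerE.
    rewrite -/(moment j P) => e; rewrite -[LHS](mulKf (lt0r_neq0 tau0)) -e; congr (_ * _).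
    apply: eq_tint => t _; rewrite /a shifted_monoE hornerM hornerXn PE; congr (_.[_] * _).
    by field; rewrite gt_eqF.
  rewrite normrM (gtr0_norm it0) (ler_pM2l it0); apply: hd.
    by apply: leq_trans (size_shifted_mono _ _ _) _.
  move=> t /andP[st ts]; rewrite shifted_monoE ger0_norm.
    apply: exprn_ile1; first by apply: divr_ge0; lra.
    by rewrite ler_pdivrMr// mul1r; lra.
  by rewrite exprn_ge0//; apply: divr_ge0; lra.
have dle t : s < t < s + tau -> `|d.[t]| <= C * r.+1%:R * (tau^-1 * J).
  move=> /andP[st ts]; have -> : d.[t] = P.[(t - s) / tau].
    by rewrite PE; congr _.[_]; field; rewrite gt_eqF.
  apply: le_trans (hC P _ _ _) _.
  - exact: leq_trans sP sd.
  - rewrite ler_pdivrMr// mul1r mulr_ge0 ?invr_ge0 ?subr_ge0 ?(ltW st) ?(ltW tau0)//=; lra.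
  - rewrite big_ord0 addr0 subn0 -mulrA; apply: ler_wpM2l => //.
    apply: (@le_trans _ _ (\sum_(j < r.+1) (tau^-1 * J))).
      by apply: ler_sum => j _; exact: mle.
    by rewrite sumr_const card_ord mulr_natl.
apply: (@le_trans _ _ (tint s (s + tau) (fun=> C * r.+1%:R * (tau^-1 * J)))).
  by apply: le_tint => //; [apply/tintegrable_norm/poly_tintegrable|exact: tintegrable_cst].
rewrite tint_cst// le_eqVlt; apply/orP; left; apply/eqP.
by field; rewrite gt_eqF.
Qed.

End Unisolvence.

(** * Sums of integrals over steps, and projection errors in time *)

Section TimeSums.
Context {R : realType}.
Implicit Types (a b : R) (f : R -> R).

(** Nonnegativity of the integral of the squared deviation of [f] from its mean. *)
Lemma tint_cauchy a b f : a <= b -> tintegrable a b f ->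
  tintegrable a b (fun t => f t ^+ 2) ->
  tint a b f ^+ 2 <= (b - a) * tint a b (fun t => f t ^+ 2).
Proof.
move=> ab If If2.
have [ab'|] := ltP a b; last by move=> ba; rewrite !tint0// expr0n/= mulr0.
have L0 : 0 < b - a by rewrite subr_gt0.
set m := tint a b f / (b - a).
have : 0 <= tint a b (fun t => (f t - m) ^+ 2) by apply: tint_ge0 => t _; exact: sqr_ge0.
have -> : tint a b (fun t => (f t - m) ^+ 2) =
    tint a b (fun t => f t ^+ 2 - (2 * m) * f t + m ^+ 2).
  by apply: eq_tint => t _; ring.
have I1 := tintegrableZ (2 * m) If.
rewrite tintD; [|exact: tintegrableB|exact: tintegrable_cst].
rewrite tintB// tintZ// tint_cst//.
have -> : tint a b f = m * (b - a) by rewrite /m divfK// gt_eqF.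
move=> h.
have : 0 <= (b - a) * (tint a b (fun t => f t ^+ 2) - 2 * m * (m * (b - a)) + m ^+ 2 * (b - a)).
  by rewrite mulr_ge0// ltW.
nra.
Qed.

Lemma tint_steps (h : R) f (g0 n : nat) : 0 < h ->
  tintegrable (g0%:R * h) ((g0 + n)%:R * h) f ->
  \sum_(1 <= k < n.+1) tint ((g0 + k.-1)%:R * h) ((g0 + k)%:R * h) f =
  tint (g0%:R * h) ((g0 + n)%:R * h) f.
Proof.
move=> h0; elim: n => [|n IH] If; first by rewrite big_geq// addn0 tint0.
have ln : (g0 + n)%:R * h <= (g0 + n.+1)%:R * h by rewrite ler_pM2r// ler_nat leq_add2l.
rewrite big_nat_recr//= IH; last exact: tintegrableS If.
by rewrite -tint_split// ler_pM2r// ler_nat leq_addr.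
Qed.

(** Intervals of [K] consecutive steps cover each time at most [K] times. The truncated subtraction
    clips them at 0. *)
Lemma tint_windows (T h : R) f (K n : nat) : 0 < h -> n%:R * h <= T ->
  tintegrable 0 T f -> (forall t, 0 < t < T -> 0 <= f t) ->
  \sum_(1 <= g < n.+1) tint ((g - K)%:R * h) (g%:R * h) f <= K%:R * tint 0 T f.
Proof.
move=> h0 nT If f0.
have f0' a b t : 0 <= a -> b <= T -> a < t < b -> 0 <= f t.
  by move=> a0 bT /andP[at' tb]; rewrite f0// (le_lt_trans a0)//= (lt_le_trans tb).
have le0 (g : nat) : 0 <= g%:R * h by rewrite mulr_ge0// ltW.
have leT (g : nat) : (g <= n)%N -> g%:R * h <= T.
  by move=> gn; rewrite (le_trans _ nT)// ler_pM2r// ler_nat.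
elim: K => [|K IH].
  by rewrite mul0r big1// => g _; rewrite subn0 tint0.
(* The last step is split off; what remains is the interval of [K] steps ending one step earlier, so
   the induction hypothesis applies after a shift of the index. *)
have E g : (1 <= g < n.+1)%N -> tint ((g - K.+1)%:R * h) (g%:R * h) f =
    tint ((g.-1 - K)%:R * h) (g.-1%:R * h) f + tint ((0 + g.-1)%:R * h) ((0 + g)%:R * h) f.
  case: g => // g /andP[_ gn]; rewrite !add0n /= subSS; apply: tint_split.
  - by rewrite ler_pM2r// ler_nat leq_subr.
  - by rewrite ler_pM2r// ler_nat.
  - by apply: tintegrableS If => //; exact: leT.
rewrite (eq_big_nat _ _ E) big_split/= -natr1 mulrDl mul1r lerD//; last first.
  rewrite (@tint_steps h f 0 n)//; first by apply: tint_le_sub; rewrite ?add0n.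
  by rewrite mul0r; apply: tintegrableS If; rewrite ?add0n.
apply: le_trans IH.
rewrite big_add1/=.
case: n nT leT {E} => [|n] nT leT; first by rewrite !big_geq.
rewrite big_nat_recl//= tint0 ?sub0n// add0r.
rewrite [leRHS]big_add1/= [leRHS]big_nat_recr//= lerDl.
apply: tint_ge0 => t; apply: f0' => //; exact: leT.
Qed.

Lemma sum_gidx (M : 'I_2 -> nat) i N (f : nat -> R) :
  \sum_(1 <= w < N.+1) \sum_(1 <= n < (M i).+1) f (gidx M i w n) =
  \sum_(1 <= g < (N * M i).+1) f g.
Proof.
elim: N => [|N IH]; first by rewrite mul0n !big_geq.
rewrite big_nat_recr//= IH [RHS](@big_cat_nat _ _ _ (N * M i).+1)//=; last first.
  by rewrite ltnS leq_mul2r leqnSn orbT.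
congr (_ + _); rewrite -[(N * M i).+1]add1n big_addn mulSn subSn ?leq_addl// addnK.
by apply: eq_bigr => k _; rewrite /gidx /= addnC.
Qed.

Lemma tintegrableM_poly a b f (p : {poly R}) : tintegrable a b f ->
  tintegrable a b (fun t => f t * p.[t]).
Proof. by move=> If; apply: tintegrableM_cont => // t; exact: continuous_horner. Qed.

Lemma ler_tintM_le1 a b f (p : {poly R}) : tintegrable a b f ->
  (forall t, a < t < b -> `|p.[t]| <= 1) ->
  `|tint a b (fun t => f t * p.[t])| <= tint a b (fun t => `|f t|).
Proof.
move=> If p1; have If' := tintegrableM_poly p If.
apply: (le_trans (ler_norm_tint If')); apply: le_tint.
- exact: tintegrable_norm.
- exact: tintegrable_norm.
- by move=> t /p1 h; rewrite normrM ler_piMr.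
Qed.

(** [ph] is the discrete quantity, [f] the exact one and [pf] a polynomial near it, with error [z];
    [J] measures how far [ph] is from being the projection of [f]. *)
Definition projection_stable (r : nat) (K : R) : Prop :=
  forall (s tau : R) (ph pf : {poly R}) f (z J : R), 0 < tau ->
    (size ph <= r.+1)%N -> (size pf <= r.+1)%N -> tintegrable s (s + tau) f ->
    tint s (s + tau) (fun t => `|f t - pf.[t]|) <= z ->
    (forall a : {poly R}, (size a <= r.+1)%N ->
      (forall t, s < t < s + tau -> `|a.[t]| <= 1) ->
      `|tint s (s + tau) (fun t => (ph.[t] - f t) * a.[t])| <= J) ->
    tint s (s + tau) (fun t => `|ph.[t] - f t|) <= K * (J + z).

(** [projection_bound] applies to the polynomial [ph - pf], whose defect is at most [J + z]; the
    triangle inequality adds [z] once more. *)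
Lemma projection_error (r : nat) : exists2 K : R, 0 <= K & projection_stable r K.
Proof.
have [K K0 hK] := projection_bound R r.
exists (K + 1); first by rewrite addr_ge0.
move=> s tau ph pf f z J t0 sh sf If hz hJ.
have Ip p : tintegrable s (s + tau) (horner p) by exact: poly_tintegrable.
have Iz : tintegrable s (s + tau) (fun t => f t - pf.[t]) by exact: tintegrableB.
have Ij : tintegrable s (s + tau) (fun t => ph.[t] - f t) by exact: tintegrableB.
have J0 : 0 <= J.
  apply: le_trans (hJ 0 _ _); rewrite ?size_poly0//.
  by move=> t _; rewrite horner0 normr0.
have := hK s tau (ph - pf) (J + z) t0.
rewrite (leq_trans (size_polyD _ _)) ?geq_max ?size_polyN ?sh// => /(_ isT) h.
have {}h : tint s (s + tau) (fun t => `|(ph - pf).[t]|) <= K * (J + z).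
  apply: h => a sa a1.
  rewrite (@eq_tint _ _ _ _ (fun t => (ph.[t] - f t) * a.[t] + (f t - pf.[t]) * a.[t])); last first.
    by move=> t _; rewrite hornerD hornerN; ring.
  rewrite tintD ?(le_trans (ler_normD _ _)) ?lerD ?hJ//; [|exact: tintegrableM_poly..].
  exact: le_trans (ler_tintM_le1 Iz a1) hz.
apply: (@le_trans _ _ (tint s (s + tau) (fun t => `|(ph - pf).[t]| + `|f t - pf.[t]|))).
  apply: le_tint.
  - exact: tintegrable_norm.
  - by apply: tintegrableD; exact: tintegrable_norm.
  - move=> t _; rewrite hornerD hornerN.
    by rewrite (le_trans _ (ler_normB _ _))// opprB addrA subrK.
rewrite tintD; [|exact: tintegrable_norm|exact: tintegrable_norm].
rewrite mulrDl mul1r lerD// (le_trans hz)// lerDr//.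
Qed.

End TimeSums.

(** * The error equations in coordinates *)

Section Coordinates.
Context (R : realType) (T : R) (q ns ks : nat) (r : 'I_2 -> nat).
Context (theta : 'I_ns -> R) (Dm : 'M[R]_(ns, ks.+1)) (N0 : nat).
Context (d : 'I_2 -> nat) (nG : nat).
Context (U : forall i, 'I_(d i) -> R -> R) (V F gam : 'I_2 -> 'I_nG -> R -> R).
Context (A : forall i, 'I_(d i) -> 'I_(d i) -> R) (G : forall i, 'I_(d i) -> 'I_nG -> R).
Context (P : forall i, 'I_nG -> 'I_(d i) -> R) (b : 'I_2 -> 'I_2 -> R).
Context (dn den zn : 'I_2 -> R -> R).

(* [U], [V], [F] are coordinates of u_i, of its trace and of F_i; [dn] and [zn]
   bound their derivatives of the order controlling the approximation error, and
   [den] the squared norms in the consistency bounds. [gam] collects the source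
   terms of the flux condition. *)
Record exact_ok : Prop := ExactOk {
  ex_T : 0 < T;
  ex_ns : (ns <= q.+1)%N;
  ex_uni : unisolvent q theta;
  ex_theta : forall j, theta j <= 1;
  ex_U : forall i k, tintegrable 0 T (@U i k);
  ex_V : forall i l, tintegrable 0 T (V i l);
  ex_F : forall i l, tintegrable 0 T (F i l);
  ex_dn : forall i, tintegrable 0 T (dn i);
  ex_den : forall i, tintegrable 0 T (den i);
  ex_zn : forall i, tintegrable 0 T (zn i);
  ex_dn_ge0 : forall i t, 0 <= dn i t;
  ex_dn_den : forall i t, 0 < t < T -> dn i t ^+ 2 <= den i t;
  ex_zn_ge0 : forall i t, 0 <= zn i t;
  ex_U_approx : forall i k s t, 0 <= s -> s <= t -> t <= T ->
    exists2 p : {poly R}, (size p <= q.+1)%N & forall x, s <= x <= t ->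
      `|@U i k x - p.[x]| <= (t - s) ^+ q * tint s t (dn i);
  ex_V_approx : forall i l s t, 0 <= s -> s <= t -> t <= T ->
    exists2 p : {poly R}, (size p <= (r i).+1)%N &
      tint s t (fun x => `|V i l x - p.[x]|) <= (t - s) ^+ (r i).+1 * tint s t (zn i);
  ex_F_approx : forall i l s t, 0 <= s -> s <= t -> t <= T ->
    exists2 p : {poly R}, (size p <= (r i).+1)%N &
      tint s t (fun x => `|F i l x - p.[x]|) <= (t - s) ^+ (r i).+1 * tint s t (zn i);
  ex_VE : forall i l t, 0 < t < T -> V i l t = \sum_k P l k * @U i k t;
  ex_FE : forall i l t, 0 < t < T -> F i l t = \sum_j b i j * V j l t - gam i l t
}.

(* A run of the method in coordinates; [rE i g] are the errors of the side
   values at the time [g * tau], and [reps] bounds those of the initialization. *)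
Record run := Run {
  rN : nat;
  rM : 'I_2 -> nat;
  reta : forall i, nat -> nat -> 'I_(d i) -> {poly R};
  rE : forall i, nat -> 'I_(d i) -> R;
  ruG : 'I_2 -> nat -> 'I_nG -> {poly R};
  rFG : 'I_2 -> nat -> 'I_nG -> {poly R};
  reps : R
}.

Definition dT X : R := T / (rN X)%:R.
Definition tau X i : R := dT X / (rM X i)%:R.
Definition tg X i (g : nat) : R := g%:R * tau X i.
Definition gid X i w n := gidx (rM X) i w n.
Definition err X i w n k t : R := (@reta X i w n k).[t] - U k t.
Definition del X i w l t : R := (rFG X i w l).[t] - F i l t.
Definition nE X i g : R := \sum_k `|@rE X i g k|.
Definition instep X i w n (f : R -> R) : R :=
  tint (tg X i (gid X i w n).-1) (tg X i (gid X i w n)) f.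
Definition inwin X w (f : R -> R) : R := tint (w.-1%:R * dT X) (w%:R * dT X) f.
Definition valid X i w n := ((N0 <= w <= rN X) && (1 <= n <= rM X i))%N.
Definition resid X i g j k : R := @U i k (tg X i g.-1 + theta j * tau X i) -
  \sum_(l < ks.+1) Dm j l * @U i k (tg X i (g - l)).

Record run_ok (C : R) (X : run) : Prop := RunOk {
  run_N : (0 < rN X)%N;
  run_M : forall i, (0 < rM X i)%N;
  run_avail : forall i (j : 'I_ns), (ks <= N0.-1 * rM X i + 1)%N /\
    0 <= (N0.-1 * rM X i)%:R + theta j;
  run_N0 : (0 < N0)%N;
  run_eta : forall i w n k, valid X i w n -> (size (@reta X i w n k) <= q.+1)%N;
  run_uG : forall i w l, (N0 <= w <= rN X)%N -> (size (ruG X i w l) <= (r i).+1)%N;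
  run_FG : forall i w l, (N0 <= w <= rN X)%N -> (size (rFG X i w l) <= (r i).+1)%N;
  run_S : forall i w n j k, valid X i w n ->
    (@reta X i w n k).[tg X i (gid X i w n).-1 + theta j * tau X i] =
    \sum_(l < ks.+1) Dm j l * (@rE X i (gid X i w n - l) k + U k (tg X i (gid X i w n - l)));
  run_V : forall i w n k (a : {poly R}), valid X i w n -> (size a <= (q.+1 - ns).+1)%N ->
    a.[tg X i (gid X i w n)] * @rE X i (gid X i w n) k
      - instep X i w n (fun t => @err X i w n k t * a^`().[t]) =
    a.[tg X i (gid X i w n).-1] * @rE X i (gid X i w n).-1 k
      - instep X i w n (fun t => a.[t] * (\sum_l A k l * @err X i w n l t
                                        + \sum_l G k l * del X i w l t));
  run_T : forall i w l (a : {poly R}), (N0 <= w <= rN X)%N -> (size a <= (r i).+1)%N ->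
    inwin X w (fun t => (ruG X i w l).[t] * a.[t]) =
    \sum_(1 <= n < (rM X i).+1)
      instep X i w n (fun t => (\sum_k P l k * (@reta X i w n k).[t]) * a.[t]);
  run_F : forall i w l (a : {poly R}), (N0 <= w <= rN X)%N -> (size a <= (r i).+1)%N ->
    inwin X w (fun t => (rFG X i w l).[t] * a.[t]) =
    inwin X w (fun t => (\sum_j b i j * (ruG X j w l).[t] - gam i l t) * a.[t]);
  run_cons : forall i w n, valid X i w n ->
    tau X i * \sum_j \sum_k @resid X i (gid X i w n) j k ^+ 2 <=
    C * tau X i ^+ (2 * q + 2) *
      tint (tg X i (gid X i w n - ks)) (tg X i (gid X i w n)) (den i);
  run_init : forall i g, (g <= N0.-1 * rM X i)%N -> nE X i g <= reps X
}.

Hypothesis ex : exact_ok.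
Let hT := ex_T ex.

(* A step uses times reaching back at most [lookback] steps. *)
Definition lookback : nat := (1 + ks + \sum_j Num.bound (1 - theta j))%N.

Lemma lookback_ge j : 1 - theta j <= lookback%:R.
Proof.
rewrite /lookback (bigD1 j)//= -addnCA natrD.
apply: le_trans (_ : (Num.bound (1 - theta j))%:R <= _); last by rewrite lerDl ler0n.
by rewrite ltW// archi_boundP// subr_ge0 (ex_theta ex).
Qed.

Section OneRun.
Variables (C : R) (X : run).
Hypothesis ok : run_ok C X.
Hypothesis C0 : 0 <= C.

Lemma dT_gt0 : 0 < dT X. Proof. by rewrite divr_gt0// ltr0n (run_N ok). Qed.
Lemma tau_gt0 i : 0 < tau X i. Proof. by rewrite divr_gt0 ?dT_gt0// ltr0n (run_M ok). Qed.
Lemma tauM i : (rM X i)%:R * tau X i = dT X.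
Proof. by rewrite mulrC divfK// pnatr_eq0 -lt0n (run_M ok). Qed.
Lemma dTN : (rN X)%:R * dT X = T.
Proof. by rewrite mulrC divfK// pnatr_eq0 -lt0n (run_N ok). Qed.
Lemma dT_le_T : dT X <= T.
Proof. by rewrite -[leRHS]dTN ler_peMl ?(ltW dT_gt0)// ler1n (run_N ok). Qed.
Lemma tg_ge0 i g : 0 <= tg X i g.
Proof. by rewrite mulr_ge0// ltW// tau_gt0. Qed.
Lemma tg_le i g g' : (g <= g')%N -> tg X i g <= tg X i g'.
Proof. by move=> h; rewrite ler_pM2r ?tau_gt0// ler_nat. Qed.
Lemma tg_winl i w : tg X i (w * rM X i)%N = w%:R * dT X.
Proof. by rewrite /tg natrM -mulrA tauM. Qed.
Lemma tg_T i g : (g <= rN X * rM X i)%N -> tg X i g <= T.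
Proof. by move=> h; rewrite -dTN -(tg_winl i) tg_le. Qed.
Lemma tg_pred i g : (0 < g)%N -> tg X i g.-1 + tau X i = tg X i g.
Proof. by case: g => // g _; rewrite /tg /= -natr1 mulrDl mul1r. Qed.

Section OneStep.
Variables (i : 'I_2) (w n : nat).
Hypothesis v : valid X i w n.
Let g := gid X i w n.

Lemma gid_gt0 : (0 < g)%N.
Proof. by case/andP: v => _ /andP[+ _]; rewrite /g /gid /gidx; case: n => // k _; rewrite addnS. Qed.
Lemma gid_le_w : (g <= w * rM X i)%N.
Proof.
case/andP: v => /andP[w0 _] /andP[_ nM]; rewrite /g /gid /gidx.
have w1 : (0 < w)%N by rewrite (leq_trans (run_N0 ok)).
by rewrite -[in leqRHS](prednK w1) mulSn addnC leq_add2r.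
Qed.
Lemma gid_le : (g <= rN X * rM X i)%N.
Proof.
case/andP: v => /andP[_ wN] _.
by rewrite (leq_trans gid_le_w)// leq_mul2r wN orbT.
Qed.
Lemma gid_ge : (N0.-1 * rM X i < g)%N.
Proof.
case/andP: v => /andP[w0 _] /andP[n1 _]; rewrite /g /gid /gidx.
rewrite -addn1 leq_add// leq_mul2r; apply/orP; right.
by rewrite -!subn1 leq_sub2r.
Qed.
Lemma gid_ge_w : (w.-1 * rM X i < g)%N.
Proof. by case/andP: v => _ /andP[n1 _]; rewrite /g /gid /gidx -addn1 leq_add2l. Qed.

Lemma step_lt : tg X i g.-1 < tg X i g.
Proof. by rewrite -(tg_pred i gid_gt0) ltrDl tau_gt0. Qed.
Lemma step_in t : tg X i g.-1 < t < tg X i g -> 0 < t < T.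
Proof.
case/andP=> h1 h2; rewrite (le_lt_trans (tg_ge0 i g.-1))//=.
exact: lt_le_trans (tg_T gid_le).
Qed.
Lemma tintegrable_step f : tintegrable 0 T f -> tintegrable (tg X i g.-1) (tg X i g) f.
Proof. by apply: tintegrableS; [exact: tg_ge0|exact: tg_T gid_le]. Qed.
Lemma err_int k : tintegrable (tg X i g.-1) (tg X i g) (@err X i w n k).
Proof.
apply: tintegrableB; first exact: poly_tintegrable.
exact: tintegrable_step (ex_U ex _).
Qed.
Lemma del_int l : tintegrable (tg X i g.-1) (tg X i g) (del X i w l).
Proof.
apply: tintegrableB; first exact: poly_tintegrable.
exact: tintegrable_step (ex_F ex _ _).
Qed.
Lemma errs_int : tintegrable (tg X i g.-1) (tg X i g) (fun t => \sum_k `|@err X i w n k t|).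
Proof. by apply: tintegrable_sum => k; exact: tintegrable_norm (err_int k). Qed.
Lemma dels_int : tintegrable (tg X i g.-1) (tg X i g) (fun t => \sum_l `|del X i w l t|).
Proof. by apply: tintegrable_sum => k; exact: tintegrable_norm (del_int k). Qed.

End OneStep.
End OneRun.

Definition Xs X i w n : R := instep X i w n (fun t => \sum_k `|@err X i w n k t|).
Definition Ys X i w n : R := instep X i w n (fun t => \sum_l `|del X i w l t|).
Definition Jden X i g : R := tint (tg X i (g - lookback)) (tg X i g) (den i).
(** Size of the data error of one step: a Bramble-Hilbert bound over the times looked back upon,
    plus the residual of the side conditions. *)
Definition Qs X i g : R := tau X i ^+ q * tint (tg X i (g - lookback)) (tg X i g) (dn i)
  + \sum_j \sum_k `|@resid X i g j k|.

Lemma Xs_ge0 X i w n : 0 <= Xs X i w n.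
Proof. by apply: tint_ge0 => t _; rewrite sumr_ge0. Qed.
Lemma Ys_ge0 X i w n : 0 <= Ys X i w n.
Proof. by apply: tint_ge0 => t _; rewrite sumr_ge0. Qed.

Definition cA i : R := \sum_k \sum_l `|@A i k l|.
Definition cG i : R := \sum_k \sum_l `|@G i k l|.
Definition cD : R := \sum_j \sum_l `|Dm j l|.

Lemma le_bigsum (I : finType) (f : I -> R) i : (forall i, 0 <= f i) -> f i <= \sum_j f j.
Proof. by move=> f0; rewrite (bigD1 i)//= lerDl sumr_ge0. Qed.

Lemma ler_norm_lincomb (I J : finType) (a : J -> I -> R) (x : I -> R) j :
  `|\sum_i a j i * x i| <= (\sum_j \sum_i `|a j i|) * \sum_i `|x i|.
Proof.
rewrite (le_trans (ler_norm_sum _ _ _))// mulr_sumr ler_sum// => i _.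
rewrite normrM ler_wpM2r//.
apply: (le_trans (@le_bigsum _ (fun i => `|a j i|) i (fun=> normr_ge0 _))).
by apply: (@le_bigsum _ (fun j => \sum_i `|a j i|)) => j'; rewrite sumr_ge0.
Qed.

Section StepBound.
Variables (C : R) (X : run).
Hypothesis ok : run_ok C X.
Hypothesis C0 : 0 <= C.
Variables (i : 'I_2) (w n : nat).
Hypothesis v : valid X i w n.
Let g := gid X i w n.
Let L := lookback.
Let g_gt0 := gid_gt0 v.

Definition load k t : R := \sum_l @A i k l * @err X i w n l t + \sum_l @G i k l * del X i w l t.

Lemma load_int k : tintegrable (tg X i g.-1) (tg X i g) (load k).
Proof.
by apply: tintegrableD; apply: tintegrable_sum => l; apply: tintegrableZ;
  [exact: (err_int ok v)|exact: (del_int ok v)].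
Qed.

Lemma load_bound k : tint (tg X i g.-1) (tg X i g) (fun t => `|load k t|) <=
  (cA i + cG i) * (Xs X i w n + Ys X i w n).
Proof.
have I1 := errs_int ok v; have I2 := dels_int ok v.
have h : tint (tg X i g.-1) (tg X i g) (fun t => `|load k t|) <=
    cA i * Xs X i w n + cG i * Ys X i w n.
  rewrite /Xs /Ys /instep -tintZ// -tintZ// -tintD; [|exact: tintegrableZ|exact: tintegrableZ].
  apply: le_tint.
  - exact: tintegrable_norm (load_int k).
  - by apply: tintegrableD; exact: tintegrableZ.
  - move=> t _; rewrite (le_trans (ler_normD _ _))// lerD//; exact: ler_norm_lincomb.
apply: le_trans h _; have := Xs_ge0 X i w n; have := Ys_ge0 X i w n.
have : 0 <= cA i by rewrite sumr_ge0// => ? _; rewrite sumr_ge0.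
have : 0 <= cG i by rewrite sumr_ge0// => ? _; rewrite sumr_ge0.
nra.
Qed.

(** One polynomial is needed on all the past times involved, because nodes with negative [theta] lie
    before the step. The interval has length at most [L] steps, hence the factor [L%:R ^+ q]. *)
Lemma approx_step k : exists2 p : {poly R}, (size p <= q.+1)%N & forall t,
  tg X i (g - L) <= t <= tg X i g -> `|@U i k t - p.[t]| <= L%:R ^+ q * Qs X i g.
Proof.
have le1 : tg X i (g - L) <= tg X i g by apply: (tg_le ok); rewrite leq_subr.
have [p sp hp] := ex_U_approx ex k (tg_ge0 ok i (g - L)) le1 (tg_T ok (gid_le ok v)).
exists p => // t /hp /le_trans; apply.
set Z := tint _ _ _; have Z0 : 0 <= Z by apply: tint_ge0 => ? _; exact: (ex_dn_ge0 ex).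
apply: (@le_trans _ _ (L%:R ^+ q * (tau X i ^+ q * Z))); last first.
  by rewrite ler_wpM2l ?exprn_ge0// lerDl sumr_ge0// => ? _; rewrite sumr_ge0.
rewrite mulrA -exprMn ler_wpM2r// lerXn2r// ?nnegrE ?subr_ge0//.
  by rewrite mulr_ge0// ltW// (tau_gt0 ok).
rewrite lerBlDr /tg -mulrDl ler_pM2r ?(tau_gt0 ok)// -natrD ler_nat.
by rewrite -leq_subLR.
Qed.

(** Away from the start this is the choice of [lookback]. Near the start [g - L] is truncated to 0,
    and availability keeps the node nonnegative. *)
Lemma node_in j : tg X i (g - L) <= tg X i g.-1 + theta j * tau X i <= tg X i g.
Proof.
have t0 := tau_gt0 ok i.
rewrite -(tg_pred X i g_gt0) lerD2l ler_piMl ?(ltW t0) ?(ex_theta ex)// andbT.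
rewrite /tg -mulrDl ler_pM2r//.
have [Lg|gL] := leqP L g.
  rewrite natrB// -[g in leLHS](prednK g_gt0) -natr1.
  have := lookback_ge j; rewrite -/L; lra.
have -> : (g - L = 0)%N by apply/eqP; rewrite subn_eq0 ltnW.
have [_ h] := run_avail ok i j; apply: le_trans h _; rewrite lerD2r ler_nat.
by rewrite -ltnS (prednK g_gt0); exact: gid_ge v.
Qed.

(** One-step stability is applied to the discrete solution minus the polynomial [p] of
    [approx_step], with [rho] the approximation error and [load] as forcing. The bound [Bd] includes
    the current side value, which (S) may use. *)
Lemma step_bound_coord K1 : 0 <= K1 ->
  step_stable q theta K1 ->
  forall Bd, (forall g', (g' <= g)%N -> nE X i g' <= Bd) -> forall k,
  `|@rE X i g k| <= `|@rE X i g.-1 k| + (cA i + cG i) * (Xs X i w n + Ys X i w n) /\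
  forall t, tg X i g.-1 <= t <= tg X i g -> `|@err X i w n k t| <=
    K1 * (Bd + ns%:R * (cD * Bd + Qs X i g + L%:R ^+ q * Qs X i g) + L%:R ^+ q * Qs X i g
          + (cA i + cG i) * (Xs X i w n + Ys X i w n)) + L%:R ^+ q * Qs X i g.
Proof.
move=> K10 hK Bd hBd k; have t0 := tau_gt0 ok i.
have [p sp hp] := approx_step k.
have LB : tg X i (g - L) <= tg X i g.-1.
  by apply: (tg_le ok); rewrite -subn1 leq_sub2l// /L /lookback.
have LG : tg X i g.-1 <= tg X i g by apply: (tg_le ok); exact: leq_pred.
have rho_int : tintegrable (tg X i g.-1) (tg X i g) (fun t => @U i k t - p.[t]).
  apply: tintegrableB; last exact: poly_tintegrable.
  exact: (tintegrable_step ok v (ex_U ex _)).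
have [] := hK (tg X i g.-1) (tau X i) (@reta X i w n k - p) (fun t => @U i k t - p.[t])
  (load k) (@rE X i g.-1 k) (@rE X i g k)
  (fun j => (\sum_(l < ks.+1) Dm j l * (@rE X i (g - l) k + @U i k (tg X i (g - l))))
     - p.[tg X i g.-1 + theta j * tau X i]) t0.
- by rewrite (leq_trans (size_polyD _ _))// geq_max size_polyN sp (run_eta ok).
- by rewrite (tg_pred X i g_gt0).
- by rewrite (tg_pred X i g_gt0)//; exact: load_int.
- move=> a sa; rewrite (tg_pred X i g_gt0).
  rewrite (@eq_tint _ _ _ _ (fun t => @err X i w n k t * a^`().[t])); first exact: (run_V ok).
  by move=> t _; rewrite /err hornerD hornerN; ring.
- by move=> j; rewrite hornerD hornerN (run_S ok).
rewrite (tg_pred X i g_gt0)// => E1 sup; split.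
  rewrite E1 (le_trans (ler_normB _ _))// lerD2l.
  exact: le_trans (ler_norm_tint (load_int k)) (load_bound k).
move=> t tin; have /sup h := tin.
have -> : @err X i w n k t = (@reta X i w n k - p).[t] - (@U i k t - p.[t]).
  by rewrite /err hornerD hornerN; ring.
rewrite (le_trans (ler_normB _ _))// lerD//; last first.
  by apply: hp; case/andP: tin => t1 ->; rewrite (le_trans LB t1).
apply: le_trans h _; rewrite ler_wpM2l// lerD ?load_bound//.
have Q0 : 0 <= L%:R ^+ q * Qs X i g.
  have := hp (tg X i g); rewrite lexx (le_trans LB LG) => /(_ isT).
  exact: le_trans.
rewrite lerD//; last first.
  rewrite ler_pdivrMl//; apply: (@le_trans _ _ (tint (tg X i g.-1) (tg X i g)
     (fun=> L%:R ^+ q * Qs X i g))).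
    apply: le_tint; [exact: tintegrable_norm|exact: tintegrable_cst|].
    move=> x /andP[x1 x2]; apply: hp; rewrite (ltW x2) andbT (le_trans LB)//; exact: ltW.
  rewrite tint_cst// -{1}(tg_pred X i g_gt0) [X in _ * X]addrC addKr.
  by rewrite mulrC.
have Ek g' : (g' <= g)%N -> `|@rE X i g' k| <= Bd.
  move=> /hBd; apply: le_trans.
  by apply: (@le_bigsum _ (fun k => `|@rE X i g' k|)).
rewrite lerD ?Ek ?leq_pred//.
rewrite -[X in X%:R * _]card_ord mulr_natl -sumr_const ler_sum// => j _.
(* The nodal datum splits into past side errors, the residual of the side conditions for the exact
   solution, and the approximation error at the node. *)
have -> : \sum_(l < ks.+1) Dm j l * (@rE X i (g - l) k + @U i k (tg X i (g - l)))
     - p.[tg X i g.-1 + theta j * tau X i] =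
  \sum_(l < ks.+1) Dm j l * @rE X i (g - l) k - @resid X i g j k
  + (@U i k (tg X i g.-1 + theta j * tau X i) - p.[tg X i g.-1 + theta j * tau X i]).
  by rewrite /resid (eq_bigr _ (fun l _ => mulrDr _ _ _)) big_split/=; ring.
rewrite (le_trans (ler_normD _ _))// lerD//; last by apply: hp; exact: node_in.
rewrite (le_trans (ler_normB _ _))// lerD//.
  rewrite (le_trans (ler_norm_sum _ _ _))// /cD.
  have B0 : 0 <= Bd by rewrite (le_trans _ (Ek g _)).
  apply: (@le_trans _ _ ((\sum_l `|Dm j l|) * Bd)).
    by rewrite mulr_suml ler_sum// => l _; rewrite normrM ler_wpM2l// Ek// leq_subr.
  rewrite ler_wpM2r//.
  by apply: (@le_bigsum _ (fun j => \sum_l `|Dm j l|)) => j'; rewrite sumr_ge0.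
rewrite /Qs; apply: ler_wpDl.
  rewrite mulr_ge0 ?exprn_ge0 ?(ltW t0)//; apply: tint_ge0 => ? _; exact: (ex_dn_ge0 ex).
apply: (le_trans (@le_bigsum _ (fun k => `|@resid X i g j k|) k (fun=> normr_ge0 _))).
by apply: (@le_bigsum _ (fun j => \sum_k `|@resid X i g j k|)) => j'; rewrite sumr_ge0.
Qed.

End StepBound.

(** The side error grows additively, with coefficient 1 on the previous one and no [Bd]. All growth
    passes through the error integrals, which are small on short windows. *)
Definition step_estimate i (Kc : R) : Prop := forall C X, run_ok C X -> 0 <= C ->
  forall w n, valid X i w n -> let g := gid X i w n in
  forall Bd, (forall g', (g' <= g)%N -> nE X i g' <= Bd) ->
  nE X i g <= nE X i g.-1 + Kc * (Xs X i w n + Ys X i w n) /\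
  forall t, tg X i g.-1 <= t <= tg X i g -> \sum_k `|@err X i w n k t| <=
    Kc * (Bd + Qs X i g + (Xs X i w n + Ys X i w n)).

Lemma Qs_ge0 C X i g : run_ok C X -> 0 <= Qs X i g.
Proof.
move=> ok; rewrite addr_ge0//; last by rewrite sumr_ge0// => ? _; rewrite sumr_ge0.
rewrite mulr_ge0 ?exprn_ge0 ?(ltW (tau_gt0 ok _))//.
by apply: tint_ge0 => ? _; exact: (ex_dn_ge0 ex).
Qed.

Lemma nE_ge0 X i g : 0 <= nE X i g. Proof. by rewrite sumr_ge0. Qed.

Lemma step_bound i : exists2 Kc, 0 <= Kc & step_estimate i Kc.
Proof.
have [K1 K10 hK] := unisolvent_step_stable (ex_ns ex) (ex_uni ex).
have [D1 D10 eD1] : exists2 x, 0 <= x & cA i + cG i = x.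
  by exists (cA i + cG i) => //; rewrite addr_ge0// sumr_ge0// => ? _; rewrite sumr_ge0.
have [Lq Lq0 eLq] : exists2 x, 0 <= x & lookback%:R ^+ q = x :> R.
  by exists (lookback%:R ^+ q); rewrite ?exprn_ge0.
have [c c0 ecD] : exists2 x, 0 <= x & cD = x.
  by exists cD => //; rewrite sumr_ge0// => ? _; rewrite sumr_ge0.
have [Z Z0 eZ] : exists2 x : R, 0 <= x & ns%:R = x by exists ns%:R.
have [dd dd0 edd] : exists2 x : R, 0 <= x & (d i)%:R = x by exists (d i)%:R.
pose K2 := K1 * (1 + Z * (c + 1 + Lq) + Lq + D1) + Lq.
have K20 : 0 <= K2 by rewrite /K2; do ?[apply: addr_ge0|apply: mulr_ge0].
exists (dd * (D1 + K2)); first by rewrite mulr_ge0// addr_ge0.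
move=> C X ok C0 w n v g Bd hBd.
have h := step_bound_coord ok v K10 hK hBd.
have [S S0 eS] : exists2 x, 0 <= x & Xs X i w n + Ys X i w n = x.
  by exists (Xs X i w n + Ys X i w n); rewrite // addr_ge0 ?Xs_ge0 ?Ys_ge0.
have [Q Q0 eQ] : exists2 x, 0 <= x & Qs X i g = x.
  by exists (Qs X i g); rewrite // (Qs_ge0 i g ok).
have B0 : 0 <= Bd by apply: le_trans (hBd g (leqnn _)); exact: nE_ge0.
rewrite eS eQ; move: h; rewrite -/g eS eQ eLq eD1 ecD eZ => h.
split.
  apply: (@le_trans _ _ (nE X i g.-1 + dd * (D1 * S))).
    rewrite -edd -[X in X%:R * _]card_ord mulr_natl -sumr_const -big_split/= ler_sum// => k _.
    by case: (h k).
  by rewrite lerD2l -mulrA ler_wpM2l// ler_wpM2r// lerDl.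
move=> t tin.
apply: (@le_trans _ _ (dd * (K2 * (Bd + Q + S)))).
  rewrite -edd -[X in X%:R * _]card_ord mulr_natl -sumr_const ler_sum// => k _.
  have [_ /(_ t tin) hk] := h k; apply: le_trans hk _.
  (* The difference of the two sides is displayed as a sum of products of nonnegative quantities;
     the constants were replaced by variables so that this becomes a ring identity. *)
  have e : K1 * (1 + Z * (c + 1 + Lq) + Lq + D1) * (Bd + Q + S) + Lq * (Bd + Q + S)
    = K1 * (Bd + Z * (c * Bd + Q + Lq * Q) + Lq * Q + D1 * S) + Lq * Q
    + (K1 * (Q + S + Z * (c * (Q + S) + (1 + Lq) * (Bd + S)) + Lq * (Bd + S) + D1 * (Bd + Q))
       + Lq * (Bd + S)) by ring.
  rewrite /K2 mulrDl e lerDl.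
  by do ?[apply: addr_ge0|apply: mulr_ge0].
rewrite -mulrA ler_wpM2l// ler_wpM2r ?lerDr//.
by do ?[apply: addr_ge0|apply: mulr_ge0].
Qed.

(** Window totals: [Xw] is the L^1 error of the [u_i], [Yw] that of the fluxes, and [Zw] bounds the
    best approximation of traces and fluxes by polynomials in time. *)
Definition Xw X w : R := \sum_i \sum_(1 <= n < (rM X i).+1) Xs X i w n.
Definition Yw X w : R := \sum_i inwin X w (fun t => \sum_l `|del X i w l t|).
Definition Zw X w : R := \sum_i dT X ^+ (r i).+1 * inwin X w (zn i).

Section Window.
Variables (C : R) (X : run).
Hypothesis ok : run_ok C X.
Hypothesis C0 : 0 <= C.
Variables (w : nat).
Hypothesis v : (N0 <= w <= rN X)%N.
Let w0 : (0 < w)%N. Proof. by case/andP: v => + _; exact: leq_trans (run_N0 ok). Qed.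

Lemma win_len : w%:R * dT X = w.-1%:R * dT X + dT X.
Proof. by rewrite -[in LHS](prednK w0) -natr1 mulrDl mul1r. Qed.
Lemma win_ge0 : 0 <= w.-1%:R * dT X.
Proof. by rewrite mulr_ge0// ltW// (dT_gt0 ok). Qed.
Lemma win_le : w.-1%:R * dT X <= w%:R * dT X.
Proof. by rewrite win_len lerDl ltW// (dT_gt0 ok). Qed.
Lemma win_T : w%:R * dT X <= T.
Proof.
rewrite -[leRHS](dTN ok) ler_pM2r ?(dT_gt0 ok)// ler_nat.
by case/andP: v.
Qed.
Lemma win_in t : w.-1%:R * dT X < t < w%:R * dT X -> 0 < t < T.
Proof.
case/andP=> h1 h2; rewrite (le_lt_trans win_ge0 h1)/=; exact: lt_le_trans win_T.
Qed.
Lemma tintegrable_win f : tintegrable 0 T f ->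
  tintegrable (w.-1%:R * dT X) (w%:R * dT X) f.
Proof. by apply: tintegrableS; [exact: win_ge0|exact: win_T]. Qed.
Lemma inwin_ge0 f : (forall t, 0 < t < T -> 0 <= f t) -> 0 <= inwin X w f.
Proof. by move=> f0; apply: tint_ge0 => t /win_in; exact: f0. Qed.

Lemma inwin_steps i f : tintegrable (w.-1%:R * dT X) (w%:R * dT X) f ->
  inwin X w f = \sum_(1 <= n < (rM X i).+1) instep X i w n f.
Proof.
move=> If; have e1 := tg_winl ok i w.-1; have e2 := tg_winl ok i w.
have e3 : (w * rM X i = w.-1 * rM X i + rM X i)%N.
  by rewrite -[in LHS](prednK w0) mulSn addnC.
rewrite /inwin -e1 -e2 e3 -tint_steps ?(tau_gt0 ok)//; last first.
  by move: If; rewrite -e1 -e2 e3.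
apply: eq_big_nat => n /andP[n1 _]; rewrite /instep /gid /gidx /tg.
by case: n n1 => // n _; rewrite addnS.
Qed.

Lemma Xw_ge0 : 0 <= Xw X w.
Proof. by rewrite sumr_ge0// => i _; rewrite sumr_ge0// => n _; exact: Xs_ge0. Qed.
Lemma Yw_ge0 : 0 <= Yw X w.
Proof. by rewrite sumr_ge0// => i _; apply: inwin_ge0 => t _; rewrite sumr_ge0. Qed.
Lemma Zw_ge0 : 0 <= Zw X w.
Proof.
rewrite sumr_ge0// => i _; rewrite mulr_ge0 ?exprn_ge0 ?(ltW (dT_gt0 ok))//.
by apply: inwin_ge0 => t _; exact: (ex_zn_ge0 ex).
Qed.

Lemma valid_step i n : (1 <= n < (rM X i).+1)%N -> valid X i w n.
Proof. by move=> h; rewrite /valid v. Qed.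

Lemma delw_int i l : tintegrable (w.-1%:R * dT X) (w%:R * dT X) (del X i w l).
Proof.
apply: tintegrableB; first exact: poly_tintegrable.
exact: tintegrable_win (ex_F ex _ _).
Qed.

Lemma Ys_inwin i : \sum_(1 <= n < (rM X i).+1) Ys X i w n =
  inwin X w (fun t => \sum_l `|del X i w l t|).
Proof.
rewrite (inwin_steps i)//; apply: tintegrable_sum => l.
exact: tintegrable_norm (delw_int i l).
Qed.

End Window.

Definition cP i : R := \sum_l \sum_k `|@P i l k|.

(** By (T) the tested defect of [ruG] is that of the traces of [u_i^n]; for test polynomials bounded
    by 1 it is a multiple of [Xw], and [projection_error] concludes. *)
Lemma trace_bound i : exists2 Kt, 0 <= Kt & forall C X, run_ok C X -> forall w l,
  (N0 <= w <= rN X)%N ->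
  inwin X w (fun t => `|(ruG X i w l).[t] - V i l t|) <= Kt * (Xw X w + Zw X w).
Proof.
have [K1 K10 hK] := @projection_error R (r i).
have cP0 : 0 <= cP i by rewrite sumr_ge0// => ? _; rewrite sumr_ge0.
exists (K1 * (cP i + 1)); first by rewrite mulr_ge0// addr_ge0.
move=> C X ok w l v.
have IV := tintegrable_win ok v (ex_V ex i l).
have [p sp hp] := ex_V_approx ex i l (win_ge0 ok w) (win_le ok v) (win_T ok v).
have eL := win_len ok v.
have hz : tint (w.-1%:R * dT X) (w%:R * dT X) (fun t => `|V i l t - p.[t]|) <= Zw X w.
  apply: le_trans hp _; rewrite eL [X in X ^+ _]addrC addKr -eL.
  rewrite /Zw (bigD1 i)//= lerDl sumr_ge0// => j _.
  rewrite mulr_ge0 ?exprn_ge0 ?(ltW (dT_gt0 ok))//.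
  by apply: (inwin_ge0 ok v) => t _; exact: (ex_zn_ge0 ex).
apply: (@le_trans _ _ (K1 * (cP i * Xw X w + Zw X w))); last first.
  rewrite -mulrA ler_wpM2l//.
  have := Xw_ge0 X w; have := Zw_ge0 ok v; nra.
rewrite /inwin eL; apply: (hK _ _ _ p) => //; rewrite -?eL//.
- exact: (dT_gt0 ok).
- exact: (run_uG ok).
move=> a sa a1.
have -> : tint (w.-1%:R * dT X) (w%:R * dT X) (fun t => ((ruG X i w l).[t] - V i l t) * a.[t]) =
    \sum_(1 <= n < (rM X i).+1) instep X i w n
      (fun t => (\sum_k @P i l k * @err X i w n k t) * a.[t]).
  have := run_T ok l v sa; rewrite /inwin => hT'.
  rewrite (@eq_tint _ _ _ _ (fun t => (ruG X i w l).[t] * a.[t] - V i l t * a.[t])); last first.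
    by move=> t _; rewrite mulrBl.
  rewrite tintB; [|exact: tintegrableM_poly (poly_tintegrable _ _ _)|exact: tintegrableM_poly].
  rewrite hT' -/(inwin X w (fun t => V i l t * a.[t])) (inwin_steps ok v i); last first.
    exact: tintegrableM_poly.
  rewrite -sumrB; apply: eq_big_nat => n hn; have vn := valid_step v hn.
  rewrite /instep -tintB.
  - apply: eq_tint => t /(step_in ok vn) tin; rewrite (ex_VE ex)// -mulrBl -sumrB.
    by congr (_ * _); apply: eq_bigr => k _; rewrite /err mulrBr.
  - apply: tintegrableM_poly; apply: tintegrable_sum => k; apply: tintegrableZ.
    exact: poly_tintegrable.
  - by apply: tintegrableM_poly; exact: (tintegrable_step ok vn (ex_V ex i l)).
apply: (@le_trans _ _ (\sum_(1 <= n < (rM X i).+1) cP i * Xs X i w n)); last first.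
  rewrite -mulr_sumr ler_wpM2l// /Xw (bigD1 i)//= lerDl.
  by rewrite sumr_ge0// => j _; rewrite sumr_ge0// => k _; exact: Xs_ge0.
rewrite (le_trans (ler_norm_sum _ _ _))//.
rewrite big_seq [leRHS]big_seq; apply: ler_sum => n; rewrite mem_index_iota => hn.
have vn := valid_step v hn.
have Ie : tintegrable (tg X i (gid X i w n).-1) (tg X i (gid X i w n))
    (fun t => \sum_k P l k * @err X i w n k t).
  by apply: tintegrable_sum => k; apply: tintegrableZ; exact: (err_int ok vn).
rewrite /instep.
apply: (@le_trans _ _ (tint (tg X i (gid X i w n).-1) (tg X i (gid X i w n))
   (fun t => `|\sum_k P l k * @err X i w n k t|))).
  apply: ler_tintM_le1 => // t /andP[t1 t2]; apply: a1.
  apply/andP; split.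
    apply: le_lt_trans t1; rewrite -(tg_winl ok i); apply: (tg_le ok).
    by rewrite -ltnS (prednK (gid_gt0 vn)) (gid_ge_w vn).
  by apply: (lt_le_trans t2); rewrite -(tg_winl ok i); apply: (tg_le ok); exact: (gid_le_w ok vn).
rewrite /Xs /instep -tintZ; last exact: (errs_int ok vn).
apply: le_tint.
- exact: tintegrable_norm.
- by apply: tintegrableZ; exact: (errs_int ok vn).
- by move=> t _; exact: ler_norm_lincomb.
Qed.

Definition cB : R := \sum_i \sum_j `|b i j|.

(** As in [trace_bound], now with (F): [gam] cancels between the discrete and the exact flux
    conditions, so the defect is a combination of the trace errors of both subdomains. *)
Lemma coupling_bound : exists2 Ky, 0 <= Ky & forall C X, run_ok C X -> forall w,
  (N0 <= w <= rN X)%N -> Yw X w <= Ky * (Xw X w + Zw X w).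
Proof.
have /choice[Kt hKt] : forall i, exists Kt, 0 <= Kt /\ forall C X, run_ok C X -> forall w l,
    (N0 <= w <= rN X)%N ->
    inwin X w (fun t => `|(ruG X i w l).[t] - V i l t|) <= Kt * (Xw X w + Zw X w).
  by move=> i; have [K h1 h2] := trace_bound i; exists K.
have /choice[K1 hK1] : forall i, exists K, 0 <= K /\ @projection_stable R (r i) K.
  by move=> i; have [K h1 h2] := @projection_error R (r i); exists K.
pose St := \sum_i Kt i.
have St0 : 0 <= St by rewrite sumr_ge0// => i _; case: (hKt i).
have cB0 : 0 <= cB by rewrite sumr_ge0// => ? _; rewrite sumr_ge0.
exists (\sum_i nG%:R * (K1 i * (cB * St + 1))).
  rewrite sumr_ge0// => i _; have [? _] := hK1 i.
  rewrite mulr_ge0// mulr_ge0// addr_ge0// mulr_ge0//.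
move=> C X ok w v; rewrite mulr_suml /Yw ler_sum// => i _.
rewrite /inwin tint_sum; last by move=> l; exact: tintegrable_norm (delw_int ok v i l).
apply: (@le_trans _ _ (\sum_(l < nG) K1 i * (cB * St + 1) * (Xw X w + Zw X w))); last first.
  by rewrite -!mulrA mulr_natl sumr_const card_ord.
apply: ler_sum => l _.
have [K10 hK] := hK1 i.
have IV j := tintegrable_win ok v (ex_V ex j l).
have IF := tintegrable_win ok v (ex_F ex i l).
have [p sp hp] := ex_F_approx ex i l (win_ge0 ok w) (win_le ok v) (win_T ok v).
have eL := win_len ok v.
have X0 := Xw_ge0 X w; have Z0 := Zw_ge0 ok v.
have hz : tint (w.-1%:R * dT X) (w%:R * dT X) (fun t => `|F i l t - p.[t]|) <= Zw X w.
  apply: le_trans hp _; rewrite eL [X in X ^+ _]addrC addKr -eL.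
  rewrite /Zw (bigD1 i)//= lerDl sumr_ge0// => j _.
  rewrite mulr_ge0 ?exprn_ge0 ?(ltW (dT_gt0 ok))//.
  by apply: (inwin_ge0 ok v) => t _; exact: (ex_zn_ge0 ex).
apply: (@le_trans _ _ (K1 i * (cB * (St * (Xw X w + Zw X w)) + Zw X w))); last first.
  have : 0 <= cB * St by exact: mulr_ge0.
  rewrite -mulrA ler_wpM2l//; nra.
rewrite /inwin eL; apply: (hK _ _ _ p) => //; rewrite -?eL//.
- exact: (dT_gt0 ok).
- exact: (run_FG ok).
move=> a sa a1.
have Id j : tintegrable (w.-1%:R * dT X) (w%:R * dT X)
    (fun t => (ruG X j w l).[t] - V j l t).
  by apply: tintegrableB => //; exact: poly_tintegrable.
have Igam : tintegrable (w.-1%:R * dT X) (w%:R * dT X) (gam i l).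
  apply: (@eq_tintegrable _ _ _ (fun t => \sum_j b i j * V j l t - F i l t)).
    by move=> t /(win_in ok v) tin; rewrite (ex_FE ex)// opprB addrC subrK.
  by apply: tintegrableB => //; apply: tintegrable_sum => j; exact: tintegrableZ.
have Is : tintegrable (w.-1%:R * dT X) (w%:R * dT X)
    (fun t => \sum_j b i j * ((ruG X j w l).[t] - V j l t)).
  by apply: tintegrable_sum => j; exact: tintegrableZ.
have -> : tint (w.-1%:R * dT X) (w%:R * dT X) (fun t => ((rFG X i w l).[t] - F i l t) * a.[t]) =
    tint (w.-1%:R * dT X) (w%:R * dT X)
      (fun t => (\sum_j b i j * ((ruG X j w l).[t] - V j l t)) * a.[t]).
  have := run_F ok l v sa; rewrite /inwin => hF'.
  rewrite (@eq_tint _ _ _ _ (fun t => (rFG X i w l).[t] * a.[t] - F i l t * a.[t])); last first.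
    by move=> t _; rewrite mulrBl.
  rewrite tintB; [|exact: tintegrableM_poly (poly_tintegrable _ _ _)|exact: tintegrableM_poly].
  rewrite hF' -tintB.
  - apply: eq_tint => t /(win_in ok v) tin; rewrite (ex_FE ex)// -mulrBl; congr (_ * _).
    rewrite opprB addrA subrK -sumrB; apply: eq_bigr => j _; by rewrite mulrBr.
  - apply: tintegrableM_poly; apply: tintegrableB => //; apply: tintegrable_sum => j.
    by apply: tintegrableZ; exact: poly_tintegrable.
  - exact: tintegrableM_poly.
apply: le_trans (ler_tintM_le1 Is a1) _.
apply: (@le_trans _ _ (tint (w.-1%:R * dT X) (w%:R * dT X)
   (fun t => cB * \sum_j `|(ruG X j w l).[t] - V j l t|))).
  apply: le_tint.
  - exact: tintegrable_norm.
  - by apply: tintegrableZ; apply: tintegrable_sum => j; exact: tintegrable_norm.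
  - by move=> t _; exact: ler_norm_lincomb.
rewrite tintZ; last by apply: tintegrable_sum => j; exact: tintegrable_norm.
rewrite ler_wpM2l// tint_sum; last by move=> j; exact: tintegrable_norm.
rewrite /St mulr_suml ler_sum// => j _; have [_ h] := hKt j; exact: (h _ _ ok _ l v).
Qed.


Definition KQ X w : R :=
  \sum_i \sum_(1 <= n < (rM X i).+1) tau X i * Qs X i (gid X i w n).

Lemma KQ_ge0 C X w : run_ok C X -> 0 <= KQ X w.
Proof.
move=> ok; rewrite sumr_ge0// => i _; rewrite sumr_ge0// => n _.
by rewrite mulr_ge0 ?(ltW (tau_gt0 ok i))// (Qs_ge0 i _ ok).
Qed.

Lemma step_bound_all : exists2 Kc, 0 <= Kc & forall i, step_estimate i Kc.
Proof.
have /choice[Kc hKc] : forall i, exists Kc, 0 <= Kc /\ step_estimate i Kc.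
  by move=> i; have [K h1 h2] := step_bound i; exists K.
have K0 i : 0 <= Kc i by case: (hKc i).
exists (\sum_i Kc i); first by rewrite sumr_ge0.
move=> i C X ok C0 w n v g Bd hB.
have [_ /(_ C X ok C0 w n v Bd hB)[h1 h2]] := hKc i.
have le : Kc i <= \sum_i Kc i by exact: le_bigsum.
have S0 : 0 <= Xs X i w n + Ys X i w n by rewrite addr_ge0 ?Xs_ge0 ?Ys_ge0.
split; first by apply: le_trans h1 _; rewrite lerD2l ler_wpM2r.
move=> t /h2 h; apply: le_trans h _; rewrite ler_wpM2r// addr_ge0//.
rewrite addr_ge0 ?(Qs_ge0 i _ ok)//; apply: le_trans (hB g (leqnn _)); exact: nE_ge0.
Qed.

Section WindowSteps.
Variables (Kc : R).
Hypothesis Kc0 : 0 <= Kc.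
Hypothesis hKc : forall i, step_estimate i Kc.
Variables (C : R) (X : run).
Hypothesis ok : run_ok C X.
Hypothesis C0 : 0 <= C.
Variables (w : nat) (Bd : R).
Hypothesis v : (N0 <= w <= rN X)%N.
Hypothesis hB : forall i g, (g <= w.-1 * rM X i)%N -> nE X i g <= Bd.
Let S := Xw X w + Yw X w.

Lemma Bd_ge0 : 0 <= Bd.
Proof. by apply: le_trans (@hB ord0 0%N _) => //; exact: nE_ge0. Qed.

Lemma steps_le i : \sum_(1 <= n < (rM X i).+1) (Xs X i w n + Ys X i w n) <= S.
Proof.
rewrite big_split/= (Ys_inwin ok v) lerD//.
  rewrite /Xw (bigD1 i)//= lerDl.
  by rewrite sumr_ge0// => j _; rewrite sumr_ge0// => k _; exact: Xs_ge0.
rewrite /Yw (bigD1 i)//= lerDl sumr_ge0// => j _.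
by apply: (inwin_ge0 ok v) => t _; rewrite sumr_ge0.
Qed.

Lemma XY_ge0 i n : 0 <= Xs X i w n + Ys X i w n.
Proof. by rewrite addr_ge0 ?Xs_ge0 ?Ys_ge0. Qed.

Lemma step_le i n : (1 <= n <= rM X i)%N -> Xs X i w n + Ys X i w n <= S.
Proof.
move=> hn; apply: le_trans (steps_le i).
rewrite (big_rem n)/=; last by rewrite mem_index_iota.
by rewrite lerDl sumr_ge0// => k _; exact: XY_ge0.
Qed.

(** Induction over the steps, adding up the increments of [step_estimate]; their total over the
    window is at most [S]. *)
Lemma nE_window i n : (n <= rM X i)%N ->
  forall g, (g <= gid X i w n)%N -> nE X i g <= Bd + Kc * S.
Proof.
suff h : (n <= rM X i)%N -> forall g, (g <= gid X i w n)%N ->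
    nE X i g <= Bd + Kc * \sum_(1 <= k < n.+1) (Xs X i w k + Ys X i w k).
  move=> nM g /(h nM) /le_trans; apply; rewrite lerD2l ler_wpM2l//.
  apply: le_trans (steps_le i).
  rewrite [leRHS](@big_cat_nat _ _ _ n.+1)//= lerDl.
  by rewrite sumr_ge0// => k _; exact: XY_ge0.
elim: n => [|n IH] nM g hg.
  by rewrite big_geq// mulr0 addr0; apply: hB; rewrite /gid /gidx addn0 in hg.
rewrite big_nat_recr//= mulrDr addrA.
have [hg'|hg'] := leqP g (gid X i w n).
  apply: le_trans (IH (ltnW nM) g hg') _; rewrite lerDl mulr_ge0//; exact: XY_ge0.
have eg : g = gid X i w n.+1.
  by apply/eqP; rewrite eqn_leq hg /gid /gidx addnS.
have vn : valid X i w n.+1 by rewrite /valid v.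
(* [step_estimate] wants a bound that covers the current step too. The maximum with the current
   error provides one at no cost, as the growth estimate does not involve it. *)
have hBn g' : (g' <= gid X i w n.+1)%N -> nE X i g' <= Num.max (nE X i g)
    (Bd + Kc * \sum_(1 <= k < n.+1) (Xs X i w k + Ys X i w k)).
  rewrite leq_eqVlt => /orP[/eqP ->|]; rewrite le_max; first by rewrite eg lexx.
  by rewrite /gid /gidx addnS ltnS => /(IH (ltnW nM)) ->; rewrite orbT.
have [+ _] := hKc ok C0 vn hBn.
rewrite -eg => /le_trans; apply; rewrite lerD2r; apply: IH (ltnW nM) _ _.
by rewrite eg /gid /gidx addnS.
Qed.

Lemma err_window i n t : (1 <= n <= rM X i)%N ->
  tg X i (gid X i w n).-1 <= t <= tg X i (gid X i w n) ->
  \sum_k `|@err X i w n k t| <= Kc * (Bd + Qs X i (gid X i w n) + (Kc + 1) * S).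
Proof.
move=> hn tin; have vn : valid X i w n by rewrite /valid v.
have nM : (n <= rM X i)%N by case/andP: hn.
have [_ /(_ t tin) h] := hKc ok C0 vn (@nE_window i n nM).
apply: le_trans h _; rewrite ler_wpM2l//; have := step_le hn; lra.
Qed.

(** Integrates the pointwise bound of [err_window] over the steps, whose lengths add up to [dT X] in
    each of the two subdomains. *)
Lemma Xw_bound : Xw X w <= Kc * (2 * dT X * (Bd + (Kc + 1) * S) + KQ X w).
Proof.
have e i : \sum_(1 <= n < (rM X i).+1)
    tau X i * (Kc * (Bd + Qs X i (gid X i w n) + (Kc + 1) * S)) =
    Kc * (dT X * (Bd + (Kc + 1) * S)) +
    Kc * \sum_(1 <= n < (rM X i).+1) tau X i * Qs X i (gid X i w n).
  rewrite (eq_bigr (fun n => Kc * (tau X i * (Bd + (Kc + 1) * S)) +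
     Kc * (tau X i * Qs X i (gid X i w n)))); last by move=> n _; ring.
  rewrite big_split/= sumr_const_nat subSS subn0 -(tauM ok i).
  by rewrite -[_ *+ rM X i]mulr_natl -mulr_sumr; ring.
have -> : Kc * (2 * dT X * (Bd + (Kc + 1) * S) + KQ X w) = \sum_i \sum_(1 <= n < (rM X i).+1)
    tau X i * (Kc * (Bd + Qs X i (gid X i w n) + (Kc + 1) * S)).
  rewrite (eq_bigr _ (fun i _ => e i)) big_split/= sumr_const card_ord -mulr_sumr.
  by rewrite /KQ -[_ *+ 2]mulr_natl; ring.
apply: ler_sum => i _; rewrite big_seq [leRHS]big_seq; apply: ler_sum => n.
rewrite mem_index_iota => hn; have vn : valid X i w n by rewrite /valid v.
apply: (@le_trans _ _ (tint (tg X i (gid X i w n).-1) (tg X i (gid X i w n))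
  (fun=> Kc * (Bd + Qs X i (gid X i w n) + (Kc + 1) * S)))).
  apply: le_tint; [exact: (errs_int ok vn)|exact: tintegrable_cst|].
  by move=> t /andP[t1 t2]; apply: err_window => //; rewrite !ltW.
rewrite tint_cst; last exact: ltW (step_lt ok vn).
by rewrite -[in leLHS](tg_pred X i (gid_gt0 vn)) [X in _ * X]addrC addKr mulrC.
Qed.
End WindowSteps.


(* For short windows, the terms [dT X * S] are absorbed by the left-hand side. *)
Lemma window_estimate : exists2 K, 0 <= K & exists2 dlt, 0 < dlt &
  forall C X, run_ok C X -> 0 <= C -> dT X <= dlt ->
  forall w Bd, (N0 <= w <= rN X)%N ->
  (forall i g, (g <= w.-1 * rM X i)%N -> nE X i g <= Bd) ->
  let S := Xw X w + Yw X w in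
  [/\ S <= K * (dT X * Bd + KQ X w + Zw X w),
      forall i g, (g <= w * rM X i)%N -> nE X i g <= Bd + K * S
    & forall i n t, (1 <= n <= rM X i)%N ->
        tg X i (gid X i w n).-1 <= t <= tg X i (gid X i w n) ->
        \sum_k `|@err X i w n k t| <= K * (Bd + Qs X i (gid X i w n) + S)].
Proof.
have [Kc Kc0 hKc] := step_bound_all.
have [Ky Ky0 hKy] := coupling_bound.
(* Chosen so that the feedback term of the bound below is [c * dT X * S / 2], hence at most [S / 2]
   on a short window. *)
pose c := 4 * (1 + Ky) * Kc * (Kc + 1).
have c0 : 0 <= c by rewrite /c; do ?[apply: addr_ge0|apply: mulr_ge0].
pose K := Kc + Kc * (Kc + 1) + 4 * (1 + Ky) * Kc + 2 * Ky.
have le1 : Kc <= K by rewrite /K; nra.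
have le2 : Kc * (Kc + 1) <= K by rewrite /K; nra.
have le3 : 4 * (1 + Ky) * Kc + 2 * Ky <= K by rewrite /K; nra.
have K0 : 0 <= K by exact: le_trans le1.
exists K => //; exists (c + 1)^-1; first by rewrite invr_gt0 ltr_wpDl.
move=> C X ok C0 dd w Bd v hB S.
have B0 := Bd_ge0 hB; have X0 := Xw_ge0 X w; have Y0 := Yw_ge0 ok v; have Z0 := Zw_ge0 ok v.
have S0 : 0 <= S by exact: addr_ge0.
have Q0 := KQ_ge0 w ok; have t0 := ltW (dT_gt0 ok).
have w0 : (0 < w)%N by case/andP: v => + _; exact: leq_trans (run_N0 ok).
split.
- have h1 := Xw_bound Kc0 hKc ok C0 v hB.
  have h2 := hKy C X ok w v.
  have h3 : c * dT X <= 1.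
    have : dT X * (c + 1) <= 1 by rewrite -ler_pdivlMr ?ltr_wpDl// div1r.
    lra.
  have : S <= (1 + Ky) * (Kc * (2 * dT X * (Bd + (Kc + 1) * S) + KQ X w)) + Ky * Zw X w.
    have : (1 + Ky) * Xw X w <= (1 + Ky) * (Kc * (2 * dT X * (Bd + (Kc + 1) * S) + KQ X w)).
      by rewrite ler_wpM2l// addr_ge0.
    rewrite /S in h1 *; lra.
  have -> : (1 + Ky) * (Kc * (2 * dT X * (Bd + (Kc + 1) * S) + KQ X w)) + Ky * Zw X w =
    c * dT X * S / 2 + ((1 + Ky) * Kc * (2 * (dT X * Bd) + KQ X w) + Ky * Zw X w).
    by rewrite /c; field.
  move=> h4; have h5 : c * dT X * S <= S by rewrite ler_piMl.
  have h6 : S <= 2 * ((1 + Ky) * Kc * (2 * (dT X * Bd) + KQ X w) + Ky * Zw X w) by lra.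
  apply: le_trans h6 _.
  apply: (@le_trans _ _ ((4 * (1 + Ky) * Kc + 2 * Ky) * (dT X * Bd + KQ X w + Zw X w))).
    have aux (e k x y z : R) : 0 <= e -> 0 <= k -> 0 <= x -> 0 <= y -> 0 <= z ->
        2 * (e * (2 * x + y) + k * z) <= (4 * e + 2 * k) * (x + y + z).
      move=> e0 k0 x0 y0 z0; have := mulr_ge0 e0 y0; have := mulr_ge0 e0 z0.
      have := mulr_ge0 k0 x0; have := mulr_ge0 k0 y0; lra.
    by rewrite -[4 * _ * _]mulrA; apply: aux; rewrite // mulr_ge0// addr_ge0.
  by rewrite ler_wpM2r// !addr_ge0// mulr_ge0.
- move=> i g hg; apply: le_trans (nE_window Kc0 hKc ok C0 v hB (leqnn _) _) _.
    rewrite /gid /gidx; apply: leq_trans hg _.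
    by rewrite -{1}(prednK w0) mulSn addnC.
  by rewrite lerD2l ler_wpM2r.
- move=> i n t hn tin; apply: le_trans (err_window Kc0 hKc ok C0 v hB hn tin) _.
  have q0 := Qs_ge0 i (gid X i w n) ok.
  apply: (@le_trans _ _ (Kc * (Bd + Qs X i (gid X i w n)) + Kc * (Kc + 1) * S)).
    by rewrite mulrDr mulrA.
  by rewrite [leRHS]mulrDr lerD// ler_wpM2r// addr_ge0.
Qed.

(** * Accumulation of the consistency errors *)

Lemma sum_sqr_le (I J : finType) (x : I -> J -> R) :
  (\sum_i \sum_j `|x i j|) ^+ 2 <= (#|I| * #|J|)%:R ^+ 2 * \sum_i \sum_j x i j ^+ 2.
Proof.
set s := \sum_i \sum_j x i j ^+ 2.
have s0 : 0 <= s by rewrite sumr_ge0// => i _; rewrite sumr_ge0// => j _; exact: sqr_ge0.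
have h i j : `|x i j| <= Num.sqrt s.
  rewrite -sqrtr_sqr ler_wsqrtr//.
  apply: (le_trans (@le_bigsum _ (fun j => x i j ^+ 2) j _)); first by move=> ?; exact: sqr_ge0.
  apply: (@le_bigsum _ (fun i => \sum_j x i j ^+ 2)) => i'.
  by rewrite sumr_ge0// => ? _; exact: sqr_ge0.
rewrite -[X in _ * X](sqr_sqrtr s0) -exprMn; apply: lerXn2r; rewrite ?nnegrE.
- by rewrite sumr_ge0// => i _; rewrite sumr_ge0.
- by rewrite mulr_ge0// sqrtr_ge0.
rewrite natrM -mulrA mulr_natl -sumr_const ler_sum// => i _.
by rewrite mulr_natl -sumr_const ler_sum// => j _.
Qed.

Lemma sqrD_le (x y : R) : (x + y) ^+ 2 <= 2 * x ^+ 2 + 2 * y ^+ 2.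
Proof. by have := sqr_ge0 (x - y); nra. Qed.

Definition cQ C i : R := 2 * lookback%:R + 2 * (ns * d i)%:R ^+ 2 * C.

Lemma den_ge0 i t : 0 < t < T -> 0 <= den i t.
Proof. by move=> tin; apply: le_trans (ex_dn_den ex i tin); exact: sqr_ge0. Qed.

Section Residual.
Variables (C : R) (X : run).
Hypothesis ok : run_ok C X.
Hypothesis C0 : 0 <= C.

Lemma lookback_in i g : (g <= rN X * rM X i)%N ->
  [/\ 0 <= tg X i (g - lookback), tg X i (g - lookback) <= tg X i g & tg X i g <= T].
Proof.
by move=> gN; rewrite (tg_ge0 ok) (tg_le ok) ?leq_subr// (tg_T ok).
Qed.

Lemma Jden_ge0 i g : (g <= rN X * rM X i)%N -> 0 <= Jden X i g.
Proof.
move=> gN; have [h1 h2 h3] := lookback_in gN; apply: tint_ge0 => t /andP[t1 t2].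
by apply: den_ge0; rewrite (le_lt_trans h1)//= (lt_le_trans t2).
Qed.

(** Cauchy-Schwarz over at most [lookback] steps supplies one more power of [tau] for the
    approximation part; the consistency hypothesis has the same order for the residual. *)
Lemma Qs_sqr i w n : valid X i w n -> tau X i * Qs X i (gid X i w n) ^+ 2 <=
  cQ C i * tau X i ^+ (2 * q + 2) * Jden X i (gid X i w n).
Proof.
move=> v; set g := gid X i w n; have gN := gid_le ok v; have [h1 h2 h3] := lookback_in gN.
have t0 := tau_gt0 ok i; have J0 := Jden_ge0 gN.
set D := tint (tg X i (g - lookback)) (tg X i g) (dn i).
set Rs := \sum_j \sum_k `|@resid X i g j k|.
have Idn : tintegrable (tg X i (g - lookback)) (tg X i g) (dn i).
  exact: tintegrableS (ex_dn ex i).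
have Iden : tintegrable (tg X i (g - lookback)) (tg X i g) (den i).
  exact: tintegrableS (ex_den ex i).
have inT t : tg X i (g - lookback) < t < tg X i g -> 0 < t < T.
  by case/andP=> t1 t2; rewrite (le_lt_trans h1)//= (lt_le_trans t2).
have Idn2 : tintegrable (tg X i (g - lookback)) (tg X i g) (fun t => dn i t ^+ 2).
  apply: tintegrable_le Iden _; first by apply: measurable_funX; exact: tintegrable_measurable.
  by move=> t /inT tin; rewrite ger0_norm ?sqr_ge0// (ex_dn_den ex).
have hD : D ^+ 2 <= lookback%:R * tau X i * Jden X i g.
  apply: (le_trans (tint_cauchy h2 Idn Idn2)).
  apply: (@le_trans _ _ ((tg X i g - tg X i (g - lookback)) * Jden X i g)).
    rewrite ler_wpM2l ?subr_ge0// le_tint// => t /inT; exact: (ex_dn_den ex).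
  rewrite ler_wpM2r// lerBlDr /tg -mulrDl ler_pM2r// -natrD ler_nat.
  by rewrite -leq_subLR.
have hR : tau X i * Rs ^+ 2 <= (ns * d i)%:R ^+ 2 * (C * tau X i ^+ (2 * q + 2) * Jden X i g).
  have := @sum_sqr_le _ _ (@resid X i g); rewrite !card_ord => h.
  apply: (@le_trans _ _ ((ns * d i)%:R ^+ 2 * (tau X i * \sum_j \sum_k @resid X i g j k ^+ 2))).
    by rewrite [leRHS]mulrCA ler_wpM2l// ltW.
  rewrite ler_wpM2l ?sqr_ge0//; apply: (le_trans (run_cons ok v)).
  rewrite ler_wpM2l ?mulr_ge0 ?exprn_ge0 ?(ltW t0)//.
  apply: tint_le_sub => //; last by move=> t /inT; exact: den_ge0.
  by apply: (tg_le ok); rewrite leq_sub2l// /lookback addnAC leq_addl.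
have -> : Qs X i g = tau X i ^+ q * D + Rs by [].
have /(ler_wpM2l (ltW t0)) h := sqrD_le (tau X i ^+ q * D) Rs; apply: le_trans h _.
have e : tau X i ^+ (2 * q + 2) = tau X i ^+ q * tau X i ^+ q * tau X i * tau X i.
  by rewrite mulSn mul1n -!exprD -!exprSr; congr (_ ^+ _); rewrite addnS addn1.
have hD' : tau X i * (tau X i ^+ q * D) ^+ 2 <=
    lookback%:R * tau X i ^+ (2 * q + 2) * Jden X i g.
  have -> : tau X i * (tau X i ^+ q * D) ^+ 2 = (tau X i * (tau X i ^+ q * tau X i ^+ q)) * D ^+ 2.
    by ring.
  have -> : lookback%:R * tau X i ^+ (2 * q + 2) * Jden X i g =
    (tau X i * (tau X i ^+ q * tau X i ^+ q)) * (lookback%:R * tau X i * Jden X i g).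
    by rewrite e; ring.
  rewrite ler_wpM2l// mulr_ge0 ?(ltW t0)//.
  by rewrite mulr_ge0// exprn_ge0// ltW.
rewrite /cQ; lra.
Qed.

(** With [y] the quotient of [Qs] by [tau ^+ q], [Qs_sqr] reads [y ^+ 2 <= tau * (cQ * Jden)], and
    the arithmetic-geometric inequality gives [y <= tau + cQ * Jden]. Both terms are summable over
    all steps. *)
Lemma Qs_le i w n : valid X i w n -> tau X i * Qs X i (gid X i w n) <=
  tau X i ^+ q.+1 * (tau X i + cQ C i * Jden X i (gid X i w n)).
Proof.
move=> v; set g := gid X i w n; have h := Qs_sqr v; rewrite -/g in h.
have t0 := tau_gt0 ok i; have tq : 0 < tau X i ^+ q by rewrite exprn_gt0.
pose y := Qs X i g / tau X i ^+ q.
have eQ : Qs X i g = tau X i ^+ q * y by rewrite /y mulrC divfK// gt_eqF.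
have hy : y ^+ 2 <= tau X i * (cQ C i * Jden X i g).
  have k0 : 0 < tau X i * (tau X i ^+ q * tau X i ^+ q) by rewrite mulr_gt0// mulr_gt0.
  rewrite -(ler_pM2l k0); move: h; rewrite eQ mulSn mul1n exprD exprD => h.
  have -> : tau X i * (tau X i ^+ q * tau X i ^+ q) * y ^+ 2 =
    tau X i * (tau X i ^+ q * y) ^+ 2 by ring.
  by apply: le_trans h _; rewrite le_eqVlt; apply/orP; left; apply/eqP; ring.
rewrite eQ exprSr -mulrA [leLHS]mulrCA ler_pM2l// ler_pM2l//.
have c0 : 0 <= cQ C i * Jden X i g.
  have := sqr_ge0 y => /le_trans/(_ hy); rewrite pmulr_rge0//.
have hh : tau X i * y <= tau X i * (tau X i + cQ C i * Jden X i g).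
  have := sqr_ge0 (tau X i - y); nra.
by rewrite -(ler_pM2l t0).
Qed.
End Residual.

Definition rho X : R := \sum_i (tau X i ^+ q.+1 + dT X ^+ (r i).+1).

Section Totals.
Variables (C : R) (X : run).
Hypothesis ok : run_ok C X.
Hypothesis C0 : 0 <= C.

Lemma cQ_ge0 i : 0 <= cQ C i.
Proof. by rewrite addr_ge0// mulr_ge0// mulr_ge0// sqr_ge0. Qed.

Lemma sum_windows (f : nat -> R) : (forall w, (1 <= w <= rN X)%N -> 0 <= f w) ->
  \sum_(N0 <= w < (rN X).+1) f w <= \sum_(1 <= w < (rN X).+1) f w.
Proof.
move=> f0; have [NN|NN] := leqP N0 (rN X).
  rewrite [leRHS](@big_cat_nat _ _ _ N0)//=; [|exact: run_N0 ok|exact: ltnW].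
  rewrite lerDr big_seq sumr_ge0// => w; rewrite mem_index_iota => /andP[w1 wN].
  by rewrite f0// w1/= (leq_trans (ltnW wN)).
rewrite big_geq// big_seq sumr_ge0// => w; rewrite mem_index_iota; exact: f0.
Qed.

Lemma gidx_le i w n : (1 <= w <= rN X)%N -> (1 <= n < (rM X i).+1)%N ->
  (gid X i w n <= rN X * rM X i)%N.
Proof.
move=> /andP[w1 wN] /andP[_ nM]; rewrite /gid /gidx.
apply: (@leq_trans (w * rM X i)); last by rewrite leq_mul2r wN orbT.
by rewrite -[in leqRHS](prednK w1) mulSn addnC leq_add2r.
Qed.

(** The look-back intervals overlap at most [lookback] times, whatever the step size. *)
Lemma Jden_total i : \sum_(N0 <= w < (rN X).+1) \sum_(1 <= n < (rM X i).+1)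
  Jden X i (gid X i w n) <= lookback%:R * tint 0 T (den i).
Proof.
apply: le_trans (sum_windows _) _.
  move=> w hw; rewrite big_seq sumr_ge0// => n; rewrite mem_index_iota => hn.
  by apply: (Jden_ge0 ok); exact: gidx_le.
rewrite (sum_gidx (rM X) i (rN X) (fun g => Jden X i g)).
apply: tint_windows; [exact: tau_gt0 ok i|by rewrite -/(tg X i _) (tg_T ok)|
  exact: ex_den ex i|exact: den_ge0].
Qed.

Lemma steps_total i : \sum_(N0 <= w < (rN X).+1) \sum_(1 <= n < (rM X i).+1) tau X i <= T.
Proof.
apply: le_trans (sum_windows _) _.
  by move=> w hw; rewrite sumr_ge0// => n _; rewrite ltW ?(tau_gt0 ok).
by rewrite !sumr_const_nat !subSS !subn0 -[tau X i *+ _]mulr_natl (tauM ok)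
  -[dT X *+ _]mulr_natl (dTN ok).
Qed.

Lemma KQ_total : \sum_(N0 <= w < (rN X).+1) KQ X w <=
  \sum_i tau X i ^+ q.+1 * (T + cQ C i * (lookback%:R * tint 0 T (den i))).
Proof.
rewrite /KQ exchange_big/=; apply: ler_sum => i _.
have tq : 0 <= tau X i ^+ q.+1 by rewrite exprn_ge0// ltW// (tau_gt0 ok).
apply: (@le_trans _ _ (\sum_(N0 <= w < (rN X).+1) \sum_(1 <= n < (rM X i).+1)
   tau X i ^+ q.+1 * (tau X i + cQ C i * Jden X i (gid X i w n)))).
  rewrite big_seq [leRHS]big_seq; apply: ler_sum => w; rewrite mem_index_iota => hw.
  rewrite big_seq [leRHS]big_seq; apply: ler_sum => n; rewrite mem_index_iota => hn.
  by apply: (Qs_le ok C0); apply/andP; split.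
under eq_bigr => w _ do rewrite -mulr_sumr.
rewrite -mulr_sumr ler_wpM2l//.
rewrite (eq_bigr (fun w => \sum_(1 <= n < (rM X i).+1) tau X i +
   cQ C i * \sum_(1 <= n < (rM X i).+1) Jden X i (gid X i w n))); last first.
  by move=> w _; rewrite big_split/= [in RHS]mulr_sumr.
rewrite big_split/= lerD ?steps_total// -mulr_sumr ler_wpM2l ?cQ_ge0//.
exact: Jden_total.
Qed.

Lemma Zw_total : \sum_(N0 <= w < (rN X).+1) Zw X w <=
  \sum_i dT X ^+ (r i).+1 * tint 0 T (zn i).
Proof.
rewrite /Zw exchange_big/=; apply: ler_sum => i _; rewrite -mulr_sumr.
have t0 := dT_gt0 ok.
rewrite ler_wpM2l ?exprn_ge0 ?(ltW t0)//.
apply: le_trans (sum_windows _) _.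
  move=> w _; apply: tint_ge0 => t _; exact: (ex_zn_ge0 ex).
have := @tint_steps R (dT X) (zn i) 0 (rN X) t0.
rewrite mul0r add0n (dTN ok) => /(_ (ex_zn ex i)) <-.
by rewrite le_eqVlt; apply/orP; left; apply/eqP; apply: eq_bigr => w _; rewrite !add0n.
Qed.
End Totals.

(** Discrete Gronwall over windows for the side errors. The window error follows by squaring the
    pointwise bound of [window_estimate] and integrating it. *)
Theorem coordinate_estimate (C : R) : 0 <= C -> exists2 K, 0 <= K & exists2 dlt, 0 < dlt &
  forall X, run_ok C X -> 0 <= reps X -> dT X <= dlt ->
  forall w, (N0 <= w <= rN X)%N ->
  (forall i n, (1 <= n <= rM X i)%N -> nE X i (gid X i w n) <= K * (reps X + rho X)) /\
  \sum_i \sum_(1 <= n < (rM X i).+1)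
    instep X i w n (fun t => (\sum_k `|@err X i w n k t|) ^+ 2) <= K * (reps X + rho X) ^+ 2.
Proof.
move=> C0; have [K K0 [dlt d0 hK]] := window_estimate.
pose D i := T + cQ C i * (lookback%:R * tint 0 T (den i)) + tint 0 T (zn i).
have den0 i : 0 <= tint 0 T (den i) by apply: tint_ge0 => t; exact: den_ge0.
have zn0 i : 0 <= tint 0 T (zn i) by apply: tint_ge0 => t _; exact: (ex_zn_ge0 ex).
have cJ0 i : 0 <= cQ C i * (lookback%:R * tint 0 T (den i)).
  by rewrite mulr_ge0 ?mulr_ge0// cQ_ge0.
have D0 i : 0 <= D i by rewrite addr_ge0// addr_ge0// ltW.
pose SD := \sum_i D i.
have SD0 : 0 <= SD by rewrite sumr_ge0.
(* The exponential bounds the product of the factors [1 + K ^+ 2 * dT X] over at most [T / dT X]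
   windows; [SD] bounds the accumulated data relative to the rate. *)
pose G1 := expR (K ^+ 2 * T) * (1 + K ^+ 2 * SD).
have G10 : 0 <= G1 by rewrite mulr_ge0 ?expR_ge0// addr_ge0// mulr_ge0// sqr_ge0.
pose K2 := 4 * T * (K * G1 + G1) ^+ 2 + 2 * K ^+ 2 * SD + G1.
have TD0 : 0 <= 4 * T * (K * G1 + G1) ^+ 2.
  by rewrite mulr_ge0 ?sqr_ge0// mulr_ge0// ltW.
have KD0 : 0 <= 2 * K ^+ 2 * SD by rewrite mulr_ge0// mulr_ge0// sqr_ge0.
exists K2; first by rewrite !addr_ge0.
exists dlt => // X ok e0 dd.
have t0 := ltW (dT_gt0 ok).
have rho0 : 0 <= rho X.
  by rewrite sumr_ge0// => i _; rewrite addr_ge0// exprn_ge0// ltW// (tau_gt0 ok).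
pose S w := Xw X w + Yw X w.
(* [B] accumulates the unknown window errors, [B'] only data; the invariant below bounds the former
   by the latter. *)
pose B w := reps X + K * \sum_(N0 <= v < w.+1) S v.
pose B' w := reps X + K ^+ 2 * \sum_(N0 <= v < w.+1) (KQ X v + Zw X v).
have N01 := run_N0 ok.
have S0 w : (N0 <= w <= rN X)%N -> 0 <= S w.
  by move=> hw; rewrite addr_ge0 ?Xw_ge0 ?(Yw_ge0 ok hw).
have KZ0 w : (N0 <= w <= rN X)%N -> 0 <= KQ X w + Zw X w.
  by move=> hw; rewrite addr_ge0 ?(KQ_ge0 w ok) ?(Zw_ge0 ok hw).
have B0 : B N0.-1 = reps X by rewrite /B (prednK N01) big_geq// mulr0 addr0.
have B'0 : B' N0.-1 = reps X by rewrite /B' (prednK N01) big_geq// mulr0 addr0.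
have BS w : (N0 <= w)%N -> B w = B w.-1 + K * S w.
  move=> hw; rewrite /B prednK ?(leq_trans N01)// big_nat_recr//= mulrDr addrA//.
have B'S w : (N0 <= w)%N -> B' w = B' w.-1 + K ^+ 2 * (KQ X w + Zw X w).
  move=> hw; rewrite /B' prednK ?(leq_trans N01)// big_nat_recr//= mulrDr addrA//.
have inv k : (N0.-1 + k <= rN X)%N ->
    [/\ forall i g, (g <= (N0.-1 + k) * rM X i)%N -> nE X i g <= B (N0.-1 + k)%N,
        0 <= B' (N0.-1 + k)%N
      & B (N0.-1 + k)%N <= expR (K ^+ 2 * dT X * k%:R) * B' (N0.-1 + k)%N].
  elim: k => [|k IH] hk.
    rewrite !addn0 B0 B'0 mulr0 expR0 mul1r; split => //.
    exact: (run_init ok).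
  rewrite addnS in hk *; have [h1 h2 h3] := IH (ltnW hk).
  set w := (N0.-1 + k).+1.
  have hw : (N0 <= w <= rN X)%N.
    by rewrite hk andbT /w -[leqLHS](prednK N01) ltnS leq_addr.
  have Nw : (N0 <= w)%N by case/andP: hw.
  have [e1 e2 _] := hK C X ok C0 dd w (B w.-1) hw h1.
  have := KZ0 w hw; set kz := KQ X w + Zw X w => kz0.
  split.
  - by move=> i g hg; rewrite (BS w Nw); exact: e2.
  - by rewrite (B'S w Nw) addr_ge0// mulr_ge0// sqr_ge0.
  have -> : K ^+ 2 * dT X * k.+1%:R = K ^+ 2 * dT X * k%:R + K ^+ 2 * dT X.
    by rewrite -natr1 mulrDr mulr1.
  rewrite (BS w Nw) (B'S w Nw) expRD.
  (* [S w] is replaced by its bound in terms of [B w.-1] and data, which produces the growth factor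
     of one window. *)
  have a1 : B w.-1 + K * S w <= (1 + K ^+ 2 * dT X) * B w.-1 + K ^+ 2 * kz.
    have := ler_wpM2l K0 e1; rewrite /S /kz; nra.
  apply: le_trans a1 _; rewrite [leRHS]mulrDr; apply: lerD.
    rewrite [expR _ * expR _]mulrC -[leRHS]mulrA; apply: ler_pM.
    - by rewrite addr_ge0// mulr_ge0// sqr_ge0.
    - by apply: le_trans (h1 ord0 0%N _) => //; exact: nE_ge0.
    - exact: expR_ge1Dx.
    - exact: h3.
  rewrite ler_peMl//; first by rewrite mulr_ge0// sqr_ge0.
  by rewrite -expRD -expR0 ler_expR addr_ge0// mulr_ge0// mulr_ge0// sqr_ge0.
(* The data of all windows together are of the order of the rate, as [KQ_total] and [Zw_total]
   show. *)
have tot : \sum_(N0 <= v < (rN X).+1) (KQ X v + Zw X v) <= SD * rho X.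
  rewrite big_split/=; apply: (le_trans (lerD (KQ_total ok C0) (Zw_total ok))).
  rewrite -big_split/= /rho mulr_sumr; apply: ler_sum => i _.
  have tq : 0 <= tau X i ^+ q.+1 by rewrite exprn_ge0// ltW// (tau_gt0 ok).
  have dr : 0 <= dT X ^+ (r i).+1 by rewrite exprn_ge0.
  have DS : D i <= SD by exact: le_bigsum.
  rewrite [leRHS]mulrDr ![SD * _]mulrC lerD// ler_wpM2l//; apply: le_trans DS; rewrite /D.
    by rewrite lerDl.
  by rewrite lerDr addr_ge0// ltW.
have B'_le w : (N0 <= w <= rN X)%N -> B' w <= (1 + K ^+ 2 * SD) * (reps X + rho X).
  move=> /andP[Nw wN]; have KK := sqr_ge0 K.
  apply: (@le_trans _ _ (reps X + K ^+ 2 * (SD * rho X))); last first.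
    by have := mulr_ge0 (mulr_ge0 KK SD0) e0; nra.
  rewrite lerD2l ler_wpM2l//; apply: le_trans tot.
  rewrite [leRHS](@big_cat_nat _ _ _ w.+1)//=; last exact: leq_trans Nw _.
  rewrite lerDl big_seq sumr_ge0// => v; rewrite mem_index_iota => /andP[v1 v2].
  by apply: KZ0; apply/andP; split; [exact: leq_trans Nw (ltnW v1)|].
have B_le w : (N0 <= w <= rN X)%N -> 
    (forall i g, (g <= w * rM X i)%N -> nE X i g <= B w) /\ B w <= G1 * (reps X + rho X).
  move=> hw; have /andP[Nw wN] := hw.
  have ew : (N0.-1 + (w - N0.-1))%N = w by rewrite subnKC// (leq_trans (leq_pred _)).
  have := inv (w - N0.-1)%N; rewrite ew => /(_ wN)[h1 h2 h3]; split=> //.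
  apply: (le_trans h3); rewrite /G1 -[leRHS]mulrA; apply: ler_pM; rewrite ?expR_ge0 ?B'_le//.
  rewrite ler_expR -mulrA ler_wpM2l ?sqr_ge0// -(dTN ok) mulrC ler_wpM2r//.
  by rewrite ler_nat (leq_trans (leq_subr _ _)).
move=> w hw; have /andP[Nw wN] := hw.
have [h1 h2] := B_le w hw.
set Rt := reps X + rho X in h2 *; have Rt0 : 0 <= Rt by exact: addr_ge0.
split.
  move=> i n hn; have v : valid X i w n by rewrite /valid hw.
  apply: le_trans (h1 i _ (gid_le_w ok v)) _; apply: (le_trans h2).
  by rewrite ler_wpM2r// /K2 lerDr addr_ge0.
have hB : forall i g, (g <= w.-1 * rM X i)%N -> nE X i g <= B w.-1.
  have ew : (N0.-1 + (w.-1 - N0.-1))%N = w.-1 by rewrite subnKC// -!subn1 leq_sub2r.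
  have := inv (w.-1 - N0.-1)%N; rewrite ew => -[]//.
  exact: leq_trans (leq_pred _) wN.
have [_ _ h3] := hK C X ok C0 dd w (B w.-1) hw hB.
have Bw0 : 0 <= B w.-1 by apply: le_trans (hB ord0 0%N _) => //; exact: nE_ge0.
have hS : K * S w <= G1 * Rt by apply: le_trans h2; rewrite (BS w Nw) lerDr.
have hBw : B w.-1 <= G1 * Rt by apply: le_trans h2; rewrite (BS w Nw) lerDl mulr_ge0// S0.
have pt i n t : (1 <= n <= rM X i)%N -> tg X i (gid X i w n).-1 <= t <= tg X i (gid X i w n) ->
    (\sum_k `|@err X i w n k t|) ^+ 2 <= 2 * ((K * G1 + G1) * Rt) ^+ 2
      + 2 * (K * Qs X i (gid X i w n)) ^+ 2.
  move=> hn tin; have h := h3 i n t hn tin.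
  have q0 := Qs_ge0 i (gid X i w n) ok.
  apply: le_trans (sqrD_le _ _); rewrite lerXn2r ?nnegrE ?sumr_ge0//.
    by rewrite addr_ge0 ?mulr_ge0// addr_ge0// mulr_ge0.
  apply: (le_trans h); have := ler_wpM2l K0 hBw; rewrite -/(S w); lra.
have step i n : (1 <= n <= rM X i)%N ->
    instep X i w n (fun t => (\sum_k `|@err X i w n k t|) ^+ 2) <=
    tau X i * (2 * ((K * G1 + G1) * Rt) ^+ 2)
    + 2 * K ^+ 2 * (cQ C i * tau X i ^+ (2 * q + 2) * Jden X i (gid X i w n)).
  move=> hn; have v : valid X i w n by rewrite /valid hw.
  have Ie := errs_int ok v.
  set c := 2 * ((K * G1 + G1) * Rt) ^+ 2 + 2 * (K * Qs X i (gid X i w n)) ^+ 2.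
  have lt := step_lt ok v.
  apply: (@le_trans _ _ (tint (tg X i (gid X i w n).-1) (tg X i (gid X i w n)) (fun=> c))).
    have hc t : tg X i (gid X i w n).-1 < t < tg X i (gid X i w n) ->
        (\sum_k `|@err X i w n k t|) ^+ 2 <= c.
      by case/andP=> t1 t2; apply: pt => //; rewrite !ltW.
    apply: le_tint => //; last exact: tintegrable_cst.
    apply: tintegrable_le (tintegrable_cst _ _ c) _.
      by apply: measurable_funX; exact: tintegrable_measurable.
    by move=> t /hc; rewrite ger0_norm// sqr_ge0.
  rewrite tint_cst ?(ltW lt)// -[X in _ * (X - _)](tg_pred X i (gid_gt0 v)).
  rewrite [X in _ * X]addrC addKr [leLHS]mulrC /c mulrDr lerD2l.
  have := ler_wpM2l (sqr_ge0 K) (Qs_sqr ok C0 v).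
  by rewrite exprMn; lra.
(* The terms of one window are bounded by the sum over all windows. *)
have J1 i : \sum_(1 <= n < (rM X i).+1) Jden X i (gid X i w n) <=
    lookback%:R * tint 0 T (den i).
  apply: le_trans (Jden_total ok i); rewrite [leRHS](big_rem w)/=; last first.
    by rewrite mem_index_iota; exact: hw.
  rewrite lerDl big_seq sumr_ge0// => v /mem_rem; rewrite mem_index_iota => /andP[v1 v2].
  rewrite big_seq sumr_ge0// => n; rewrite mem_index_iota => hn.
  by apply: (Jden_ge0 ok); apply: gidx_le => //; apply/andP; split; first exact: leq_trans v1.
apply: (@le_trans _ _ (\sum_i (dT X * (2 * ((K * G1 + G1) * Rt) ^+ 2)
    + 2 * K ^+ 2 * (D i * Rt ^+ 2)))).
  apply: ler_sum => i _.
  apply: (@le_trans _ _ (\sum_(1 <= n < (rM X i).+1) (tau X i * (2 * ((K * G1 + G1) * Rt) ^+ 2)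
    + 2 * K ^+ 2 * (cQ C i * tau X i ^+ (2 * q + 2) * Jden X i (gid X i w n))))).
    rewrite big_seq [leRHS]big_seq; apply: ler_sum => n; rewrite mem_index_iota; exact: step.
  rewrite big_split/= sumr_const_nat subSS subn0 -[_ *+ rM X i]mulr_natl mulrA (tauM ok).
  rewrite lerD2l -!mulr_sumr ler_wpM2l//; first by rewrite mulr_ge0// sqr_ge0.
  have tq : 0 <= tau X i ^+ q.+1 by rewrite exprn_ge0// ltW// (tau_gt0 ok).
  (* The power [2 * q + 2] is the square of this one, so the consistency part is of the order of
     [Rt ^+ 2]. *)
  have tR : tau X i ^+ q.+1 <= Rt.
    apply: (@le_trans _ _ (rho X)); last by rewrite lerDr.
    apply: (@le_trans _ _ (tau X i ^+ q.+1 + dT X ^+ (r i).+1)).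
      by rewrite lerDl exprn_ge0.
    rewrite /rho (bigD1 i)//= lerDl sumr_ge0// => j _.
    by rewrite addr_ge0// exprn_ge0// ltW// (tau_gt0 ok).
  have -> : tau X i ^+ (2 * q + 2) = (tau X i ^+ q.+1) ^+ 2.
    by rewrite -exprM [(q.+1 * 2)%N]mulnC mulnS addnC.
  rewrite mulrAC; apply: ler_pM.
  - by rewrite mulr_ge0 ?cQ_ge0// big_seq sumr_ge0// => n; rewrite mem_index_iota => hn;
      apply: (Jden_ge0 ok); apply: gidx_le => //; rewrite wN (leq_trans N01).
  - exact: sqr_ge0.
  - apply: (@le_trans _ _ (cQ C i * (lookback%:R * tint 0 T (den i)))).
      by rewrite ler_wpM2l ?cQ_ge0.
    by rewrite /D -addrA addrCA lerDl addr_ge0// ltW.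
  - by rewrite lerXn2r.
rewrite big_split/= sumr_const card_ord -mulr_sumr -mulr_suml -/SD.
have dTT := dT_le_T ok.
have e1 : dT X * (2 * ((K * G1 + G1) * Rt) ^+ 2) *+ 2 <= 4 * T * (K * G1 + G1) ^+ 2 * Rt ^+ 2.
  have := ler_wpM2r (sqr_ge0 ((K * G1 + G1) * Rt)) dTT; rewrite exprMn -mulr_natl; lra.
have : 0 <= G1 * Rt ^+ 2 by rewrite mulr_ge0// sqr_ge0.
rewrite /K2; lra.
Qed.
End Coordinates.

(** * From the method to the error equations *)

Section TimeRegularity.
Context {R : realType}.
Implicit Types f g : R -> R.

(** [g 0] may lack continuity, so the pointwise approximation is made for its continuous
    representative and only the integral is claimed. One integration more turns the exponent [k]
    into [k.+1]. *)
Lemma tintegrable_poly_approx T k (g : nat -> R -> R) : 0 < T ->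
  (forall j, (j <= k)%N -> weak_deriv 0 T (g j) (g j.+1)) ->
  forall s t, 0 <= s -> s <= t -> t <= T ->
  exists2 p : {poly R}, (size p <= k.+1)%N &
    tint s t (fun x => `|g 0%N x - p.[x]|) <=
    (t - s) ^+ k.+1 * tint s t (fun x => `|g k.+1 x|).
Proof.
move=> T0 hg s t s0 st tT.
have [c hc] := weak_deriv_ae T0 (hg 0%N (leq0n _)).
have Ig j : (j <= k.+1)%N -> tintegrable 0 T (g j).
  by case: j => [_|j jk]; [have [] := hg 0%N (leq0n _)|have [] := hg j jk].
have [|p sp hp] := @iterated_approx R T s t k (fun j => g j.+1) c T0 (Ig 1%N isT) _ s0 st tT.
  by move=> j jk; exact: hg.
exists p => //.
have sub j : (j <= k.+1)%N -> tintegrable s t (g j).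
  by move=> /Ig; exact: tintegrableS.
have Ip : tintegrable s t (horner p) by exact: poly_tintegrable.
have If : tintegrable s t (fun x => g 0%N x - p.[x]) by apply: tintegrableB => //; exact: sub.
set K := (t - s) ^+ k * tint s t (fun x => `|g k.+1 x|) in hp *.
have K0 : 0 <= K.
  by rewrite mulr_ge0 ?exprn_ge0 ?subr_ge0//; apply: tint_ge0.
have cF : tintegrable s t (fun x => c + tint 0 x (g 1%N)).
  apply: (@tintegrableS _ 0 T) => //; apply: tintegrableD; first exact: tintegrable_cst.
  by apply: within_continuous_tintegrable; apply: tint_continuous; [exact: ltW|exact: Ig].
have -> : tint s t (fun x => `|g 0%N x - p.[x]|) =
    tint s t (fun x => `|c + tint 0 x (g 1%N) - p.[x]|).
  apply: tint_ae.
  - by apply: measurableT_comp => //; exact: tintegrable_measurable.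
  - by apply: measurableT_comp => //; apply: tintegrable_measurable; exact: tintegrableB.
  - apply: (ae_impl hc) => x hx /andP[sx xt]; rewrite hx// (le_lt_trans s0)//=.
    exact: lt_le_trans tT.
apply: (@le_trans _ _ (tint s t (fun=> K))).
  apply: le_tint.
  - by apply: tintegrable_norm; exact: tintegrableB.
  - exact: tintegrable_cst.
  - by move=> x /andP[sx xt]; apply: hp; rewrite !ltW.
by rewrite tint_cst// /K exprSr -!mulrA [X in _ * X]mulrC.
Qed.

(* An almost everywhere equality is only usable under [tint] between measurable
   functions; this makes the pointwise derivatives of [sd_ode] measurable. *)
Lemma deriv_within_measurable T f du : 0 < T -> {within `[0, T], continuous f} ->
  (forall t, 0 < t < T -> deriv_within `[0, T] f t (du t)) ->
  measurable_fun `]0, T[ du.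
Proof.
move=> T0 cf hdu.
(* Projection of the line onto [[0, T]]: it makes [f \o cl] continuous everywhere, so that forward
   difference quotients are measurable. *)
pose cl (x : R) : R := ppart x - ppart (x - T).
have ccl : continuous cl.
  move=> x; apply: cvgB; first exact: ppart_cont.
  apply: (@continuous_comp _ _ _ (fun x => x - T) (@ppart R)); last exact: ppart_cont.
  by apply: (@continuousB _ _ _ id (cst T)); [exact: cvg_id|exact: cst_continuous].
have clE x : 0 <= x <= T -> cl x = x.
  by case/andP=> x0 xT; rewrite /cl /ppart (max_l x0) max_r ?subr0// subr_le0.
have clin x : 0 <= cl x <= T.
  rewrite /cl /ppart; have [x0|x0] := leP x 0.
    by rewrite max_r ?subr0 ?lexx ?(ltW T0)//; lra.
  by have [xT|xT] := leP (x - T) 0; apply/andP; split; lra.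
have cfc : continuous (f \o cl).
  move=> x; have FF := nbhs_filter x.
  move/subspace_continuousP : cf => /(_ (cl x)) h.
  have {}h := h (clin x).
  apply: (@cvg_comp _ _ _ cl f _ (within `[0, T] (nbhs (cl x)))) => //.
  move=> A hA; have hB : nbhs x [set z | `[0, T]%classic (cl z) -> A (cl z)] by exact: (ccl x _ hA).
  suff : nbhs x [set z | A (cl z)] by [].
  by apply: filterS hB => z hz; apply: hz; rewrite /= in_itv/=; exact: clin.
have cs n : continuous (fun t : R => f (cl (t + n.+1%:R^-1))).
  move=> x; apply: (@continuous_comp _ _ _ (fun t : R => t + n.+1%:R^-1) (f \o cl)); last exact: cfc.
  by apply: cvgD; [exact: cvg_id|exact: cst_continuous].
apply: (@measurable_fun_cvg _ (measurableTypeR R) R _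
  (fun n t => n.+1%:R * (f (cl (t + n.+1%:R^-1)) - f (cl t)))) => //.
  move=> n; apply: measurable_funM => //; apply: measurable_funB; apply: measurable_funTS.
    by apply: continuous_measurable_fun; exact: cs.
  exact: continuous_measurable_fun.
move=> t /=; rewrite in_itv/= => tin; have := hdu t tin; rewrite /deriv_within => hd.
have /andP[t0 tT] := tin.
have lim0 : (t + m.+1%:R^-1 : R) @[m --> \oo] --> within `[0, T] t^'.
  move=> A hA; have Tt : 0 < T - t by rewrite subr_gt0.
  have h1 : nbhs t [set y | y != t -> `[0, T]%classic y -> A y] by exact: hA.
  have /nbhs_ballP[e /= e0 he] := h1.
  have m0 : 0 < Num.min e (T - t) by rewrite lt_min e0.
  have h2 := harmonic_lt m0.
  apply: filterS h2 => m; rewrite lt_min => /andP[me mT] /=.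
  have p0 : 0 < m.+1%:R^-1 :> R by rewrite invr_gt0.
  apply: (he (t + m.+1%:R^-1)).
  - by rewrite /ball /= opprD addNKr normrN gtr0_norm.
  - by rewrite gt_eqF// ltrDl.
  - by rewrite /= in_itv/= addr_ge0 ?(ltW t0) ?(ltW p0)//= -lerBrDl ltW.
have := cvg_comp _ _ lim0 hd; apply: cvg_trans.
apply: near_eq_cvg; have Tt : 0 < T - t by rewrite subr_gt0.
apply: filterS (harmonic_lt Tt) => m mT /=.
have p0 : 0 < m.+1%:R^-1 :> R by rewrite invr_gt0.
rewrite !clE ?(ltW t0) ?(ltW tT)//; last first.
  by rewrite addr_ge0 ?(ltW t0) ?(ltW p0)//= -lerBrDl ltW.
by rewrite mulrC; congr (_ * _); rewrite addrC addKr invrK.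
Qed.
End TimeRegularity.

Definition form_lin (T : Type) (R : fieldType) (W : set (T -> R)) (L : (T -> R) -> R) : Prop :=
  forall (a b : R) v w, W v -> W w -> L (fun x => a * v x + b * w x) = a * L v + b * L w.

Lemma coords_form (R : realType) n (D : set 'rV[R]_n) W d pt phi dual C
    (cs : @is_coords R n D W d pt phi dual C) L v :
  lin_closed W -> form_lin W L -> W v -> L v = \sum_k v (pt k) * L (phi k).
Proof.
move=> hW hL Wv.
suff h (r : seq 'I_d) : W (fun x => \sum_(k <- r) v (pt k) * phi k x) /\
    L (fun x => \sum_(k <- r) v (pt k) * phi k x) = \sum_(k <- r) v (pt k) * L (phi k).
  have [_ <-] := h (index_enum _); congr L; exact: (coordsE cs Wv).
elim: r => [|k r [IH1 IH2]].
  have e0 : (fun x => \sum_(k <- [::]) v (pt k) * phi k x) = (fun x => 0 * v x + 0 * v x).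
    by apply/funext => x; rewrite big_nil !mul0r addr0.
  by rewrite e0 big_nil hL// !mul0r addr0; split => //; exact: hW.
have e0 : (fun x => \sum_(j <- k :: r) v (pt j) * phi j x) =
    (fun x => v (pt k) * phi k x + 1 * \sum_(j <- r) v (pt j) * phi j x).
  by apply/funext => x; rewrite big_cons mul1r.
have Wk := coords_phi cs k.
by rewrite e0 hL// IH2 mul1r big_cons; split => //; exact: hW.
Qed.

(** Packs the dimension with the basis, so that a family over the two subdomains can have different
    dimensions. *)
Record coordsys (R : realType) n (D : set 'rV[R]_n) (W : set ('rV[R]_n -> R)) := Coordsys {
  csd : nat;
  cpt : 'I_csd -> 'rV[R]_n;
  cphi : 'I_csd -> 'rV[R]_n -> R;
  cdual : 'I_csd -> 'rV[R]_n -> R;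
  cC : R;
  csok : is_coords D W cpt cphi cdual cC
}.

(** * The semi-discrete solution in coordinates *)

Section Exact.
Context (R : realType) (m : nat) (pb : problem R m) (hpb : admissible pb).
Context (mt : method R) (hmt : method_ok mt).
Context (u : 'I_2 -> R -> 'rV[R]_m.+1 -> R) (F : 'I_2 -> R -> 'rV[R]_m -> R).
Context (hsd : sd_solution pb u F).
Context (Du : 'I_2 -> nat -> R -> 'rV[R]_m.+1 -> R) (DuG DF : 'I_2 -> nat -> R -> 'rV[R]_m -> R).
Context (C0 : R) (hreg : regular_on pb mt u F Du DuG DF C0 1 (fun=> 1%N)).
Context (uni : unisolvent (qd mt) (@theta R mt)).
Context (cs : forall i, coordsys (@Omega R m i) (Usp pb i)) (cg : coordsys (@Gam R m) (UG pb)).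
Local Notation T := (tf pb).
Local Notation q := (qd mt).

Definition cU i (k : 'I_(csd (cs i))) (t : R) : R := u i t (cpt k).
Definition cV i (l : 'I_(csd cg)) (t : R) : R := trace (u i t) (cpt l).
Definition cF i (l : 'I_(csd cg)) (t : R) : R := F i t (cpt l).
(** Defined as the defect of the flux condition, so that this condition holds by construction;
    [run_F_coords] identifies it with the coordinates of the source on the interface. *)
Definition cgam i l t : R := \sum_j cpl pb i j * cV j l t - cF i l t.
Definition cAm i (k l : 'I_(csd (cs i))) : R := Lform pb i (cphi l) (cdual k).
Definition cGm i (k : 'I_(csd (cs i))) (l : 'I_(csd cg)) : R :=
  inner (@Gam R m) (cphi l) (trace (cdual k)).
Definition cPm i (l : 'I_(csd cg)) (k : 'I_(csd (cs i))) : R :=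
  inner (@Gam R m) (trace (cphi k)) (cdual l).
Definition cdn i t : R := \sum_(k < csd (cs i)) `|Du i q.+1 t (cpt k)|.
(** The product with [cC] makes it dominate [cdn ^+ 2]; the added 1 makes it dominate the density of
    the consistency bound. *)
Definition cden i t : R := ((csd (cs i))%:R ^+ 2 * cC (cs i) + 1) *
  \sum_(j < q.+2) nsq (@Omega R m i) (Du i j t).
Definition czn i t : R := \sum_(l < csd cg)
  (`|DuG i (rd mt i).+1 t (cpt l)| + `|DF i (rd mt i).+1 t (cpt l)|).

Let T0 : 0 < T := adm_tf hpb.

(** With one window of one step, the regularity hypothesis speaks of the whole time interval at
    once. *)
Lemma dt1 : dt pb 1 = T. Proof. by rewrite /dt divr1. Qed.

Lemma reg_u i : sobolev_time (Usp pb i) (@Omega R m i) 0 T q.+1 (u i) (Du i).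
Proof.
have [+ _] := hreg i; move=> /(_ 1%N 1%N isT isT).
by rewrite /tpt /dti dt1 divr1 /= mulr0n !mul0r !add0r mul1r.
Qed.

Lemma reg_uG i : sobolev_time (UG pb) (@Gam R m) 0 T (rd mt i).+1
  (fun t => trace (u i t)) (DuG i).
Proof. by have [_ [+ _]] := hreg i => /(_ 1%N isT)[+ _]; rewrite dt1 mul0r mul1r. Qed.

Lemma reg_F i : sobolev_time (UG pb) (@Gam R m) 0 T (rd mt i).+1 (F i) (DF i).
Proof. by have [_ [+ _]] := hreg i => /(_ 1%N isT)[_]; rewrite dt1 mul0r mul1r. Qed.

Lemma sobolev_weak_deriv n (W : set ('rV[R]_n -> R)) A a b k v Dv :
  sobolev_time W A a b k v Dv -> forall j x, (j < k)%N ->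
  weak_deriv a b (fun t => Dv j t x) (fun t => Dv j.+1 t x).
Proof. by case=> _ _ h j x /h /(_ x)[]. Qed.

Lemma weak_deriv_eq a b (f g f' : R -> R) : (forall t, a < t < b -> f t = f' t) ->
  weak_deriv a b f g -> weak_deriv a b f' g.
Proof.
move=> e [If Ig h]; split => //; first exact: eq_tintegrable e If.
by move=> phi hphi; rewrite -h//; apply: eq_tint => t /e ->.
Qed.

Lemma u_weak_deriv i x : weak_deriv 0 T (fun t => u i t x) (fun t => Du i 1%N t x).
Proof.
have := sobolev_weak_deriv (reg_u i) x (isT : (0 < q.+1)%N).
by apply: weak_deriv_eq => t tin; have [-> // _ _] := reg_u i.
Qed.

Lemma u_ftc i x t : 0 <= t <= T -> u i t x = u i 0 x + tint 0 t (fun s => Du i 1%N s x).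
Proof.
case/andP=> t0 tT.
have := weak_deriv_continuous T0 (u_weak_deriv i x) (@sd_cont _ _ _ _ _ hsd i x) (lexx 0) t0 tT.
by move=> <-; rewrite addrC subrK.
Qed.

Lemma trace_UG i t : 0 < t < T -> UG pb (trace (u i t)).
Proof.
move=> tin; have [e h _] := reg_uG i; have [+ _] := h 0%N isT.
by move=> /(_ t tin); rewrite e.
Qed.

Let mG : measurable (@Gam R m) := box_measurable _ _.
Let mO i : measurable (@Omega R m i) := box_measurable _ _.
Let fG : (leb R m (@Gam R m) < +oo)%E := leb_box_fin (@Gam_lt R m).

Lemma trace_form i lam : UG pb lam ->
  form_lin (Usp pb i) (fun v => inner (@Gam R m) (trace v) lam).
Proof.
move=> hl a b v w Uv Uw; rewrite -inner_lin//.
- apply: ess_bounded_integrable => //; apply: ess_boundedM => //.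
    exact: trace_ess_bounded Uv.
  exact: UG_ess_bounded hl.
- apply: ess_bounded_integrable => //; apply: ess_boundedM => //.
    exact: trace_ess_bounded Uw.
  exact: UG_ess_bounded hl.
Qed.

Lemma flux_form i w : Usp pb i w ->
  form_lin (UG pb) (fun v => inner (@Gam R m) v (trace w)).
Proof.
move=> hw a b v1 v2 h1 h2; rewrite inner_lin//.
- apply: ess_bounded_integrable => //; apply: ess_boundedM => //.
    exact: UG_ess_bounded h1.
  exact: trace_ess_bounded hw.
- apply: ess_bounded_integrable => //; apply: ess_boundedM => //.
    exact: UG_ess_bounded h2.
  exact: trace_ess_bounded hw.
Qed.

Lemma Lform_form i w : Usp pb i w -> form_lin (Usp pb i) (fun v => Lform pb i v w).
Proof. by move=> hw a b v1 v2 h1 h2; rewrite Lform_linl. Qed.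

Lemma trace_coords i v l : Usp pb i v ->
  inner (@Gam R m) (trace v) (cdual l) = \sum_(k < csd (cs i)) cPm l k * v (cpt k).
Proof.
move=> Uv; have Ul := coords_dual (csok cg) l.
rewrite (coords_form (csok (cs i)) (@Usp_lin _ _ pb i) (trace_form Ul) Uv).
by apply: eq_bigr => k _; rewrite mulrC.
Qed.

Lemma flux_coords i v k : UG pb v ->
  inner (@Gam R m) v (trace (cdual k)) = \sum_l @cGm i k l * v (cpt l).
Proof.
move=> Uv; have Uk := coords_dual (csok (cs i)) k.
rewrite (coords_form (csok cg) (@UG_lin _ _ pb) (flux_form Uk) Uv).
by apply: eq_bigr => l _; rewrite mulrC.
Qed.

Lemma Lform_coords i v k : Usp pb i v ->
  Lform pb i v (cdual k) = \sum_l @cAm i k l * v (cpt l).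
Proof.
move=> Uv; have Uk := coords_dual (csok (cs i)) k.
rewrite (coords_form (csok (cs i)) (@Usp_lin _ _ pb i) (Lform_form Uk) Uv).
by apply: eq_bigr => l _; rewrite mulrC.
Qed.

Lemma nsq_tintegrable i j : (j <= q.+1)%N ->
  tintegrable 0 T (fun t => nsq (@Omega R m i) (Du i j t)).
Proof. by move=> hj; have [_ h _] := reg_u i; have [_] := h j hj. Qed.

Lemma exact_coords : exact_ok T q (rd mt) (@theta R mt) cU cV cF cgam cPm (cpl pb) cdn cden czn.
Proof.
have [hns _ hth _] := hmt.
have Idn i : tintegrable 0 T (cdn i).
  apply: tintegrable_sum => k; apply: tintegrable_norm.
  by have [] := sobolev_weak_deriv (reg_u i) (cpt k) (ltnSn q).
have wuG i l j : (j <= rd mt i)%N ->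
    weak_deriv 0 T (fun t => DuG i j t (cpt l)) (fun t => DuG i j.+1 t (@cpt _ _ _ _ cg l)).
  by move=> hj; exact: (sobolev_weak_deriv (reg_uG i)).
have wF i l j : (j <= rd mt i)%N ->
    weak_deriv 0 T (fun t => DF i j t (cpt l)) (fun t => DF i j.+1 t (@cpt _ _ _ _ cg l)).
  by move=> hj; exact: (sobolev_weak_deriv (reg_F i)).
have IV i l : tintegrable 0 T (@cV i l).
  have [+ _ _] := wuG i l 0%N isT; apply: eq_tintegrable => t tin.
  by have [-> // _ _] := reg_uG i.
have IF i l : tintegrable 0 T (@cF i l).
  have [+ _ _] := wF i l 0%N isT; apply: eq_tintegrable => t tin.
  by have [-> // _ _] := reg_F i.
have Izn i : tintegrable 0 T (czn i).
  apply: tintegrable_sum => l; apply: tintegrableD; apply: tintegrable_norm.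
    by have [] := wuG i l _ (leqnn _).
  by have [] := wF i l _ (leqnn _).
have IDs (f : 'I_2 -> R -> R) i s t : 0 <= s -> t <= T -> tintegrable 0 T (f i) ->
    tintegrable s t (f i) by move=> ? ?; exact: tintegrableS.
split => //.
- move=> i k; apply: within_continuous_tintegrable; exact: (sd_cont hsd).
- move=> i; apply: tintegrableZ; apply: tintegrable_sum => j.
  by apply: nsq_tintegrable; rewrite -ltnS.
- by move=> i t; rewrite sumr_ge0.
- move=> i t tin; have [_ h _] := reg_u i; have [Ud _] := h q.+1 (leqnn _).
  have cok := csok (cs i); set v := Du i q.+1 t.
  have hk (k : 'I_(csd (cs i))) : `|v (cpt k)| <= Num.sqrt (cC (cs i) * nsq (@Omega R m i) v).
    by rewrite -sqrtr_sqr ler_wsqrtr//; exact: (coords_sqr_le cok (Ud t tin)).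
  have n0 := nsq_ge0 (@Omega R m i).
  have c0 := coords_pos cok.
  have x0 : 0 <= cC (cs i) * nsq (@Omega R m i) v by rewrite mulr_ge0// ltW.
  apply: (@le_trans _ _ ((csd (cs i))%:R ^+ 2 * (cC (cs i) * nsq (@Omega R m i) v))).
    rewrite -[X in _ * X](sqr_sqrtr x0) -exprMn; apply: lerXn2r; rewrite ?nnegrE.
    - by rewrite sumr_ge0.
    - by rewrite mulr_ge0// sqrtr_ge0.
    rewrite /cdn -[X in X%:R]card_ord mulr_natl -sumr_const.
    by apply: ler_sum => k _; exact: hk.
  rewrite /cden mulrA; apply: ler_pM => //.
  - by rewrite mulr_ge0 ?sqr_ge0// ltW.
  - by rewrite lerDl.
  - rewrite (bigD1 ord_max)//= lerDl sumr_ge0//.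
- by move=> i t; rewrite sumr_ge0// => l _; rewrite addr_ge0.
- move=> i k s t s0 st tT.
  have wu j : (j < q.+1)%N -> weak_deriv 0 T (fun t => Du i j t (cpt k)) (fun t => Du i j.+1 t (cpt k)).
    by move=> hj; exact: (sobolev_weak_deriv (reg_u i)).
  have [_ I1 _] := wu 0%N isT.
  have [p sp hp] := @iterated_approx R T s t q (fun j r => Du i j.+1 r (cpt k)) (u i 0 (cpt k))
    T0 I1 (fun j hj => wu j.+1 hj) s0 st tT.
  exists p => // x xin; have /andP[sx xt] := xin.
  rewrite /cU u_ftc; last by rewrite (le_trans s0 sx)/= (le_trans xt).
  apply: (le_trans (hp x xin)); rewrite ler_wpM2l ?exprn_ge0 ?subr_ge0//.
  have Isub : tintegrable s t (cdn i) by exact: IDs.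
  apply: le_tint => //.
    apply: (@tintegrableS _ 0 T) => //; apply: tintegrable_norm.
    by have [] := sobolev_weak_deriv (reg_u i) (cpt k) (ltnSn q).
  move=> y _; rewrite /cdn (bigD1 k)//= lerDl sumr_ge0//.
- move=> i l s t s0 st tT.
  have [p sp hp] := @tintegrable_poly_approx R T (rd mt i) (fun j r => DuG i j r (@cpt _ _ _ _ cg l)) T0 (wuG i l) s t s0 st tT.
  exists p => //.
  rewrite (@eq_tint _ _ _ _ (fun x => `|DuG i 0%N x (cpt l) - p.[x]|)); last first.
    move=> x /andP[sx xt]; have [e0 _ _] := reg_uG i; rewrite e0//.
    by rewrite (le_lt_trans s0)//= (lt_le_trans xt).
  apply: (le_trans hp); rewrite ler_wpM2l ?exprn_ge0 ?subr_ge0//.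
  apply: le_tint; [|exact: IDs|].
    apply: (@tintegrableS _ 0 T) => //; apply: tintegrable_norm.
    by have [] := wuG i l _ (leqnn _).
  move=> y _; rewrite /czn (bigD1 l)//= -addrA lerDl addr_ge0// sumr_ge0//.
- move=> i l s t s0 st tT.
  have [p sp hp] := @tintegrable_poly_approx R T (rd mt i) (fun j r => DF i j r (@cpt _ _ _ _ cg l)) T0 (wF i l) s t s0 st tT.
  exists p => //.
  rewrite (@eq_tint _ _ _ _ (fun x => `|DF i 0%N x (cpt l) - p.[x]|)); last first.
    move=> x /andP[sx xt]; have [e0 _ _] := reg_F i; rewrite e0//.
    by rewrite (le_lt_trans s0)//= (lt_le_trans xt).
  apply: (le_trans hp); rewrite ler_wpM2l ?exprn_ge0 ?subr_ge0//.
  apply: le_tint; [|exact: IDs|].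
    apply: (@tintegrableS _ 0 T) => //; apply: tintegrable_norm.
    by have [] := wF i l _ (leqnn _).
  move=> y _; rewrite /czn (bigD1 l)//= [`|DuG _ _ _ _| + _]addrC -addrA lerDl.
  by rewrite addr_ge0// sumr_ge0.
- move=> i l t tin; rewrite /cV -(coords_inner (csok cg) (trace_UG i tin) l).
  have Uu : Usp pb i (u i t) by apply: (sd_u hsd); case/andP: tin => /ltW -> /ltW ->.
  by rewrite (trace_coords _ Uu).
- by move=> i l t _; rewrite /cgam opprB addrC subrK.
Qed.


Definition csrc i (k : 'I_(csd (cs i))) (t : R) : R :=
  inner (@Omega R m i) (src pb i t) (cdual k).
(** The time derivative of the coordinate, expressed by the right-hand side of the semi-discrete
    equation tested with a dual function. *)
Definition cdU i (k : 'I_(csd (cs i))) (t : R) : R :=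
  csrc k t - (\sum_l cAm k l * cU l t + \sum_l cGm k l * cF i l t).

Lemma src_integrable i t w : 0 < t <= T -> Usp pb i w ->
  (leb R m.+1).-integrable (@Omega R m i) (EFin \o (fun x => src pb i t x * w x)).
Proof.
move=> tin Uw; have [ms is2] := adm_src hpb i tin.
have bw := Usp_ess_bounded Uw.
have iw := ess_bounded_integrable (mO i) (leb_box_fin (@lo_lt_hi R m i)) (ess_boundedM bw bw).
apply: (@integrable_dominated _ _ _ _ _ _ _ (fun x => src pb i t x ^+ 2 + w x * w x)) => //.
- by apply: measurable_funM => //; case: bw.
- exact: integrable_add.
- move=> x _; have h1 := sqr_ge0 (src pb i t x - w x); have h2 := sqr_ge0 (src pb i t x + w x).
  by rewrite ler_norml; apply/andP; split; nra.
Qed.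

Lemma sd_ode_coords i k t : 0 < t <= T -> deriv_within `[0, T] (@cU i k) t (@cdU i k t).
Proof.
move=> tin; have [du [Udu hdu hw]] := sd_ode hsd i tin.
have cok := csok (cs i).
have Uk := coords_dual cok k.
have Ut : Usp pb i (u i t) by apply: (sd_u hsd); case/andP: tin => /ltW -> ->.
have := hw _ Uk; rewrite (coords_inner cok Udu) (Lform_coords k Ut).
rewrite (flux_coords k (sd_F hsd i tin)) => e.
suff -> : @cdU i k t = du (cpt k) by exact: hdu.
by rewrite e /cdU /csrc /cU /cF; ring.
Qed.

Lemma cU_weak_deriv i k : weak_deriv 0 T (@cU i k) (fun t => Du i 1%N t (cpt k)).
Proof. exact: u_weak_deriv. Qed.

Lemma cU_cont i k : {within `[0, T], continuous (@cU i k)}.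
Proof. exact: (sd_cont hsd). Qed.

Lemma cdU_ae i k : {ae lebesgue_measure, forall t, 0 < t < T ->
  @cdU i k t = Du i 1%N t (cpt k)}.
Proof.
have := deriv_within_ae T0 (cU_weak_deriv k) (@cU_cont i k).
move=> h; apply: (ae_impl h) => t ht tin; apply: ht => //.
by apply: sd_ode_coords; case/andP: tin => -> /ltW.
Qed.

Lemma cdU_measurable i k : measurable_fun `]0, T[ (@cdU i k).
Proof.
apply: (deriv_within_measurable T0 (@cU_cont i k)) => t /andP[t0 tT].
by apply: sd_ode_coords; rewrite t0 ltW.
Qed.

Lemma cdU_int i k : tintegrable 0 T (@cdU i k).
Proof.
have [_ ID _] := cU_weak_deriv k.
apply: (tintegrable_ae ID (@cdU_measurable i k)).
by apply: (ae_impl (cdU_ae k)) => t h /h.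
Qed.

Let ex := exact_coords.

(** Admissibility speaks of the source at each time separately. Integrability in time comes from the
    equation itself, which writes the source through [cdU], [cU] and [cF]. *)
Lemma csrc_int i k : tintegrable 0 T (@csrc i k).
Proof.
apply: (@eq_tintegrable _ _ _ (fun t => @cdU i k t +
    (\sum_l cAm k l * cU l t + \sum_l cGm k l * cF i l t))).
  by move=> t _; rewrite /cdU subrK.
apply: tintegrableD; first exact: cdU_int.
by apply: tintegrableD; apply: tintegrable_sum => l; apply: tintegrableZ;
  [exact: (ex_U ex)|exact: (ex_F ex)].
Qed.

(** The counterpart of (V) for the exact solution: integration by parts, with the weak derivative
    replaced almost everywhere by [cdU]. *)
Lemma exact_identity i k (a : {poly R}) s t : 0 <= s -> s <= t -> t <= T ->
  a.[t] * @cU i k t - tint s t (fun r => cU k r * a^`().[r]) =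
  a.[s] * @cU i k s + tint s t (fun r => a.[r] * cdU k r).
Proof.
move=> s0 st tT.
have := weak_deriv_by_parts a T0 (cU_weak_deriv k) (@cU_cont i k) s0 st tT.
have [IU ID _] := cU_weak_deriv k.
have I1 : tintegrable s t (fun r => a^`().[r] * cU k r).
  apply: (@eq_tintegrable _ _ _ (fun r => cU k r * a^`().[r])) => [r _|]; first by rewrite mulrC.
  by apply: tintegrableM_poly; exact: tintegrableS IU.
have I2 : tintegrable s t (fun r => a.[r] * Du i 1%N r (cpt k)).
  apply: (@eq_tintegrable _ _ _ (fun r => Du i 1%N r (cpt k) * a.[r])) => [r _|]; first by rewrite mulrC.
  by apply: tintegrableM_poly; exact: tintegrableS ID.
have I3 : tintegrable s t (fun r => a.[r] * cdU k r).
  apply: (@eq_tintegrable _ _ _ (fun r => cdU k r * a.[r])) => [r _|]; first by rewrite mulrC.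
  by apply: tintegrableM_poly; apply: (@tintegrableS _ 0 T) => //; exact: cdU_int.
rewrite tintD//.
have -> : tint s t (fun r => a.[r] * Du i 1%N r (cpt k)) = tint s t (fun r => a.[r] * cdU k r).
  apply: tint_ae; [exact: tintegrable_measurable|exact: tintegrable_measurable|].
  apply: (ae_impl (cdU_ae k)) => r hr /andP[sr rt]; rewrite hr//.
  by rewrite (le_lt_trans s0)//= (lt_le_trans rt).
have -> : tint s t (fun r => cU k r * a^`().[r]) = tint s t (fun r => a^`().[r] * cU k r).
  by apply: eq_tint => r _; rewrite mulrC.
move=> h; rewrite -[_ * cU k t](subrK (a.[s] * cU k s)) h; ring.
Qed.

Lemma timepoly_coord n (W : set ('rV[R]_n -> R)) p v x : timepoly W p v ->
  exists P : {poly R}, (size P <= p.+1)%N /\ forall t, v t x = P.[t].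
Proof.
case=> d [c [w [hc hw ->]]]; exists (\sum_j w j x *: c j); split.
  apply: (leq_trans (size_sum _ _ _)); apply/bigmax_leqP => j _.
  exact: leq_trans (size_scale_leq _ _) _.
by move=> t; rewrite horner_sum; apply: eq_bigr => j _; rewrite hornerZ mulrC.
Qed.

Lemma timepoly_in n (W : set ('rV[R]_n -> R)) p v w0 t : lin_closed W -> W w0 ->
  timepoly W p v -> W (v t).
Proof.
move=> hW W0 [[|d] [c [w [hc hw ->]]]]; last exact: lin_closed_sum ord0 hW hw.
(* An empty sum is the zero function; [w0] witnesses that [W] contains it. *)
have := hW 0 0 _ _ W0 W0; congr W; apply/funext => x.
by rewrite big_ord0 !mul0r addr0.
Qed.

Lemma timepoly_mul n (W : set ('rV[R]_n -> R)) p (a : {poly R}) w : W w ->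
  (size a <= p.+1)%N -> timepoly W p (fun t x => a.[t] * w x).
Proof.
move=> Ww sa; exists 1%N, (fun=> a), (fun=> w); split => //.
by apply/funext => t; apply/funext => x; rewrite big_ord1.
Qed.

Lemma dtime_mul n (a : {poly R}) (w : 'rV[R]_n -> R) t :
  dtime (fun t x => a.[t] * w x) t = (fun x => a^`().[t] * w x).
Proof.
apply/funext => x; rewrite /dtime.
have -> : (fun s => a.[s] * w x) = horner (w x *: a).
  by apply/funext => s; rewrite hornerZ mulrC.
by rewrite -derivE derivZ hornerZ mulrC.
Qed.

(* the polynomial in time [v _ x], when [v] is a [timepoly] *)
Definition coordpoly n (v : R -> 'rV[R]_n -> R) (p : nat) (x : 'rV[R]_n) : {poly R} :=
  xget 0 [set P : {poly R} | (size P <= p.+1)%N /\ forall t, v t x = P.[t]].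

Lemma coordpolyP n (W : set ('rV[R]_n -> R)) p v x : timepoly W p v ->
  (size (coordpoly v p x) <= p.+1)%N /\ forall t, (coordpoly v p x).[t] = v t x.
Proof.
move=> /(timepoly_coord x)[P hP]; rewrite /coordpoly; case: xgetP => [Q _ [h1 h2]|/(_ P)//].
by split => // t; rewrite h2.
Qed.

Lemma inner_scaler n (D : set 'rV[R]_n) (c : R) (f w : 'rV[R]_n -> R) : measurable D ->
  (leb R n).-integrable D (EFin \o (fun x => f x * w x)) ->
  inner D f (fun x => c * w x) = c * inner D f w.
Proof.
move=> mD h; rewrite /inner -RintegralZl//; apply: eq_Rintegral => x _; ring.
Qed.

Lemma Usp0 i : Usp pb i (u i 0).
Proof. by apply: (sd_u hsd); rewrite lexx ltW. Qed.
Lemma UG0 : UG pb (F ord0 T).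
Proof. by apply: (sd_F hsd); rewrite T0 lexx. Qed.


(** * The discrete solution in coordinates *)

Section RunCoordinates.
Context (N : nat) (M : 'I_2 -> nat).
Context (ud : 'I_2 -> nat -> nat -> R -> 'rV[R]_m.+1 -> R) (US : 'I_2 -> nat -> 'rV[R]_m.+1 -> R).
Context (uG FG : 'I_2 -> nat -> R -> 'rV[R]_m -> R).
Context (N_gt0 : (0 < N)%N) (M_gt0 : forall i, (0 < M i)%N).
Context (av : available mt M) (dg : dgit_solution pb mt N M ud US uG FG).
Context (Cc pp : R) (Cc0 : 0 < Cc).
Context (con : consistent pb mt u Du Cc N M) (ini : init_accurate pb mt u Cc pp N M ud US).
Context (N0N : (N0 mt <= N)%N).

(** The initialization bound converted from L^2 norms to sums of nodal values: a dimension times the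
    square root of the equivalence constant. *)
Definition ceps : R := (\sum_i (csd (cs i))%:R * Num.sqrt (cC (cs i))) * (Cc * dt pb N `^ pp).

Definition crun : run R (fun i => csd (cs i)) (csd cg) := Run N M
  (fun i w n k => coordpoly (ud i w n) q (cpt k))
  (fun i g k => US i g (cpt k) - cU k (g%:R * dti pb N M i))
  (fun i w l => coordpoly (uG i w) (rd mt i) (cpt l))
  (fun i w l => coordpoly (FG i w) (rd mt i) (cpt l)) ceps.

Let N0_gt0 : (0 < N0 mt)%N. Proof. by case: hmt. Qed.

Lemma dti_gt0 i : 0 < dti pb N M i.
Proof. by rewrite !divr_gt0// ltr0n. Qed.
Lemma dtM i : (M i)%:R * dti pb N M i = dt pb N.
Proof. by rewrite mulrC divfK// pnatr_eq0 -lt0n. Qed.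

Lemma tptE i w z : (0 < w)%N -> tpt pb N M i w z = ((w.-1 * M i)%:R + z) * dti pb N M i.
Proof. by move=> w0; rewrite /tpt mulrDl natrM -mulrA dtM. Qed.

Lemma tpt_tg i w n : (0 < w)%N -> tpt pb N M i w n%:R = tg T crun i (gidx M i w n).
Proof. by move=> w0; rewrite tptE// /tg -natrD. Qed.

Lemma tpt_pred i w n : (0 < w)%N -> (0 < n)%N ->
  tpt pb N M i w n.-1%:R = tg T crun i (gidx M i w n).-1.
Proof. by move=> w0 n0; rewrite tpt_tg// /gidx; case: n n0 => // n _; rewrite addnS. Qed.

Lemma sint_instep i w n f : (0 < w)%N -> (0 < n)%N ->
  sint pb N M i w n f = instep T crun i w n f.
Proof. by move=> w0 n0; rewrite /sint /instep tpt_pred// tpt_tg. Qed.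

Lemma valid_w i w n : valid (N0 mt) crun i w n -> (0 < w)%N /\ (0 < n)%N.
Proof.
by case/andP=> /andP[h _] /andP[h' _]; split => //; exact: leq_trans h.
Qed.

Lemma tg_bound i g : (g <= N * M i)%N -> 0 <= tg T crun i g <= T.
Proof.
move=> hg; rewrite mulr_ge0 ?(ltW (dti_gt0 i))//=.
have TE : T = (N * M i)%:R * dti pb N M i.
  by rewrite natrM -mulrA dtM mulrC /dt divfK// pnatr_eq0 -lt0n.
by rewrite [leRHS]TE /tg ler_pM2r ?dti_gt0// ler_nat.
Qed.

Section StepData.
Variables (i : 'I_2) (w n : nat).
Hypothesis v : valid (N0 mt) crun i w n.
Let g := gid crun i w n.
Let w0 : (0 < w)%N. Proof. by case: (valid_w v). Qed.
Let n0 : (0 < n)%N. Proof. by case: (valid_w v). Qed.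
Let wN : (N0 mt <= w <= N)%N. Proof. by case/andP: v. Qed.
Let nM : (1 <= n <= M i)%N. Proof. by case/andP: v. Qed.
Let wN1 : (1 <= w <= N)%N. Proof. by rewrite w0; case/andP: wN. Qed.

Lemma gid_bound : (g <= N * M i)%N.
Proof.
rewrite /g /gid /gidx /=; apply: (@leq_trans (w * M i)).
  by rewrite -[in leqRHS](prednK w0) mulSn addnC leq_add2r; case/andP: nM.
by rewrite leq_mul2r; case/andP: wN => _ ->; rewrite orbT.
Qed.
Lemma gid_pos : (0 < g)%N.
Proof. by rewrite /g /gid /gidx; case: n n0 => // k _; rewrite addnS. Qed.

Lemma ud_in t : Usp pb i (ud i w n t).
Proof. exact: (timepoly_in _ (@Usp_lin _ _ pb i) (Usp0 i) (dg_ud dg wN1 nM)). Qed.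
Lemma eta_ud (k : 'I_(csd (cs i))) t : (reta crun w n k).[t] = ud i w n t (cpt k).
Proof. by have [_ ->] := coordpolyP (cpt k) (dg_ud dg wN1 nM). Qed.
Lemma FG_in t : UG pb (FG i w t).
Proof. exact: (timepoly_in _ (@UG_lin _ _ pb) UG0 (dg_FG dg i wN)). Qed.
Lemma FG_coord l t : (rFG crun i w l).[t] = FG i w t (cpt l).
Proof. by have [_ ->] := coordpolyP (cpt l) (dg_FG dg i wN). Qed.

Lemma step_times : 0 <= tg T crun i g.-1 /\ tg T crun i g.-1 < tg T crun i g /\ tg T crun i g <= T.
Proof.
have /andP[_ h3] := tg_bound gid_bound; have /andP[h1 _] := tg_bound (leq_trans (leq_pred g) gid_bound).
split=> //; split=> //.
by rewrite /tg ltr_pM2r ?dti_gt0// ltr_nat ltn_predL gid_pos.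
Qed.

(** (V) is tested with a polynomial in time times a dual function; pairing with the latter reads off
    a nodal value. *)
Lemma dg_V_coords k (a : {poly R}) : (size a <= (q.+1 - ns mt).+1)%N ->
  a.[tg T crun i g] * US i g (cpt k)
    - instep T crun i w n (fun t => (reta crun w n k).[t] * a^`().[t]) =
  a.[tg T crun i g.-1] * US i g.-1 (cpt k)
    - instep T crun i w n (fun t => a.[t] * (\sum_l cAm k l * (reta crun w n l).[t]
       + \sum_l cGm k l * (rFG crun i w l).[t] - @csrc i k t)).
Proof.
move=> sa; have cok := csok (cs i); have Uk := coords_dual cok k.
have bk := Usp_ess_bounded Uk.
have finO := leb_box_fin (@lo_lt_hi R m i).
have IU z : Usp pb i z -> (leb R m.+1).-integrable (@Omega R m i)
    (EFin \o (fun x => z x * @cdual _ _ _ _ (cs i) k x)).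
  move=> Uz; apply: ess_bounded_integrable => //; apply: ess_boundedM => //.
  exact: Usp_ess_bounded Uz.
have := dg_V dg wN nM (timepoly_mul Uk sa).
rewrite !sint_instep// tpt_tg// tpt_pred// -/g.
have gg : gidx M i w n.-1 = g.-1.
  by rewrite /g /gid /gidx /=; case: n n0 => // n' _; rewrite addnS.
have U1 := dg_US dg gid_bound.
have U2 := dg_US dg (leq_trans (leq_pred g) gid_bound).
rewrite gg !inner_scaler ?(coords_inner cok U1) ?(coords_inner cok U2)//; [|exact: IU..].
move=> h.
have -> : instep T crun i w n (fun t => (reta crun w n k).[t] * a^`().[t]) =
    instep T crun i w n (fun t => inner (@Omega R m i) (ud i w n t)
      (dtime (fun t x => a.[t] * cdual k x) t)).
  apply: eq_tint => t _; rewrite dtime_mul inner_scaler//; last exact: IU (ud_in t).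
  by rewrite (coords_inner cok (ud_in t)) eta_ud mulrC.
rewrite h; congr (_ - _); apply: eq_tint => t /andP[t1 t2].
have [s1 [s2 s3]] := step_times.
have tin : 0 < t <= T by rewrite (le_lt_trans s1 t1)/= ltW// (lt_le_trans t2).
have -> : Lform pb i (ud i w n t) (fun x => a.[t] * cdual k x) =
    a.[t] * Lform pb i (ud i w n t) (cdual k).
  rewrite -[RHS]addr0 -[X in _ + X](mul0r (Lform pb i (ud i w n t) (cdual k))).
  rewrite -Lform_linr//; last exact: ud_in.
  by congr (Lform _ _ _ _); apply/funext => x; rewrite mul0r addr0.
rewrite (Lform_coords k (ud_in t)).
have -> : trace (fun x => a.[t] * cdual k x) = (fun y => a.[t] * trace (cdual k) y) by [].
rewrite inner_scaler//; last first.
  apply: ess_bounded_integrable => //; apply: ess_boundedM => //.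
    exact: UG_ess_bounded (FG_in t).
  exact: trace_ess_bounded Uk.
rewrite (flux_coords k (FG_in t)).
rewrite inner_scaler//; last exact: src_integrable.
rewrite -mulrDr -mulrBr; congr (_ * (_ + _ - _)).
  by apply: eq_bigr => l _; rewrite eta_ud.
by apply: eq_bigr => l _; rewrite FG_coord.
Qed.

(** Difference of [dg_V_coords] and [exact_identity]: the source terms cancel, leaving only
    errors. *)
Lemma run_V_coords k (a : {poly R}) : (size a <= (q.+1 - ns mt).+1)%N ->
  a.[tg T crun i g] * @rE _ _ _ crun i g k
    - instep T crun i w n (fun t => @err _ _ _ cU crun i w n k t * a^`().[t]) =
  a.[tg T crun i g.-1] * @rE _ _ _ crun i g.-1 k
    - instep T crun i w n (fun t => a.[t] * (\sum_l @cAm i k l * @err _ _ _ cU crun i w n l t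
       + \sum_l @cGm i k l * del cF crun i w l t)).
Proof.
move=> sa; have h1 := dg_V_coords k sa.
have [s1 [s2 s3]] := step_times.
have h2 := exact_identity k a s1 (ltW s2) s3.
have sub f : tintegrable 0 T f -> tintegrable (tg T crun i g.-1) (tg T crun i g) f.
  by apply: tintegrableS.
have Ip p : tintegrable (tg T crun i g.-1) (tg T crun i g) (horner p) by exact: poly_tintegrable.
have IU l := sub _ (ex_U ex (i:=i) l).
have IF l := sub _ (ex_F ex i l).
have IA : tintegrable (tg T crun i g.-1) (tg T crun i g)
    (fun t => a.[t] * (\sum_l @cAm i k l * (@reta _ _ _ crun i w n l).[t]
       + \sum_l @cGm i k l * (rFG crun i w l).[t] - @csrc i k t)).
  apply: (@eq_tintegrable _ _ _ (fun t => (\sum_l @cAm i k l * (@reta _ _ _ crun i w n l).[t]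
       + \sum_l @cGm i k l * (rFG crun i w l).[t] - @csrc i k t) * a.[t])) => [t _|].
    by rewrite mulrC.
  apply: tintegrableM_poly; apply: tintegrableB; last exact: sub (csrc_int k).
  by apply: tintegrableD; apply: tintegrable_sum => l; apply: tintegrableZ; exact: Ip.
have ID : tintegrable (tg T crun i g.-1) (tg T crun i g) (fun t => a.[t] * @cdU i k t).
  apply: (@eq_tintegrable _ _ _ (fun t => @cdU i k t * a.[t])) => [t _|].
    by rewrite mulrC.
  by apply: tintegrableM_poly; exact: sub (cdU_int k).
have -> : instep T crun i w n (fun t => @err _ _ _ cU crun i w n k t * a^`().[t]) =
    instep T crun i w n (fun t => (@reta _ _ _ crun i w n k).[t] * a^`().[t]) -
    tint (tg T crun i g.-1) (tg T crun i g) (fun t => @cU i k t * a^`().[t]).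
  rewrite /instep -/g -tintB; last 2 first.
  - exact: tintegrableM_poly (Ip _).
  - exact: tintegrableM_poly (IU _).
  by apply: eq_tint => t _; rewrite /err mulrBl.
have -> : instep T crun i w n (fun t => a.[t] * (\sum_l @cAm i k l * @err _ _ _ cU crun i w n l t
       + \sum_l @cGm i k l * del cF crun i w l t)) =
    instep T crun i w n (fun t => a.[t] * (\sum_l @cAm i k l * (@reta _ _ _ crun i w n l).[t]
       + \sum_l @cGm i k l * (rFG crun i w l).[t] - @csrc i k t)) +
    tint (tg T crun i g.-1) (tg T crun i g) (fun t => a.[t] * @cdU i k t).
  rewrite /instep -/g -tintD//; apply: eq_tint => t _.
  rewrite -mulrDr; congr (_ * _); rewrite /cdU /err /del.
  rewrite (eq_bigr _ (fun l _ => mulrBr _ _ _)) sumrB.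
  rewrite [X in _ + X = _](eq_bigr _ (fun l _ => mulrBr _ _ _)) sumrB; ring.
rewrite /= -!/(tg T crun i _).
set A1 := instep _ _ _ _ _ _ in h1 *; set A2 := instep _ _ _ _ _ _ in h1 *.
set B1 := tint _ _ _ in h2 *; set B2 := tint _ _ _ in h2 *.
by rewrite !mulrBr; move: h1 h2; rewrite /tg /=; lra.
Qed.
End StepData.

Lemma tg_sub i w n l : (0 < w)%N -> (l <= gidx M i w n)%N ->
  tpt pb N M i w (n%:R - l%:R) = tg T crun i (gidx M i w n - l).
Proof.
move=> w0 hl; rewrite tptE// /tg natrB// addrA -natrD //.
Qed.

Lemma tpt_node i w n (c : R) : (0 < w)%N -> (0 < n)%N ->
  tpt pb N M i w (n.-1%:R + c) = tg T crun i (gidx M i w n).-1 + c * dti pb N M i.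
Proof.
move=> w0 n0; rewrite tptE// addrA mulrDl -natrD /tg; congr (_%:R * _ + _).
by rewrite /gidx; case: n n0 => // k _; rewrite addnS.
Qed.

Lemma wint_inwin w f : wint pb N w f = inwin T crun w f.
Proof. by []. Qed.

Lemma win_times w t : (N0 mt <= w <= N)%N -> w.-1%:R * dT T crun < t < w%:R * dT T crun ->
  0 < t < T.
Proof.
move=> /andP[_ wN] /andP[t1 t2].
have d0 : 0 < dT T crun by rewrite divr_gt0// ltr0n.
apply/andP; split; first by rewrite (le_lt_trans _ t1)// mulr_ge0// ltW.
apply: (lt_le_trans t2).
have TE : T = N%:R * dT T crun by rewrite mulrC /dT /= divfK// pnatr_eq0 -lt0n.
by rewrite [leRHS]TE ler_pM2r// ler_nat.
Qed.

Lemma UG_inner z l : UG pb z ->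
  (leb R m).-integrable (@Gam R m) (EFin \o (fun y => z y * @cdual _ _ _ _ cg l y)).
Proof.
move=> Uz; apply: ess_bounded_integrable => //; apply: ess_boundedM => //.
  exact: UG_ess_bounded Uz.
exact: UG_ess_bounded (coords_dual (csok cg) l).
Qed.

Lemma run_T_coords i w l (a : {poly R}) : (N0 mt <= w <= N)%N ->
  (size a <= (rd mt i).+1)%N ->
  inwin T crun w (fun t => (ruG crun i w l).[t] * a.[t]) =
  \sum_(1 <= n < (M i).+1)
    instep T crun i w n (fun t => (\sum_k cPm l k * (@reta _ _ _ crun i w n k).[t]) * a.[t]).
Proof.
move=> wN sa; have Ul := coords_dual (csok cg) l.
have h := dg_T dg wN (timepoly_mul Ul sa).
have tG := dg_uG dg i wN.
have UGt t : UG pb (uG i w t) by exact: (timepoly_in _ (@UG_lin _ _ pb) UG0 tG).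
rewrite wint_inwin in h.
have -> : inwin T crun w (fun t => (ruG crun i w l).[t] * a.[t]) =
    inwin T crun w (fun t => inner (@Gam R m) (uG i w t) (fun x => a.[t] * cdual l x)).
  apply: eq_tint => t _; rewrite inner_scaler//; last exact: UG_inner.
  rewrite (coords_inner (csok cg) (UGt t)) mulrC; congr (_ * _).
  by have [_ ->] := coordpolyP (cpt l) tG.
rewrite h; apply: eq_big_nat => n hn.
have v : valid (N0 mt) crun i w n by rewrite /valid wN.
have [w0 n0] := valid_w v.
rewrite sint_instep//; apply: eq_tint => t _.
rewrite inner_scaler//; last first.
  apply: ess_bounded_integrable => //; apply: ess_boundedM => //.
    exact: trace_ess_bounded (ud_in v t).
  exact: UG_ess_bounded Ul.
rewrite (trace_coords _ (ud_in v t)) mulrC; congr (_ * _).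
by apply: eq_bigr => k _; rewrite (eta_ud v).
Qed.

Lemma srcG_integrable i t l : 0 < t <= T ->
  (leb R m).-integrable (@Gam R m) (EFin \o (fun y => srcG pb i t y * @cdual _ _ _ _ cg l y)).
Proof.
move=> tin; have [ms is2] := adm_srcG hpb i tin.
have bw := UG_ess_bounded (coords_dual (csok cg) l).
have iw := ess_bounded_integrable mG fG (ess_boundedM bw bw).
set w := cdual l in iw *.
apply: (@integrable_dominated _ _ _ _ _ _ _ (fun x => srcG pb i t x ^+ 2 + w x * w x)) => //.
- by apply: measurable_funM => //; case: bw.
- exact: integrable_add.
- move=> x _; have h1 := sqr_ge0 (srcG pb i t x - w x).
  have h2 := sqr_ge0 (srcG pb i t x + w x).
  by rewrite ler_norml; apply/andP; split; nra.
Qed.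

Lemma run_F_coords i w l (a : {poly R}) : (N0 mt <= w <= N)%N ->
  (size a <= (rd mt i).+1)%N ->
  inwin T crun w (fun t => (rFG crun i w l).[t] * a.[t]) =
  inwin T crun w (fun t => (\sum_j cpl pb i j * (ruG crun j w l).[t] - cgam i l t) * a.[t]).
Proof.
move=> wN sa; have Ul := coords_dual (csok cg) l.
have h := dg_F dg wN (timepoly_mul Ul sa); rewrite !wint_inwin in h.
have tF := dg_FG dg i wN.
have UFt t : UG pb (FG i w t) by exact: (timepoly_in _ (@UG_lin _ _ pb) UG0 tF).
have UGt j t : UG pb (uG j w t) by exact: (timepoly_in _ (@UG_lin _ _ pb) UG0 (dg_uG dg j wN)).
have -> : inwin T crun w (fun t => (rFG crun i w l).[t] * a.[t]) =
    inwin T crun w (fun t => inner (@Gam R m) (FG i w t) (fun x => a.[t] * cdual l x)).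
  apply: eq_tint => t _; rewrite inner_scaler//; last exact: UG_inner.
  rewrite (coords_inner (csok cg) (UFt t)) mulrC; congr (_ * _).
  by have [_ ->] := coordpolyP (cpt l) tF.
rewrite h; apply: eq_tint => t /(win_times wN) tin.
have tin' : 0 < t <= T by case/andP: tin => -> /ltW.
have split_inner (z : 'I_2 -> 'rV[R]_m -> R) : (forall j, UG pb (z j)) ->
    inner (@Gam R m) (fun y => \sum_j cpl pb i j * z j y - srcG pb i t y) (cdual l) =
    \sum_j cpl pb i j * z j (cpt l) - inner (@Gam R m) (srcG pb i t) (cdual l).
  move=> Uz; have Us := lin_closed_sum (cpl pb i) ord0 (@UG_lin _ _ pb) Uz.
  have -> : (fun y => \sum_j cpl pb i j * z j y - srcG pb i t y) =
      (fun y => 1 * (\sum_j cpl pb i j * z j y) + (-1) * srcG pb i t y).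
    by apply/funext => y; rewrite mul1r mulN1r.
  rewrite inner_lin// ?mul1r ?mulN1r; [|exact: UG_inner|exact: srcG_integrable].
  by rewrite (coords_inner (csok cg) Us).
have Iz (z : 'I_2 -> 'rV[R]_m -> R) : (forall j, UG pb (z j)) ->
    (leb R m).-integrable (@Gam R m)
      (EFin \o (fun y => (\sum_j cpl pb i j * z j y - srcG pb i t y) * cdual l y)).
  move=> Uz; have Us := lin_closed_sum (cpl pb i) ord0 (@UG_lin _ _ pb) Uz.
  under eq_fun do rewrite mulrBl.
  by apply: integrable_sub => //; [exact: UG_inner|exact: srcG_integrable].
rewrite inner_scaler//; last exact: (Iz (fun j => uG j w t)).
rewrite (split_inner (fun j => uG j w t))// mulrC; congr (_ * _).
(* The exact flux condition, used at each time, turns the pairing of the source with the dual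
   function into [cgam]. *)
have hF := sd_flux hsd i tin' Ul.
rewrite (split_inner (fun j => trace (u j t))) in hF; last by move=> j; exact: trace_UG.
rewrite (coords_inner (csok cg) (sd_F hsd i tin')) in hF.
have -> : inner (@Gam R m) (srcG pb i t) (cdual l) = cgam i l t.
  by rewrite /cgam /cF hF /cV; ring.
congr (_ - _); apply: eq_bigr => j _; congr (_ * _).
by have [_ ->] := coordpolyP (cpt l) (dg_uG dg j wN).
Qed.

Lemma run_S_coords i w n j k : valid (N0 mt) crun i w n ->
  (@reta _ _ _ crun i w n k).[tg T crun i (gid crun i w n).-1 + theta j * tau T crun i] =
  \sum_(l < (ks mt).+1) sideD mt j l *
    (@rE _ _ _ crun i (gid crun i w n - l) k + @cU i k (tg T crun i (gid crun i w n - l))).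
Proof.
move=> v; have [w0 n0] := valid_w v; have /andP[wN nM] := v.
rewrite (eta_ud v) -[_ + _]tpt_node// (dg_S dg j wN nM).
by apply: eq_bigr => l _; congr (_ * _); rewrite /= subrK.
Qed.

Definition ccons : R := Cc * \sum_i (csd (cs i))%:R * cC (cs i).

Lemma cC_gt0 i : 0 < cC (cs i). Proof. exact: coords_pos (csok (cs i)). Qed.
Lemma ccons_ge0 : 0 <= ccons.
Proof.
rewrite mulr_ge0 ?(ltW Cc0)// sumr_ge0// => i _.
by rewrite mulr_ge0// ltW// cC_gt0.
Qed.

(** The residual of the side conditions for [u_i] is itself a finite element function, so its nodal
    values are bounded by the norm in the hypothesis. *)
Lemma run_cons_coords i w n : valid (N0 mt) crun i w n ->
  tau T crun i * \sum_j \sum_k @resid R T _ (ks mt) (@theta R mt) (sideD mt) _ _ cU crun i (gid crun i w n) j k ^+ 2 <=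
  ccons * tau T crun i ^+ (2 * q + 2) *
    tint (tg T crun i (gid crun i w n - ks mt)) (tg T crun i (gid crun i w n)) (cden i).
Proof.
move=> v; have [w0 n0] := valid_w v; have /andP[wN nM] := v.
have gN := gid_bound v; set g := gid crun i w n in gN *.
have t0 := dti_gt0 i; rewrite -[tau T crun i]/(dti pb N M i).
have gks : (g - ks mt <= N * M i)%N by rewrite (leq_trans (leq_subr _ _)).
have /andP[a1 a2] := tg_bound gks; have /andP[b1 b2] := tg_bound gN.
pose nn t := \sum_(j < q.+2) nsq (@Omega R m i) (Du i j t).
have nn0 t : 0 <= nn t by rewrite sumr_ge0// => j _; exact: nsq_ge0.
have Inn : tintegrable (tg T crun i (g - ks mt)) (tg T crun i g) nn.
  apply: (@tintegrableS _ 0 T) => //; apply: tintegrable_sum => j.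
  by apply: nsq_tintegrable; rewrite -ltnS.
set J := tint _ _ (cden i).
have JE : tint (tg T crun i (g - ks mt)) (tg T crun i g) nn <= J.
  rewrite /J /cden tintZ// ler_peMl; first by [].
    exact: tint_ge0.
  by rewrite lerDr mulr_ge0 ?sqr_ge0// ltW// cC_gt0.
have J0 : 0 <= J by apply: le_trans JE; exact: tint_ge0.
have tq0 : 0 <= dti pb N M i ^+ (2 * q + 2) by rewrite exprn_ge0// ltW.
(* Without nodes the residual sum is empty. Otherwise a node is at hand to invoke [available], which
   is stated per node. *)
have [nse|/lt0n_neq0] := posnP (ns mt).
  rewrite big1 => [|[j hj] _]; last by exfalso; rewrite nse in hj.
  by rewrite mulr0; apply: mulr_ge0 => //; apply: mulr_ge0 => //; exact: ccons_ge0.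
rewrite -lt0n => ns0; pose j0 := Ordinal ns0.
have [hks _] := av i j0.
(* No index [g - l] is truncated, so it denotes the same time as the real-valued [n - l] of the
   hypothesis. *)
have gk : (ks mt <= g)%N.
  apply: (leq_trans hks); rewrite addn1; exact: (gid_ge v).
pose z (j : 'I_(ns mt)) := fun x => u i (tpt pb N M i w (n.-1%:R + theta j)) x
   - \sum_(l < (ks mt).+1) sideD mt j l * u i (tpt pb N M i w (n%:R - (l : nat)%:R)) x.
have lg (l : 'I_(ks mt).+1) : (l <= g)%N by rewrite (leq_trans _ gk)// -ltnS.
have Uz j : Usp pb i (z j).
  have U1 : Usp pb i (u i (tpt pb N M i w (n.-1%:R + theta j))).
    apply: (sd_u hsd); rewrite tpt_node//; apply/andP; split.
      have [_ hav] := av i j; rewrite /tg -mulrDl mulr_ge0 ?(ltW t0)//.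
      apply: le_trans hav _; rewrite lerD2r ler_nat -ltnS prednK; last exact: (gid_pos v).
      exact: (gid_ge v).
    apply: le_trans b2; rewrite -(tg_pred T crun i (gid_pos v)) lerD2l.
    rewrite -[tau T crun i]/(dti pb N M i) ler_piMl ?(ltW t0)//.
    by have [_ _ + _] := hmt; apply.
  have U2 (l : 'I_(ks mt).+1) : Usp pb i (u i (tpt pb N M i w (n%:R - (l : nat)%:R))).
    apply: (sd_u hsd); rewrite (tg_sub w0 (lg l)).
    by apply: tg_bound; rewrite (leq_trans (leq_subr _ _)).
  have Us := lin_closed_sum (fun l => sideD mt j l) ord0 (@Usp_lin _ _ pb i) U2.
  have := @Usp_lin _ _ pb i 1 (-1) _ _ U1 Us; congr (Usp _ _); apply/funext => x.
  by rewrite mul1r mulN1r.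
have hz j k : @resid R T _ (ks mt) (@theta R mt) (sideD mt) _ _ cU crun i g j k = z j (cpt k).
  rewrite /resid /z tpt_node//; congr (_ - _).
  by apply: eq_bigr => l _; rewrite (tg_sub w0 (lg l)).
have hsum : \sum_j \sum_k @resid R T _ (ks mt) (@theta R mt) (sideD mt) _ _ cU crun i g j k ^+ 2 <=
    (csd (cs i))%:R * cC (cs i) * \sum_j nsq (@Omega R m i) (z j).
  rewrite mulr_sumr; apply: ler_sum => j _.
  rewrite -[X in X%:R]card_ord -mulrA mulr_natl -sumr_const; apply: ler_sum => k _.
  by rewrite hz; exact: (coords_sqr_le (csok (cs i)) (Uz j)).
apply: le_trans (ler_wpM2l (ltW t0) hsum) _.
have hc := con wN nM; rewrite -/(z _) in hc.
have {}hc : dti pb N M i * \sum_j nsq (@Omega R m i) (z j) <=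
    Cc * dti pb N M i ^+ (2 * q + 2) * J.
  apply: le_trans hc _; rewrite tg_sub// tpt_tg//; apply: ler_wpM2l => //.
  by apply: mulr_ge0 => //; exact: ltW Cc0.
rewrite mulrCA; apply: le_trans (ler_wpM2l _ hc) _.
  by rewrite mulr_ge0// ltW// cC_gt0.
rewrite /ccons -!mulrA [leLHS]mulrA [leLHS]mulrCA ler_wpM2l ?(ltW Cc0)//.
rewrite ler_wpM2r ?mulr_ge0//.
rewrite (bigD1 i)//= lerDl sumr_ge0// => i' _; by rewrite mulr_ge0// ltW// cC_gt0.
Qed.

Lemma nE_le i g (e : R) : (g <= N * M i)%N ->
  nrm (@Omega R m i) (fun x => u i (tg T crun i g) x - US i g x) <= e ->
  nE crun i g <= (csd (cs i))%:R * (Num.sqrt (cC (cs i)) * e).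
Proof.
move=> gN he; rewrite -[X in X%:R]card_ord mulr_natl -sumr_const; apply: ler_sum => k _.
have Ue : Usp pb i (fun x => u i (tg T crun i g) x - US i g x).
  have := @Usp_lin _ _ pb i 1 (-1) _ _ (sd_u hsd i (tg_bound gN)) (dg_US dg gN).
  by congr (Usp _ _); apply/funext => x; rewrite mul1r mulN1r.
rewrite -normrN opprB.
apply: (@le_trans _ _ (Num.sqrt (cC (cs i)) * nrm (@Omega R m i)
  (fun x => u i (tg T crun i g) x - US i g x))); last by rewrite ler_wpM2l// sqrtr_ge0.
rewrite /nrm -sqrtrM ?(ltW (cC_gt0 i))// -sqrtr_sqr ler_wsqrtr//.
exact: (coords_sqr_le (csok (cs i)) Ue k).
Qed.

(** The value at time 0 and the values in the initialization windows come from separate hypotheses,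
    each bounding a sum of squares of which one term is kept. *)
Lemma run_init_coords i g : (g <= (N0 mt).-1 * M i)%N -> nE crun i g <= ceps.
Proof.
move=> hg; have gN : (g <= N * M i)%N.
  apply: (leq_trans hg); rewrite leq_mul2r; apply/orP; right.
  exact: leq_trans (leq_pred _) N0N.
have [ini0 iniw] := ini.
set e := Cc * dt pb N `^ pp in ini0 iniw.
have e0 : 0 <= e by rewrite mulr_ge0 ?powR_ge0 ?(ltW Cc0).
suff h : nrm (@Omega R m i) (fun x => u i (tg T crun i g) x - US i g x) <= e.
  apply: (le_trans (nE_le gN h)); rewrite mulrA /ceps -/e ler_wpM2r//.
  rewrite (bigD1 i)//= lerDl sumr_ge0// => j _; rewrite mulr_ge0// sqrtr_ge0.
case: g hg gN => [|g] hg gN.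
  rewrite /tg mul0r; apply: le_trans ini0; rewrite /nrm ler_wsqrtr//.
  by rewrite (bigD1 i)//= lerDl sumr_ge0// => j _; exact: nsq_ge0.
(* Euclidean division recovers window and step from the global number [g.+1], both counted from
   1. *)
pose w := (g %/ M i).+1; pose n := (g %% M i).+1.
have gE : gidx M i w n = g.+1 by rewrite /gidx /w /n /= addnS -divn_eq.
have hw : (1 <= w < N0 mt)%N.
  rewrite /= -(prednK N0_gt0) ltnS ltn_divLR//.
have hn : (1 <= n < (M i).+1)%N by rewrite /= ltnS ltn_mod M_gt0.
have [h _] := iniw w hw; apply: le_trans h; rewrite /nrm ler_wsqrtr//.
rewrite (bigD1 i)//= (big_rem n)/=; last by rewrite mem_index_iota.
have -> : (fun x => u i (tg T crun i g.+1) x - US i g.+1 x) = side_error pb u N M US i w n.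
  by rewrite /side_error tpt_tg// gE.
rewrite -addrA lerDl addr_ge0// sumr_ge0// => j _; first exact: nsq_ge0.
by rewrite sumr_ge0// => k _; exact: nsq_ge0.
Qed.

Lemma run_coords : run_ok T q (rd mt) (@theta R mt) (sideD mt) (N0 mt) cU cF cgam cAm cGm cPm
  (cpl pb) cden ccons crun.
Proof.
split => //.
- move=> i w n k /andP[wN nM]; have w0 : (0 < w)%N.
    by case/andP: wN => + _; exact: leq_trans.
  have wN1 : (1 <= w <= N)%N by rewrite w0; case/andP: wN.
  by have [] := coordpolyP (cpt k) (dg_ud dg wN1 nM).
- by move=> i w l wN; have [] := coordpolyP (cpt l) (dg_uG dg i wN).
- by move=> i w l wN; have [] := coordpolyP (cpt l) (dg_FG dg i wN).
- by move=> i w n j k; exact: run_S_coords.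
- by move=> i w n k a v sa; exact: (run_V_coords v).
- by move=> i w l a; exact: run_T_coords.
- by move=> i w l a; exact: run_F_coords.
- exact: run_cons_coords.
- exact: run_init_coords.
Qed.


Lemma rate_rho : ceps + rho T q (rd mt) crun <=
  ((\sum_i (csd (cs i))%:R * Num.sqrt (cC (cs i))) * Cc + 1) * rate pb mt pp N M.
Proof.
rewrite /rate -/(rho T q (rd mt) crun).
set A1 := \sum_i _; have A10 : 0 <= A1.
  by rewrite sumr_ge0// => j _; rewrite mulr_ge0// sqrtr_ge0.
have r0 : 0 <= rho T q (rd mt) crun.
  rewrite sumr_ge0// => i _; rewrite addr_ge0// exprn_ge0// ltW//.
    exact: (dti_gt0 i).
  by rewrite divr_gt0// ltr0n.
have p0 : 0 <= dt pb N `^ pp by exact: powR_ge0.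
rewrite /ceps -/A1; have h := mulr_ge0 (mulr_ge0 A10 (ltW Cc0)) r0; lra.
Qed.

Lemma side_error_le i w n : valid (N0 mt) crun i w n ->
  nrm (@Omega R m i) (side_error pb u N M US i w n) <=
  Num.sqrt (cC (cs i)) * nE crun i (gid crun i w n).
Proof.
move=> v; have [w0 n0] := valid_w v; have gN := gid_bound v.
have -> : side_error pb u N M US i w n =
    (fun x => u i (tg T crun i (gid crun i w n)) x - US i (gid crun i w n) x).
  by rewrite /side_error tpt_tg.
set e := fun x => _.
have Ue : Usp pb i e.
  have := @Usp_lin _ _ pb i 1 (-1) _ _ (sd_u hsd i (tg_bound gN)) (dg_US dg gN).
  by congr (Usp _ _); apply/funext => x; rewrite mul1r mulN1r.
have eE : nE crun i (gid crun i w n) = \sum_(k < csd (cs i)) `|e (cpt k)|.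
  by apply: eq_bigr => k _; rewrite -normrN opprB.
have n0' := nE_ge0 crun i (gid crun i w n).
rewrite -[X in _ * X](ger0_norm n0') -sqrtr_sqr -sqrtrM ?(ltW (cC_gt0 i))//.
by rewrite /nrm ler_wsqrtr// eE; exact: (coords_nsq_le (csok (cs i)) Ue).
Qed.

Lemma err_cont i w n k : valid (N0 mt) crun i w n ->
  {within `[tg T crun i (gid crun i w n).-1, tg T crun i (gid crun i w n)],
    continuous (@err _ _ _ cU crun i w n k)}.
Proof.
move=> v; have [s1 [s2 s3]] := step_times v.
have c1 : {within `[tg T crun i (gid crun i w n).-1, tg T crun i (gid crun i w n)],
    continuous (@cU i k)}.
  apply: continuous_subspaceW (@cU_cont i k) => t /=; rewrite !in_itv/= => /andP[t1 t2].
  by rewrite (le_trans s1 t1) (le_trans t2 s3).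
move=> t; apply: cvgB; last exact: c1.
by apply: continuous_subspaceT => y; exact: continuous_horner.
Qed.

Lemma err_mul_int i w n k l : valid (N0 mt) crun i w n ->
  tintegrable (tg T crun i (gid crun i w n).-1) (tg T crun i (gid crun i w n))
    (fun t => @err _ _ _ cU crun i w n k t * @err _ _ _ cU crun i w n l t).
Proof.
move=> v; apply: within_continuous_tintegrable => t.
by apply: cvgM; exact: err_cont.
Qed.

Lemma inner_form i w : Usp pb i w -> form_lin (Usp pb i) (fun z => inner (@Omega R m i) z w).
Proof.
move=> Uw a b v1 v2 U1 U2; have bw := Usp_ess_bounded Uw.
have I z : Usp pb i z -> (leb R m.+1).-integrable (@Omega R m i) (EFin \o (fun x => z x * w x)).
  move=> Uz; apply: ess_bounded_integrable => //; first exact: leb_box_fin (@lo_lt_hi R m i).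
  by apply: ess_boundedM => //; exact: Usp_ess_bounded Uz.
by rewrite inner_lin//; exact: I.
Qed.

(** Pointwise in time this is the norm bound of [is_coords]. Integrability in time comes from
    writing the squared norm as a finite sum of products of continuous coordinate errors. *)
Lemma step_error_le i w n : valid (N0 mt) crun i w n ->
  sint pb N M i w n (fun t => nsq (@Omega R m i) (fun x => u i t x - ud i w n t x)) <=
  cC (cs i) * instep T crun i w n (fun t => (\sum_k `|@err _ _ _ cU crun i w n k t|) ^+ 2).
Proof.
move=> v; have [w0 n0] := valid_w v; have [s1 [s2 s3]] := step_times v.
pose e t x := u i t x - ud i w n t x.
have Ue t : 0 <= t <= T -> Usp pb i (e t).
  move=> tin; have := @Usp_lin _ _ pb i 1 (-1) _ _ (sd_u hsd i tin) (ud_in v t).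
  by congr (Usp _ _); apply/funext => x; rewrite mul1r mulN1r.
have inT t : tg T crun i (gid crun i w n).-1 < t < tg T crun i (gid crun i w n) -> 0 <= t <= T.
  by case/andP=> t1 t2; rewrite (le_trans s1 (ltW t1)) (le_trans (ltW t2) s3).
have eE t k : e t (cpt k) = - @err _ _ _ cU crun i w n k t.
  by rewrite /e /err (eta_ud v) /cU opprB.
have sqE t : (\sum_k `|@err _ _ _ cU crun i w n k t|) ^+ 2 =
    \sum_k \sum_l `|@err _ _ _ cU crun i w n k t * @err _ _ _ cU crun i w n l t|.
  rewrite expr2 mulr_suml; apply: eq_bigr => k _; rewrite mulr_sumr.
  by apply: eq_bigr => l _; rewrite normrM.
have I2 : tintegrable (tg T crun i (gid crun i w n).-1) (tg T crun i (gid crun i w n))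
    (fun t => (\sum_k `|@err _ _ _ cU crun i w n k t|) ^+ 2).
  apply: (@eq_tintegrable _ _ _ (fun t => \sum_k \sum_l
      `|@err _ _ _ cU crun i w n k t * @err _ _ _ cU crun i w n l t|)) => [t _|].
    by rewrite sqE.
  apply: tintegrable_sum => k; apply: tintegrable_sum => l; apply: tintegrable_norm.
  exact: err_mul_int.
have nE t : 0 <= t <= T -> nsq (@Omega R m i) (e t) =
    \sum_k \sum_l inner (@Omega R m i) (cphi l) (cphi k) *
      (@err _ _ _ cU crun i w n k t * @err _ _ _ cU crun i w n l t).
  move=> tin; have cok := csok (cs i); have U := Ue t tin.
  rewrite /nsq (coords_form cok (@Usp_lin _ _ pb i) (inner_form U) U).
  apply: eq_bigr => k _; rewrite innerC.
  rewrite (coords_form cok (@Usp_lin _ _ pb i) (inner_form (coords_phi cok k)) U) mulr_sumr.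
  by apply: eq_bigr => l _; rewrite !eE; ring.
rewrite sint_instep// /instep -tintZ//; apply: le_tint.
- apply: (@eq_tintegrable _ _ _ (fun t => \sum_k \sum_l inner (@Omega R m i) (cphi l) (cphi k) *
      (@err _ _ _ cU crun i w n k t * @err _ _ _ cU crun i w n l t))).
    by move=> t /inT tin; rewrite -nE.
  apply: tintegrable_sum => k; apply: tintegrable_sum => l; apply: tintegrableZ.
  exact: err_mul_int.
- exact: tintegrableZ.
- move=> t /inT tin; apply: (le_trans (coords_nsq_le (csok (cs i)) (Ue t tin))).
  rewrite ler_wpM2l ?(ltW (cC_gt0 i))// le_eqVlt; apply/orP; left; apply/eqP.
  by congr (_ ^+ 2); apply: eq_bigr => k _; rewrite eE normrN.
Qed.

End RunCoordinates.

(** Translates [coordinate_estimate] back to L^2 norms through the equivalence constants [cC], which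
    depend on the mesh. *)
Lemma dgit_estimate (C p : R) : 0 < C -> exists Ch delta : R, 0 < Ch /\ 0 < delta /\
  forall (N : nat) (M : 'I_2 -> nat)
    (ud : 'I_2 -> nat -> nat -> R -> 'rV[R]_m.+1 -> R)
    (US : 'I_2 -> nat -> 'rV[R]_m.+1 -> R)
    (uG FG : 'I_2 -> nat -> R -> 'rV[R]_m -> R),
    (0 < N)%N -> (forall i, (0 < M i)%N) ->
    available mt M ->
    dgit_solution pb mt N M ud US uG FG ->
    consistent pb mt u Du C N M ->
    init_accurate pb mt u C p N M ud US ->
    (forall i, dti pb N M i <= delta / (M i)%:R) ->
    forall w : nat, (N0 mt <= w <= N)%N ->
      (forall (j : 'I_2) (n : nat), (1 <= n <= M j)%N ->
         nrm (@Omega R m j) (side_error pb u N M US j w n)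
           <= Ch * rate pb mt p N M) /\
      window_error pb u N M ud w <= Ch * rate pb mt p N M.
Proof.
move=> C_gt0.
have c0 := ccons_ge0 C_gt0.
have [K K0 [dlt d0 hK]] := coordinate_estimate (sideD mt) (N0 mt) cAm cGm ex c0.
pose A1 := (\sum_i (csd (cs i))%:R * Num.sqrt (cC (cs i))) * C + 1.
have A10 : 0 < A1.
  by rewrite ltr_wpDl// mulr_ge0 ?(ltW C_gt0)// sumr_ge0.
pose SC := \sum_i Num.sqrt (cC (cs i)).
have SC0 : 0 <= SC by rewrite sumr_ge0// => i _; exact: sqrtr_ge0.
pose SQ := \sum_i cC (cs i).
have SQ0 : 0 <= SQ by rewrite sumr_ge0// => i _; exact: ltW (cC_gt0 i).
(* One summand for each of the two estimates; the final 1 makes the constant positive. *)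
pose Ch := SC * (K * A1) + Num.sqrt (SQ * K) * A1 + 1.
have h1 : 0 <= SC * (K * A1) by rewrite mulr_ge0// mulr_ge0// ltW.
have h2 : 0 <= Num.sqrt (SQ * K) * A1 by rewrite mulr_ge0 ?sqrtr_ge0// ltW.
exists Ch, dlt; split; first by rewrite ltr_wpDl// addr_ge0.
split=> // N M ud US uG FG Ngt0 Mgt0 av dg con ini hdt w hw.
have NN : (N0 mt <= N)%N by case/andP: hw => h /(leq_trans h).
pose X := crun N M ud US uG FG C p.
have ok := run_coords Ngt0 Mgt0 av dg C_gt0 con ini NN.
have e0 : 0 <= reps X.
  by rewrite mulr_ge0// ?mulr_ge0 ?powR_ge0 ?(ltW C_gt0)// sumr_ge0.
(* Since [dti] is [dt] divided by [M i], the smallness condition for one subdomain already bounds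
   the window length. *)
have dX : dT T X <= dlt.
  have := hdt ord0; rewrite /dti ler_pM2r// invr_gt0 ltr0n//.
have [e1 e2] := hK X ok e0 dX w hw.
have rr : reps X + rho T q (rd mt) X <= A1 * rate pb mt p N M by exact: rate_rho.
have rate0 : 0 <= rate pb mt p N M.
  have q1 : 0 <= A1 * rate pb mt p N M.
    apply: le_trans rr; rewrite addr_ge0// sumr_ge0// => i _.
    rewrite addr_ge0// exprn_ge0// ltW//; first exact: (dti_gt0 Ngt0 Mgt0 i).
    by rewrite divr_gt0// ltr0n.
  by rewrite pmulr_rge0 in q1.
have rho0 : 0 <= reps X + rho T q (rd mt) X.
  rewrite addr_ge0// sumr_ge0// => i _.
  rewrite addr_ge0// exprn_ge0// ltW//; first exact: (dti_gt0 Ngt0 Mgt0 i).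
  by rewrite divr_gt0// ltr0n.
split.
  move=> j n hn; have v : valid (N0 mt) X j w n by rewrite /valid hw.
  apply: le_trans (side_error_le Ngt0 Mgt0 dg v) _.
  apply: (@le_trans _ _ (SC * (K * A1) * rate pb mt p N M)); last first.
    by rewrite ler_wpM2r// /Ch -addrA lerDl addr_ge0.
  rewrite -mulrA; apply: ler_pM.
  - exact: sqrtr_ge0.
  - exact: nE_ge0.
  - rewrite /SC (bigD1 j)//= lerDl sumr_ge0// => i _; exact: sqrtr_ge0.
  - by apply: le_trans (e1 j n hn) _; rewrite -mulrA ler_wpM2l.
apply: (@le_trans _ _ (Num.sqrt (SQ * K) * A1 * rate pb mt p N M)); last first.
  by rewrite ler_wpM2r// /Ch addrAC lerDr addr_ge0.
have Ar0 : 0 <= A1 * rate pb mt p N M by exact: le_trans rr.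
rewrite -mulrA -[X in _ * X](ger0_norm Ar0) -sqrtr_sqr -sqrtrM ?mulr_ge0// /window_error.
apply: ler_wsqrtr.
apply: (@le_trans _ _ (SQ * \sum_i \sum_(1 <= n < (M i).+1)
    instep T X i w n (fun t => (\sum_k `|@err _ _ _ cU X i w n k t|) ^+ 2))).
  rewrite mulr_sumr; apply: ler_sum => i _; rewrite mulr_sumr.
  rewrite big_seq [leRHS]big_seq; apply: ler_sum => n; rewrite mem_index_iota => hn.
  have v : valid (N0 mt) X i w n by rewrite /valid hw.
  apply: le_trans (step_error_le Ngt0 Mgt0 dg v) _.
  rewrite ler_wpM2r//; first by apply: tint_ge0 => t _; exact: sqr_ge0.
  rewrite /SQ (bigD1 i)//= lerDl sumr_ge0// => j _; exact: ltW (cC_gt0 j).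
rewrite -mulrA ler_wpM2l//; apply: (le_trans e2); rewrite ler_wpM2l//.
by rewrite lerXn2r.
Qed.

End Exact.

Theorem theorem4 (R : realType) (m : nat) (hd : m.+1 = 2%N \/ m.+1 = 3%N)
  (pb : problem R m) (hpb : admissible pb)
  (mt : method R) (hmt : method_ok mt)
  (u : 'I_2 -> R -> 'rV[R]_m.+1 -> R) (F : 'I_2 -> R -> 'rV[R]_m -> R)
  (hsd : sd_solution pb u F)
  (Du : 'I_2 -> nat -> R -> 'rV[R]_m.+1 -> R)
  (DuG DF : 'I_2 -> nat -> R -> 'rV[R]_m -> R)
  (C p : R) (hC : 0 < C) (hp : 0 < p)
  (hreg : forall (N : nat) (M : 'I_2 -> nat),
     (0 < N)%N -> (forall i, (0 < M i)%N) ->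
     regular_on pb mt u F Du DuG DF C N M)
  (psi : nat -> {poly R}) (hpsi : orthogonal_basis (qd mt) psi)
  (hD : (0 < ns mt)%N -> Dtilde mt psi \in unitmx) :
  exists Ch delta : R, 0 < Ch /\ 0 < delta /\
  forall (N : nat) (M : 'I_2 -> nat)
    (ud : 'I_2 -> nat -> nat -> R -> 'rV[R]_m.+1 -> R)
    (US : 'I_2 -> nat -> 'rV[R]_m.+1 -> R)
    (uG FG : 'I_2 -> nat -> R -> 'rV[R]_m -> R),
    (0 < N)%N -> (forall i, (0 < M i)%N) ->
    available mt M ->
    dgit_solution pb mt N M ud US uG FG ->
    consistent pb mt u Du C N M ->
    init_accurate pb mt u C p N M ud US ->
    (forall i, dti pb N M i <= delta / (M i)%:R) ->
    forall w : nat, (N0 mt <= w <= N)%N ->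
      (forall (j : 'I_2) (n : nat), (1 <= n <= M j)%N ->
         nrm (Omega j) (side_error pb u N M US j w n)
           <= Ch * rate pb mt p N M) /\
      window_error pb u N M ud w <= Ch * rate pb mt p N M.
Proof.
have [hns _ _ _] := hmt.
have uni := orthogonal_basis_unisolvent hns hpsi hD.
have hcs i : exists c : coordsys (@Omega R m i) (Usp pb i), True.
  have [d [pt [phi [dual [K ok]]]]] := fe_coords (deg pb)
    (boundary (@Omega R m i) `\` (@emb R m @` @Gam R m)) (@lo_lt_hi R m i) (adm_mesh hpb i).
  by exists (Coordsys ok).
have [cg _] : exists c : coordsys (@Gam R m) (UG pb), True.
  have [d [pt [phi [dual [K ok]]]]] := fe_coords (deg pb) (boundary (@Gam R m))
    (@Gam_lt R m) (adm_meshG hpb).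
  by exists (Coordsys ok).
pose cs i := projT1 (cid (hcs i)).
(* Regularity is instantiated with one window of one step, so the data entering the constants are
   integrals over the whole time interval and do not depend on [N] or [M]. *)
exact: (dgit_estimate hpb hmt hsd (hreg 1%N (fun=> 1%N) isT (fun=> isT)) uni cs cg p hC).
Qed.
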